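(* Let $q\ge 1$ and let $(X_n)_{n\ge1}$ be i.i.d. random variables with values in $S$, defined on a probability space $(\Omega,\mathcal F,\mathbb P)$, with $X^{(n)}=X_n\cdots X_1$. Assume the contraction condition $\mathbb P\bigl(\bigcup_{n\ge1}[X^{(n)}\in S^\circ]\bigr)>0$. Assume moreover that there exist a real number $\alpha$ with $0<\alpha\le 2$, a slowly varying function $L$ (which is unbounded in case $\alpha=2$), and constants $c_+\ge0$, $c_-\ge0$ with $c_++c_->0$, such that (i) $\displaystyle\lim_{u\to+\infty}\frac{u^\alpha}{L(u)}\mathbb P[N_1>e^u]=c_+$ and $\displaystyle\lim_{u\to+\infty}\frac{u^\alpha}{L(u)}\mathbb P[N_1\le e^{-u}]=c_-$; (ii) $\displaystyle\limsup_{u\to+\infty}\frac{u^\alpha}{L(u)}\mathbb P[V_1\le e^{-u}]<+\infty$. Then there exist a sequence $(a_n)_{n\ge1}$ of positive reals with $\lim_n a_n=+\infty$ and a sequence $(b_n)_{n\ge1}$ of reals such that, for any sequences $(x_n)_{n\ge1}$ and $(y_n)_{n\ge1}$ of elements of $\overline B$, the random sequences $$\Bigl(\tfrac1{a_n}\bigl(1_{[T\le n]}\ln\langle y_n,X^{(n)}x_n\rangle-b_n\bigr)\Bigr)_{n\ge1}\quad\text{and}\quad\Bigl(\tfrac1{a_n}\bigl(\ln\Lambda_n-b_n\bigr)\Bigr)_{n\ge1}$$ converge in distribution to a stable law of index $\alpha$ (the same limit law for all such choices).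
   Context: $S$ is the multiplicative semigroup of real $q\times q$ matrices with nonnegative entries such that every row and every column contains a strictly positive entry; $S^\circ\subset S$ is the set of matrices with all entries strictly positive. $(e_i)_{i=1}^q$ is the canonical basis of $\mathbb R^q$, $\langle\cdot,\cdot\rangle$ the canonical scalar product, $\|x\|=\sum_{i=1}^q|\langle x,e_i\rangle|$. $\overline C=\{x\in\mathbb R^q:\langle x,e_i\rangle\ge0\ \forall i\}$ and $\overline B=\{x\in\overline C:\|x\|=1\}$. $T(\omega)=\inf\{n\ge1: X^{(n)}(\omega)\in S^\circ\}$; the quantity $1_{[T\le n]}\ln\langle y,X^{(n)}x\rangle$ is taken to be $0$ on $[T>n]$. $\Lambda_n$ is the spectral radius of $X^{(n)}$ (which is $>0$). $N_1=\sum_{i,j=1}^q\langle e_i,X_1e_j\rangle$ and $V_1=\min_{i=1,\dots,q}\sum_{j=1}^q\langle e_i,X_1e_j\rangle$. *)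

(* Defs.v *)
From mathcomp Require Import all_boot all_order all_algebra.
From mathcomp Require Import all_classical all_reals all_analysis.
From mathcomp Require Import complex.
Import numFieldNormedType.Exports.
Import Order.TTheory GRing.Theory Num.Theory.

Set Implicit Arguments.
Unset Strict Implicit.
Unset Printing Implicit Defensive.

Local Open Scope classical_set_scope.
Local Open Scope ring_scope.

Section Defs.
Variable R : realType.

Definition in_S (q : nat) (M : 'M[R]_q) : Prop :=
  (forall i j, 0 <= M i j) /\
  (forall i, exists j, 0 < M i j) /\
  (forall j, exists i, 0 < M i j).

Definition in_Spos (q : nat) (M : 'M[R]_q) : Prop := forall i j, 0 < M i j.

Definition dotv (q : nat) (x y : 'cV[R]_q) : R := \sum_(i < q) x i 0 * y i 0.

Definition in_Bbar (q : nat) (x : 'cV[R]_q) : Prop :=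
  (forall i, 0 <= x i 0) /\ \sum_(i < q) `|x i 0| = 1.

Definition Nsum (q : nat) (M : 'M[R]_q) : R := \sum_(i < q) \sum_(j < q) M i j.

Definition Vmin (q : nat) (M : 'M[R]_q) : R :=
  inf [set (\sum_(j < q) M i j) | i in [set: 'I_q]].

Definition spectral_radius (q : nat) (M : 'M[R]_q) : R :=
  sup [set Normc.normc z | z in
        [set z : R[i] | eigenvalue (map_mx (fun r : R => (r%:C)%C) M) z]].

(* X^(n) = X_n ... X_1 (X^(0) = identity); the index 0 of X is unused *)
Fixpoint Xprod (T : Type) (q : nat) (X : nat -> T -> 'M[R]_q) (n : nat) (w : T)
  : 'M[R]_q :=
  match n with
  | 0 => 1%:M
  | n'.+1 => X n'.+1 w *m Xprod X n' w
  end.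

(* the event [T <= n], T = inf {n >= 1 : X^(n) in S°} *)
Definition T_le (T : Type) (q : nat) (X : nat -> T -> 'M[R]_q) (n : nat) (w : T)
  : Prop := exists k, (1 <= k <= n)%N /\ in_Spos (Xprod X k w).

Definition logcoef (T : Type) (q : nat) (X : nat -> T -> 'M[R]_q)
  (x y : 'cV[R]_q) (n : nat) (w : T) : R :=
  if `[< T_le X n w >] then ln (dotv y (Xprod X n w *m x)) else 0.

Definition mx_measurable (q : nat) : set (set 'M[R]_q) :=
  <<s [set A : set 'M[R]_q | exists (i j : 'I_q) (B : set R),
               measurable B /\ A = [set M : 'M[R]_q | B (M i j)]] >>.

Definition iid_mx (d : measure_display) (Omega : measurableType d)
  (P : probability Omega R) (q : nat) (X : nat -> Omega -> 'M[R]_q) : Prop :=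
  (forall n B, (1 <= n)%N -> mx_measurable B -> measurable (X n @^-1` B)) /\
  (forall (I : seq nat) (B : nat -> set 'M[R]_q),
      uniq I -> all (fun n => 1 <= n)%N I ->
      (forall n, mx_measurable (B n)) ->
      fine (P (\big[setI/setT]_(n <- I) (X n @^-1` B n)))
      = \prod_(n <- I) fine (P (X n @^-1` B n))) /\
  (forall n B, (1 <= n)%N -> mx_measurable B ->
      P (X n @^-1` B) = P (X 1%N @^-1` B)).

Definition slowly_varying (L : R -> R) : Prop :=
  measurable_fun [set: R] L /\
  (exists x0 : R, forall u, x0 < u -> 0 < L u) /\
  (forall lam : R, 0 < lam -> (L (lam * u) / L u) @[u --> +oo] --> (1 : R)).

Definition unbounded_fun (L : R -> R) : Prop :=
  forall (M x : R), exists u, x < u /\ M < L u.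

Definition cvg_in_distribution (d : measure_display) (Omega : measurableType d)
  (P : probability Omega R) (Y : nat -> Omega -> R) (mu : probability R R)
  : Prop :=
  forall f : R -> R, continuous f -> (exists M, forall x, `|f x| <= M) ->
    (\int[P]_w (f (Y n w))%:E)%E @[n --> \oo] --> (\int[mu]_x (f x)%:E)%E.

(* (non-degenerate) stable law of index alpha, via its characteristic function
   phi(t) = exp(i gamma t - c |t|^alpha (1 - i beta sgn(t) tan(pi alpha/2)))
   (alpha <> 1), resp.
   phi(t) = exp(i gamma t - c |t| (1 + i beta (2/pi) sgn(t) ln |t|)) (alpha = 1),
   with c > 0, beta in [-1,1]; written in real and imaginary parts. *)
Definition stable_phase (alpha c beta gamma t : R) : R :=
  if alpha == 1 then gamma * t - c * beta * (2 / pi) * t * ln `|t|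
  else gamma * t + c * beta * Num.sg t * (`|t| `^ alpha) * tan (pi * alpha / 2).

Definition stable_law (alpha : R) (mu : probability R R) : Prop :=
  exists c beta gamma : R, 0 < c /\ -1 <= beta <= 1 /\
    forall t : R,
      (\int[mu]_x (cos (t * x))%:E)%E
        = (expR (- (c * `|t| `^ alpha)) * cos (stable_phase alpha c beta gamma t))%:E
   /\ (\int[mu]_x (sin (t * x))%:E)%E
        = (expR (- (c * `|t| `^ alpha)) * sin (stable_phase alpha c beta gamma t))%:E.

End Defs.

(* Main.v *)
(** Let N(M) be the sum of the entries of M, V(M) its smallest row sum, and
    Z_k = ln N(X_k). Multiplying the factors one at a time from the right,
    ln N(X^(n)) = ln q + sum_k Z_k - sum_k eta_k, where eta_k is a function of X_k
    and of the factors after it, with 0 <= eta_k <= ln (N(X_k) / V(X_k)).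

    The Z_k are i.i.d. with regularly varying tails. With a_n defined by
    a_n^2 = n D(a_n), where D(a) = E min(|Z|, a)^2 tends to infinity, the
    characteristic function of sum_k (Z_k / a_n - E sin(Z / a_n)) converges to that of
    a stable law; the exponent is computed from the integrals of (1 - cos (t x)) and
    (sin (t x) - t sin x) against x^(-alpha-1) dx.

    The sum of the eta_k only shifts the centering. By (ii), the truncated second
    moment of eta_k is O(D(a_n)). The contraction condition provides blocks of factors
    whose product contracts the projective metric, so that eta_k feels a factor m steps
    later only through a term decaying geometrically in m; this makes the variance of
    the truncated sum o(n D(a_n)) = o(a_n^2), since the effect of each single distance m
    is O(1) in mean square up to a vanishing fraction of D(a_n).

    Finally, blocks of the same kind near both ends of the product make all the entries
    of X^(n) comparable to N(X^(n)) outside an event of small probability. Hence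
    ln <y, X^(n) x> and ln Lambda_n, which lies between the logarithms of a diagonal
    entry and of N(X^(n)), differ from ln N(X^(n)) by a tight quantity. *)

From HB Require Import structures.
Require Import Defs.
From mathcomp Require Import all_boot all_order all_algebra.
From mathcomp Require Import all_classical all_reals all_analysis.
From mathcomp Require Import complex measurable_realfun.
From mathcomp Require Import ring lra zify.
Import numFieldNormedType.Exports.
Import Order.TTheory GRing.Theory Num.Theory.
Local Open Scope classical_set_scope.
Local Open Scope ring_scope.

Set Implicit Arguments.
Unset Strict Implicit.
Unset Printing Implicit Defensive.

(** * Expectations of bounded functions *)

(** Three choices shape the proof. Measurability of the logarithm of the spectral radius is not
    established: the limit is proved for measurable sums, then transferred to arbitrary functions
    close to them outside a small measurable event, whose integrals are squeezed between measurable
    bounds. Each term is centred by E sin (Z / a_n) rather than by a truncated mean: this keeps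
    every function bounded and smooth and treats all indices at once, the cases alpha = 1 (a
    resonance) and alpha = 2 (D(a) outgrows a^2 P(|Z| > a)) separating only in the tail estimates
    and in the limiting exponent. Finally, eta_k depends on all later factors, so the sum of the
    truncated eta_k is reorganised by distance j: the change due to the factor j + 1 steps later
    involves only j + 2 consecutive factors, so for fixed j these changes are (j + 1)-dependent in
    k. No correlation between different distances is estimated; geometric weights and Cauchy-Schwarz
    replace it. The limit law is not given beforehand: it is built from limits of expectations, and
    its characteristic function is recognised afterwards. *)

Definition bmf (d : measure_display) (T : measurableType d) (R : realType)
  (f : T -> R) : Prop :=
  measurable_fun [set: T] f /\ exists M : R, forall x, `|f x| <= M.

Section Expectation.
Context (d : measure_display) (T : measurableType d) (R : realType).
Implicit Types f g : T -> R.

Lemma mset_lt f g : measurable_fun [set: T] f -> measurable_fun [set: T] g ->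
  measurable [set x | f x < g x].
Proof.
move=> mf mg; have := measurable_fun_ltr mf mg measurableT (Y := [set true]).
rewrite setTI => /(_ I) H; rewrite (_ : mkset _ = (fun x => f x < g x) @^-1` [set true])//.
Qed.

Lemma mset_le f g : measurable_fun [set: T] f -> measurable_fun [set: T] g ->
  measurable [set x | f x <= g x].
Proof.
move=> mf mg; have := measurable_fun_ler mf mg measurableT (Y := [set true]).
rewrite setTI => /(_ I) H; rewrite (_ : mkset _ = (fun x => f x <= g x) @^-1` [set true])//.
Qed.

Lemma bmf_cst (c : R) : bmf (fun _ : T => c).
Proof. by split=> //; exists `|c|. Qed.

Lemma bmf_comp f (g : R -> R) (M : R) : measurable_fun [set: T] f ->
  measurable_fun [set: R] g -> (forall x, `|g x| <= M) -> bmf (g \o f).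
Proof. by move=> mf mg gM; split; [exact: measurableT_comp|exists M => x /=]. Qed.

Lemma bmf_ccomp f (g : R -> R) (M : R) : measurable_fun [set: T] f ->
  continuous g -> (forall x, `|g x| <= M) -> bmf (g \o f).
Proof.
by move=> mf cg; apply: bmf_comp => //; exact: continuous_measurable_fun.
Qed.

Lemma bmfD f g : bmf f -> bmf g -> bmf (fun x => f x + g x).
Proof.
move=> [mf [M fM]] [mg [N gN]]; split; first exact: measurable_funD.
by exists (M + N) => x; rewrite (le_trans (ler_normD _ _))// lerD.
Qed.

Lemma bmfM f g : bmf f -> bmf g -> bmf (fun x => f x * g x).
Proof.
move=> [mf [M fM]] [mg [N gN]]; split; first exact: measurable_funM.
by exists (M * N) => x; rewrite normrM ler_pM.
Qed.

Lemma bmfN f : bmf f -> bmf (fun x => - f x).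
Proof.
move=> [mf [M fM]]; split; first exact: measurableT_comp.
by exists M => x; rewrite normrN.
Qed.

Lemma bmfB f g : bmf f -> bmf g -> bmf (fun x => f x - g x).
Proof. by move=> bf /bmfN; exact: bmfD. Qed.

Lemma bmfZ (c : R) f : bmf f -> bmf (fun x => c * f x).
Proof. by move=> bf; apply: bmfM => //; exact: bmf_cst. Qed.

Lemma bmf_norm f : bmf f -> bmf (fun x => `|f x|).
Proof.
move=> [mf [M fM]]; split; first exact: measurableT_comp.
by exists M => x; rewrite normr_id.
Qed.

Lemma bmfX f n : bmf f -> bmf (fun x => f x ^+ n).
Proof.
move=> bf; elim: n => [|n ih].
  by under eq_fun do rewrite expr0; exact: bmf_cst.
by under eq_fun do rewrite exprS; exact: bmfM.
Qed.

Lemma bmf_sum (I : Type) (s : seq I) (Q : pred I) (F : I -> T -> R) :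
  (forall i, Q i -> bmf (F i)) -> bmf (fun x => \sum_(i <- s | Q i) F i x).
Proof.
move=> bF; elim: s => [|i s ih].
  rewrite (_ : (fun x => _) = fun=> 0); first exact: bmf_cst.
  by apply/funext => x; rewrite big_nil.
rewrite (_ : (fun x => _) = fun x => if Q i then F i x + \sum_(i <- s | Q i) F i x
   else \sum_(i <- s | Q i) F i x).
  by case: (boolP (Q i)) => // Qi; apply: bmfD => //; exact: bF.
by apply/funext => x; rewrite big_cons.
Qed.

Lemma bmf_indic (A : set T) : measurable A -> bmf (\1_A : T -> R).
Proof.
move=> mA; split; first exact: measurable_indic.
by exists 1 => x; rewrite indicE ger0_norm ?lern1 ?leq_b1.
Qed.

Lemma bmf_le f g : measurable_fun [set: T] f -> bmf g ->
  (forall x, `|f x| <= g x) -> bmf f.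
Proof.
move=> mf [_ [M gM]] fg; split=> //; exists M => x.
by rewrite (le_trans (fg x))// (le_trans (ler_norm _)).
Qed.

Variable P : probability T R.

(** Random variables enter only after truncation or composition with a bounded function, so a
    real-valued expectation suffices and its rules carry the single side condition [bmf]. *)
Definition Ex f : R := (\int[P]_x f x)%R.

Lemma bmf_integrable f : bmf f -> P.-integrable [set: T] (EFin \o f).
Proof.
move=> [mf [M fM]]; apply: measurable_bounded_integrable => //.
  by rewrite (le_lt_trans (probability_le1 _ _))// ltry.
exists M; split; first exact: num_real.
by move=> x Mx y _; exact: le_trans (fM y) (ltW Mx).
Qed.

Lemma ExE f : bmf f -> (\int[P]_x (f x)%:E)%E = (Ex f)%:E.
Proof.
move=> /bmf_integrable bf; rewrite /Ex /Rintegral fineK//.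
exact: integrable_fin_num.
Qed.

Lemma ExD f g : bmf f -> bmf g -> Ex (fun x => f x + g x) = Ex f + Ex g.
Proof. by move=> *; rewrite /Ex RintegralD//; exact: bmf_integrable. Qed.

Lemma ExB f g : bmf f -> bmf g -> Ex (fun x => f x - g x) = Ex f - Ex g.
Proof. by move=> *; rewrite /Ex RintegralB//; exact: bmf_integrable. Qed.

Lemma ExZ c f : bmf f -> Ex (fun x => c * f x) = c * Ex f.
Proof. by move=> *; rewrite /Ex RintegralZl//; exact: bmf_integrable. Qed.

Lemma Ex_cst c : Ex (fun _ : T => c) = c.
Proof.
by rewrite /Ex Rintegral_cst//= probability_setT mulr1.
Qed.

Lemma le_Ex f g : bmf f -> bmf g -> (forall x, f x <= g x) -> Ex f <= Ex g.
Proof.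
by move=> bf bg fg; apply: le_Rintegral => //; exact: bmf_integrable.
Qed.

Lemma Ex_ge0 f : (forall x, 0 <= f x) -> 0 <= Ex f.
Proof. by move=> f0; apply: Rintegral_ge0. Qed.

Lemma Ex_norm f : bmf f -> `|Ex f| <= Ex (fun x => `|f x|).
Proof. by move=> bf; apply: le_normr_Rintegral => //; exact: bmf_integrable. Qed.

Lemma Ex_normB f g : bmf f -> bmf g ->
  `|Ex f - Ex g| <= Ex (fun x => `|f x - g x|).
Proof. by move=> bf bg; rewrite -ExB// Ex_norm//; exact: bmfB. Qed.

Lemma Ex_sum (I : Type) (s : seq I) (Q : pred I) (F : I -> T -> R) :
  (forall i, Q i -> bmf (F i)) ->
  Ex (fun x => \sum_(i <- s | Q i) F i x) = \sum_(i <- s | Q i) Ex (F i).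
Proof.
move=> bF; elim: s => [|i s ih].
  rewrite big_nil -[RHS]Ex_cst; congr Ex.
  by apply/funext => x; rewrite big_nil.
rewrite big_cons; case: ifPn => Qi.
  rewrite -ih -ExD; [|exact: bF|exact: bmf_sum].
  by congr Ex; apply/funext => x; rewrite big_cons Qi.
by rewrite -ih; congr Ex; apply/funext => x; rewrite big_cons (negbTE Qi).
Qed.

Lemma Ex_indic (A : set T) : measurable A -> Ex (\1_A : T -> R) = fine (P A).
Proof. by move=> mA; rewrite /Ex /Rintegral integral_indic// setIT. Qed.

Lemma Ex_le_cst f c : bmf f -> (forall x, f x <= c) -> Ex f <= c.
Proof. by move=> bf fc; rewrite -[leRHS]Ex_cst le_Ex//; exact: bmf_cst. Qed.

Lemma Pr_fine (A : set T) : measurable A -> P A = (fine (P A))%:E.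
Proof. by move=> mA; rewrite fineK// fin_num_measure. Qed.

Lemma le_Pr (A B : set T) : measurable A -> measurable B -> A `<=` B ->
  fine (P A) <= fine (P B).
Proof.
by move=> mA mB AB; rewrite fine_le ?fin_num_measure ?le_measure ?inE.
Qed.

Lemma Pr_ge0 (A : set T) : 0 <= fine (P A).
Proof. exact: fine_ge0. Qed.

Lemma Pr_le1 (A : set T) : measurable A -> fine (P A) <= 1.
Proof.
by move=> mA; rewrite -lee_fin -Pr_fine// probability_le1.
Qed.

Lemma PrU (A B : set T) : measurable A -> measurable B ->
  fine (P (A `|` B)) <= fine (P A) + fine (P B).
Proof.
move=> mA mB; rewrite -lee_fin EFinD -!Pr_fine//; last exact: measurableU.
by rewrite measureU2.
Qed.

Lemma Pr_setC (A : set T) : measurable A -> fine (P (~` A)) = 1 - fine (P A).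
Proof.
move=> mA; apply: EFin_inj; rewrite EFinB -!Pr_fine//; last exact: measurableC.
by rewrite probability_setC.
Qed.

Lemma Pr_bigU (A : nat -> set T) n : (forall i, measurable (A i)) ->
  fine (P (\big[setU/set0]_(i < n) A i)) <= \sum_(i < n) fine (P (A i)).
Proof.
move=> mA; elim: n => [|n ih]; first by rewrite !big_ord0 measure0.
rewrite !big_ord_recr/= (le_trans (PrU _ _))//; last by rewrite lerD2r.
exact: bigsetU_measurable.
Qed.

Lemma Ex_markov f (c : R) (A : set T) : bmf f -> (forall x, 0 <= f x) ->
  measurable A -> (forall x, A x -> c <= f x) -> c * fine (P A) <= Ex f.
Proof.
move=> bf f0 mA Af; rewrite -Ex_indic// -ExZ; last exact: bmf_indic.
apply: le_Ex => //; first by apply: bmfZ; exact: bmf_indic.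
move=> x; rewrite indicE; case: (boolP (x \in A)) => [/set_mem/Af|_].
  by rewrite mulr1.
by rewrite mulr0.
Qed.

Lemma Ex_CS f g : bmf f -> bmf g ->
  Ex (fun x => f x * g x) ^+ 2 <= Ex (fun x => f x ^+ 2) * Ex (fun x => g x ^+ 2).
Proof.
move=> bf bg.
have bf2 : bmf (fun x => f x ^+ 2) by exact: bmfX.
have bg2 : bmf (fun x => g x ^+ 2) by exact: bmfX.
have bfg : bmf (fun x => f x * g x) by exact: bmfM.
set a := Ex (fun x => g x ^+ 2); set b := Ex (fun x => f x * g x).
set c := Ex (fun x => f x ^+ 2).
have a0 : 0 <= a by apply: Ex_ge0 => x; exact: sqr_ge0.
have c0 : 0 <= c by apply: Ex_ge0 => x; exact: sqr_ge0.
have H (s t : R) : 0 <= s ^+ 2 * c + (2 * s * t) * b + t ^+ 2 * a.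
  have -> : s ^+ 2 * c + (2 * s * t) * b + t ^+ 2 * a =
      Ex (fun x => (s * f x + t * g x) ^+ 2).
    rewrite (_ : (fun x => _) = fun x => (s ^+ 2 * f x ^+ 2 +
      (2 * s * t) * (f x * g x)) + t ^+ 2 * g x ^+ 2); last first.
      by apply/funext => x; ring.
    by rewrite ExD ?ExD ?ExZ//; do ?apply: bmfD; apply: bmfZ.
  by apply: Ex_ge0 => x; exact: sqr_ge0.
have [a0'|a0'] := eqVneq a 0.
  rewrite a0' mulr0; have := H (- b) (1 + c).
  have := H b (- (1 + c)); rewrite a0'.
  have := H (- b) 1; rewrite a0' => H1.
  (* For a = 0 the form is s^2 c + 2 s t b; at s = - b and t = 1 + c / 2 it equals - 2 b^2, which
     forces b = 0. *)
  have := H (- b) (1 + c / 2); rewrite a0'; nra.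
have ap : 0 < a by rewrite lt_neqAle eq_sym a0' a0.
have := H a (- b); nra.
Qed.

Lemma Ex_sqr f : bmf f -> Ex f ^+ 2 <= Ex (fun x => f x ^+ 2).
Proof.
move=> bf; have := Ex_CS bf (bmf_cst 1).
under [X in Ex X ^+ 2]eq_fun do rewrite mulr1.
by under [X in _ * Ex X]eq_fun do rewrite expr1n; rewrite Ex_cst mulr1.
Qed.

End Expectation.

(** The sum counts the multiples of [e] up to [x], so it rounds [x] to a grid of step [e]. Applied
    to the values of a bounded function it writes that function, up to [e], as a combination of
    indicators of superlevel sets. *)
Lemma step_sum_approx (R : realType) (e x : R) n : 0 < e -> 0 <= x <= n%:R * e ->
  0 <= x - \sum_(i < n) e * (i.+1%:R * e <= x)%R%:R <= e.
Proof.
move=> e0; elim: n => [|n ih] /andP[x0 xn].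
  by rewrite big_ord0 subr0 x0/= (le_trans xn)// mul0r ltW.
rewrite big_ord_recr/=; have [nx|nx] := leP (n.+1%:R * e) x.
  have -> : \sum_(i < n) e * (i.+1%:R * e <= x)%R%:R = n%:R * e.
    rewrite (eq_bigr (fun=> e)).
      by rewrite sumr_const card_ord mulr_natl.
    move=> i _; rewrite (le_trans _ nx) ?mulr1//.
    by rewrite ler_pM2r// ler_nat ltnS ltnW.
  have -> : x = n.+1%:R * e by apply/eqP; rewrite eq_le xn nx.
  by rewrite mulr1 -natr1 mulrDl mul1r subrr lexx ltW.
rewrite mulr0 addr0; have [xn'|xn'] := leP x (n%:R * e).
  by apply: ih; rewrite x0.
have -> : \sum_(i < n) e * (i.+1%:R * e <= x)%R%:R = n%:R * e.
  rewrite (eq_bigr (fun=> e)).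
    by rewrite sumr_const card_ord mulr_natl.
  move=> i _; rewrite (le_trans _ (ltW xn')) ?mulr1//.
  by rewrite ler_pM2r// ler_nat.
rewrite subr_ge0 (ltW xn')/= lerBlDl.
by move: nx; rewrite -natr1 mulrDl mul1r => /ltW.
Qed.

(** * Independence of generated sigma-algebras *)

Section Independence.
Context (d : measure_display) (T : measurableType d) (R : realType).
Variable P : probability T R.
Implicit Types (C D : set (set T)) (f g : T -> R).

Definition meas_wrt C f := measurable_fun [set: g_sigma_algebraType C] f.

Definition indep C D := forall A B, <<s C >> A -> <<s D >> B ->
  fine (P (A `&` B)) = fine (P A) * fine (P B).

Lemma gsigma_measurable C A : C `<=` measurable -> <<s C >> A -> measurable A.
Proof.
by move=> Cm; apply: (smallest_sub (@sigma_algebra_measurable _ T) Cm).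
Qed.

Lemma meas_wrtW C f : C `<=` measurable -> meas_wrt C f ->
  measurable_fun [set: T] f.
Proof.
move=> Cm mf _ B mB; rewrite setTI; apply: (gsigma_measurable Cm).
by have := mf measurableT B mB; rewrite setTI.
Qed.

(** For fixed [B] the trace of P on [B] and the multiple P(B) of P are finite measures that agree on
    the pi-system [C], hence on the sigma-algebra it generates. Using this once on each side gives
    [indep_pi]. *)
Lemma indep_pi_half C D : C `<=` measurable -> D `<=` measurable ->
  setI_closed C -> C setT ->
  (forall A B, C A -> D B -> P (A `&` B) = (P A * P B)%E) ->
  forall A B, <<s C >> A -> D B -> P (A `&` B) = (P A * P B)%E.
Proof.
move=> Cm Dm CI CT H A B sA DB; have mB := Dm _ DB.
pose r := NngNum (Pr_ge0 P B).
have PB : P B = (fine (P B))%:E by rewrite -Pr_fine.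
have := @g_sigma_algebra_measure_unique d R T C Cm (fun=> setT) (fun=> CT) _
   (mrestr P mB) (mscale r P) CI _ _ A sA.
rewrite /mrestr/= /mscale/= -PB muleC; apply.
- by rewrite bigcup_const//; exists 0%N.
- by move=> E CE; rewrite /= /mrestr /mscale/= muleC; exact: H.
- by move=> k; rewrite /= /mrestr setTI PB ltry.
Qed.

Lemma indep_pi C D : C `<=` measurable -> D `<=` measurable ->
  setI_closed C -> setI_closed D -> C setT -> D setT ->
  (forall A B, C A -> D B -> P (A `&` B) = (P A * P B)%E) -> indep C D.
Proof.
move=> Cm Dm CI DI CT DT H A B sA sB.
have sDm : <<s C >> `<=` measurable by move=> E; exact: gsigma_measurable.
have H1 := indep_pi_half Cm Dm CI CT H.
have := @indep_pi_half D <<s C >> Dm sDm DI DT.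
move=> /(_ _ B A sB sA); rewrite setIC => ->.
  by rewrite fineM ?fin_num_measure 1?mulrC//; apply: gsigma_measurable;
    [exact: Dm|exact: sB|exact: Cm|exact: sA].
by move=> E F DE CF; rewrite setIC H1// muleC.
Qed.

(** For staircase approximations of [f] and [g] the product rule is the independence of their
    superlevel sets [A i] and [B j]; uniform approximation passes it on to [f] and [g]. *)
Lemma indep_Ex C D f g : C `<=` measurable -> D `<=` measurable -> indep C D ->
  meas_wrt C f -> meas_wrt D g ->
  (exists M, forall x, `|f x| <= M) -> (exists M, forall x, `|g x| <= M) ->
  Ex P (fun x => f x * g x) = Ex P f * Ex P g.
Proof.
move=> Cm Dm CD mf mg [M fM'] [N gN'].
have bf : bmf f by split; [exact: meas_wrtW mf|exists M].
have bg : bmf g by split; [exact: meas_wrtW mg|exists N].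
(* Adding the bounds [M] and [N] makes both functions nonnegative, and both sides change by the same
   linear terms. *)
wlog [f0 g0] : f g M N mf mg fM' gN' bf bg /
    (forall x, 0 <= f x) /\ (forall x, 0 <= g x).
  move=> H.
  have := H (fun x => f x + M) (fun x => g x + N) (M + M) (N + N).
  have mf1 : meas_wrt C (fun x => f x + M) by exact: measurable_funD.
  have mg1 : meas_wrt D (fun x => g x + N) by exact: measurable_funD.
  have bf1 : bmf (fun x => f x + M) by apply: bmfD => //; exact: bmf_cst.
  have bg1 : bmf (fun x => g x + N) by apply: bmfD => //; exact: bmf_cst.
  have fM1 x : `|f x + M| <= M + M.
    by have := fM' x; rewrite !ler_norml => /andP[? ?]; apply/andP; lra.
  have gN1 x : `|g x + N| <= N + N.
    by have := gN' x; rewrite !ler_norml => /andP[? ?]; apply/andP; lra.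
  move=> /(_ mf1 mg1 fM1 gN1 bf1 bg1).
  have bfg := bmfM bf bg.
  rewrite (_ : (fun x => _ * _) = (fun x => (f x * g x + M * g x) +
      (N * f x + M * N))); last by apply/funext => x; ring.
  have bc c := @bmf_cst _ T R c.
  rewrite !ExD ?ExZ ?Ex_cst//; do ?[exact: bmfZ|apply: bmfD => //; exact: bmfZ].
  have pos : (forall x, 0 <= f x + M) /\ (forall x, 0 <= g x + N).
    split=> x; have := fM' x; have := gN' x; rewrite !ler_norml => /andP[? ?] /andP[? ?]; lra.
  by move=> /(_ pos); nra.
have fM x : f x <= M by rewrite (le_trans (ler_norm _)).
have gN x : g x <= N by rewrite (le_trans (ler_norm _)).
have x0 : T by exact: point.
have M0 : 0 <= M by rewrite (le_trans (f0 x0)).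
have N0 : 0 <= N by rewrite (le_trans (g0 x0)).
apply/eqP; rewrite -subr_eq0 -normr_le0; apply/ler_addgt0Pr => e' e'0; rewrite add0r.
(* Replacing [f] and [g] by their staircases moves each side by at most (M + N) e. *)
pose e := e' / (1 + 2 * (M + N)).
have K0 : 0 < 1 + 2 * (M + N) by lra.
have e0 : 0 < e by rewrite divr_gt0.
have [n [Mn Nn]] : exists n, M <= n%:R * e /\ N <= n%:R * e.
  exists (Num.bound ((M + N) / e)).
  have : (M + N) / e < (Num.bound ((M + N) / e))%:R.
    by apply: archi_boundP; rewrite divr_ge0 ?addr_ge0// ltW.
  rewrite ltr_pdivrMr// => h; lra.
pose sf x := \sum_(i < n) e * (i.+1%:R * e <= f x)%R%:R.
pose sg x := \sum_(i < n) e * (i.+1%:R * e <= g x)%R%:R.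
have Hf x : 0 <= f x - sf x <= e.
  by apply: step_sum_approx => //; rewrite f0 (le_trans (fM x)).
have Hg x : 0 <= g x - sg x <= e.
  by apply: step_sum_approx => //; rewrite g0 (le_trans (gN x)).
pose A i := [set x | i.+1%:R * e <= f x].
pose B i := [set x | i.+1%:R * e <= g x].
have CA i : <<s C >> (A i).
  have := mf measurableT `[i.+1%:R * e, +oo[%classic.
  rewrite setTI => /(_ (measurable_itv _)).
  by rewrite (_ : _ @^-1` _ = A i)//; apply/seteqP; split=> x /=;
    rewrite /A/= in_itv/= andbT.
have DB i : <<s D >> (B i).
  have := mg measurableT `[i.+1%:R * e, +oo[%classic.
  rewrite setTI => /(_ (measurable_itv _)).
  by rewrite (_ : _ @^-1` _ = B i)//; apply/seteqP; split=> x /=;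
    rewrite /B/= in_itv/= andbT.
have mA i : measurable (A i) by exact: (gsigma_measurable Cm).
have mB i : measurable (B i) by exact: (gsigma_measurable Dm).
have sfE : sf = fun x => \sum_(i < n) e * \1_(A i) x.
  apply/funext => x; apply: eq_bigr => i _; rewrite indicE; congr (e * _%:R).
  by rewrite (_ : (x \in A i) = (i.+1%:R * e <= f x))//; apply/idP/idP;
    rewrite inE.
have sgE : sg = fun x => \sum_(i < n) e * \1_(B i) x.
  apply/funext => x; apply: eq_bigr => i _; rewrite indicE; congr (e * _%:R).
  by rewrite (_ : (x \in B i) = (i.+1%:R * e <= g x))//; apply/idP/idP;
    rewrite inE.
have bA i : bmf (fun x => e * \1_(A i) x) by apply: bmfZ; exact: bmf_indic.
have bB i : bmf (fun x => e * \1_(B i) x) by apply: bmfZ; exact: bmf_indic.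
have bsf : bmf sf by rewrite sfE; exact: bmf_sum.
have bsg : bmf sg by rewrite sgE; exact: bmf_sum.
have Esf : Ex P sf = \sum_(i < n) e * fine (P (A i)).
  rewrite sfE Ex_sum//; apply: eq_bigr => i _.
  by rewrite ExZ ?Ex_indic//; exact: bmf_indic.
have Esg : Ex P sg = \sum_(i < n) e * fine (P (B i)).
  rewrite sgE Ex_sum//; apply: eq_bigr => i _.
  by rewrite ExZ ?Ex_indic//; exact: bmf_indic.
have Es : Ex P (fun x => sf x * sg x) = Ex P sf * Ex P sg.
  rewrite Esf Esg big_distrlr/= sfE sgE.
  rewrite (_ : (fun x => _ * _) = fun x => \sum_(i < n) \sum_(j < n)
      e * e * \1_(A i `&` B j) x); last first.
    apply/funext => x; rewrite big_distrlr/=; apply: eq_bigr => i _.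
    by apply: eq_bigr => j _; rewrite indicI/=; ring.
  have bAB i j : bmf (fun x => e * e * \1_(A i `&` B j) x).
    by apply: bmfZ; apply: bmf_indic; exact: measurableI.
  rewrite Ex_sum; last by move=> i _; exact: bmf_sum.
  apply: eq_bigr => i _; rewrite Ex_sum//; apply: eq_bigr => j _.
  rewrite ExZ ?Ex_indic ?CD//; [ring|exact: measurableI|].
  by apply: bmf_indic; exact: measurableI.
have bfg := bmfM bf bg; have bsfg := bmfM bsf bsg.
have H1 : Ex P f - e <= Ex P sf <= Ex P f.
  rewrite le_Ex ?andbT//; last by move=> x; have := Hf x; lra.
  rewrite -[X in _ - X](Ex_cst P e) -ExB//; last exact: bmf_cst.
  apply: le_Ex => //; first by apply: bmfB => //; exact: bmf_cst.
  by move=> x; have := Hf x; lra.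
have H2 : Ex P g - e <= Ex P sg <= Ex P g.
  rewrite le_Ex ?andbT//; last by move=> x; have := Hg x; lra.
  rewrite -[X in _ - X](Ex_cst P e) -ExB//; last exact: bmf_cst.
  apply: le_Ex => //; first by apply: bmfB => //; exact: bmf_cst.
  by move=> x; have := Hg x; lra.
have H3 : `|Ex P (fun x => f x * g x) - Ex P (fun x => sf x * sg x)| <= (M + N) * e.
  rewrite (le_trans (Ex_normB _ _ _))// Ex_le_cst//.
    by apply: bmf_norm; exact: bmfB.
  move=> x; have := Hf x; have := Hg x; have := fM x; have := gN x.
  have := f0 x; have := g0 x.
  have sf0 : 0 <= sf x by apply: sumr_ge0 => i _; rewrite mulr_ge0 ?ler0n// ltW.
  have sg0 : 0 <= sg x by apply: sumr_ge0 => i _; rewrite mulr_ge0 ?ler0n// ltW.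
  move=> ? ? ? ? /andP[? ?] /andP[? ?]; rewrite ler_norml; nra.
have fE0 : 0 <= Ex P f by exact: Ex_ge0.
have gE0 : 0 <= Ex P g by exact: Ex_ge0.
have fEM : Ex P f <= M by exact: Ex_le_cst.
have gEN : Ex P g <= N by exact: Ex_le_cst.
have sf0 : 0 <= Ex P sf.
  by apply: Ex_ge0 => x; apply: sumr_ge0 => i _; rewrite mulr_ge0 ?ler0n// ltW.
have sg0 : 0 <= Ex P sg.
  by apply: Ex_ge0 => x; apply: sumr_ge0 => i _; rewrite mulr_ge0 ?ler0n// ltW.
have H4 : `|Ex P sf * Ex P sg - Ex P f * Ex P g| <= (M + N) * e.
  by move: H1 H2 => /andP[? ?] /andP[? ?]; rewrite ler_norml; nra.
rewrite Es in H3.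
have -> : e' = (1 + 2 * (M + N)) * e by rewrite /e mulrC divfK// gt_eqF.
move: H3 H4; rewrite !ler_norml => /andP[? ?] /andP[? ?]; nra.
Qed.

End Independence.

(** * Convergence in distribution from characteristic functions *)

Lemma cvgn_le (R : realType) (u : nat -> R) (l : R) :
  (forall e, 0 < e -> exists N, forall n, (N <= n)%N -> `|u n - l| <= e) ->
  u n @[n --> \oo] --> l.
Proof.
move=> H; apply/cvgrPdist_le => e /H[N HN].
by exists N => //= n /HN; rewrite distrC.
Qed.

Lemma cvgn_leP (R : realType) (u : nat -> R) (l : R) : u n @[n --> \oo] --> l ->
  forall e, 0 < e -> exists N, forall n, (N <= n)%N -> `|u n - l| <= e.
Proof.
move=> /cvgrPdist_le H e /H[N _ HN].
by exists N => n /HN; rewrite distrC.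
Qed.

Lemma cvgy_leP (R : realType) (u : R -> R) (l : R) : u x @[x --> +oo] --> l ->
  forall e, 0 < e -> exists B, forall x, B < x -> `|u x - l| <= e.
Proof.
move=> /cvgrPdist_le H e /H[N [_ HN]].
by exists N => n /HN; rewrite distrC.
Qed.

Lemma cvgy_le (R : realType) (u : R -> R) (l : R) :
  (forall e, 0 < e -> exists B, forall x, B < x -> `|u x - l| <= e) ->
  u x @[x --> +oo] --> l.
Proof.
move=> H; apply/cvgrPdist_le => e /H[B HB].
exists B; split; first exact: num_real.
by move=> x /HB; rewrite distrC.
Qed.

Lemma le_cvgn (R : realType) (u v : nat -> R) (l l' : R) :
  u n @[n --> \oo] --> l -> v n @[n --> \oo] --> l' ->
  (exists N, forall n, (N <= n)%N -> u n <= v n) -> l <= l'.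
Proof.
move=> /cvgn_leP ul /cvgn_leP vl [N HN]; apply/ler_addgt0Pr => e e0.
have e2 : 0 < e / 2 by lra.
have [N1 H1] := ul _ e2; have [N2 H2] := vl _ e2.
pose m := (N + N1 + N2)%N.
have := HN m; have := H1 m; have := H2 m.
have [mN mN1 mN2] : [/\ (N <= m)%N, (N1 <= m)%N & (N2 <= m)%N].
  by rewrite /m; split; lia.
by rewrite !ler_norml => /(_ mN2)/andP[? ?] /(_ mN1)/andP[? ?] /(_ mN); lra.
Qed.

Lemma cvg_sum_ord (R : realType) (T : Type) (G : set_system T) (N : nat)
  (f : nat -> T -> R) (l : nat -> R) : Filter G ->
  (forall i, (i < N)%N -> f i x @[x --> G] --> l i) ->
  (\sum_(i < N) f i x) @[x --> G] --> \sum_(i < N) l i.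
Proof.
move=> FG; elim: N => [|N ih] H.
  by under eq_fun do rewrite big_ord0; rewrite big_ord0; exact: cvg_cst.
under eq_fun do rewrite big_ord_recr; rewrite big_ord_recr.
by apply: cvgD; [apply: ih => i iN; apply: H; exact: leqW|exact: H].
Qed.

Lemma cvgn_approx (R : realType) (u : nat -> R) :
  (forall e, 0 < e -> exists (v : nat -> R) (l : R),
     v n @[n --> \oo] --> l /\
     exists N, forall n, (N <= n)%N -> `|u n - v n| <= e) ->
  cvg (u n @[n --> \oo]).
Proof.
move=> H; apply/cauchy_cvgP/cauchy_ballP => e e0; near_simpl.
(* Four errors of e / 5 stay strictly below e, as the open ball requires. *)
have e4 : 0 < e / 5 by lra.
have [v [l [/cvgn_leP/(_ _ e4)[N1 vl] [N2 uv]]]] := H _ e4.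
pose N := maxn N1 N2.
exists ([set n | (N <= n)%N], [set n | (N <= n)%N]).
  by split; exists N.
move=> [n m] /= []; rewrite /N !geq_max => /andP[n1 n2] /andP[m1 m2].
rewrite /ball /=.
have := vl _ n1; have := vl _ m1; have := uv _ n2; have := uv _ m2.
by rewrite !ler_norml ltr_norml => /andP[? ?] /andP[? ?] /andP[? ?] /andP[? ?];
  apply/andP; split; lra.
Qed.

(** Compactness of the segment. Only [x] is confined to it: near an end point it may be compared
    with a [y] outside, as happens when a random variable is moved by a perturbation. *)
Lemma unif_cont_itv (R : realType) (f : R -> R) (a b e : R) : continuous f ->
  0 < e -> exists2 dl : R, 0 < dl & forall x y, a <= x <= b -> `|x - y| < dl ->
    `|f x - f y| <= e.
Proof.
move=> cf e0.
have /compact_near_coveringP := @segment_compact R a b.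
move=> /(_ _ (0^'+) (fun dl x => forall y, `|x - y| < dl -> `|f x - f y| <= e)).
case.
  move=> x0 _; have /cvgrPdist_le/(_ (e / 2)) := cf x0.
  rewrite divr_gt0// => /(_ isT)/nbhs_ballP[r /= r0 H].
  exists (ball x0 (r / 2), [set dl | 0 < dl < r / 2]).
    split=> /=.
      by apply/nbhs_ballP; exists (r / 2) => //=; rewrite divr_gt0.
    exists (r / 2) => /=; first by rewrite divr_gt0.
    by move=> z /=; rewrite sub0r normrN => zr z0; rewrite z0 (le_lt_trans _ zr)// ler_norm.
  move=> [x dl] /= [xx0 /andP[dl0 dlr]] y xy.
  have x0x : `|x0 - x| < r / 2 := xx0.
  have H1 : `|f x0 - f x| <= e / 2.
    by apply: H; rewrite /ball/=; lra.
  have H2 : `|f x0 - f y| <= e / 2.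
    apply: H; rewrite /ball/= -(subrK x x0) -addrA (le_lt_trans (ler_normD _ _))//.
    lra.
  move: H1 H2; rewrite !ler_norml => /andP[? ?] /andP[? ?]; apply/andP; lra.
move=> r /= r0 H; exists (r / 2); first by rewrite divr_gt0.
move=> x y xab; apply: H => //=.
- by rewrite sub0r normrN gtr0_norm; lra.
- lra.
Qed.

(* Expectation of [phi (k + binomial(n, x))], by recursion on the number of
   trials: Bernstein's polynomials without binomial coefficients. *)
Fixpoint bern (R : realType) (phi : nat -> R) (n : nat) (x : R) : R :=
  if n is m.+1 then (1 - x) * bern phi m x + x * bern (phi \o succn) m x
  else phi 0%N.

Section Bernstein.
Variable R : realType.
Implicit Types (phi psi : nat -> R) (x : R).

Lemma bernD phi psi n x :
  bern (fun k => phi k + psi k) n x = bern phi n x + bern psi n x.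
Proof.
elim: n phi psi => [//|n ih] phi psi /=; rewrite ih.
by rewrite (_ : _ \o _ = fun k => (phi \o succn) k + (psi \o succn) k)// ih; ring.
Qed.

Lemma bernZ c phi n x : bern (fun k => c * phi k) n x = c * bern phi n x.
Proof.
elim: n phi => [//|n ih] phi /=; rewrite ih.
by rewrite (_ : _ \o _ = fun k => c * (phi \o succn) k)// ih; ring.
Qed.

Lemma bern_cst c n x : bern (fun=> c) n x = c.
Proof. by elim: n => [//|n ih] /=; rewrite /comp ih; ring. Qed.

Lemma bern_le phi psi n x : 0 <= x <= 1 ->
  (forall k, (k <= n)%N -> phi k <= psi k) -> bern phi n x <= bern psi n x.
Proof.
move=> /andP[x0 x1]; elim: n phi psi => [|n ih] phi psi H /=; first exact: H.
by rewrite lerD// ler_wpM2l ?subr_ge0//; apply: ih => k kn; apply: H => //;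
  exact: leqW.
Qed.

Lemma bern_var n x (c : R) :
  bern (fun k => (k%:R - c) ^+ 2) n x = n%:R * x * (1 - x) + (n%:R * x - c) ^+ 2.
Proof.
elim: n c => [|n ih] c /=; first by ring.
rewrite ih (_ : _ \o _ = fun k => (k%:R - (c - 1)) ^+ 2); last first.
  by apply/funext => k /=; rewrite -natr1; ring.
by rewrite ih -natr1; ring.
Qed.

(** Bernstein's proof of the Weierstrass theorem. With c = 2 M / dl^2 the error at k / n is at most
    e / 2 + c (k / n - x)^2: uniform continuity covers |k / n - x| < dl, and beyond it the quadratic
    term exceeds 2 M. Its average, by [bern_var], is c x (1 - x) / n. *)
Lemma bernstein (h : R -> R) (M e : R) : continuous h -> 0 < e ->
  (forall x, `|h x| <= M) ->
  exists2 n, (0 < n)%N & forall x, 0 <= x <= 1 ->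
    `|h x - bern (fun k => h (k%:R / n%:R)) n x| <= e.
Proof.
move=> ch e0 hM.
have e2 : 0 < e / 2 by lra.
have [dl dl0 hdl] := unif_cont_itv 0 1 ch e2.
have M0 : 0 <= M by rewrite (le_trans (normr_ge0 (h 0))).
pose c := 2 * M / dl ^+ 2.
have c0 : 0 <= c by rewrite divr_ge0 ?sqr_ge0// mulr_ge0.
pose n := (Num.bound (c / (e / 2))).+1.
exists n => // x x01.
have n0 : 0 < n%:R :> R by rewrite ltr0n.
have cn : c / n%:R <= e / 2.
  rewrite ler_pdivrMr// mulrC -ler_pdivrMr//.
  have : c / (e / 2) < (Num.bound (c / (e / 2)))%:R.
    by apply: archi_boundP; rewrite divr_ge0// ltW.
  by move/ltW/le_trans; apply; rewrite ler_nat.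
pose Q k := e / 2 + (c / n%:R ^+ 2) * (k%:R - n%:R * x) ^+ 2.
have HQ k : `|h x - h (k%:R / n%:R)| <= Q k.
  have q0 : 0 <= (c / n%:R ^+ 2) * (k%:R - n%:R * x) ^+ 2.
    by rewrite mulr_ge0 ?sqr_ge0// divr_ge0 ?sqr_ge0.
  have [d1|d1] := ltP `|x - k%:R / n%:R| dl.
    by rewrite (le_trans (hdl _ _ x01 d1))// lerDl.
  rewrite (@le_trans _ _ (2 * M))//.
    rewrite (le_trans (ler_normB _ _))// mulrDl mul1r lerD//.
  rewrite /Q; have -> : c / n%:R ^+ 2 * (k%:R - n%:R * x) ^+ 2 =
      2 * M * (`|x - k%:R / n%:R| / dl) ^+ 2.
    rewrite expr_div_n real_normK ?num_real// /c.
    by field; rewrite !gt_eqF.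
  have : 1 <= (`|x - k%:R / n%:R| / dl) ^+ 2.
    by rewrite exprn_ege1// ler_pdivlMr// mul1r.
  nra.
have E1 : bern (fun k => h x - h (k%:R / n%:R)) n x =
    h x - bern (fun k => h (k%:R / n%:R)) n x.
  have := bernD (fun=> h x) (fun k => - 1 * h (k%:R / n%:R)) n x.
  rewrite bern_cst bernZ mulN1r => <-; congr bern.
  by apply/funext => k; rewrite mulN1r.
have E2 : bern Q n x <= e.
  rewrite /Q bernD bern_cst bernZ bern_var subrr expr0n/= addr0.
  have : c / n%:R ^+ 2 * (n%:R * x * (1 - x)) = (c / n%:R) * (x * (1 - x)).
    by field; rewrite gt_eqF.
  move=> ->; move: x01 => /andP[x0 x1].
  have : 0 <= c / n%:R by rewrite divr_ge0// ltW.
  nra.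
rewrite -E1 ler_norml; apply/andP; split.
  have := @bern_le (fun k => - 1 * Q k) (fun k => h x - h (k%:R / n%:R)) n x x01.
  rewrite bernZ => H; apply: le_trans (H _); first by lra.
  by move=> k _; have := HQ k; rewrite ler_norml => /andP[]; lra.
apply: le_trans E2; apply: bern_le => // k _.
by rewrite (le_trans (ler_norm _)).
Qed.

End Bernstein.

Section TrigApprox.
Context (d : measure_display) (T : measurableType d) (R : realType).
Variable P : probability T R.
Variable Y : nat -> T -> R.
Hypothesis mY : forall n, measurable_fun [set: T] (Y n).
Hypothesis cosY : forall t, cvg (Ex P (fun w => cos (t * Y n w)) @[n --> \oo]).
Hypothesis sinY : forall t, cvg (Ex P (fun w => sin (t * Y n w)) @[n --> \oo]).
Hypothesis tightY : forall e, 0 < e -> exists K : R, exists N, forall n,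
  (N <= n)%N -> fine (P [set w | K < `|Y n w|]) <= e.

(** Test functions whose products with all cos (t Y) and sin (t Y) have convergent expectations. The
    trigonometric factor makes the class stable under multiplication by sin (s x), by the
    product-to-sum formulas, so it contains the polynomials in sin (s x); constants belong to it by
    convergence of the characteristic functions. *)
Let tcvg (g : R -> R) := [/\ continuous g, exists M, forall x, `|g x| <= M,
  forall t, cvg (Ex P (fun w => g (Y n w) * cos (t * Y n w)) @[n --> \oo]) &
  forall t, cvg (Ex P (fun w => g (Y n w) * sin (t * Y n w)) @[n --> \oo])].

Lemma continuous_cosM (t : R) : continuous (fun x => cos (t * x)).
Proof.
move=> x; apply: (@continuous_comp _ _ _ ( *%R t)); first exact: mulrl_continuous.
exact: continuous_cos.
Qed.

Lemma continuous_sinM (t : R) : continuous (fun x => sin (t * x)).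
Proof.
move=> x; apply: (@continuous_comp _ _ _ ( *%R t)); first exact: mulrl_continuous.
exact: continuous_sin.
Qed.

Let bY (g : R -> R) n : continuous g -> (exists M, forall x, `|g x| <= M) ->
  bmf (fun w => g (Y n w)).
Proof. by move=> cg [M gM]; exact: (bmf_ccomp (mY n) cg gM). Qed.

Let bcos t n : bmf (fun w => cos (t * Y n w)).
Proof.
apply: (@bY (fun x => cos (t * x))); first exact: continuous_cosM.
by exists 1 => x; exact: cos_max.
Qed.

Let bsin t n : bmf (fun w => sin (t * Y n w)).
Proof.
apply: (@bY (fun x => sin (t * x))); first exact: continuous_sinM.
by exists 1 => x; exact: sin_max.
Qed.

Let tcvg_cst c : tcvg (fun=> c).
Proof.
split; [exact: cst_continuous|by exists `|c| | |] => t.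
- rewrite (_ : (fun n => _) = fun n => c * Ex P (fun w => cos (t * Y n w))).
    by apply: is_cvgMr; exact: cosY.
  by apply/funext => n; rewrite ExZ//; exact: bcos.
- rewrite (_ : (fun n => _) = fun n => c * Ex P (fun w => sin (t * Y n w))).
    by apply: is_cvgMr; exact: sinY.
  by apply/funext => n; rewrite ExZ//; exact: bsin.
Qed.

Let tcvgD f g : tcvg f -> tcvg g -> tcvg (fun x => f x + g x).
Proof.
move=> [cf [M fM] fc fs] [cg [N gN] gc gs].
have bf n : bmf (fun w => f (Y n w)) by apply: bY => //; exists M.
have bg n : bmf (fun w => g (Y n w)) by apply: bY => //; exists N.
split.
- by move=> x; apply: cvgD; [exact: cf|exact: cg].
- by exists (M + N) => x; rewrite (le_trans (ler_normD _ _))// lerD.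
- move=> t; have bc n := bcos t n; rewrite (_ : (fun n => _) = fun n =>
      Ex P (fun w => f (Y n w) * cos (t * Y n w)) +
      Ex P (fun w => g (Y n w) * cos (t * Y n w))); first exact: is_cvgD.
  apply/funext => n; rewrite -ExD; [|exact: bmfM|exact: bmfM].
  by congr Ex; apply/funext => w; rewrite mulrDl.
- move=> t; have bs n := bsin t n; rewrite (_ : (fun n => _) = fun n =>
      Ex P (fun w => f (Y n w) * sin (t * Y n w)) +
      Ex P (fun w => g (Y n w) * sin (t * Y n w))); first exact: is_cvgD.
  apply/funext => n; rewrite -ExD; [|exact: bmfM|exact: bmfM].
  by congr Ex; apply/funext => w; rewrite mulrDl.
Qed.

Let tcvgZ c f : tcvg f -> tcvg (fun x => c * f x).
Proof.
move=> [cf [M fM] fc fs].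
have bf n : bmf (fun w => f (Y n w)) by apply: bY => //; exists M.
split.
- by move=> x; apply: cvgMr; exact: cf.
- by exists (`|c| * M) => x; rewrite normrM ler_wpM2l.
- move=> t; rewrite (_ : (fun n => _) = fun n => c * Ex P (fun w => f (Y n w) * cos (t * Y n w))).
    by apply: is_cvgMr.
  apply/funext => n; rewrite -ExZ; last by apply: bmfM => //; exact: bcos.
  by congr Ex; apply/funext => w; rewrite mulrA.
- move=> t; rewrite (_ : (fun n => _) = fun n => c * Ex P (fun w => f (Y n w) * sin (t * Y n w))).
    by apply: is_cvgMr.
  apply/funext => n; rewrite -ExZ; last by apply: bmfM => //; exact: bsin.
  by congr Ex; apply/funext => w; rewrite mulrA.
Qed.

Let tcvg_sin s f : tcvg f -> tcvg (fun x => sin (s * x) * f x).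
Proof.
move=> [cf [M fM] fc fs].
have bf n : bmf (fun w => f (Y n w)) by apply: bY => //; exists M.
split.
- by move=> x; apply: cvgM; [exact: continuous_sinM|exact: cf].
- exists M => x; rewrite normrM -[leRHS]mul1r ler_pM//; exact: sin_max.
- move=> t; rewrite (_ : (fun n => _) = fun n =>
      2^-1 * (Ex P (fun w => f (Y n w) * sin ((s + t) * Y n w)) +
              Ex P (fun w => f (Y n w) * sin ((s - t) * Y n w)))).
    by apply: is_cvgMr; exact: is_cvgD.
  apply/funext => n; have bs t' := bsin t' n.
  rewrite -ExD; [|exact: bmfM|exact: bmfM].
  rewrite -ExZ; last by apply: bmfD; exact: bmfM.
  by congr Ex; apply/funext => w; rewrite mulrDl mulrBl sinD sinB; field.
- move=> t; rewrite (_ : (fun n => _) = fun n =>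
      2^-1 * (Ex P (fun w => f (Y n w) * cos ((s - t) * Y n w)) -
              Ex P (fun w => f (Y n w) * cos ((s + t) * Y n w)))).
    by apply: is_cvgMr; exact: is_cvgB.
  apply/funext => n; have bc t' := bcos t' n.
  rewrite -ExB; [|exact: bmfM|exact: bmfM].
  rewrite -ExZ; last by apply: bmfB; exact: bmfM.
  by congr Ex; apply/funext => w; rewrite mulrBl mulrDl cosB cosD; field.
Qed.

Let tcvg_bern phi n s : tcvg (fun x => bern phi n (2^-1 + 2^-1 * sin (s * x))).
Proof.
elim: n phi => [|n ih] phi /=; first exact: tcvg_cst.
rewrite (_ : (fun x => _) = (fun x =>
  (2^-1 * bern phi n (2^-1 + 2^-1 * sin (s * x)) +
   (- 2^-1) * (sin (s * x) * bern phi n (2^-1 + 2^-1 * sin (s * x)))) +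
  (2^-1 * bern (phi \o succn) n (2^-1 + 2^-1 * sin (s * x)) +
   2^-1 * (sin (s * x) * bern (phi \o succn) n (2^-1 + 2^-1 * sin (s * x)))))).
  have h1 := ih phi; have h2 := ih (phi \o succn).
  exact: (tcvgD (tcvgD (tcvgZ _ h1) (tcvgZ _ (tcvg_sin s h1)))
    (tcvgD (tcvgZ _ h2) (tcvgZ _ (tcvg_sin s h2)))).
by apply/funext => x; field.
Qed.

(** On [-K, K] the map x |-> sin (x / K) is injective, so there [f] is a continuous function [h] of
    (1 + sin (x / K)) / 2, and a Bernstein polynomial of [h] gives a trigonometric polynomial
    uniformly close to [f]. Outside, tightness leaves an event of small probability. *)
Lemma cvg_Ex_of_cf (f : R -> R) : continuous f -> (exists M, forall x, `|f x| <= M) ->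
  cvg (Ex P (fun w => f (Y n w)) @[n --> \oo]).
Proof.
move=> cf [M fM]; apply: cvgn_approx => e e0.
have M0 : 0 <= M by rewrite (le_trans (normr_ge0 (f 0))).
have e2 : 0 < e / 2 / (2 * M + e + 1) by rewrite !divr_gt0//; lra.
have [K0 [N HN]] := tightY e2.
pose K := Num.max K0 1.
have K1 : 1 <= K by rewrite le_max lexx orbT.
have Kp : 0 < K by lra.
have e4 : 0 < e / 2 by lra.
have s1 : sin 1 < 1 :> R.
  have := cos1_gt0 R; have := cos2Dsin2 (1 : R); have := sin_le1 (1 : R); nra.
have s0 : 0 < sin 1 :> R by apply: sin2_gt0; lra.
(* Clamping at sin 1 < 1 keeps [asin] inside the open interval where it is continuous; for |x| <= K
   the clamp has no effect, since |x / K| <= 1. *)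
pose cl (u : R) := Num.min (sin 1) (Num.max (- sin 1) (2 * u - 1)).
have ccl : continuous cl.
  move=> u; apply: (@continuous_min R R (fun=> sin 1)
    (fun v => Num.max (- sin 1) (2 * v - 1))); first exact: cst_continuous.
  apply: (@continuous_max R R (fun=> - sin 1) (fun v => 2 * v - 1)).
    exact: cst_continuous.
  by apply: cvgB; [exact: mulrl_continuous|exact: cst_continuous].
have clB u : - sin 1 <= cl u <= sin 1.
  by rewrite /cl le_min ge_min lexx/= andbT le_max lexx/= andbT; lra.
pose h u := f (asin (cl u) * K).
have ch : continuous h.
  move=> u; rewrite /h; apply: (@continuous_comp _ _ _ (fun v => asin (cl v) * K)); last exact: cf.
  apply: (@continuous_comp _ _ _ (asin \o cl) (fun v => v * K)); last exact: mulrr_continuous.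
  apply: continuous_comp; first exact: ccl.
  by apply: continuous_asin; have := clB u; lra.
have [n n0 Hn] := bernstein ch e4 (fun u => fM _).
pose g x := bern (fun k => h (k%:R / n%:R)) n (2^-1 + 2^-1 * sin (K^-1 * x)).
have s01 (x : R) : 0 <= 2^-1 + 2^-1 * sin x <= 1.
  by have := sin_le1 x; have := sin_geN1 x; lra.
have [cg [Mg gM] gcos gsin] := tcvg_bern (fun k => h (k%:R / n%:R)) n K^-1.
have gB x : `|g x| <= M + e / 2.
  have := Hn _ (s01 (K^-1 * x)); rewrite -/(g x) => H.
  have := fM (asin (cl (2^-1 + 2^-1 * sin (K^-1 * x))) * K); rewrite -/(h _).
  by move: H; rewrite !ler_norml => /andP[? ?] /andP[? ?]; apply/andP; lra.
have fg x : `|x| <= K -> `|f x - g x| <= e / 2.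
  move=> xK; have := Hn _ (s01 (K^-1 * x)); rewrite -/(g x).
  suff -> : h (2^-1 + 2^-1 * sin (K^-1 * x)) = f x by [].
  have xK1 : -1 <= K^-1 * x <= 1.
    move: xK; rewrite ler_norml => /andP[? ?].
    by rewrite mulrC ler_pdivlMr// ler_pdivrMr// mulN1r mul1r; apply/andP.
  have pi2 : 1 <= pi / 2 :> R by have := pi_ge2 R; lra.
  have sB : - sin 1 <= sin (K^-1 * x) <= sin 1.
    rewrite -sinN; apply/andP; split.
      by rewrite leNgt ltr_sin -?leNgt ?in_itv//=; lra.
    by rewrite leNgt ltr_sin -?leNgt ?in_itv//=; lra.
  rewrite /h (_ : cl _ = sin (K^-1 * x)).
    by rewrite sinK ?in_itv/= 1?mulrC 1?mulrA ?mulfV ?mul1r ?gt_eqF//; lra.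
  rewrite /cl (_ : 2 * _ - 1 = sin (K^-1 * x)); last by field.
  rewrite max_r; last by case/andP: sB.
  by rewrite min_r//; case/andP: sB.
exists (fun m => Ex P (fun w => g (Y m w))).
have cvgg : cvg (Ex P (fun w => g (Y m w)) @[m --> \oo]).
  have := gcos 0; rewrite (_ : (fun m => _) = fun m => Ex P (fun w => g (Y m w)))//.
  by apply/funext => m; congr Ex; apply/funext => w; rewrite mul0r cos0 mulr1.
exists (lim (Ex P (fun w => g (Y m w)) @[m --> \oo])); split=> //.
exists N => m Nm.
have bf : bmf (fun w => f (Y m w)) by apply: bY => //; exists M.
have bg : bmf (fun w => g (Y m w)) by apply: bY => //; exists Mg.
have mA : measurable [set w | K0 < `|Y m w|].
  by apply: mset_lt => //; exact: measurableT_comp.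
rewrite (le_trans (Ex_normB _ bf bg))//.
apply: (@le_trans _ _ (Ex P (fun w => e / 2 + (2 * M + e / 2) * \1_[set w | K0 < `|Y m w|] w))).
  apply: le_Ex.
  - by apply: bmf_norm; exact: bmfB.
  - by apply: bmfD; [exact: bmf_cst|apply: bmfZ; exact: bmf_indic].
  - move=> w; rewrite indicE; case: (boolP (w \in _)).
      move=> _; rewrite mulr1 (le_trans (ler_normB _ _))//.
      have := fM (Y m w); have := gB (Y m w); lra.
    rewrite notin_setE/= => /negP; rewrite -leNgt => H.
    by rewrite mulr0 addr0 fg// /K (le_trans H)// le_max lexx.
rewrite ExD ?Ex_cst ?ExZ ?Ex_indic//; try exact: bmf_cst; try exact: bmf_indic;
  try (by apply: bmfZ; exact: bmf_indic).
have := HN _ Nm; set p := fine _ => Hp.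
have p0 : 0 <= p by exact: Pr_ge0.
move: Hp; rewrite ler_pdivlMr; last lra.
nra.
Qed.

End TrigApprox.

Section StepApprox.
Context (d : measure_display) (T : measurableType d) (R : realType).
Variable P : probability T R.

(** A Riemann-Stieltjes estimate: by telescoping, Z minus the sum is the sum of (Z - x i) times the
    increments of [rho], plus Z (1 - rho N + rho 0). Leaving [rho] abstract lets it serve both for
    indicators of half-lines under the limit law and for ramps along the sequence. *)
Lemma step_Ex (Z c : T -> R) (x : nat -> R) (rho : nat -> T -> R) (M e : R) N :
  0 <= e -> bmf Z -> (forall w, `|Z w| <= M) ->
  (forall i, bmf (rho i)) ->
  (forall i w, (i < N)%N -> rho i w <= rho i.+1 w) ->
  (forall w, 0 <= rho 0%N w) -> (forall w, rho N w <= 1) ->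
  (forall i w, (i < N)%N -> rho i w < rho i.+1 w -> `|Z w - x i| <= e) ->
  `|Ex P Z - \sum_(i < N) x i * (Ex P (rho i.+1) - Ex P (rho i))| <=
    e + M * (1 - Ex P (rho N) + Ex P (rho 0%N)).
Proof.
move=> e0 bZ ZM brho rhoS rho0 rho1 H.
have bs i : bmf (fun w => x i * (rho i.+1 w - rho i w)).
  by apply: bmfZ; exact: bmfB.
have -> : \sum_(i < N) x i * (Ex P (rho i.+1) - Ex P (rho i)) =
    Ex P (fun w => \sum_(i < N) x i * (rho i.+1 w - rho i w)).
  rewrite Ex_sum//; apply: eq_bigr => i _.
  by rewrite ExZ ?ExB//; exact: bmfB.
have b1 := @bmf_cst _ T R 1; have be := @bmf_cst _ T R e.
have -> : e + M * (1 - Ex P (rho N) + Ex P (rho 0%N)) =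
    Ex P (fun w => e + M * ((1 - rho N w) + rho 0%N w)).
  have bB : bmf (fun w => 1 - rho N w) by exact: bmfB.
  have bD := bmfD bB (brho 0%N).
  rewrite (ExD P be (bmfZ M bD)) (ExZ P M bD) (ExD P bB (brho 0%N)).
  by rewrite (ExB P b1 (brho N)) !Ex_cst.
have bsum : bmf (fun w => \sum_(i < N) x i * (rho i.+1 w - rho i w)).
  exact: bmf_sum.
rewrite (le_trans (Ex_normB _ bZ bsum))//; apply: le_Ex.
- by apply: bmf_norm; exact: bmfB.
- by apply: bmfD => //; apply: bmfZ; apply: bmfD => //; exact: bmfB.
move=> w.
have tel : \sum_(i < N) (rho i.+1 w - rho i w) = rho N w - rho 0%N w.
  by rewrite -(big_mkord xpredT (fun i => rho i.+1 w - rho i w)) telescope_sumr.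
have -> : Z w - \sum_(i < N) x i * (rho i.+1 w - rho i w) =
    \sum_(i < N) (Z w - x i) * (rho i.+1 w - rho i w) +
    Z w * (1 - rho N w + rho 0%N w).
  rewrite [X in _ = X + _](eq_bigr (fun i : 'I_N => Z w * (rho i.+1 w - rho i w) -
     x i * (rho i.+1 w - rho i w))); last by move=> i _; rewrite mulrBl.
  rewrite sumrB -mulr_sumr tel; ring.
rewrite (le_trans (ler_normD _ _))//; apply: lerD.
  apply: (@le_trans _ _ (\sum_(i < N) e * (rho i.+1 w - rho i w))).
    rewrite (le_trans (ler_norm_sum _ _ _))//; apply: ler_sum => i _.
    have r0 : 0 <= rho i.+1 w - rho i w by rewrite subr_ge0 rhoS.
    rewrite normrM (ger0_norm r0).
    have := rhoS i w (ltn_ord i); rewrite le_eqVlt => /predU1P[->|lt].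
      by rewrite subrr !mulr0.
    by rewrite ler_wpM2r// H.
  rewrite -mulr_sumr tel -[leRHS]mulr1 ler_wpM2l//.
  by have := rho0 w; have := rho1 w; lra.
rewrite normrM ler_pM// ger0_norm//.
by have := rho0 w; have := rho1 w; lra.
Qed.

End StepApprox.

(** Continuous substitute for the indicator of ]-oo, v]: the limit of its expectations is given,
    whereas that of an indicator may fail to exist at an atom of the limit. *)
Definition ramp (R : realType) (v h y : R) : R :=
  Num.max 0 (Num.min 1 ((v + h - y) / h)).

Section Ramp.
Variable R : realType.
Implicit Types v h y : R.

Lemma ramp_itv v h y : 0 <= ramp v h y <= 1.
Proof. by rewrite /ramp le_max lexx/= ge_max ler01 ge_min lexx. Qed.

Lemma ramp1 v h y : 0 < h -> y <= v -> ramp v h y = 1.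
Proof.
move=> h0 yv; rewrite /ramp min_l ?max_r// ler_pdivlMr// mul1r; lra.
Qed.

Lemma ramp0 v h y : 0 < h -> v + h <= y -> ramp v h y = 0.
Proof.
move=> h0 yv; rewrite /ramp max_l// ge_min; apply/orP; right.
rewrite pmulr_lle0 ?invr_gt0//; lra.
Qed.

Lemma ramp_le v h v' h' y : 0 < h -> 0 < h' -> v + h <= v' ->
  ramp v h y <= ramp v' h' y.
Proof.
move=> h0 h'0 vv; have [yv|yv] := leP y v'.
  by rewrite (@ramp1 v')//; case/andP: (ramp_itv v h y).
by rewrite ramp0//; [case/andP: (ramp_itv v' h' y)|lra].
Qed.

Lemma continuous_ramp v h : continuous (ramp v h).
Proof.
move=> y; apply: (@continuous_max R R (fun=> 0)
  (fun y => Num.min 1 ((v + h - y) / h))); first exact: cst_continuous.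
apply: (@continuous_min R R (fun=> 1) (fun y => (v + h - y) / h)).
  exact: cst_continuous.
apply: cvgMl; apply: cvgB; [exact: cst_continuous|exact: cvg_id].
Qed.

End Ramp.

Lemma dist_diff (R : realType) (a b c d e : R) :
  `|c - a| <= e -> `|d - b| <= e -> `|a - b - (c - d)| <= 2 * e.
Proof. by rewrite !ler_norml => /andP[? ?] /andP[? ?]; apply/andP; split; lra. Qed.

Lemma tail_sum_le (R : realType) (a b fa fb e1 e : R) : `|a - fa| <= e1 -> `|b - fb| <= e1 ->
  e1 <= e -> 1 - e <= fa -> fb <= e -> 1 - a + b <= 4 * e.
Proof. by rewrite !ler_norml => /andP[? ?] /andP[? ?] ? ? ?; lra. Qed.

(** * Construction of the limit law from limits of expectations *)

Section WeakLimit.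
Context (d : measure_display) (T : measurableType d) (R : realType).
Variable P : probability T R.
Variable Y : nat -> T -> R.
Hypothesis mY : forall n, measurable_fun [set: T] (Y n).
Hypothesis cvgY : forall f : R -> R, continuous f ->
  (exists M, forall x, `|f x| <= M) ->
  cvg (Ex P (fun w => f (Y n w)) @[n --> \oo]).
Hypothesis tightY : forall e, 0 < e -> exists K : R, exists N, forall n,
  (N <= n)%N -> fine (P [set w | K < `|Y n w|]) <= e.

Let Lam (f : R -> R) : R := lim (Ex P (fun w => f (Y n w)) @[n --> \oo]).

Let bY (g : R -> R) n : continuous g -> (exists M, forall x, `|g x| <= M) ->
  bmf (fun w => g (Y n w)).
Proof. by move=> cg [M gM]; exact: (bmf_ccomp (mY n) cg gM). Qed.

Let rbd v h : exists M, forall x : R, `|ramp v h x| <= M.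
Proof.
by exists 1 => x; have /andP[? ?] := ramp_itv v h x; rewrite ger0_norm.
Qed.

Let cvgL f : continuous f -> (exists M, forall x, `|f x| <= M) ->
  Ex P (fun w => f (Y n w)) @[n --> \oo] --> Lam f.
Proof. by move=> cf bf; exact: cvgY. Qed.

Let cvgR v h : Ex P (fun w => ramp v h (Y n w)) @[n --> \oo] --> Lam (ramp v h).
Proof. by apply: cvgL; [exact: continuous_ramp|exact: rbd]. Qed.

Let bR v h n : bmf (fun w => ramp v h (Y n w)).
Proof. by apply: bY; [exact: continuous_ramp|exact: rbd]. Qed.

Let le_Lam v h v' h' : (forall y, ramp v h y <= ramp v' h' y) ->
  Lam (ramp v h) <= Lam (ramp v' h').
Proof.
move=> H; apply: (le_cvgn (@cvgR v h) (@cvgR v' h')).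
by exists 0%N => n _; exact: le_Ex.
Qed.

Let Lam01 v h : 0 <= Lam (ramp v h) <= 1.
Proof.
apply/andP; split.
  apply: (le_cvgn (@cvg_cst _ 0 _ \oo _) (@cvgR v h)).
  exists 0%N => n _; apply: Ex_ge0 => w.
  by case/andP: (ramp_itv v h (Y n w)).
apply: (le_cvgn (@cvgR v h) (@cvg_cst _ (1 : R) _ \oo _)).
exists 0%N => n _; apply: Ex_le_cst => // w.
by case/andP: (ramp_itv v h (Y n w)).
Qed.

(* The right-continuous distribution function of the limit law: requiring
   [x < v.1] makes right-continuity immediate. *)
Let A x := [set Lam (ramp v.1 v.2) | v in [set v : R * R | x < v.1 /\ 0 < v.2]].
Let F x : R := inf (A x).

Let has_infA x : has_inf (A x).
Proof.
split; first by exists (Lam (ramp (x + 1) 1)), (x + 1, 1) => //=; rewrite ltrDl.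
by exists 0 => _ [v _ <-]; case/andP: (Lam01 v.1 v.2).
Qed.

Let F_le x v h : x < v -> 0 < h -> F x <= Lam (ramp v h).
Proof.
by move=> xv h0; apply: ge_inf; [exact: (has_infA x).2|exists (v, h)].
Qed.

(** Squeezing a ramp into ]x, x + eta] can only decrease its limit, which stays at least F x; so the
    infimum is approached by ramps arbitrarily close to [x]. *)
Let F_approx x e eta : 0 < e -> 0 < eta -> exists v h,
  [/\ x < v, 0 < h, v + h <= x + eta & `|Lam (ramp v h) - F x| <= e].
Proof.
move=> e0 eta0; have [_ [[v h] /= [xv h0] <-] lt] := inf_adherent e0 (has_infA x).
pose m := Num.min v (x + eta).
have xm : x < m by rewrite lt_min xv ltrDl.
exists (x + (m - x) / 2), ((m - x) / 2); split; rewrite ?divr_gt0 ?subr_gt0 ?ltrDl//.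
- by rewrite divr_gt0 ?subr_gt0.
- by rewrite -addrA -splitr addrC subrK ge_min lexx orbT.
- have m0 : 0 < (m - x) / 2 by rewrite divr_gt0 ?subr_gt0.
  rewrite ger0_norm; last by rewrite subr_ge0 F_le// ltrDl.
  rewrite lerBlDl (le_trans _ (ltW lt))//; apply: le_Lam => y.
  apply: ramp_le => //.
  by rewrite -addrA -splitr addrC subrK ge_min lexx.
Qed.

Let F_nd : nondecreasing F.
Proof.
move=> x y xy; apply: lb_le_inf; first exact: (has_infA y).1.
move=> _ [[v h] /= [yv h0] <-]; apply: F_le => //.
exact: le_lt_trans yv.
Qed.

Let F_rc : right_continuous F.
Proof.
move=> x; apply/cvgrPdist_le => e e0.
have [v [h [xv h0 _ Le]]] := F_approx x e0 ltr01.
near=> y.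
have xy : x < y by near: y; exact: nbhs_right_gt.
have yv : y < v by near: y; exact: nbhs_right_lt.
have := F_nd (ltW xy); have := F_le yv h0.
by move: Le; rewrite !ler_norml => /andP[? ?] ? ?; apply/andP; lra.
Unshelve. all: by end_near. Qed.

Let mset_tail K n : measurable [set w | K < `|Y n w|].
Proof. by apply: mset_lt => //; exact: measurableT_comp. Qed.

Let Lam_tail e : 0 < e -> exists K : R, forall v h, 0 < h ->
  (K <= v -> 1 - e <= Lam (ramp v h)) /\ (v + h <= - K -> Lam (ramp v h) <= e).
Proof.
move=> e0; have [K [N HN]] := tightY e0; exists (K + 1) => v h h0; split.
- move=> Kv; apply: (le_cvgn (@cvg_cst _ (1 - e) _ \oo _) (@cvgR v h)).
  exists N => n /HN; set p := fine _ => pe.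
  apply: (@le_trans _ _ (1 - p)); first by rewrite lerD2l lerN2.
  rewrite /p -Pr_setC// -Ex_indic; last exact: measurableC.
  apply: le_Ex => //; first by apply: bmf_indic; exact: measurableC.
  move=> w; rewrite indicE; case: (boolP (w \in _)) => [|_]; last first.
    by case/andP: (ramp_itv v h (Y n w)).
  rewrite inE/= => /negP; rewrite -leNgt => yK; rewrite ramp1//.
  have := ler_norm (Y n w); lra.
- move=> Kv; apply: (le_cvgn (@cvgR v h) (@cvg_cst _ e _ \oo _)).
  exists N => n /HN; rewrite -Ex_indic//; apply: le_trans.
  apply: le_Ex => //; first by apply: bmf_indic.
  move=> w; rewrite indicE; case: (boolP (w \in _)) => [_|].
    by case/andP: (ramp_itv v h (Y n w)).
  rewrite notin_setE/= => /negP; rewrite -leNgt => yK; rewrite ramp0//.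
  by move: yK; rewrite ler_norml => /andP[]; lra.
Qed.

Let F_tail e : 0 < e -> exists2 K : R, 0 < K & forall x,
  (K <= x -> 1 - e <= F x <= 1) /\ (x <= - K -> 0 <= F x <= e).
Proof.
move=> e0; have [K HK] := Lam_tail e0; exists (`|K| + 2).
  by rewrite ltr_wpDl.
have F0 x : 0 <= F x.
  apply: lb_le_inf; first exact: (has_infA x).1.
  by move=> _ [v _ <-]; case/andP: (Lam01 v.1 v.2).
have := ler_norm K; move=> K1 x; split=> Kx.
- apply/andP; split.
    apply: lb_le_inf; first exact: (has_infA x).1.
    by move=> _ [v /= [xv h0] <-]; apply: (HK v.1 v.2 h0).1; lra.
  apply: (le_trans (@F_le x (x + 1) 1 _ _)) => //; first by rewrite ltrDl.
  by case/andP: (Lam01 (x + 1) 1).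
- rewrite F0/= (le_trans (@F_le x (x + 1) 1 _ _)) ?ltrDl//.
  by apply: (HK _ _ _).2 => //; lra.
Qed.

HB.instance Definition _ := isCumulative.Build R _ R F F_nd F_rc.

Let F_Ny : F @ -oo --> (0 : R).
Proof.
apply/cvgrPdist_le => e e0; have [K K0 HK] := F_tail e0.
exists (- K); split; first exact: num_real.
move=> x /ltW /(HK x).2 /andP[F0 Fe]; by rewrite sub0r normrN ger0_norm.
Qed.

Let F_y : F @ +oo --> (1 : R).
Proof.
apply/cvgrPdist_le => e e0; have [K K0 HK] := F_tail e0.
exists K; split; first exact: num_real.
by move=> x /ltW /(HK x).1 /andP[F0 Fe]; rewrite ger0_norm; lra.
Qed.

HB.instance Definition _ := isCumulativeBounded.Build R 0 1 F F_Ny F_y.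

(* [lebesgue_stieltjes_measure] lives on [measurableTypeR R], whose display is
   not that of [R]: transport it along the identity. *)
Let idR : measurableTypeR R -> R := idfun.

HB.instance Definition _ :=
  @isMeasurableFun.Build _ _ _ _ idR (@measurable_id _ _ setT).

Let mu : probability R R := distribution
  (lebesgue_stieltjes_measure F : probability (measurableTypeR R) R)
  (idR : {RV (lebesgue_stieltjes_measure F) >-> R}).

Let mu_itv x : fine (mu `]-oo, x]%classic) = F x.
Proof.
rewrite (_ : mu _ = (F x)%:E)//; exact: cdf_lebesgue_stieltjes_id F x.
Qed.

(** Both functionals of [f] are compared with Riemann sums on one grid of [-B, B]. For the
    constructed measure the increments are those of F; for the limit functional they are those of
    ramps placed just to the right of the grid points, whose limits differ from F by at most e1. *)
Lemma weak_limit : exists mu : probability R R, forall f : R -> R,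
  continuous f -> (exists M, forall x, `|f x| <= M) ->
  Ex P (fun w => f (Y n w)) @[n --> \oo] --> Ex mu f.
Proof.
exists mu => f cf [M fM].
have bfM : exists M, forall x, `|f x| <= M by exists M.
suff -> : Ex mu f = Lam f by exact: cvgL.
have M0 : 0 <= M by rewrite (le_trans (normr_ge0 (f 0))).
apply/eqP; rewrite -subr_eq0 -normr_le0; apply/ler_addgt0Pr => e' e'0; rewrite add0r.
pose e := e' / (3 + 8 * M); have e0 : 0 < e by rewrite divr_gt0//; lra.
have [B B0 HB] := F_tail e0.
have [dl dl0 fdl] := unif_cont_itv (- B) B cf e0.
(* The mesh s satisfies 2 s < dl because the ramp attached to x (i + 1) may extend to x (i + 1) + s
   / 2, that is x i + 3 s / 2. *)
pose N := (Num.bound (4 * B / dl)).+1.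
have N0 : 0 < N%:R :> R by rewrite ltr0n.
pose s := 2 * B / N%:R.
have s0 : 0 < s by rewrite divr_gt0// mulr_gt0.
have sdl : 2 * s < dl.
  have : 4 * B / dl < N%:R.
    apply: (@lt_trans _ _ (Num.bound (4 * B / dl))%:R); last by rewrite ltr_nat.
    by apply: archi_boundP; rewrite divr_ge0 ?mulr_ge0// ltW.
  by rewrite ltr_pdivrMr// => h; rewrite /s mulrA ltr_pdivrMr//; lra.
pose x i := - B + i%:R * s.
have x0 : x 0%N = - B by rewrite /x mul0r addr0.
have xN : x N = B by rewrite /x /s mulrC divfK ?gt_eqF//; ring.
have xS i : x i.+1 = x i + s by rewrite /x -natr1; ring.
have xB i : (i <= N)%N -> - B <= x i <= B.
  move=> iN; apply/andP; split; first by rewrite /x lerDl mulr_ge0// ltW.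
  by rewrite -[leRHS]xN /x lerD2l ler_pM2r// ler_nat.
have mle z : measurable (`]-oo, z] : set R) by exact: measurable_itv.
pose S := \sum_(i < N) f (x i) * (F (x i.+1) - F (x i)).
have /andP[FB1 FB1'] := (HB B).1 (lexx _).
have /andP[FB0' FB0] := (HB (- B)).2 (lexx _).
have Hmu : `|Ex mu f - S| <= e + M * (2 * e).
  have := @step_Ex _ _ R mu f f (f \o x) (fun i => \1_(`]-oo, x i] : set R)) M e N.
  have Emu z : Ex mu (\1_(`]-oo, z] : set R)) = F z by rewrite Ex_indic// mu_itv.
  rewrite xN x0 !Emu (eq_bigr (fun i : 'I_N => f (x i) * (F (x i.+1) - F (x i)))).
    move=> H; apply: (le_trans (H _ _ _ _ _ _ _ _)).
    - exact: ltW.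
    - by split; [exact: continuous_measurable_fun|].
    - exact: fM.
    - by move=> i; exact: bmf_indic.
    - move=> i w iN; rewrite !indicE ler_nat.
      case: (boolP (w \in (`]-oo, x i]%classic))) => [|_]; last by case: (_ \in _).
      rewrite inE/= in_itv/= => wx.
      rewrite (_ : (w \in _) = true)//; apply/mem_set; rewrite /= in_itv/=.
      by rewrite (le_trans wx)// xS lerDl ltW.
    - by move=> w; rewrite indicE ler0n.
    - by move=> w; rewrite indicE lern1 leq_b1.
    - move=> i w iN; rewrite !indicE ltr_nat.
      case: (boolP (w \in (`]-oo, x i]%classic))) => [_|]; first by case: (_ \in _).
      rewrite notin_setE/= in_itv/= => /negP; rewrite -ltNge => xw.
      case: (boolP (w \in (`]-oo, x i.+1]%classic))) => [|//].
      rewrite inE/= in_itv/= xS => wx _.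
      by rewrite distrC fdl ?xB// ?(ltnW iN)// ltr_distl; apply/andP; split; lra.
    - by rewrite lerD2l ler_wpM2l//; lra.
  by move=> i _; rewrite !Emu.
(* Each of the N increments carries two errors e1, so the two Riemann sums differ by at most M e. *)
pose e1 := e / (N%:R * 2).
have e10 : 0 < e1 by rewrite divr_gt0// mulr_gt0.
have /choice[v Hv] : forall i, exists v : R * R, [/\ x i < v.1, 0 < v.2,
    v.1 + v.2 <= x i + s / 2 & `|Lam (ramp v.1 v.2) - F (x i)| <= e1].
  move=> i; have s20 : 0 < s / 2 by rewrite divr_gt0.
  by have [v [h H]] := F_approx (x i) e10 s20; exists (v, h).
pose S' := \sum_(i < N) f (x i) * (Lam (ramp (v i.+1).1 (v i.+1).2) -
                                   Lam (ramp (v i).1 (v i).2)).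
have Hlam : `|Lam f - S'| <= e + M * (4 * e).
  have : (`|Ex P (fun w => f (Y n w)) - \sum_(i < N) f (x i) *
     (Ex P (fun w => ramp (v i.+1).1 (v i.+1).2 (Y n w)) -
      Ex P (fun w => ramp (v i).1 (v i).2 (Y n w)))|) @[n --> \oo] --> `|Lam f - S'|.
    apply: cvg_norm; apply: cvgB; first exact: cvgL.
    apply: (@cvg_sum_ord R nat \oo N (fun i n => f (x i) *
       (Ex P (fun w => ramp (v i.+1).1 (v i.+1).2 (Y n w)) -
        Ex P (fun w => ramp (v i).1 (v i).2 (Y n w))))
      (fun i => f (x i) * (Lam (ramp (v i.+1).1 (v i.+1).2) -
         Lam (ramp (v i).1 (v i).2)))) => i _.
    by apply: cvgMr; apply: cvgB; exact: cvgR.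
  have : (e + M * (1 - Ex P (fun w => ramp (v N).1 (v N).2 (Y n w)) +
     Ex P (fun w => ramp (v 0%N).1 (v 0%N).2 (Y n w)))) @[n --> \oo] -->
     (e + M * (1 - Lam (ramp (v N).1 (v N).2) + Lam (ramp (v 0%N).1 (v 0%N).2))).
    apply: cvgD; first exact: cvg_cst.
    apply: cvgMr; apply: cvgD; last exact: cvgR.
    by apply: cvgB; [exact: cvg_cst|exact: cvgR].
  move=> c1 c2; apply: (@le_trans _ _ (e + M * (1 - Lam (ramp (v N).1 (v N).2) + Lam (ramp (v 0%N).1 (v 0%N).2)))).
    apply: (le_cvgn c2 c1); exists 0%N => n _.
    apply: (@step_Ex _ _ R P (fun w => f (Y n w)) (fun w => f (Y n w)) (f \o x)
      (fun i w => ramp (v i).1 (v i).2 (Y n w)) M e N).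
    - exact: ltW.
    - exact: bY.
    - by move=> w.
    - by move=> i.
    - move=> i w iN; have [? ? ? _] := Hv i; have [? ? ? _] := Hv i.+1.
      by apply: ramp_le => //; have := xS i; lra.
    - by move=> w; case/andP: (ramp_itv (v 0%N).1 (v 0%N).2 (Y n w)).
    - by move=> w; case/andP: (ramp_itv (v N).1 (v N).2 (Y n w)).
    - move=> i w iN; have [xv h0 ? _] := Hv i; have [? ? ? _] := Hv i.+1.
      have [y1|y1] := leP (Y n w) (v i).1.
        rewrite (ramp1 h0 y1) => /lt_le_trans.
        case/andP: (ramp_itv (v i.+1).1 (v i.+1).2 (Y n w)) => _ h1 /(_ _ h1).
        by rewrite ltxx.
      have [y2|y2] := leP ((v i.+1).1 + (v i.+1).2) (Y n w).
        rewrite [X in _ < X](ramp0 _ y2)// => /(le_lt_trans _).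
        case/andP: (ramp_itv (v i).1 (v i).2 (Y n w)) => h1 _ /(_ _ h1).
        by rewrite ltxx.
      move=> _; rewrite distrC fdl ?xB// ?(ltnW iN)// ltr_distl.
      by have xSi := xS i; apply/andP; split; lra.
  rewrite lerD2l ler_wpM2l//.
  have [_ _ _] := Hv 0%N; have [_ _ _] := Hv N; rewrite xN x0 => hN h0.
  have e1e : e1 <= e.
    by rewrite /e1 ler_pdivrMr ?mulr_gt0// ler_peMr ?ltW// -natrM ltr1n muln2 -addnn addSn addnS.
  exact: tail_sum_le hN h0 e1e FB1 FB0.
have HS : `|S - S'| <= M * e.
  rewrite /S /S' -sumrB (le_trans (ler_norm_sum _ _ _))//.
  apply: (@le_trans _ _ (\sum_(i < N) M * (2 * e1))).
    apply: ler_sum => i _; rewrite -mulrBr normrM ler_pM//.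
    have [_ _ _] := Hv i.+1; have [_ _ _] := Hv i => h h1.
    exact: dist_diff h1 h.
  rewrite sumr_const card_ord -[_ *+ N]mulr_natl /e1.
  by rewrite le_eqVlt; apply/orP; left; apply/eqP; field; rewrite gt_eqF.
have -> : e' = (3 + 8 * M) * e by rewrite /e mulrC divfK// gt_eqF//; lra.
have Me : 0 <= M * e by rewrite mulr_ge0// ltW.
have h := ler_distD S (Ex mu f) (Lam f).
rewrite (le_trans h)// (le_trans (lerD Hmu (ler_distD S' S (Lam f))))//.
rewrite (distrC S') (le_trans (lerD (lexx _) (lerD HS Hlam)))//.
lra.
Qed.

End WeakLimit.

(** * Transfer of a limit law to nonmeasurable perturbations *)

Section Slutsky.
Context (d : measure_display) (T : measurableType d) (R : realType).
Variable P : probability T R.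

(** The integral of a nonnegative function is a supremum over the simple functions below it, and
    this supremum is monotone whatever the functions. *)
Lemma le_integralT_nm (f g : T -> \bar R) : (forall x, (0 <= f x)%E) ->
  (forall x, (f x <= g x)%E) ->
  (\int[P]_x f x <= \int[P]_x g x)%E.
Proof.
move=> f0 fg; have g0 x : (0 <= g x)%E by rewrite (le_trans (f0 x)).
rewrite !ge0_integralTE//; apply: le_ereal_sup => _ [h hf <-].
by exists h => //= x; rewrite (le_trans (hf x)).
Qed.

(** Each of the positive and negative parts of [g] lies between measurable functions, the same part
    of [h] minus and plus [e] (cut at 0), so its integral is finite and within E e of that of the
    part of [h]; the two parts give the factor 2. This evaluates an integral when [g] is only known
    to be close to a measurable function. *)
Lemma integral_nm_approx (g h e : T -> R) : bmf h -> bmf e ->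
  (forall x, `|g x - h x| <= e x) ->
  exists2 r : R, (\int[P]_x (g x)%:E)%E = r%:E & `|r - Ex P h| <= 2 * Ex P e.
Proof.
move=> bh be gh.
have e0 x : 0 <= e x by rewrite (le_trans (normr_ge0 _) (gh x)).
have half (g' h' : T -> R) : bmf h' -> (forall x, 0 <= h' x) ->
    (forall x, 0 <= g' x) -> (forall x, `|g' x - h' x| <= e x) ->
    exists2 r : R, (\int[P]_x (g' x)%:E)%E = r%:E & `|r - Ex P h'| <= Ex P e.
  move=> bh' h0 g0 gh'.
  have up : (\int[P]_x (g' x)%:E <= (Ex P h' + Ex P e)%:E)%E.
    rewrite -ExD// -ExE; last exact: bmfD.
    apply: le_integralT_nm => x; rewrite lee_fin//.
    by have := gh' x; rewrite ler_norml => /andP[]; lra.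
  have bm : bmf (fun x => Num.max 0 (h' x - e x)).
    apply: (bmf_le _ bh').
      apply: measurable_maxr => //; apply: measurable_funB; [exact: bh'.1|exact: be.1].
    move=> x; rewrite ger0_norm ?le_max ?lexx// ge_max h0/=.
    by have := e0 x; lra.
  have lo : ((Ex P h' - Ex P e)%:E <= \int[P]_x (g' x)%:E)%E.
    apply: (@le_trans _ _ (Ex P (fun x => Num.max 0 (h' x - e x)))%:E).
      rewrite lee_fin -ExB//; apply: le_Ex => //; first exact: bmfB.
      by move=> x; rewrite le_max lexx orbT.
    rewrite -ExE//; apply: le_integralT_nm => x; rewrite lee_fin ?le_max ?lexx//.
    rewrite ge_max g0/=.
    by have := gh' x; rewrite ler_norml => /andP[]; lra.
  have fin : (\int[P]_x (g' x)%:E)%E \is a fin_num.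
    by rewrite fin_numE; apply/andP; split; apply/eqP => E; move: up lo; rewrite E.
  exists (fine (\int[P]_x (g' x)%:E)%E); first by rewrite fineK.
  move: up lo; rewrite -{1 2}(fineK fin) !lee_fin => ? ?.
  by rewrite ler_norml; apply/andP; split; lra.
have bp (f : T -> R) : bmf f -> bmf (fun x => Num.max (f x) 0).
  move=> bf; apply: (bmf_le _ (bmf_norm bf)).
    by apply: measurable_maxr => //; exact: bf.1.
  move=> x; rewrite ger0_norm ?le_max ?lexx ?orbT//.
  by rewrite ge_max ler_norm normr_ge0.
have m0 (a : R) : 0 <= Num.max a 0 by rewrite le_max lexx orbT.
have maxd (a b : R) : `|Num.max a 0 - Num.max b 0| <= `|a - b|.
  have [a0|a0] := leP a 0; have [b0|b0] := leP b 0.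
  - by rewrite subrr normr0.
  - by rewrite sub0r normrN gtr0_norm// distrC (le_trans _ (ler_norm _))//; lra.
  - by rewrite subr0 gtr0_norm// (le_trans _ (ler_norm _))//; lra.
  - by [].
have [r1 E1 H1] := half _ _ (bp h bh) (fun x => m0 _) (fun x => m0 _)
  (fun x => le_trans (maxd (g x) (h x)) (gh x)).
have ghN x : `|Num.max (- g x) 0 - Num.max (- h x) 0| <= e x.
  by rewrite (le_trans (maxd _ _))// (_ : - g x - - h x = - (g x - h x)) ?normrN//; ring.
have [r2 E2 H2] := half _ _ (bp _ (bmfN bh)) (fun x => m0 _)
  (fun x => m0 _) ghN.
exists (r1 - r2).
  rewrite integralE EFinB -E1 -E2; congr (_ - _)%E; apply: eq_integral => x _.
    by rewrite funeposE EFin_max.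
  by rewrite funenegE EFin_max.
have -> : Ex P h = Ex P (fun x => Num.max (h x) 0) - Ex P (fun x => Num.max (- h x) 0).
  rewrite -ExB; [|exact: bp|exact: bp (bmfN bh)].
  by congr Ex; apply/funext => x; case: (leP (h x) 0); case: (leP (- h x) 0) => ? ?; lra.
move: H1 H2; rewrite !ler_norml => /andP[? ?] /andP[? ?]; apply/andP; lra.
Qed.

Lemma slutsky (Y Z : nat -> T -> R) (mu : probability R R) :
  (forall n, measurable_fun [set: T] (Z n)) ->
  (forall f : R -> R, continuous f -> (exists M, forall x, `|f x| <= M) ->
     Ex P (fun w => f (Z n w)) @[n --> \oo] --> Ex mu f) ->
  (forall e, 0 < e -> exists N, forall n, (N <= n)%N -> exists2 E, measurable E &
     1 - e <= fine (P E) /\ forall w, E w -> `|Y n w - Z n w| <= e) ->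
  cvg_in_distribution P Y mu.
Proof.
move=> mZ cvgZ YZ f cf [M fM].
have M0 : 0 <= M by rewrite (le_trans (normr_ge0 (f 0))).
have bf : bmf f by split; [exact: continuous_measurable_fun|exists M].
rewrite (ExE mu bf).
have bZ (g : R -> R) n : continuous g -> (exists M, forall x, `|g x| <= M) ->
    bmf (fun w => g (Z n w)).
  by move=> cg [B gB]; exact: (bmf_ccomp (mZ n) cg gB).
have key e : 0 < e -> exists N, forall n, (N <= n)%N -> exists2 r : R,
    (\int[P]_w (f (Y n w))%:E)%E = r%:E & `|r - Ex mu f| <= e.
  (* The error is e1 on an event of probability at least 1 - 3 e1 and 2 M elsewhere;
     [integral_nm_approx] doubles e1 + 6 M e1, and the convergence along [Z] adds e1: in all (3 + 12
     M) e1. *)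
  move=> e0; have [e1 e10 eE] : exists2 e1, 0 < e1 & e = (3 + 12 * M) * e1.
    exists (e / (3 + 12 * M)); first by rewrite divr_gt0//; lra.
    by rewrite mulrC divfK// gt_eqF//; lra.
  (* tightness of [Z], read off the limit law *)
  have [K K0 HK] : exists2 K : R, 0 < K & exists N, forall n, (N <= n)%N ->
      1 - 2 * e1 <= fine (P [set w | `|Z n w| <= K]).
    have [k Hk] : exists k : nat, 1 - e1 <= fine (mu [set x | `|x| <= k%:R]).
      have mA k : measurable [set x : R | `|x| <= k%:R].
        by apply: mset_le => //; exact: measurable_normr.
      have : mu [set x | `|x| <= k%:R] @[k --> \oo] --> mu (\bigcup_k [set x | `|x| <= k%:R]).
        apply: nondecreasing_cvg_mu => //; first exact: bigcupT_measurable.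
        by move=> i j ij; apply/subsetPset => x /= /le_trans; apply; rewrite ler_nat.
      rewrite (_ : \bigcup_k _ = setT); last first.
        apply/seteqP; split=> // x _; exists (Num.bound `|x|) => //=.
        by rewrite ltW// archi_boundP.
      rewrite probability_setT => /fine_cvgP[_ /cvgn_leP/(_ _ e10)[N HN]].
      exists N; have := HN N (leqnn _) => /=.
      by rewrite ler_norml => /andP[]; lra.
    exists (k%:R + 1); first by rewrite ltr_wpDl.
    pose g (x : R) := Num.max 0 (Num.min 1 (k%:R + 1 - `|x|)).
    have cg : continuous g.
      move=> y; apply: (@continuous_max R R (fun=> 0)
        (fun y => Num.min 1 (k%:R + 1 - `|y|))); first exact: cst_continuous.
      apply: (@continuous_min R R (fun=> 1) (fun y => k%:R + 1 - `|y|)).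
        exact: cst_continuous.
      apply: cvgB; [exact: cst_continuous|exact: norm_continuous].
    have g01 x : 0 <= g x <= 1 by rewrite /g le_max lexx/= ge_max ler01 ge_min lexx.
    have gb : exists M, forall x, `|g x| <= M.
      by exists 1 => x; have /andP[? ?] := g01 x; rewrite ger0_norm.
    have [N HN] := cvgn_leP (cvgZ g cg gb) e10.
    exists N => n /HN.
    have : 1 - e1 <= Ex mu g.
      have mA : measurable [set x : R | `|x| <= k%:R].
        by apply: mset_le => //; exact: measurable_normr.
      apply: (le_trans Hk); rewrite -Ex_indic//; apply: le_Ex.
      - exact: bmf_indic.
      - by split; [exact: continuous_measurable_fun|].
      - move=> x; rewrite indicE; case: (boolP (x \in _)) => [|_]; last first.
          by case/andP: (g01 x).
        by rewrite inE/= => xk; rewrite /g min_l ?max_r//; lra.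
    have : Ex P (fun w => g (Z n w)) <= fine (P [set w | `|Z n w| <= k%:R + 1]).
      have mA : measurable [set w | `|Z n w| <= k%:R + 1].
        by apply: mset_le => //; exact: measurableT_comp.
      rewrite -Ex_indic//; apply: le_Ex; [exact: bZ|exact: bmf_indic|].
      move=> w; rewrite indicE; case: (boolP (w \in _)) => [_|].
        by case/andP: (g01 (Z n w)).
      rewrite notin_setE/= => /negP; rewrite -ltNge => h.
      by rewrite /g max_l// ge_min; apply/orP; right; lra.
    by rewrite ler_norml => ? ? /andP[? ?]; lra.
  have [N1 HN1] := HK.
  have [dl dl0 fdl] := unif_cont_itv (- K) K cf e10.
  pose e2 := Num.min e1 (dl / 2).
  have e20 : 0 < e2 by rewrite lt_min e10 divr_gt0.
  have [N2 HN2] := YZ _ e20.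
  have bfM : exists M, forall x, `|f x| <= M by exists M.
  have [N3 HN3] := cvgn_leP (cvgZ f cf bfM) e10.
  exists (maxn N1 (maxn N2 N3)) => n; rewrite !geq_max => /and3P[n1 n2 n3].
  have [E mE [PE HE]] := HN2 _ n2.
  pose A := E `&` [set w | `|Z n w| <= K].
  have mK : measurable [set w | `|Z n w| <= K].
    by apply: mset_le => //; exact: measurableT_comp.
  have mA : measurable A by exact: measurableI.
  have PA : fine (P (~` A)) <= 3 * e1.
    rewrite /A setCI (le_trans (PrU _ _ _)) ?Pr_setC//; do ?exact: measurableC.
    have := HN1 _ n1; have : e2 <= e1 by rewrite ge_min lexx.
    lra.
  have bfZ : bmf (fun w => f (Z n w)) by exact: bZ.
  have be : bmf (fun w => e1 + 2 * M * \1_(~` A) w).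
    apply: bmfD; first exact: bmf_cst.
    by apply: bmfZ; apply: bmf_indic; exact: measurableC.
  have [|r Er Hr] := @integral_nm_approx (fun w => f (Y n w)) _ _ bfZ be.
    move=> w; rewrite indicE; case: (boolP (w \in _)) => [_|].
      rewrite mulr1 (le_trans (ler_normB _ _))//.
      by have := fM (Y n w); have := fM (Z n w); lra.
    rewrite notin_setE/= => /contrapT[Ew Zw]; rewrite mulr0 addr0 distrC.
    apply: fdl; first by rewrite -ler_norml.
    rewrite distrC (le_lt_trans (HE _ Ew))// /e2 gt_min; apply/orP; right; lra.
  exists r => //; have := HN3 _ n3.
  move: Hr; rewrite ExD ?ExZ ?Ex_cst ?Ex_indic//; do ?[exact: bmf_cst|
    exact: measurableC|(by apply: bmf_indic; exact: measurableC)|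
    (by apply: bmfZ; apply: bmf_indic; exact: measurableC)].
  have pA0 : 0 <= fine (P (~` A)) by exact: Pr_ge0.
  rewrite eE !ler_norml => /andP[? ?] /andP[? ?].
  have := ler_wpM2l M0 PA => ?; apply/andP; split; nra.
apply/fine_cvgP; split.
  by have [N HN] := key 1 ltr01; exists N => // n /HN[r -> _].
apply: cvgn_le => e /key[N HN]; exists N => n /HN[r /= -> ].
by [].
Qed.

End Slutsky.

(** * The integrals in the exponent of a stable law *)

Section LineIntegral.
Variable R : realType.
Implicit Types (f g F : R -> R) (c C : R).

(** Integrals over ]0, +oo[ against x^(-al-1) dx are taken in the variable y = ln x, where the
    measure becomes exp(- al y) dy on the whole line: scaling becomes translation, and power decay
    at 0 and at infinity becomes exponential decay at both ends. *)
Definition LI f : R := (\int[lebesgue_measure]_y f y)%R.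

Definition li f : Prop := lebesgue_measure.-integrable [set: R] (EFin \o f).

Lemma liD f g : li f -> li g -> li (fun y => f y + g y).
Proof.
move=> lf lg; rewrite /li (_ : _ \o _ = (EFin \o f) \+ (EFin \o g))%E.
  exact: integrableD.
by apply/funext => y /=; rewrite EFinD.
Qed.

Lemma liZ c f : li f -> li (fun y => c * f y).
Proof.
move=> lf; rewrite /li (_ : _ \o _ = (fun y => c%:E * (EFin \o f) y)%E).
  exact: integrableZl.
by apply/funext => y /=; rewrite EFinM.
Qed.

Lemma liB f g : li f -> li g -> li (fun y => f y - g y).
Proof.
move=> lf /(liZ (-1)) lg; have := liD lf lg.
by congr li; apply/funext => y; rewrite mulN1r.
Qed.

Lemma LID f g : li f -> li g -> LI (fun y => f y + g y) = LI f + LI g.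
Proof. by move=> lf lg; rewrite /LI RintegralD. Qed.

Lemma LIZ c f : li f -> LI (fun y => c * f y) = c * LI f.
Proof. by move=> lf; rewrite /LI RintegralZl. Qed.

Lemma LIB f g : li f -> li g -> LI (fun y => f y - g y) = LI f - LI g.
Proof. by move=> lf lg; rewrite /LI RintegralB. Qed.

Lemma le_LI f g : li f -> li g -> (forall y, f y <= g y) -> LI f <= LI g.
Proof. by move=> lf lg fg; apply: le_Rintegral. Qed.

Lemma li_le f g : measurable_fun [set: R] f -> li g ->
  (forall y, `|f y| <= g y) -> li f.
Proof.
move=> mf lg fg; apply: (le_integrable measurableT _ _ lg).
  exact/measurable_EFinP.
by move=> y _ /=; rewrite lee_fin (le_trans (fg y))// ler_norm.
Qed.

Lemma continuous_expabs c : continuous (fun y : R => expR (- (c * `|y|))).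
Proof.
move=> y; apply: (@continuous_comp _ _ _ (fun y : R => - (c * `|y|))); last exact: continuous_expR.
by apply: cvgN; apply: cvgMr; exact: norm_continuous.
Qed.

Lemma li_expabs c : 0 < c -> li (fun y => expR (- (c * `|y|))).
Proof.
move=> c0; apply/integrableP; split.
  by apply/measurable_EFinP; apply: continuous_measurable_fun; exact: continuous_expabs.
under eq_integral do rewrite /= ger0_norm ?expR_ge0//.
have even : (fun y : R => expR (- (c * `|y|))) =1
    (fun y : R => expR (- (c * `|y|))) \o -%R by move=> y /=; rewrite normrN.
rewrite (ge0_symfun_integralT (fun y => expR_ge0 _) (continuous_expabs (c := c)) even).
rewrite lte_mul_pinfty//.
apply: (@le_lt_trans _ _ (\int[lebesgue_measure]_(x in [set x | (0 <= x)%R])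
   ((c^-1)%:E * (exponential_pdf c x)%:E))%E).
  apply: ge0_le_integral => //.
  - by rewrite -set_itvcy.
  - apply/measurable_funTS; apply/measurable_EFinP.
    by apply: continuous_measurable_fun; exact: continuous_expabs.
  - apply/measurable_funTS; apply/measurable_EFinP.
    by apply: measurable_funM => //; exact: measurable_exponential_pdf.
  - move=> x /= x0; rewrite -EFinM lee_fin exponential_pdfE//.
    by rewrite mulKf ?gt_eqF// ger0_norm// mulNr.
have := integrable_exponential_pdf c0.
move=> /(integrableZl measurableT (c^-1)) H.
have : lebesgue_measure.-integrable [set x : R | 0 <= x]
    (fun x => (c^-1)%:E * (exponential_pdf c x)%:E)%E.
  by apply: integrableS H => //; rewrite -set_itvcy.
move=> /integrableP[_].
have E x : (`|(c^-1)%:E * (exponential_pdf c x)%:E| =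
    (c^-1)%:E * (exponential_pdf c x)%:E)%E.
  by rewrite gee0_abs// mule_ge0// lee_fin ?invr_ge0 ?exponential_pdf_ge0 ?ltW.
by under eq_integral do rewrite E.
Qed.

Lemma li_dom f c C : 0 < c -> continuous f ->
  (forall y, `|f y| <= C * expR (- (c * `|y|))) -> li f.
Proof.
move=> c0 cf fC; apply: li_le fC; first exact: continuous_measurable_fun.
by apply: liZ; exact: li_expabs.
Qed.

Lemma LI_lim_itv f : li f ->
  (\int[lebesgue_measure]_(y in `[- n%:R, n%:R]) f y)%R @[n --> \oo] --> LI f.
Proof.
move=> lf; have mf : measurable_fun [set: R] f.
  by apply/measurable_EFinP; exact: (measurable_int lebesgue_measure).
have := @dominated_convergence _ _ R lebesgue_measure [set: R] measurableT
  (fun n y => ((f \_ `[- n%:R, n%:R]) y)%:E) (EFin \o f) (fun y => `|f y|%:E).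
case.
- move=> n; apply/measurable_EFinP.
  apply: (iffLR (measurable_restrictT _ _)) => //; exact: measurable_funTS.
- exact/measurable_EFinP.
- apply: aeW => y _; apply: cvg_EFin; first exact: nearW.
  apply: cvgn_le => e e0; exists (Num.bound `|y|) => n Nn /=.
  rewrite patchE ifT ?subrr ?normr0 ?ltW//.
  rewrite inE/= in_itv/= -ler_norml (le_trans (ltW (archi_boundP _)))//.
  by rewrite ler_nat.
- by have := integrable_abse lf; congr (_.-integrable _ _).
- apply: aeW => y n _ /=; rewrite lee_fin patchE.
  by case: ifPn => // _; rewrite normr0.
move=> _ _; rewrite /LI /Rintegral.
have fin : (\int[lebesgue_measure]_x (f x)%:E)%E \is a fin_num.
  exact: integrable_fin_num.
rewrite -[X in _ --> X -> _](fineK fin) => /fine_cvgP[_].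
apply: cvg_trans; apply: near_eq_cvg; apply: nearW => n /=.
by first [exact: Rintegral_mkcond|exact/esym/Rintegral_mkcond].
Qed.

Lemma itv_FTC f F (a b : R) : continuous f ->
  (forall y : R, is_derive y 1 F (f y)) -> a < b ->
  (\int[lebesgue_measure]_(y in `[a, b]) f y)%R = F b - F a.
Proof.
move=> cf dF ab; rewrite /Rintegral (@continuous_FTC2 _ f F)//.
- exact/continuous_subspaceT.
- have cF : continuous F.
    by move=> y; apply: differentiable_continuous; apply/derivable1_diffP; have [? _] := dF y.
  split; [by move=> y _; have [] := dF y|exact/cvg_at_right_filter/cF|
    exact/cvg_at_left_filter/cF].
- by move=> y _; rewrite derive1E; have [_ ->] := dF y.
Qed.

(** The primitive decays exponentially at both ends, so no boundary term is left. This plays the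
    part of integration by parts: a y-derivative under the integral yields an algebraic identity. *)
Lemma LI_deriv0 f F c C : 0 < c -> continuous f -> li f ->
  (forall y : R, is_derive y 1 F (f y)) ->
  (forall y, `|F y| <= C * expR (- (c * `|y|))) -> LI f = 0.
Proof.
move=> c0 cf lf dF FC; apply: (cvg_unique _ (LI_lim_itv lf)) => //.
have C0 : 0 <= C.
  by have := FC 0; rewrite normr0 mulr0 oppr0 expR0 mulr1; apply: le_trans.
apply: cvgn_le => e e0.
pose N := (Num.bound (2 * C / (c * e))).+1.
exists N => n Nn; rewrite subr0.
have n0 : 0 < n%:R :> R by rewrite ltr0n (leq_trans _ Nn).
rewrite (itv_FTC cf dF); last lra.
have H : 2 * C / (c * e) <= n%:R.
  have h0 : 0 <= 2 * C / (c * e) by apply: divr_ge0; rewrite mulr_ge0// ltW.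
  rewrite (le_trans (ltW (archi_boundP h0)))//.
  by rewrite ler_nat; apply: leq_trans Nn; exact: leqnSn.
have He : C * expR (- (c * n%:R)) <= e / 2.
  have h1 : expR (- (c * n%:R)) <= (c * n%:R)^-1.
    rewrite expRN lef_pV2 ?posrE ?expR_gt0 ?mulr_gt0//.
    by have := expR_ge1Dx (c * n%:R); lra.
  apply: (le_trans (ler_wpM2l C0 h1)).
  rewrite ler_pdivrMr ?mulr_gt0//; move: H; rewrite ler_pdivrMr ?mulr_gt0//; lra.
have := FC n%:R; have := FC (- n%:R); rewrite normrN (ger0_norm (ltW n0)).
by rewrite !ler_norml => /andP[? ?] /andP[? ?]; apply/andP; lra.
Qed.

Lemma LI_shift f (tau : R) : continuous f -> (forall y, 0 <= f y) ->
  LI (fun y => f (y + tau)) = LI f.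
Proof.
move=> cf f0; rewrite /LI /Rintegral; congr fine.
have dE : derive1 (fun y : R => y + tau) = fun=> 1.
  apply/funext => y; rewrite derive1E.
  have dy : is_derive y 1 (fun y : R => y + tau) (1 + 0) by exact: is_deriveD.
  by rewrite (@derive_val _ _ _ _ _ _ _ dy) addr0.
rewrite [RHS](@increasing_ge0_integration_by_substitutionT _ (fun y => y + tau) f)//.
- by apply: eq_integral => y _; rewrite dE /= mulr1.
- by move=> x y xy; rewrite ltrD2r.
- by rewrite dE; exact: cst_continuous.
- by rewrite dE; exact: is_cvg_cst.
- by rewrite dE; exact: is_cvg_cst.
- apply/cvgrNyPle => A; exists (A - tau); split; first exact: num_real.
  by move=> y /=; lra.
- apply/cvgryPge => A; exists (A - tau); split; first exact: num_real.
  by move=> y /=; lra.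
Qed.

End LineIntegral.

Section Calculus.
Variable R : realType.
Implicit Types (x y s t : R).

Lemma is_derive_expN (A : R -> R) x (A' : R) : is_derive x 1 A A' ->
  is_derive x 1 (fun s => expR (- A s)) (- A' * expR (- A x)).
Proof.
move=> dA; have dN : is_derive x 1 (fun s => - A s) (- A') by exact: is_deriveN.
rewrite mulrC; exact: (@is_derive1_comp R expR (fun s => - A s) x _ _ _ dN).
Qed.

Lemma is_derive_cosc (B : R -> R) x (B' : R) : is_derive x 1 B B' ->
  is_derive x 1 (fun s => cos (B s)) (- (B' * sin (B x))).
Proof.
move=> dB; rewrite (_ : - _ = - sin (B x) * B'); last by ring.
exact: (@is_derive1_comp R cos B x _ _ (is_derive_cos (B x)) dB).
Qed.

Lemma is_derive_sinc (B : R -> R) x (B' : R) : is_derive x 1 B B' ->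
  is_derive x 1 (fun s => sin (B s)) (B' * cos (B x)).
Proof.
move=> dB; rewrite mulrC.
exact: (@is_derive1_comp R sin B x _ _ (is_derive_sin (B x)) dB).
Qed.

Lemma is_derive_mul (f g : R -> R) x (f' g' : R) : is_derive x 1 f f' ->
  is_derive x 1 g g' -> is_derive x 1 (fun s => f s * g s) (f' * g x + f x * g').
Proof.
move=> df dg; have := @is_deriveM _ _ f g x 1 _ _ df dg.
by rewrite /GRing.scale/= addrC [g x * _]mulrC.
Qed.

Lemma is_derive_cmul (k : R) (f : R -> R) x (f' : R) : is_derive x 1 f f' ->
  is_derive x 1 (fun s => k * f s) (k * f').
Proof. by move=> df; exact: is_deriveZ. Qed.

Lemma is_derive_const (k x : R) : is_derive x 1 (fun=> k) (0 : R).
Proof. exact: is_derive_cst. Qed.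

Lemma is_derive_add (f g : R -> R) x (f' g' : R) : is_derive x 1 f f' ->
  is_derive x 1 g g' -> is_derive x 1 (fun s => f s + g s) (f' + g').
Proof. by move=> df dg; exact: is_deriveD. Qed.

Lemma is_derive_sub (f g : R -> R) x (f' g' : R) : is_derive x 1 f f' ->
  is_derive x 1 g g' -> is_derive x 1 (fun s => f s - g s) (f' - g').
Proof. by move=> df dg; exact: is_deriveB. Qed.

Lemma derive_continuous (f f' : R -> R) : (forall x, is_derive x 1 f (f' x)) ->
  continuous f.
Proof.
move=> df x; apply: differentiable_continuous; apply/derivable1_diffP.
by have [] := df x.
Qed.

Lemma sin_MVT y : 0 < y -> exists2 c, 0 < c < y & sin y = cos c * y.
Proof.
move=> y0; have H1 x : x \in `]0, y[ -> is_derive x 1 sin (cos x).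
  by move=> _; exact: is_derive_sin.
have H2 : {within `[0, y], continuous (@sin R)}.
  exact/continuous_subspaceT/continuous_sin.
have [c] := MVT y0 H1 H2.
by rewrite in_itv/= sin0 !subr0 => ci E; exists c.
Qed.

Lemma sin_norm_le y : `|sin y| <= `|y|.
Proof.
wlog y0 : y / 0 < y.
  move=> H; have [y0|y0|->] := ltrgtP y 0; last by rewrite sin0.
    by rewrite -normrN -sinN -[leRHS]normrN H// oppr_gt0.
  exact: H.
have [c _ ->] := sin_MVT y0.
by rewrite normrM ler_piMl// cos_max.
Qed.

Lemma cos_sub1 y : 0 <= 1 - cos y /\ 1 - cos y <= y ^+ 2 /\ 1 - cos y <= `|y|.
Proof.
have E : 1 - cos y = 2 * sin (y / 2) ^+ 2.
  have -> : cos y = cos ((y / 2) *+ 2) by rewrite -mulr_natr divfK.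
  by rewrite cos_mulr2n sin2cos2 -mulr_natl; ring.
have h := sin_norm_le (y / 2).
have h2 : sin (y / 2) ^+ 2 <= (y / 2) ^+ 2.
  by rewrite -[leLHS]real_normK ?num_real// -[leRHS]real_normK ?num_real// lerXn2r ?nnegrE.
have h3 : sin (y / 2) ^+ 2 <= `|y / 2|.
  rewrite -real_normK ?num_real// expr2 (le_trans _ h)//.
  by rewrite ler_piMl// sin_max.
have y0 := normr_ge0 y; have yy : `|y / 2| = `|y| / 2.
  by rewrite normrM [X in _ * X]gtr0_norm.
rewrite E; split; first by rewrite mulr_ge0// sqr_ge0.
by split; [have := sqr_ge0 y; lra|rewrite yy in h3; lra].
Qed.

Lemma sin_subid y : `|sin y - y| <= y ^+ 2.
Proof.
wlog y0 : y / 0 < y.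
  move=> H; have [y0|y0|->] := ltrgtP y 0; last by rewrite sin0 subrr normr0 expr0n.
    by have := H (- y); rewrite sinN sqrrN -opprD normrN; apply; rewrite oppr_gt0.
  exact: H.
have [c /andP[c0 cy] ->] := sin_MVT y0.
have [h0 [_ h1]] := cos_sub1 c; rewrite (gtr0_norm c0) in h1.
rewrite -normrN ger0_norm; last by rewrite opprB; nra.
by rewrite opprB; nra.
Qed.

Lemma expRN_bounds s : 0 <= s ->
  [/\ 0 < expR (- s), expR (- s) <= 1, 1 - s <= expR (- s) &
      expR (- s) <= 1 - s + s ^+ 2].
Proof.
move=> s0; have h1 := expR_ge1Dx s; have h2 := expR_ge1Dx (- s).
have p := expR_gt0 (- s).
have h : expR (- s) * expR s = 1 by rewrite -expRD addNr expR0.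
split=> //.
- nra.
- nra.
Qed.

Lemma sexpRN s : 0 <= s -> s * expR (- s) <= 1.
Proof.
move=> s0; have h1 := expR_ge1Dx s; have p := expR_gt0 (- s).
have h : expR (- s) * expR s = 1 by rewrite -expRD addNr expR0.
nra.
Qed.

(** At 0 the linear term of 1 - exp(- a x) cos (b x) is a x, which a x exp(- x) cancels up to
    O(x^2); away from 0 all terms are bounded. The constant depends only on a bound [t] for the
    parameters, as dominated convergence requires. *)
Lemma ecos_bound (t a b x : R) : 0 <= a <= t -> `|b| <= t -> 0 <= x ->
  `|1 - expR (- (a * x)) * cos (b * x) - a * (x * expR (- x))| <=
    (2 + t + 2 * t ^+ 2) * Num.min 1 (x ^+ 2).
Proof.
move=> /andP[a0 at_] bt x0; have t0 : 0 <= t by rewrite (le_trans a0).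
have ax0 : 0 <= a * x by rewrite mulr_ge0.
have [e0 e1 e2 e3] := expRN_bounds ax0; have [f0 f1 f2 _] := expRN_bounds x0.
have fx := sexpRN x0.
have [c0 [c1 _]] := cos_sub1 (b * x); have cm := cos_geN1 (b * x); have cM := cos_le1 (b * x).
have b2 : b ^+ 2 <= t ^+ 2.
  by rewrite -[leLHS]real_normK ?num_real// lerXn2r ?nnegrE.
have a2 : a ^+ 2 <= t ^+ 2 by rewrite lerXn2r ?nnegrE.
have x20 := sqr_ge0 x; have xf0 : 0 <= x * expR (- x) by rewrite mulr_ge0// ltW.
have axf : 0 <= a * (x * expR (- x)) <= t by rewrite mulr_ge0//=; nra.
have ec : `|expR (- (a * x)) * cos (b * x)| <= 1.
  by rewrite normrM -[leRHS]mulr1 ler_pM// ?cos_max// gtr0_norm.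
have [x1|x1] := leP 1 (x ^+ 2).
  rewrite mulr1; move: ec axf; rewrite !ler_norml => /andP[? ?] /andP[? ?].
  by have := sqr_ge0 t; move=> ?; apply/andP; split; lra.
set E := expR (- (a * x)) in e0 e1 e2 e3 *; set c := cos (b * x) in c0 c1 cm cM *.
have -> : 1 - E * c - a * (x * expR (- x)) =
    (1 - a * x - E) + E * (1 - c) + a * x * (1 - expR (- x)) by ring.
have h1 : - (t ^+ 2 * x ^+ 2) <= 1 - a * x - E <= 0.
  by apply/andP; split; [have := ler_wpM2r x20 a2; rewrite exprMn in e3; lra|lra].
have h2 : 0 <= E * (1 - c) <= t ^+ 2 * x ^+ 2.
  rewrite mulr_ge0//=; last exact: ltW.
  rewrite -[leRHS]mul1r ler_pM//; first exact: ltW.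
  by rewrite (le_trans c1)// exprMn ler_wpM2r.
have h3 : 0 <= a * x * (1 - expR (- x)) <= t * x ^+ 2.
  rewrite mulr_ge0 ?subr_ge0//= expr2 mulrA ler_pM ?subr_ge0//; first by rewrite ler_wpM2r.
  lra.
have m0 : 0 <= t * x ^+ 2 by rewrite mulr_ge0.
have m1 : 0 <= t ^+ 2 * x ^+ 2 by rewrite mulr_ge0// sqr_ge0.
move: h1 h2 h3 => /andP[? ?] /andP[? ?] /andP[? ?].
by rewrite ler_norml; apply/andP; split; lra.
Qed.

Lemma esin_bound (t a b x : R) : 0 <= a <= t -> `|b| <= t -> 0 <= x ->
  `|expR (- (a * x)) * sin (b * x) - b * (x * expR (- x))| <=
    (2 + t + 2 * t ^+ 2) * Num.min 1 (x ^+ 2).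
Proof.
move=> /andP[a0 at_] bt x0; have t0 : 0 <= t by rewrite (le_trans a0).
have ax0 : 0 <= a * x by rewrite mulr_ge0.
have [e0 e1 e2 e3] := expRN_bounds ax0; have [f0 f1 f2 _] := expRN_bounds x0.
have fx := sexpRN x0; have xf0 : 0 <= x * expR (- x) by rewrite mulr_ge0// ltW.
have x20 := sqr_ge0 x.
have [x1|x1] := leP 1 (x ^+ 2).
  rewrite mulr1 (le_trans (ler_normB _ _))// !normrM.
  rewrite (gtr0_norm e0) (gtr0_norm f0) (ger0_norm x0).
  have := sin_max (b * x); have := normr_ge0 (sin (b * x)); have := normr_ge0 b.
  by have := sqr_ge0 t; nra.
have -> : expR (- (a * x)) * sin (b * x) - b * (x * expR (- x)) =
  (expR (- (a * x)) - 1) * sin (b * x) + (sin (b * x) - b * x) +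
  b * (x * (1 - expR (- x))) by ring.
have h1 : `|(expR (- (a * x)) - 1) * sin (b * x)| <= t ^+ 2 * x ^+ 2.
  rewrite normrM -exprMn expr2 ler_pM//.
    by rewrite -normrN opprB ger0_norm ?subr_ge0//; have := ler_wpM2r x0 at_; lra.
  by rewrite (le_trans (sin_norm_le _))// normrM (ger0_norm x0) ler_wpM2r.
have h2 : `|sin (b * x) - b * x| <= t ^+ 2 * x ^+ 2.
  rewrite (le_trans (sin_subid _))// exprMn ler_wpM2r//.
  by rewrite -[leLHS]real_normK ?num_real// lerXn2r ?nnegrE.
have h3 : `|b * (x * (1 - expR (- x)))| <= t * x ^+ 2.
  rewrite normrM ler_pM// ger0_norm; last by rewrite mulr_ge0// subr_ge0.
  by rewrite expr2 ler_wpM2l//; lra.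
rewrite (le_trans (ler_normD _ _))//.
have := ler_normD ((expR (- (a * x)) - 1) * sin (b * x)) (sin (b * x) - b * x).
by lra.
Qed.

(** Bounds the parameter derivatives of the two functions above. At infinity x exp(- a x) <= 1 /
    del, which degenerates as the real part tends to 0: the imaginary axis can only be reached by
    continuity. *)
Lemma ederiv_bound (t del a b p r x : R) : 0 < del -> del <= a <= t -> `|b| <= t ->
  `|p| <= t -> `|r| <= t -> 0 <= x ->
  `|x * expR (- (a * x)) * (p * sin (b * x) + r * cos (b * x)) -
    r * (x * expR (- x))| <=
    (2 * t / del + t + 3 * t ^+ 2 + t) * Num.min 1 (x ^+ 2).
Proof.
move=> d0 /andP[da at_] bt pt rt x0; have a0 : 0 < a by rewrite (lt_le_trans d0).
have t0 : 0 <= t by rewrite (le_trans (ltW a0)).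
have ax0 : 0 <= a * x by rewrite mulr_ge0// ltW.
have [e0 e1 e2 e3] := expRN_bounds ax0; have [f0 f1 f2 _] := expRN_bounds x0.
have fx := sexpRN x0; have xf0 : 0 <= x * expR (- x) by rewrite mulr_ge0// ltW.
have ex := sexpRN ax0; have x20 := sqr_ge0 x.
have td : 0 <= t / del by rewrite divr_ge0// ltW.
have [x1|x1] := leP 1 (x ^+ 2).
  rewrite mulr1 (le_trans (ler_normB _ _))//.
  have xe : `|x * expR (- (a * x))| <= del^-1.
    rewrite ger0_norm; last by rewrite mulr_ge0// ltW.
    by rewrite -(ler_pM2l d0) mulfV ?gt_eqF//; nra.
  have pr : `|p * sin (b * x) + r * cos (b * x)| <= 2 * t.
    rewrite (le_trans (ler_normD _ _))// !normrM.
    have := sin_max (b * x); have := cos_max (b * x).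
    have := normr_ge0 (sin (b * x)); have := normr_ge0 (cos (b * x)).
    by have := normr_ge0 p; have := normr_ge0 r; nra.
  have h1 : `|x * expR (- (a * x)) * (p * sin (b * x) + r * cos (b * x))| <= 2 * t / del.
    by rewrite normrM [leRHS]mulrC ler_pM.
  have h2 : `|r * (x * expR (- x))| <= t.
    by rewrite normrM -[leRHS]mulr1 ler_pM// ger0_norm.
  by have := sqr_ge0 t; lra.
have -> : x * expR (- (a * x)) * (p * sin (b * x) + r * cos (b * x)) -
    r * (x * expR (- x)) = (x * expR (- (a * x))) * p * sin (b * x) +
    r * x * ((expR (- (a * x)) - 1) * cos (b * x) - (1 - cos (b * x)) +
       (1 - expR (- x))) by ring.
have [c0 [_ c1]] := cos_sub1 (b * x).
have bx : `|b * x| <= t * x by rewrite normrM (ger0_norm x0) ler_wpM2r.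
have h1 : `|x * expR (- (a * x)) * p * sin (b * x)| <= t ^+ 2 * x ^+ 2.
  rewrite normrM (_ : t ^+ 2 * x ^+ 2 = (x * t) * (t * x)); last by ring.
  rewrite ler_pM//; last by rewrite (le_trans (sin_norm_le _)).
  rewrite normrM ler_pM// ger0_norm; last by rewrite mulr_ge0// ltW.
  by rewrite -[leRHS]mulr1 ler_wpM2l.
have atx := ler_wpM2r x0 at_.
have h2 : `|(expR (- (a * x)) - 1) * cos (b * x) - (1 - cos (b * x)) +
       (1 - expR (- x))| <= t * x + t * x + x.
  rewrite (le_trans (ler_normD _ _))// lerD//; last by rewrite ger0_norm ?subr_ge0//; lra.
  rewrite (le_trans (ler_normB _ _))// lerD//; last first.
    by rewrite (ger0_norm c0) (le_trans c1).
  rewrite normrM -[leRHS]mulr1 ler_pM// ?cos_max//.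
  by rewrite -normrN opprB ger0_norm ?subr_ge0//; lra.
have h3 : `|r * x * ((expR (- (a * x)) - 1) * cos (b * x) - (1 - cos (b * x)) +
       (1 - expR (- x)))| <= t * x * (t * x + t * x + x).
  by rewrite normrM ler_pM// normrM (ger0_norm x0) ler_wpM2r.
rewrite (le_trans (ler_normD _ _))//.
have m0 : 0 <= t * x ^+ 2 by rewrite mulr_ge0.
have m1 : 0 <= t / del * x ^+ 2 by rewrite mulr_ge0.
have -> : 2 * t / del = 2 * (t / del) by rewrite mulrA.
by lra.
Qed.

(** This is min(1, x^2) x^(-al) at x = exp y: it decays at 0 because al < 2 and at infinity because
    al > 0. *)
Lemma min1_sqr_expR (al y : R) : 0 < al < 2 ->
  Num.min 1 (expR y ^+ 2) * expR (- (al * y)) <=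
    expR (- (Num.min al (2 - al) * `|y|)).
Proof.
move=> /andP[al0 al2]; have p := expR_gt0 (- (al * y)).
have m1 : Num.min al (2 - al) <= al by rewrite ge_min lexx.
have m2 : Num.min al (2 - al) <= 2 - al by rewrite ge_min lexx orbT.
have [y0|y0] := leP 0 y.
  apply: (@le_trans _ _ (expR (- (al * y)))).
    by apply: ler_piMl; [exact: ltW|rewrite ge_min lexx].
  by rewrite ler_expR lerN2 (ger0_norm y0) ler_wpM2r.
apply: (@le_trans _ _ (expR y ^+ 2 * expR (- (al * y)))).
  by apply: ler_wpM2r; [exact: ltW|rewrite ge_min lexx orbT].
rewrite expr2 -!expRD ler_expR ltr0_norm//.
nra.
Qed.

End Calculus.

Section StableIntegrals.
Variables (R : realType) (al : R).
Hypothesis al02 : 0 < al < 2.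
Implicit Types (a b p r t y th : R).

Let c := Num.min al (2 - al).
Let c0 : 0 < c.
Proof. by rewrite lt_min subr_gt0; case/andP: al02 => -> ->. Qed.

(* Real and imaginary parts of [(1 - exp(-z x) - z x exp(-x)) x^(-al-1) dx] and of
   [((z + w) x exp(-z x) ...) ...] for [z = a + i b], in the variable [x = e^y];
   [x exp(-x)] compensates the singularity at [0]. *)
Let uu a b y := (1 - expR (- (a * expR y)) * cos (b * expR y) -
  a * (expR y * expR (- expR y))) * expR (- (al * y)).
Let vv a b y := (expR (- (a * expR y)) * sin (b * expR y) -
  b * (expR y * expR (- expR y))) * expR (- (al * y)).
Let kk y := expR y ^+ 2 * expR (- expR y) * expR (- (al * y)).
Let Dg p r a b y := (expR y * expR (- (a * expR y)) *
  (p * sin (b * expR y) + r * cos (b * expR y)) -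
  r * (expR y * expR (- expR y))) * expR (- (al * y)).

Let U a b := LI (uu a b).
Let V a b := LI (vv a b).
Let K := LI kk.

Let dom (f : R -> R) (C : R) : (forall y, `|f y| <= C * Num.min 1 (expR y ^+ 2)) ->
  forall y, `|f y * expR (- (al * y))| <= C * expR (- (c * `|y|)).
Proof.
move=> fC y; have C0 : 0 <= C.
  by have := le_trans (normr_ge0 _) (fC 0); rewrite expR0 expr1n minxx mulr1.
rewrite normrM [X in _ * X]gtr0_norm ?expR_gt0//.
rewrite (le_trans (ler_wpM2r (expR_ge0 _) (fC y)))// -mulrA ler_wpM2l//.
exact: min1_sqr_expR.
Qed.

Let d_eal y : is_derive y 1 (fun y => expR (- (al * y))) (- (al * 1) * expR (- (al * y))).
Proof. by apply: is_derive_expN; apply: is_derive_cmul; exact: is_derive_id. Qed.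

Let d_ax a y : is_derive y 1 (fun y => a * expR y) (a * expR y).
Proof. by apply: is_derive_cmul; exact: is_derive_expR. Qed.

Let d_phi y : is_derive y 1 (fun y => expR y * expR (- expR y))
  (expR y * expR (- expR y) + expR y * (- expR y * expR (- expR y))).
Proof.
exact: (is_derive_mul (is_derive_expR y) (is_derive_expN (is_derive_expR y))).
Qed.

Let d_vv a b y : is_derive y 1 (vv a b) (b * kk y - al * vv a b y - Dg a (- b) a b y).
Proof.
have d1 := is_derive_mul (is_derive_expN (d_ax a y)) (is_derive_sinc (d_ax b y)).
have d2 := is_derive_cmul b (d_phi y).
have d3 := is_derive_sub d1 d2.
apply: (is_derive_eq (is_derive_mul d3 (d_eal y))); rewrite /kk /vv /Dg; ring.
Qed.

Let d_uu a b y : is_derive y 1 (uu a b) (Dg b a a b y + a * kk y - al * uu a b y).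
Proof.
have d1 := is_derive_mul (is_derive_expN (d_ax a y)) (is_derive_cosc (d_ax b y)).
have d2 := is_derive_cmul a (d_phi y).
have d0 := is_derive_const 1 y.
have d3 := is_derive_sub (is_derive_sub d0 d1) d2.
apply: (is_derive_eq (is_derive_mul d3 (d_eal y))); rewrite /kk /uu /Dg; ring.
Qed.

Let c_vv a b : continuous (vv a b).
Proof. exact: (derive_continuous (d_vv a b)). Qed.

Let c_uu a b : continuous (uu a b).
Proof. exact: (derive_continuous (d_uu a b)). Qed.

Let c_ex a : continuous (fun y : R => expR (- (a * expR y))).
Proof. by apply: (derive_continuous (fun y => is_derive_expN (d_ax a y))). Qed.

Let c_eal : continuous (fun y : R => expR (- (al * y))).
Proof. exact: (derive_continuous d_eal). Qed.

Let c_phi : continuous (fun y : R => expR y * expR (- expR y)).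
Proof. exact: (derive_continuous d_phi). Qed.

Let c_kk : continuous kk.
Proof.
have -> : kk = fun y => expR y * (expR y * expR (- expR y)) * expR (- (al * y)).
  by apply/funext => y; rewrite /kk expr2 mulrA.
move=> y; apply: cvgM; last exact: c_eal.
by apply: cvgM; [exact: continuous_expR|exact: c_phi].
Qed.

Let c_Dg p r a b : continuous (Dg p r a b).
Proof.
move=> y; apply: cvgM; last exact: c_eal.
apply: cvgB; last by apply: cvgMr; exact: c_phi.
apply: cvgM; first by apply: cvgM; [exact: continuous_expR|exact: c_ex].
apply: cvgD; apply: cvgMr.
- exact: (derive_continuous (fun y => is_derive_sinc (d_ax b y))).
- exact: (derive_continuous (fun y => is_derive_cosc (d_ax b y))).
Qed.

Let C1 t := 2 + t + 2 * t ^+ 2.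

Let b_uu t a b y : 0 <= a <= t -> `|b| <= t ->
  `|uu a b y| <= C1 t * expR (- (c * `|y|)).
Proof.
move=> ta tb; apply: (@dom (fun y => 1 - expR (- (a * expR y)) * cos (b * expR y) -
  a * (expR y * expR (- expR y)))) => {}y.
by apply: ecos_bound => //; exact: expR_ge0.
Qed.

Let b_vv t a b y : 0 <= a <= t -> `|b| <= t ->
  `|vv a b y| <= C1 t * expR (- (c * `|y|)).
Proof.
move=> ta tb; apply: (@dom (fun y => expR (- (a * expR y)) * sin (b * expR y) -
  b * (expR y * expR (- expR y)))) => {}y.
by apply: esin_bound => //; exact: expR_ge0.
Qed.

Let b_Dg t del p r a b y : 0 < del -> del <= a <= t -> `|b| <= t -> `|p| <= t ->
  `|r| <= t -> `|Dg p r a b y| <=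
    (2 * t / del + t + 3 * t ^+ 2 + t) * expR (- (c * `|y|)).
Proof.
move=> d0 da bt pt rt; apply: (@dom (fun y => expR y * expR (- (a * expR y)) *
  (p * sin (b * expR y) + r * cos (b * expR y)) -
  r * (expR y * expR (- expR y)))) => {}y.
by apply: ederiv_bound => //; exact: expR_ge0.
Qed.

Let b_kk y : `|kk y| <= 4 * expR (- (c * `|y|)).
Proof.
apply: (@dom (fun y => expR y ^+ 2 * expR (- expR y))) => {}y.
have x0 := expR_gt0 y; have e0 := expR_gt0 (- expR y).
rewrite ger0_norm; last by rewrite mulr_ge0// ?sqr_ge0// ltW.
have [_ e1 _ _] := expRN_bounds (ltW x0).
have h := @sexpRN R (expR y / 2).
have E : expR (- expR y) = expR (- (expR y / 2)) ^+ 2.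
  by rewrite expr2 -expRD -opprD -splitr.
have h2 : expR y / 2 * expR (- (expR y / 2)) <= 1 by apply: h; rewrite divr_ge0// ltW.
have h3 := expR_gt0 (- (expR y / 2)).
have [x1|x1] := leP 1 (expR y ^+ 2); last by nra.
pose q := expR y / 2 * expR (- (expR y / 2)).
have q0 : 0 <= q by rewrite mulr_ge0// ?divr_ge0// ltW.
have q1 : q ^+ 2 <= 1 by rewrite expr_le1.
have -> : expR y ^+ 2 * expR (- expR y) = 4 * q ^+ 2 by rewrite E /q; field.
by rewrite mulr1; lra.
Qed.

Let li_uu a b : 0 <= a -> li (uu a b).
Proof.
move=> a0; apply: (li_dom c0 (@c_uu a b)) => y.
apply: (@b_uu (a + `|b|)); first by rewrite a0 lerDl/=.
by rewrite lerDr.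
Qed.

Let li_vv a b : 0 <= a -> li (vv a b).
Proof.
move=> a0; apply: (li_dom c0 (@c_vv a b)) => y.
apply: (@b_vv (a + `|b|)); first by rewrite a0 lerDl/=.
by rewrite lerDr.
Qed.

Let li_kk : li kk. Proof. exact: (li_dom c0 c_kk b_kk). Qed.

Let li_Dg p r a b : 0 < a -> li (Dg p r a b).
Proof.
move=> a0; pose t := a + `|b| + `|p| + `|r|.
have [? ? ?] : [/\ 0 <= `|b|, 0 <= `|p| & 0 <= `|r|] by [].
apply: (li_dom c0 (@c_Dg p r a b)) => y.
by apply: (@b_Dg t a) => //; rewrite /t ?lexx/=; lra.
Qed.

(** The y-derivative of [vv] has zero integral and contains [Dg], which is also the derivative of
    [uu] in the argument of a + i b. The integral of that angular derivative is thereby expressed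
    through K and V. *)
Let LI_Dg1 a b : 0 < a -> LI (Dg a (- b) a b) = b * K - al * V a b.
Proof.
move=> a0; have lv := li_vv b (ltW a0); have lD := li_Dg a (- b) b a0.
have l1 := liB (liZ b li_kk) (liZ al lv).
have b1 y : `|vv a b y| <= C1 (a + `|b|) * expR (- (c * `|y|)).
  by apply: b_vv; [rewrite (ltW a0) lerDl/=|rewrite lerDr ltW].
have cf : continuous (fun y => b * kk y - al * vv a b y - Dg a (- b) a b y).
  move=> y; apply: cvgB; last exact: c_Dg.
  by apply: cvgB; apply: cvgMr; [exact: c_kk|exact: c_vv].
have := LI_deriv0 c0 cf (liB l1 lD) (d_vv a b) b1.
rewrite LIB// LIB ?LIZ//; do ?exact: liZ.
by rewrite -/K -/(V a b); lra.
Qed.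

Let LI_Dg2 a b : 0 < a -> LI (Dg b a a b) = al * U a b - a * K.
Proof.
move=> a0; have lu := li_uu b (ltW a0); have lD := li_Dg b a b a0.
have l1 := liD lD (liZ a li_kk).
have b1 y : `|uu a b y| <= C1 (a + `|b|) * expR (- (c * `|y|)).
  by apply: b_uu; [rewrite (ltW a0) lerDl/=|rewrite lerDr ltW].
have cf : continuous (fun y => Dg b a a b y + a * kk y - al * uu a b y).
  move=> y; apply: cvgB; last by apply: cvgMr; exact: c_uu.
  by apply: cvgD; [exact: c_Dg|apply: cvgMr; exact: c_kk].
have := LI_deriv0 c0 cf (liB l1 (liZ al lu)) (d_uu a b) b1.
rewrite LIB ?LID ?LIZ//; do ?exact: liZ.
by rewrite -/K -/(U a b); lra.
Qed.

(** * Rotating the parameter from the real to the imaginary axis *)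

Section Arc.
Variable t : R.
Hypothesis t0 : 0 < t.

Let A th := t * cos th.
Let B th := t * sin th.

Let dA th : is_derive th 1 A (- B th).
Proof.
by rewrite /A /B -mulrN; apply: is_derive_cmul; exact: is_derive_cos.
Qed.

Let dB th : is_derive th 1 B (A th).
Proof. by apply: is_derive_cmul; exact: is_derive_sin. Qed.

Let dAx (th k : R) : is_derive th 1 (fun th => A th * k) (- B th * k).
Proof.
by apply: (is_derive_eq (is_derive_mul (dA th) (is_derive_const k th))); rewrite mulr0 addr0.
Qed.

Let dBx (th k : R) : is_derive th 1 (fun th => B th * k) (A th * k).
Proof.
by apply: (is_derive_eq (is_derive_mul (dB th) (is_derive_const k th))); rewrite mulr0 addr0.
Qed.

Let d_thu th y : is_derive th 1 (fun th => uu (A th) (B th) y)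
  (Dg (A th) (- B th) (A th) (B th) y).
Proof.
have d1 := is_derive_mul (is_derive_expN (dAx th (expR y))) (is_derive_cosc (dBx th (expR y))).
have d2 := dAx th (expR y * expR (- expR y)).
have d0 := is_derive_const 1 th.
have d3 := is_derive_sub (is_derive_sub d0 d1) d2.
apply: (is_derive_eq (is_derive_mul d3 (is_derive_const (expR (- (al * y))) th))); rewrite /Dg; ring.
Qed.

Let d_thv th y : is_derive th 1 (fun th => vv (A th) (B th) y)
  (Dg (B th) (A th) (A th) (B th) y).
Proof.
have d1 := is_derive_mul (is_derive_expN (dAx th (expR y))) (is_derive_sinc (dBx th (expR y))).
have d2 := dBx th (expR y * expR (- expR y)).
have d3 := is_derive_sub d1 d2.
apply: (is_derive_eq (is_derive_mul d3 (is_derive_const (expR (- (al * y))) th))); rewrite /Dg; ring.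
Qed.

Let At th : `|A th| <= t.
Proof. by rewrite normrM gtr0_norm// ler_piMr ?cos_max// ltW. Qed.
Let Bt th : `|B th| <= t.
Proof. by rewrite normrM gtr0_norm// ler_piMr ?sin_max// ltW. Qed.

Lemma is_derive_LI (f : R -> R -> R) (f' : R -> R -> R) (G : R -> R) (u v th : R) :
  u < th < v -> (forall s, u < s < v -> li (f s)) ->
  (forall s y, u < s < v -> is_derive s 1 (f ^~ y) (f' s y)) ->
  li G -> (forall y, 0 <= G y) -> (forall s y, u < s < v -> `|f' s y| <= G y) ->
  is_derive th 1 (fun s => LI (f s)) (LI (f' th)).
Proof.
move=> uv lf df lG G0 fG.
have I0 : `]u, v[%classic th by rewrite /= in_itv.
have H1 x : `]u, v[%classic x -> lebesgue_measure.-integrable setT (EFin \o f x).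
  by rewrite /= in_itv/= => /lf.
have H2 x y : `]u, v[%classic x -> [set: R] y -> derivable (f ^~ y) x 1.
  by rewrite /= in_itv/= => /df H _; have [] := H y.
have H3 x y : `]u, v[%classic x -> [set: R] y -> `|partial1of2 f x y| <= G y.
  by rewrite /= in_itv/= partial1of2E => H _; have [_ ->] := df x y H; exact: fG.
have D1 := @derivable_under_integral _ _ _ lebesgue_measure f setT measurableT
  th u v I0 H1 H2 G G0 lG H3.
have D2 := @differentiation_under_integral _ _ _ lebesgue_measure f setT measurableT
  th u v I0 H1 H2 G G0 lG H3.
split; first exact: D1.
rewrite -derive1E D2; apply: eq_Rintegral => y _.
by rewrite partial1of2E; have [_ ->] := df th y uv.
Qed.

(** [ederiv_bound] requires a positive lower bound on the real part, so differentiation under the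
    integral is performed near each angle below pi / 2, where cos s >= cos v > 0. *)
Let arc_itv th : 0 < th < pi / 2 -> exists2 v, th < v < pi / 2 &
  exists2 del, 0 < del & forall s, 0 < s < v -> del <= A s <= t.
Proof.
move=> /andP[th0 thp]; pose v := (th + pi / 2) / 2.
have tv : th < v by rewrite /v; lra.
have vp : v < pi / 2 by rewrite /v; lra.
have pi0 := pi_gt0 R.
exists v; first by rewrite tv.
exists (A v); first by rewrite mulr_gt0// cos_gt0_pihalf//; lra.
move=> s /andP[s0 sv]; rewrite (le_trans (ler_norm _) (At s)) andbT.
rewrite ler_pM2l// leNgt ltr_cos ?in_itv/= -?leNgt; lra.
Qed.

(** Together with [dV] this is a linear system for (U, V) in the angle: a rotation of speed [al]
    forced by K times (B, - A). V vanishes at angle 0, and at pi / 2 the pair consists of the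
    integrals of 1 - cos and of the compensated sine. *)
Let dU th : 0 < th < pi / 2 ->
  is_derive th 1 (fun th => U (A th) (B th)) (B th * K - al * V (A th) (B th)).
Proof.
move=> thI; have [v /andP[tv vp] [del d0 Hd]] := arc_itv thI.
have th0 : 0 < th < v by case/andP: thI => -> _.
have Ap s : 0 < s < v -> 0 < A s by move=> /Hd/andP[h _]; exact: lt_le_trans h.
rewrite -LI_Dg1; last exact: Ap.
apply: (@is_derive_LI (fun th => uu (A th) (B th))
  (fun th => Dg (A th) (- B th) (A th) (B th))
  (fun y => (2 * t / del + t + 3 * t ^+ 2 + t) * expR (- (c * `|y|))) 0 v) => //.
- by move=> s /Ap/ltW; exact: li_uu.
- exact/liZ/li_expabs.
- move=> y; rewrite mulr_ge0 ?expR_ge0// !addr_ge0 ?(ltW t0)//.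
    by rewrite divr_ge0 ?mulr_ge0// ltW.
  by rewrite mulr_ge0// sqr_ge0.
- by move=> s y sv; apply: b_Dg => //; [exact: Hd|rewrite normrN].
Qed.

Let dV th : 0 < th < pi / 2 ->
  is_derive th 1 (fun th => V (A th) (B th)) (al * U (A th) (B th) - A th * K).
Proof.
move=> thI; have [v /andP[tv vp] [del d0 Hd]] := arc_itv thI.
have th0 : 0 < th < v by case/andP: thI => -> _.
have Ap s : 0 < s < v -> 0 < A s by move=> /Hd/andP[h _]; exact: lt_le_trans h.
rewrite -LI_Dg2; last exact: Ap.
apply: (@is_derive_LI (fun th => vv (A th) (B th))
  (fun th => Dg (B th) (A th) (A th) (B th))
  (fun y => (2 * t / del + t + 3 * t ^+ 2 + t) * expR (- (c * `|y|))) 0 v) => //.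
- by move=> s /Ap/ltW; exact: li_vv.
- exact/liZ/li_expabs.
- move=> y; rewrite mulr_ge0 ?expR_ge0// !addr_ge0 ?(ltW t0)//.
    by rewrite divr_ge0 ?mulr_ge0// ltW.
  by rewrite mulr_ge0// sqr_ge0.
- by move=> s y sv; apply: b_Dg => //; exact: Hd.
Qed.

(* [cos] is truncated so that dominated convergence applies across [pi / 2]. *)
Let A' th := t * Num.max 0 (cos th).

Let cA' : continuous A'.
Proof.
move=> x; apply: cvgMr; apply: (@continuous_max R R (fun=> 0) cos).
  exact: cst_continuous.
exact: continuous_cos.
Qed.

Let A't th : 0 <= A' th <= t.
Proof.
rewrite /A' mulr_ge0 ?(ltW t0) ?le_max ?lexx//=.
by rewrite ler_piMr ?(ltW t0)// ge_max ler01 cos_le1.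
Qed.

Let AA' th : 0 <= th <= pi / 2 -> A' th = A th.
Proof.
move=> thI; rewrite /A' max_r// cos_ge0_pihalf//.
have := pi_gt0 R; lra.
Qed.

Let cB : continuous B. Proof. exact: (derive_continuous dB). Qed.

Let cU : {within `[0, pi / 2], continuous (fun th => U (A th) (B th))}.
Proof.
apply: (@subspace_eq_continuous _ _ _ (fun th => U (A' th) (B th))).
  by move=> th; rewrite inE/= in_itv/= => /AA' ->.
apply: continuous_subspaceT => th0.
have := @continuity_under_integral R _ _ lebesgue_measure
  (fun th => uu (A' th) (B th)) setT measurableT (th0 - 1) (th0 + 1) _ _
  (fun y => C1 t * expR (- (c * `|y|))) _ _ th0.
apply.
- by move=> x _; apply: li_uu; case/andP: (A't x).
- apply: aeW => y _ x _; rewrite /uu; apply: cvgMl.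
  apply: cvgB; last by apply: cvgMl; exact: cA'.
  apply: cvgB; first exact: cvg_cst.
  apply: cvgM.
    apply: (@continuous_comp _ _ _ (fun x => - (A' x * expR y))); last exact: continuous_expR.
    by apply: cvgN; apply: cvgMl; exact: cA'.
  apply: (@continuous_comp _ _ _ (fun x => B x * expR y)); last exact: continuous_cos.
  by apply: cvgMl; exact: cB.
- exact/liZ/li_expabs.
- by move=> x _; apply: aeW => y _; exact: b_uu.
- by rewrite inE/= in_itv/=; lra.
Qed.

Let cV : {within `[0, pi / 2], continuous (fun th => V (A th) (B th))}.
Proof.
apply: (@subspace_eq_continuous _ _ _ (fun th => V (A' th) (B th))).
  by move=> th; rewrite inE/= in_itv/= => /AA' ->.
apply: continuous_subspaceT => th0.
have := @continuity_under_integral R _ _ lebesgue_measure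
  (fun th => vv (A' th) (B th)) setT measurableT (th0 - 1) (th0 + 1) _ _
  (fun y => C1 t * expR (- (c * `|y|))) _ _ th0.
apply.
- by move=> x _; apply: li_vv; case/andP: (A't x).
- apply: aeW => y _ x _; rewrite /vv; apply: cvgMl.
  apply: cvgB; last by apply: cvgMl; exact: cB.
  apply: cvgM.
    apply: (@continuous_comp _ _ _ (fun x => - (A' x * expR y))); last exact: continuous_expR.
    by apply: cvgN; apply: cvgMl; exact: cA'.
  apply: (@continuous_comp _ _ _ (fun x => B x * expR y)); last exact: continuous_sin.
  by apply: cvgMl; exact: cB.
- exact/liZ/li_expabs.
- by move=> x _; apply: aeW => y _; exact: b_vv.
- by rewrite inE/= in_itv/=; lra.
Qed.

Let arc_const (f : R -> R) : {within `[0, pi / 2], continuous f} ->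
  (forall th, 0 < th < pi / 2 -> is_derive th 1 f 0) -> f (pi / 2) = f 0.
Proof.
move=> cf df; have pi20 : 0 < pi / 2 :> R by rewrite divr_gt0// pi_gt0.
have df' x : x \in `]0, pi / 2[ -> is_derive x 1 f ((fun=> 0) x).
  by rewrite in_itv/= => /df.
have [x _] := MVT pi20 df' cf.
by rewrite mul0r => /eqP; rewrite subr_eq0 => /eqP.
Qed.

Let V0 : V (A 0) (B 0) = 0.
Proof.
rewrite /V (_ : vv _ _ = fun=> 0).
  by rewrite /LI /Rintegral integral0.
by apply/funext => y; rewrite /vv /B sin0 mulr0 !mul0r sin0 mulr0 subrr mul0r.
Qed.

Let c_sub (f : R -> R) : continuous f -> {within `[0, pi / 2], continuous f}.
Proof. exact: continuous_subspaceT. Qed.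

Let Api : A (pi / 2) = 0. Proof. by rewrite /A cos_pihalf mulr0. Qed.
Let Bpi : B (pi / 2) = t. Proof. by rewrite /B sin_pihalf mulr1. Qed.

(** The multiple b0 = - K / (1 - al) of (A, B) is a particular solution of the system. The
    difference rotates by the angle al th, so [f], one of its coordinates in the rotating frame, is
    constant; it vanishes at 0. *)
Lemma arc_neq1 : al != 1 ->
  V 0 t * cos (al * (pi / 2)) = U 0 t * sin (al * (pi / 2)) -
    K / (1 - al) * t * cos (al * (pi / 2)).
Proof.
move=> al1; pose b0 := - K / (1 - al).
have bK : K = - b0 * (1 - al).
  by rewrite /b0; field; rewrite subr_eq0 eq_sym.
pose f th := (V (A th) (B th) - b0 * B th) * cos (al * th) -
  (U (A th) (B th) - b0 * A th) * sin (al * th).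
have cc : continuous (fun th => cos (al * th)) by exact: continuous_cosM.
have cs : continuous (fun th => sin (al * th)) by exact: continuous_sinM.
have cA : continuous A by exact: (derive_continuous dA).
have cf : {within `[0, pi / 2], continuous f}.
  move=> x; apply: cvgB; apply: cvgM.
  - apply: cvgB; first exact: cV.
    by apply: cvgMr; exact: (c_sub cB).
  - exact: (c_sub cc).
  - apply: cvgB; first exact: cU.
    by apply: cvgMr; exact: (c_sub cA).
  - exact: (c_sub cs).
have df th : 0 < th < pi / 2 -> is_derive th 1 f 0.
  move=> thI.
  have d1 := is_derive_sub (dV thI) (is_derive_cmul b0 (dB th)).
  have d2 := is_derive_sub (dU thI) (is_derive_cmul b0 (dA th)).
  have da := is_derive_cmul al (is_derive_id th (1 : R)).
  by apply: (is_derive_eq (is_derive_sub (is_derive_mul d1 (is_derive_cosc da))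
    (is_derive_mul d2 (is_derive_sinc da)))); rewrite bK; ring.
have := arc_const cf df; have B0 : B 0 = 0 by rewrite /B sin0 mulr0.
rewrite /f Api Bpi V0 B0 !mulr0 cos0 sin0.
rewrite !mulr0 !subr0 mul0r /b0 => /eqP; rewrite subr_eq0 => /eqP; lra.
Qed.

(** For al = 1 the forcing resonates with the rotation and no multiple of (A, B) is a particular
    solution; one coordinate in the rotating frame drifts linearly, hence the term K t th in [f],
    while the other, [g], is constant. *)
Lemma arc_eq1 : al = 1 -> U 0 t = K * t * (pi / 2) /\ V 0 t = U t 0.
Proof.
move=> al1.
have cA : continuous A by exact: (derive_continuous dA).
have ci : continuous (fun th : R => K * t * th) by exact: mulrl_continuous.
pose f th := V (A th) (B th) * cos th - U (A th) (B th) * sin th + K * t * th.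
pose g th := V (A th) (B th) * sin th + U (A th) (B th) * cos th.
have cf : {within `[0, pi / 2], continuous f}.
  move=> x; apply: cvgD; last exact: (c_sub ci).
  apply: cvgB; apply: cvgM; [exact: cV| |exact: cU|].
    exact: (c_sub (@continuous_cos R)).
  exact: (c_sub (@continuous_sin R)).
have cg : {within `[0, pi / 2], continuous g}.
  move=> x; apply: cvgD; apply: cvgM; [exact: cV| |exact: cU|].
    exact: (c_sub (@continuous_sin R)).
  exact: (c_sub (@continuous_cos R)).
have df th : 0 < th < pi / 2 -> is_derive th 1 f 0.
  move=> thI.
  apply: (is_derive_eq (is_derive_add (is_derive_sub (is_derive_mul (dV thI) (is_derive_cos th))
    (is_derive_mul (dU thI) (is_derive_sin th)))
    (is_derive_cmul (K * t) (is_derive_id th (1 : R))))); rewrite al1 /A /B.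
  have := cos2Dsin2 th => cs.
  transitivity (K * t * (1 - (cos th ^+ 2 + sin th ^+ 2))); first by ring.
  by rewrite cs subrr mulr0.
have dg th : 0 < th < pi / 2 -> is_derive th 1 g 0.
  move=> thI.
  by apply: (is_derive_eq (is_derive_add (is_derive_mul (dV thI) (is_derive_sin th))
    (is_derive_mul (dU thI) (is_derive_cos th)))); rewrite al1 /A /B; ring.
have := arc_const cf df; have := arc_const cg dg.
rewrite /f /g Api Bpi V0 cos_pihalf sin_pihalf /A /B cos0 sin0 !mulr0 !mulr1.
by split; lra.
Qed.

End Arc.

Let Cc (t : R) := LI (fun y => (1 - cos (t * expR y)) * expR (- (al * y))).
Let Ss (t : R) := LI (fun y => (sin (t * expR y) - t * sin (expR y)) *
  expR (- (al * y))).

Let U0E t : uu 0 t = fun y => (1 - cos (t * expR y)) * expR (- (al * y)).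
Proof. by apply/funext => y; rewrite /uu !mul0r oppr0 expR0 mul1r addr0. Qed.

Let CcE t : Cc t = U 0 t. Proof. by rewrite /U U0E. Qed.

Let SsE t : Ss t = V 0 t - t * V 0 1.
Proof.
rewrite /V -LIZ; last exact: li_vv.
rewrite -LIB; [|exact: li_vv|by apply: liZ; exact: li_vv].
congr LI; apply/funext => y; rewrite /vv !mul0r oppr0 expR0 !mul1r; ring.
Qed.

Let scaleU t : 0 < t -> U 0 t = t `^ al * U 0 1.
Proof.
move=> t0; rewrite /U -LIZ; last exact: li_uu.
have c1 := c_uu (a := 0) (b := 1).
have p0 y : 0 <= uu 0 1 y.
  by rewrite U0E mulr_ge0 ?expR_ge0// subr_ge0 cos_le1.
rewrite LIZ; last exact: li_uu.
rewrite -(LI_shift (ln t) c1 p0) -LIZ.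
  congr LI; apply/funext => y; rewrite !U0E /powR gt_eqF// mulrCA -expRD expRD lnK ?posrE//.
  by congr (_ * expR _); [rewrite mul1r mulrC|ring].
apply: (li_dom c0 (C := C1 1 * expR (c * `|ln t|))).
  move=> y; apply: (@continuous_comp _ _ _ (fun y => y + ln t)); last exact: c1.
  by apply: cvgD; [exact: cvg_id|exact: cvg_cst].
move=> y; rewrite (le_trans (@b_uu 1 0 1 _ _ _)) ?lexx ?ler01 ?normr1//.
rewrite -mulrA ler_wpM2l//; first by rewrite /C1 !addr_ge0// mulr_ge0// sqr_ge0.
rewrite -expRD ler_expR -mulrBr -mulrN ler_pM2l//.
have := ler_normD (y + ln t) (- ln t); rewrite addrK normrN; lra.
Qed.

(** The integrand is nonnegative, and at least [k] for x in [pi / 2, pi], where the cosine is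
    nonpositive; the constant [k] is integrated over that interval in y = ln x. *)
Lemma Ic_gt0 : 0 < U 0 1.
Proof.
have pi0 := pi_gt0 R; have pi2 := pi_ge2 R.
pose g y := uu 0 1 y.
have p0 y : 0 <= g y.
  by rewrite /g U0E mulr_ge0 ?expR_ge0// subr_ge0 cos_le1.
have ln2 : ln (pi / 2) < ln pi :> R by rewrite ltr_ln ?posrE; lra.
pose k : R := expR (- (al * ln pi)).
have k0 : 0 < k by exact: expR_gt0.
have h y : y \in `[ln (pi / 2), ln pi]%classic -> k <= g y.
  rewrite inE/= in_itv/= => /andP[y1 y2].
  have x1 : pi / 2 <= expR y by rewrite -[leLHS]lnK ?ler_expR// posrE; lra.
  have x2 : expR y <= pi by rewrite -[leRHS]lnK ?ler_expR// posrE.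
  have cx : cos (expR y) <= 0.
    rewrite -cos_pihalf leNgt ltr_cos ?in_itv/= -?leNgt; lra.
  rewrite /g U0E -[leLHS]mul1r ler_pM ?mul1r ?expR_ge0//; first lra.
  by rewrite ler_expR lerN2 ler_pM2l//; case/andP: al02.
have lk : li (k \o* \1_(`[ln (pi / 2), ln pi] : set R)).
  apply: (li_le (g := g)); [|exact: li_uu|].
    by apply: measurable_funM => //; apply: measurable_indic; exact: measurable_itv.
  move=> y /=; rewrite indicE; case: (boolP (y \in _)) => [/h kg|_].
    by rewrite mul1r gtr0_norm.
  by rewrite mul0r normr0.
apply: (@lt_le_trans _ _ (LI (k \o* \1_(`[ln (pi / 2), ln pi] : set R)))).
  rewrite /LI /Rintegral.
  under eq_integral do rewrite /= mulrC EFinM.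
  rewrite integralZl//=; last first.
    apply: (li_le (g := fun y => k^-1 * g y)).
    - by apply: measurable_indic; exact: measurable_itv.
    - by apply: liZ; exact: li_uu.
    - move=> y; rewrite indicE; case: (boolP (y \in _)) => [/h kg|_].
        by rewrite normr1 ler_pdivlMl// mulr1.
      by rewrite normr0 mulr_ge0// invr_ge0 ltW.
  rewrite integral_indic//= ?setIT.
  rewrite lebesgue_measure_itv/= lte_fin ln2 -EFinB -EFinM/= mulr_gt0// subr_gt0//.
apply: le_LI => //; first exact: li_uu.
move=> y /=; rewrite indicE; case: (boolP (y \in _)) => [/h|_].
  by rewrite mul1r.
by rewrite mul0r.
Qed.

Let cos_al : al != 1 -> cos (al * (pi / 2)) != 0.
Proof.
move=> al1; have pi0 := pi_gt0 R; have [a1|a1|a1] := ltrgtP al 1.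
- by rewrite gt_eqF// cos_gt0_pihalf//; case/andP: al02 => ? ?; nra.
- rewrite lt_eqF// -cos_pihalf ltr_cos ?in_itv/=; case/andP: al02 => ? ?; nra.
- by rewrite a1 eqxx in al1.
Qed.

(** In V 0 t - t V 0 1 the terms K t / (1 - al) of [arc_neq1] cancel, so the auxiliary compensator x
    exp(- x) leaves no trace. *)
Lemma stable_S_neq1 t : al != 1 -> 0 < t ->
  Ss t = U 0 1 * tan (pi * al / 2) * (t `^ al - t).
Proof.
move=> al1 t0; have cal := cos_al al1.
have E1 := arc_neq1 t0 al1; have E2 := arc_neq1 (@ltr01 R) al1.
have -> : pi * al / 2 = al * (pi / 2) by rewrite mulrA [pi * _]mulrC.
rewrite SsE /tan; rewrite scaleU// in E1.
apply: (mulIf cal); rewrite mulrBl -[t * _ * _]mulrA E1 E2.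
by field; rewrite cal/= subr_eq0 eq_sym.
Qed.

Let shift_abs (tau y : R) : expR (- (c * `|y + tau|)) <=
  expR (c * `|tau|) * expR (- (c * `|y|)).
Proof.
rewrite -expRD ler_expR -mulrBr -mulrN ler_pM2l//.
have := ler_normD (y + tau) (- tau); rewrite addrK normrN; lra.
Qed.

(** By [arc_eq1] it remains to find U t 0, on the real axis. There [LI (f tau)] is a Frullani
    integral: its derivative in tau is - K by translation invariance, whence the value - K tau and,
    at tau = ln t, the logarithm. *)
Let stable_S_eq1 t : al = 1 -> 0 < t ->
  Ss t = - (2 / pi) * U 0 1 * t * ln t.
Proof.
move=> al1 t0; have pi0 := pi_gt0 R.
have [_ V1] := arc_eq1 t0 al1; have [U01 V2] := arc_eq1 (@ltr01 R) al1.
pose f (tau y : R) := expR (- expR (y + tau)) - expR (- expR y).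
have fE tau y : f tau y = expR (- tau) * Dg 0 (expR tau) (expR tau) 0 y.
  rewrite /Dg /f !mul0r cos0 mulr1 add0r al1 mul1r.
  have e1 : expR (- tau) * expR tau = 1 by rewrite -expRD addNr expR0.
  have e2 : expR y * expR (- y) = 1 by rewrite -expRD subrr expR0.
  have -> : expR (y + tau) = expR tau * expR y by rewrite expRD mulrC.
  set E1 := expR (- (expR tau * expR y)); set E2 := expR (- expR y).
  transitivity ((expR (- tau) * expR tau) * (expR y * expR (- y)) * (E1 - E2)).
    by rewrite e1 e2 !mul1r.
  by ring.
have lf tau : li (f tau).
  rewrite (_ : f tau = fun y => expR (- tau) * Dg 0 (expR tau) (expR tau) 0 y).
    by apply: liZ; apply: li_Dg; exact: expR_gt0.
  by apply/funext => y; exact: fE.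
have LIf tau : LI (f tau) = expR (- tau) * U (expR tau) 0 - K.
  rewrite (_ : f tau = fun y => expR (- tau) * Dg 0 (expR tau) (expR tau) 0 y).
    rewrite LIZ; last by apply: li_Dg; exact: expR_gt0.
    rewrite LI_Dg2 ?expR_gt0// al1 mul1r mulrBr mulrA -expRD addNr expR0 mul1r//.
  by apply/funext => y; exact: fE.
have kkE y : kk y = expR y * expR (- expR y).
  rewrite /kk al1 mul1r expr2.
  have e2 : expR y * expR (- y) = 1 by rewrite -expRD subrr expR0.
  transitivity ((expR y * expR (- y)) * (expR y * expR (- expR y))).
    by ring.
  by rewrite e2 mul1r.
have kk0 y : 0 <= kk y by rewrite kkE mulr_ge0// expR_ge0.
have dm (tau : R) : is_derive tau 1 (fun tau => LI (f tau) + K * tau) 0.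
  have -> : 0 = - LI (fun y => kk (y + tau)) + K * 1 :> R.
    by rewrite LI_shift// mulr1 addNr.
  have dK : is_derive tau 1 (fun s : R => K * s) (K * 1).
    exact: (is_derive_cmul K (is_derive_id tau (1 : R))).
  refine (is_derive_add _ dK). 
  rewrite -mulN1r -LIZ; last first.
    apply: (li_dom c0 (C := 4 * expR (c * `|tau|))).
      move=> y; apply: (@continuous_comp _ _ _ (fun y => y + tau)); last exact: c_kk.
      by apply: cvgD; [exact: cvg_id|exact: cvg_cst].
    move=> y; rewrite (le_trans (b_kk _))// -mulrA ler_pM2l//.
  apply: (@is_derive_LI f (fun tau y => -1 * kk (y + tau))
    (fun y => 4 * expR (c * (`|tau| + 1)) * expR (- (c * `|y|))) (tau - 1) (tau + 1)).
  - lra.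
  - by move=> s _; exact: lf.
  - move=> s y _; rewrite kkE /f.
    have d1 := is_derive_add (is_derive_const y s) (is_derive_id s (1 : R)).
    have d2 := @is_derive1_comp R expR (fun s => y + s) s _ _ (is_derive_expR _) d1.
    apply: (is_derive_eq (is_derive_sub (is_derive_expN d2)
      (is_derive_const (expR (- expR y)) s))).
    by rewrite /=; ring.
  - exact/liZ/li_expabs.
  - by move=> y; rewrite !mulr_ge0// expR_ge0.
  - move=> s y sI; rewrite normrM normrN1 mul1r (le_trans (b_kk _))// -mulrA.
    rewrite ler_pM2l// (le_trans (shift_abs s y))// ler_wpM2r ?expR_ge0//.
    rewrite ler_expR ler_pM2l//.
    have := ler_normD tau (s - tau); rewrite addrC subrK.
    have : `|s - tau| < 1 by rewrite ltr_distl; lra.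
    lra.
have f00 : LI (f 0) = 0.
  rewrite (_ : f 0 = fun=> 0) ?/LI /Rintegral ?integral0//.
  by apply/funext => y; rewrite /f addr0 subrr.
have mE tau : LI (f tau) = - K * tau.
  have h : LI (f tau) + K * tau = LI (f 0) + K * 0.
    exact: (@is_derive_0_is_cst _ (fun s => LI (f s) + K * s) tau 0 dm).
  by move: h; rewrite f00 [K * 0]mulr0 [0 + 0]addr0 => /eqP; rewrite addr_eq0 mulNr => /eqP.
have E1 := LIf (ln t); rewrite mE lnK ?posrE// expRN lnK ?posrE// in E1.
have E2 := LIf 0; rewrite mE expR0 oppr0 expR0 in E2.
rewrite SsE V1 V2 U01.
have Ut : U t 0 = t * (K - K * ln t).
  apply: (mulfI (x := t^-1)); first by rewrite invr_eq0 gt_eqF.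
  rewrite mulKf ?gt_eqF//; move/eqP: E1.
  by rewrite eq_sym subr_eq => /eqP ->; rewrite mulNr addrC.
have U1 : U 1 0 = K.
  by move/eqP: E2; rewrite eq_sym subr_eq mul1r mulr0 add0r => /eqP.
rewrite Ut U1.
have : pi != 0 :> R by rewrite gt_eqF.
move=> pn0; have e : 2 / pi * (pi / 2) = 1 :> R by rewrite mulrA divfK ?mulfV// pnatr_eq0.
transitivity (- (2 / pi * (pi / 2)) * K * t * ln t); last by ring.
by rewrite e; ring.
Qed.

Theorem stable_integrals : exists2 Ic : R, 0 < Ic & forall t : R,
  LI (fun y => (1 - cos (t * expR y)) * expR (- (al * y))) = `|t| `^ al * Ic /\
  LI (fun y => (sin (t * expR y) - t * sin (expR y)) * expR (- (al * y))) =
    if al == 1 then - (2 / pi) * Ic * t * ln `|t|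
    else Ic * tan (pi * al / 2) * (Num.sg t * `|t| `^ al - t).
Proof.
exists (U 0 1); first exact: Ic_gt0.
have pos t : 0 < t -> Cc t = `|t| `^ al * U 0 1 /\ Ss t =
    if al == 1 then - (2 / pi) * U 0 1 * t * ln `|t|
    else U 0 1 * tan (pi * al / 2) * (Num.sg t * `|t| `^ al - t).
  move=> t0; rewrite CcE scaleU// gtr0_norm// gtr0_sg// mul1r; split=> //.
  by case: ifPn => [/eqP al1|al1]; [exact: stable_S_eq1|exact: stable_S_neq1].
move=> t; have [t0|t0|->] := ltrgtP t 0; last 2 first.
- exact: pos.
- split.
    rewrite normr0 powR0 ?mul0r; last by case/andP: al02 => /gt_eqF ->.
    rewrite (_ : (fun y => _) = fun=> 0) ?/LI /Rintegral ?integral0//.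
    by apply/funext => y; rewrite mul0r cos0 subrr mul0r.
  rewrite (_ : (fun y => _) = fun=> 0) ?/LI /Rintegral ?integral0//.
    by case: ifP => _; rewrite ?sgr0 ?mulr0 ?mul0r// subr0 mulr0.
  by apply/funext => y; rewrite !mul0r sin0 subrr mul0r.
have [] := pos (- t); rewrite ?oppr_gt0// normrN sgrN => H1 H2; split.
  rewrite -H1; congr LI; apply/funext => y; congr (_ * _).
  by rewrite mulNr cosN.
have -> : LI (fun y => (sin (t * expR y) - t * sin (expR y)) *
    expR (- (al * y))) = -1 * Ss (- t).
  rewrite -LIZ.
    congr LI; apply/funext => y; rewrite (_ : - t * expR y = - (t * expR y)) ?sinN; ring.
  rewrite /li (_ : (fun y => _) = fun y => vv 0 (- t) y - (- t) * vv 0 1 y).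
    by apply: liB; [exact: li_vv|apply: liZ; exact: li_vv].
  by apply/funext => y; rewrite /vv !mul0r oppr0 expR0 !mul1r; ring.
by rewrite H2; case: ifP => _; ring.
Qed.

End StableIntegrals.

Lemma continuous_cmul (R : realType) (s : R) (f : R -> R) : continuous f ->
  continuous (fun x => s * f x).
Proof. by move=> cf x; apply: cvgMl_tmp; exact: cf. Qed.

(** * Expectations at a large scale, relative to the tail *)

Section ExpTail.
Variables (R : realType) (al : R).
Hypothesis al0 : 0 < al.

Let q (c y : R) : R := if c <= y then expR (- (al * y)) else 0.

Lemma li_exp_tail (c : R) : li (fun y => if c <= y then expR (- (al * y)) else 0 : R).
Proof.
apply: (@li_le _ _ (fun y => expR (2 * al * `|c|) * expR (- (al * `|y|)))).
- apply: measurable_fun_ifT => //.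
    by apply: measurable_fun_ler => //; exact: measurable_id.
  apply: continuous_measurable_fun => y.
  apply: (@continuous_comp _ _ _ (fun y : R => - (al * y))); last exact: continuous_expR.
  by apply: cvgN; apply: (@continuous_cmul _ al id) => z.
- by apply: liZ; exact: li_expabs.
move=> y; case: ifPn => cy; last by rewrite normr0 mulr_ge0// expR_ge0.
rewrite ger0_norm ?expR_ge0// -expRD ler_expR.
have [y0|y0] := leP 0 y.
  have := mulr_ge0 (ltW al0) (normr_ge0 c); rewrite [`|y|]ger0_norm//; lra.
have h : `|y| <= `|c|.
  have c0 : c < 0 := le_lt_trans cy y0.
  by rewrite !ltr0_norm// lerN2.
rewrite -mulrN -(ltr0_norm y0); have := ler_wpM2l (ltW al0) h; lra.
Qed.

Lemma LI_exp_tail (c : R) :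
  LI (fun y => if c <= y then expR (- (al * y)) else 0) = expR (- (al * c)) / al.
Proof.
apply: (cvg_unique _ (LI_lim_itv (li_exp_tail c))) => //.
apply: cvgn_le => e e0.
have de (y : R) : is_derive y 1 (fun y => - al^-1 * expR (- (al * y)))
    (expR (- (al * y))).
  apply: (is_derive_eq (is_derive_cmul (- al^-1)
    (is_derive_expN (is_derive_cmul al (is_derive_id y (1 : R)))))).
  by rewrite mulr1 mulrA mulrNN mulVf ?mul1r ?gt_eqF.
have ce : continuous (fun y : R => expR (- (al * y))).
  move=> y; apply: (@continuous_comp _ _ _ (fun y : R => - (al * y))); last exact: continuous_expR.
  by apply: cvgN; apply: (@continuous_cmul _ al id) => z.
have a0 : 0 <= (al ^+ 2 * e)^-1 by rewrite invr_ge0 mulr_ge0// ?exprn_ge0// ltW.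
exists (maxn (Num.bound `|c|).+1 (Num.bound (al ^+ 2 * e)^-1)) => n.
rewrite geq_max => /andP[n1 n2].
have cn : `|c| < n%:R.
  by rewrite (lt_le_trans (archi_boundP (normr_ge0 c)))// ler_nat ltnW.
have en : (al ^+ 2 * e)^-1 <= n%:R.
  by rewrite (le_trans (ltW (archi_boundP a0)))// ler_nat.
have n0 : 0 < n%:R :> R by rewrite (le_lt_trans _ cn).
have -> : (\int[lebesgue_measure]_(y in `[- n%:R, n%:R])
    (if c <= y then expR (- (al * y)) else 0))%R =
    (\int[lebesgue_measure]_(y in `[c, n%:R]) expR (- (al * y)))%R.
  rewrite Rintegral_mkcond [RHS]Rintegral_mkcond; congr Rintegral.
  apply/funext => y; rewrite !patchE !mem_setE !in_itv/=.
  have [cy|cy] := leP c y; last by case: ifP.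
  by rewrite (_ : - n%:R <= y)//; move: cn; rewrite ltr_norml; lra.
have [cn1 cn2] := (ltr_normlW cn, ler_norm c).
rewrite (itv_FTC ce de)//.
have -> : - al^-1 * expR (- (al * n%:R)) - - al^-1 * expR (- (al * c)) -
    expR (- (al * c)) / al = - (expR (- (al * n%:R)) / al) by ring.
rewrite normrN ger0_norm; last by rewrite divr_ge0 ?expR_ge0// ltW.
rewrite ler_pdivrMr//.
have h := sexpRN (mulr_ge0 (ltW al0) (ltW n0)).
have an0 : 0 < al * n%:R by rewrite mulr_gt0.
rewrite -(ler_pM2l an0) (le_trans h)//.
have -> : al * n%:R * (e * al) = n%:R * (al ^+ 2 * e) by ring.
by rewrite -ler_pdivrMr ?mulr_gt0 ?exprn_gt0// mul1r.
Qed.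
End ExpTail.

(** Summation over increasing levels, [W i] telling whether [y] has passed [x i]. At y = x i both
    values are allowed, so strict and large tail events are covered alike. The same inequality is
    used under P and under the limiting power density. *)
Lemma step_pt (R : realType) (g : R -> R) (x W : nat -> R) (y M e : R) n : 0 <= e ->
  (forall i, W i = 1 /\ x i <= y \/ W i = 0 /\ y <= x i) ->
  (forall i, x i < x i.+1) -> (forall z, z <= x 0%N -> g z = 0) ->
  (forall i z, (i < n)%N -> x i <= z <= x i.+1 -> `|g z - g (x i)| <= e) ->
  (forall z, `|g z| <= M) ->
  `|g y - \sum_(i < n) g (x i) * (W i - W i.+1)| <= e * W 0%N + M * W n.
Proof.
move=> e0 HW xS g0 ge gM.
have W01 i : 0 <= W i.
  by have [[-> _]|[-> _]] := HW i.
have Wd i : W i - W i.+1 = 0 \/ W i - W i.+1 = 1 /\ x i <= y <= x i.+1.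
  have := HW i; have := HW i.+1; have := xS i.
  move=> lt [[-> h1]|[-> h1]] [[-> h2]|[-> h2]]; rewrite ?subrr; [by left| |by right; rewrite subr0 h2 h1|by left].
  by have := lt_le_trans lt (le_trans h1 h2); rewrite ltxx.
have H : forall m, (m <= n)%N ->
    `|g y - g y * W m - \sum_(i < m) g (x i) * (W i - W i.+1)| <= e * (W 0%N - W m).
  elim=> [|m ih] mn.
    rewrite big_ord0 subr0 subrr mulr0.
    have [[-> _]|[-> h]] := HW 0%N; first by rewrite mulr1 subrr normr0.
    by rewrite g0// mul0r subrr normr0.
  rewrite big_ord_recr/=.
  have -> : g y - g y * W m.+1 - (\sum_(i < m) g (x i) * (W i - W i.+1) +
      g (x m) * (W m - W m.+1)) = (g y - g y * W m -
      \sum_(i < m) g (x i) * (W i - W i.+1)) + (g y - g (x m)) * (W m - W m.+1) by ring.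
  have -> : e * (W 0%N - W m.+1) = e * (W 0%N - W m) + e * (W m - W m.+1) by ring.
  rewrite (le_trans (ler_normD _ _))// lerD ?ih//; first by rewrite ltnW.
  have [->|[-> h]] := Wd m; first by rewrite !mulr0 normr0.
  by rewrite !mulr1 ge.
have := H n (leqnn _).
set S := \sum_(i < n) _ => h.
have -> : g y - S = (g y - g y * W n - S) + g y * W n by ring.
rewrite (le_trans (ler_normD _ _))// lerD//.
  by rewrite (le_trans h)// ler_wpM2l// gerBl.
by rewrite normrM [X in _ * X]ger0_norm// ler_wpM2r.
Qed.

Lemma li_sum (R : realType) (F : nat -> R -> R) n : (forall i, li (F i)) ->
  li (fun y => \sum_(i < n) F i y) /\
  LI (fun y => \sum_(i < n) F i y) = \sum_(i < n) LI (F i).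
Proof.
move=> lF; elim: n => [|n [ih1 ih2]].
  rewrite (_ : (fun y => _) = (fun y => F 0%N y - F 0%N y)); last first.
    by apply/funext => y; rewrite big_ord0 subrr.
  by rewrite big_ord0 LIB// subrr; split=> //; exact: liB.
rewrite (_ : (fun y => _) = (fun y => \sum_(i < n) F i y + F n y)); last first.
  by apply/funext => y; rewrite big_ord_recr.
by rewrite big_ord_recr/= LID// ih2; split=> //; exact: liD.
Qed.

Section Vague.
Context (d : measure_display) (T : measurableType d) (R : realType).
Variable P : probability T R.
Variables (al p : R) (U : T -> R) (A : R -> set T) (K : R -> R).
Hypothesis al0 : 0 < al.
Hypothesis p0 : 0 <= p.
Hypothesis mU : measurable_fun [set: T] U.
Hypothesis mA : forall u, measurable (A u).
Hypothesis AU : forall u w, A u w -> u <= U w.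
Hypothesis UA : forall u w, u < U w -> A u w.
Hypothesis K0 : forall u, 0 < K u.
Hypothesis tA : forall s, 0 < s ->
  fine (P (A (s * a))) / K a @[a --> +oo] --> p * s `^ (- al).

Let q (c y : R) : R := if c <= y then expR (- (al * y)) else 0.

(** [g] is replaced by a step function on [eps, eps + B], whose expectation is a combination of tail
    probabilities with known limits and whose integral is the same combination of powers. On both
    sides the error is eta times the mass beyond eps plus M times the mass beyond eps + B. *)
Lemma vague_away (g : R -> R) (eps M : R) : continuous g -> (forall x, `|g x| <= M) ->
  0 < eps -> (forall x, x <= eps -> g x = 0) ->
  li (fun y => g (expR y) * expR (- (al * y))) /\
  Ex P (fun w => g (U w / a)) / K a @[a --> +oo] -->
    p * al * LI (fun y => g (expR y) * expR (- (al * y))).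
Proof.
move=> cg gM eps0 geps.
have M0 : 0 <= M := le_trans (normr_ge0 _) (gM 0).
have c1 : continuous (fun y => g (expR y) * expR (- (al * y))).
  move=> y; apply: cvgM.
    by apply: (@continuous_comp _ _ _ expR g); [exact: continuous_expR|exact: cg].
  apply: (@continuous_comp _ _ _ (fun y : R => - (al * y))); last exact: continuous_expR.
  by apply: cvgN; apply: (@continuous_cmul _ al id) => z.
have lig : li (fun y => g (expR y) * expR (- (al * y))).
  apply: (@li_le _ _ (fun y => M * q (ln eps) y)).
  - exact: continuous_measurable_fun.
  - by apply: liZ; exact: li_exp_tail.
  move=> y; rewrite normrM [X in _ * X]ger0_norm ?expR_ge0// /q.
  case: ifPn => h; first by rewrite ler_wpM2r// expR_ge0.
  rewrite geps ?normr0 ?mul0r ?mulr0//.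
  by rewrite -[leRHS]lnK ?posrE// ler_expR ltW// ltNge.
split=> //; apply: cvgy_le => e e0.
(* [B] makes M times the limiting mass beyond eps + B at most e / 16; further down [eta] does the
   same for the mass beyond eps. *)
have [B B0 HB] : exists2 B : R, 0 < B & p * (M * (eps + B) `^ (- al)) <= e / 16.
  exists ((16 * (p * M) / e + 1) `^ (al^-1)); first by apply: powR_gt0; rewrite ltr_wpDl// divr_ge0 ?mulr_ge0// ltW.
  set z := _ + 1; have z1 : 1 <= z by rewrite lerDr divr_ge0 ?mulr_ge0// ltW.
  have z0 : 0 < z by rewrite (lt_le_trans _ z1).
  have h : (eps + z `^ al^-1) `^ (- al) <= z^-1.
    rewrite powRN lef_pV2 ?posrE ?powR_gt0// ?ltr_wpDr ?powR_ge0//.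
    rewrite -[leLHS]powRr1 ?(ltW z0)// -(mulVf (lt0r_neq0 al0)) powRrM.
    apply: ge0_ler_powR; rewrite ?nnegrE ?powR_ge0 ?(ltW al0) ?addr_ge0 ?powR_ge0 ?(ltW eps0)//.
    by rewrite lerDr ltW.
  rewrite mulrA (le_trans (ler_wpM2l _ h)) ?mulr_ge0// ler_pdivrMr//.
  have : e / 16 * z = p * M + e / 16 by rewrite /z; field; rewrite gt_eqF.
  by move=> ->; rewrite lerDl divr_ge0// ltW.
have x0a : 0 < eps `^ (- al) by rewrite powR_gt0.
pose eta := e / (16 * (p * eps `^ (- al) + 1)).
have den : 0 < 16 * (p * eps `^ (- al) + 1) by rewrite mulr_gt0// ltr_wpDl// mulr_ge0// ltW.
have eta0 : 0 < eta by rewrite divr_gt0.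
have Heta : p * (eta * eps `^ (- al)) <= e / 16.
  rewrite /eta; have -> : p * (e / (16 * (p * eps `^ (- al) + 1)) * eps `^ (- al)) =
    (e / 16) * (p * eps `^ (- al) / (p * eps `^ (- al) + 1)).
    field; by rewrite gt_eqF// ltr_wpDl// mulr_ge0// ltW.
  rewrite ler_piMr ?divr_ge0 ?(ltW e0)// ler_pdivrMr ?mul1r ?lerDl//.
  by rewrite ltr_wpDl// mulr_ge0// ltW.
have [dl dl0 Hdl] := unif_cont_itv eps (eps + B) cg eta0.
have BD : 0 <= B / dl by rewrite divr_ge0// ltW.
pose n := (Num.bound (B / dl)).+1.
pose x (i : nat) : R := eps + i%:R * (B / n%:R).
have n0 : 0 < n%:R :> R by rewrite ltr0n.
have hB : B / n%:R < dl.
  rewrite ltr_pdivrMr// mulrC -ltr_pdivrMr//.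
  by rewrite (lt_le_trans (archi_boundP BD))// ler_nat /n.
have Bn0 : 0 < B / n%:R by rewrite divr_gt0.
have xS i : x i < x i.+1.
  by rewrite /x ltrD2l ltr_pM2r// ltr_nat.
have x0 i : 0 < x i by rewrite /x ltr_wpDr// mulr_ge0// ltW.
have x00 : x 0%N = eps by rewrite /x mul0r addr0.
have xn : x n = eps + B by rewrite /x mulrC divfK// gt_eqF.
have gx i z : (i < n)%N -> x i <= z <= x i.+1 -> `|g z - g (x i)| <= eta.
  move=> iN /andP[z1 z2]; rewrite distrC; apply: Hdl; last first.
    rewrite ler0_norm ?opprB ?subr_le0//.
    have : x i.+1 - x i = B / n%:R by rewrite /x -natr1; ring.
    lra.
  rewrite /x lerDl mulr_ge0 ?(ltW Bn0)//= lerD2l -ler_pdivlMr//.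
  by rewrite invf_div mulrC divfK ?gt_eqF// ler_nat ltnW.
have gx0 z : z <= x 0%N -> g z = 0 by rewrite x00; exact: geps.
pose t a := fine (P (A a)).
pose S a := \sum_(i < n) g (x i) * (t (x i * a) / K a - t (x i.+1 * a) / K a).
pose S0 := \sum_(i < n) g (x i) * (p * x i `^ (- al) - p * x i.+1 `^ (- al)).
have cS : S a @[a --> +oo] --> S0.
  apply: (cvg_sum_ord (f := fun i a => g (x i) * (t (x i * a) / K a - t (x i.+1 * a) / K a))
    (l := fun i => g (x i) * (p * x i `^ (- al) - p * x i.+1 `^ (- al)))) => i _.
  apply: cvgMl_tmp; apply: cvgB; exact: tA.
have near1 a : 0 < a -> `|Ex P (fun w => g (U w / a)) / K a - S a| <=
    eta * (t (x 0%N * a) / K a) + M * (t (x n * a) / K a).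
  move=> a0.
  have bg : bmf (fun w => g (U w / a)).
    apply: (bmf_ccomp (f := fun w => U w / a) _ cg gM).
    by apply: measurable_funM.
  have bA i : bmf (fun w => \1_(A (x i * a)) w : R) by exact: bmf_indic.
  have bS : bmf (fun w => \sum_(i < n) g (x i) * (\1_(A (x i * a)) w - \1_(A (x i.+1 * a)) w)).
    by apply: bmf_sum => i _; apply: bmfZ; exact: bmfB.
  have ES : Ex P (fun w => \sum_(i < n) g (x i) * (\1_(A (x i * a)) w - \1_(A (x i.+1 * a)) w)) =
      S a * K a.
    rewrite Ex_sum; last by move=> i _; apply: bmfZ; exact: bmfB.
    rewrite /S mulr_suml; apply: eq_bigr => i _.
    rewrite ExZ; last exact: bmfB.
    rewrite ExB// !Ex_indic// /t; field; by rewrite gt_eqF.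
  have -> : Ex P (fun w => g (U w / a)) / K a - S a =
    (Ex P (fun w => g (U w / a)) - S a * K a) / K a by field; rewrite gt_eqF.
  rewrite normrM [X in _ * X]gtr0_norm ?invr_gt0// -ES.
  have -> : eta * (t (x 0%N * a) / K a) + M * (t (x n * a) / K a) =
    (eta * t (x 0%N * a) + M * t (x n * a)) / K a by ring.
  rewrite ler_pM2r ?invr_gt0//.
  rewrite (le_trans (Ex_normB _ bg bS))//.
  rewrite /t -!Ex_indic// -!ExZ// -ExD; try exact: bmfZ.
  apply: le_Ex.
  - by apply: bmf_norm; exact: bmfB.
  - by apply: bmfD; exact: bmfZ.
  move=> w; apply: (step_pt (x := x) (W := fun i => \1_(A (x i * a)) w) (ltW eta0) _ xS gx0 gx gM).
  move=> i; rewrite indicE; case: (boolP (w \in _)) => [/set_mem/AU h|/negP h].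
    by left; rewrite ler_pdivlMr.
  right; split=> //; rewrite ler_pdivrMr// leNgt; apply/negP => /UA h'.
  by apply: h; rewrite inE.
have near2 : `|p * al * LI (fun y => g (expR y) * expR (- (al * y))) - S0| <=
    p * (eta * eps `^ (- al)) + p * (M * (eps + B) `^ (- al)).
  pose W i y : R := if ln (x i) <= y then 1 else 0.
  have lq i : li (fun y => W i y * expR (- (al * y))).
    have := li_exp_tail al0 (ln (x i)); congr li; apply/funext => y; rewrite /W.
    by case: ifP => _; rewrite ?mul1r ?mul0r.
  have Lq i : LI (fun y => W i y * expR (- (al * y))) = x i `^ (- al) / al.
    have := LI_exp_tail al0 (ln (x i)); rewrite -mulNr -[X in X `^ _]lnK ?posrE// -expRM.
    rewrite [X in _ = expR X / _ -> _]mulrC => <-; congr LI; apply/funext => y; rewrite /W.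
    by case: ifP => _; rewrite ?mul1r ?mul0r.
  pose h := fun y => \sum_(i < n) g (x i) * (W i y * expR (- (al * y)) - W i.+1 y * expR (- (al * y))).
  have [lh Lh] : li h /\ LI h = \sum_(i < n) g (x i) * (x i `^ (- al) / al - x i.+1 `^ (- al) / al).
    have [] := @li_sum _ (fun i y => g (x i) * (W i y * expR (- (al * y)) - W i.+1 y * expR (- (al * y)))) n.
      by move=> i; apply: liZ; exact: liB.
    move=> H1 ->; split=> //; apply: eq_bigr => i _.
    by rewrite LIZ ?LIB ?Lq//; exact: liB.
  have -> : S0 = p * al * LI h.
    rewrite Lh /S0 mulr_sumr; apply: eq_bigr => i _; field; by rewrite gt_eqF.
  rewrite -mulrBr normrM [X in X * _]ger0_norm ?mulr_ge0 ?(ltW al0)//.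
  have -> : p * (eta * eps `^ (- al)) + p * (M * (eps + B) `^ (- al)) =
     p * al * (eta * (eps `^ (- al) / al) + M * ((eps + B) `^ (- al) / al)).
    by field; rewrite gt_eqF.
  rewrite ler_wpM2l ?mulr_ge0 ?(ltW al0)//.
  rewrite -xn -x00 -!Lq -!LIZ// -LID; try exact: liZ.
  have key y : `|g (expR y) * expR (- (al * y)) - h y| <=
      eta * (W 0%N y * expR (- (al * y))) + M * (W n y * expR (- (al * y))).
    have -> : h y = (\sum_(i < n) g (x i) * (W i y - W i.+1 y)) * expR (- (al * y)).
      by rewrite /h mulr_suml; apply: eq_bigr => i _; ring.
    rewrite -mulrBl normrM [X in _ * X]ger0_norm ?expR_ge0// !mulrA -mulrDl.
    rewrite ler_wpM2r ?expR_ge0//.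
    apply: (step_pt (x := x) (W := fun i => W i y) (ltW eta0) _ xS gx0 gx gM) => i.
    rewrite /W; case: ifPn => h'.
      by left; split=> //; rewrite -[leLHS]lnK ?posrE// ler_expR.
    right; split=> //; rewrite -[leRHS]lnK ?posrE// ler_expR ltW//.
    by rewrite ltNge.
  have lr : li (fun y => eta * (W 0%N y * expR (- (al * y))) + M * (W n y * expR (- (al * y)))).
    by apply: liD; exact: liZ.
  rewrite -LIB// ler_norml; apply/andP; split; last first.
    apply: le_LI => //; first exact: liB.
    by move=> y; rewrite (le_trans (ler_norm _)).
  rewrite -mulN1r -LIZ//; apply: le_LI; [exact: liZ|exact: liB|].
  by move=> y; rewrite mulN1r lerNl (le_trans (ler_norm _))// -normrN opprK.
have e16 : 0 < e / 16 by rewrite divr_gt0.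
have [B1 H1] := cvgy_leP cS e16.
have r1 : 0 < e / (16 * eta) by rewrite divr_gt0// mulr_gt0.
have r2 : 0 < e / (16 * (M + 1)) by rewrite divr_gt0// mulr_gt0// ltr_wpDl.
have [B2 H2] := cvgy_leP (tA (x0 0%N)) r1.
have [B3 H3] := cvgy_leP (tA (x0 n)) r2.
exists (Num.max 0 (Num.max B1 (Num.max B2 B3))) => a; rewrite !gt_max => /and4P[a0 a1 a2 a3].
have {}H1 := H1 a a1; have {}H2 := H2 a a2; have {}H3 := H3 a a3; have N1 := near1 a a0.
have T2 : eta * (t (x 0%N * a) / K a) <= e / 8.
  have h : t (x 0%N * a) / K a <= p * eps `^ (- al) + e / (16 * eta).
    by have := ler_normlW H2; rewrite x00 /t; lra.
  rewrite (le_trans (ler_wpM2l (ltW eta0) h))//.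
  have -> : eta * (p * eps `^ (- al) + e / (16 * eta)) = p * (eta * eps `^ (- al)) + e / 16.
    by field; rewrite gt_eqF.
  lra.
have T3 : M * (t (x n * a) / K a) <= e / 8.
  have h : t (x n * a) / K a <= p * (eps + B) `^ (- al) + e / (16 * (M + 1)).
    by have := ler_normlW H3; rewrite xn /t; lra.
  rewrite (le_trans (ler_wpM2l M0 h))//.
  have h2 : M * (e / (16 * (M + 1))) <= e / 16.
    have -> : M * (e / (16 * (M + 1))) = (e / 16) * (M / (M + 1)).
      by field; rewrite gt_eqF// ltr_wpDl.
    by rewrite ler_piMr ?(ltW e16)// ler_pdivrMr ?ltr_wpDl// mul1r lerDl.
  by rewrite mulrDr mulrCA; lra.
set X1 := Ex P _ / K a in N1 *; set X2 := p * al * _ in near2 *.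
have : `|X1 - X2| <= `|X1 - S a| + `|S a - S0| + `|X2 - S0|.
  rewrite (_ : X1 - X2 = (X1 - S a) + (S a - S0) - (X2 - S0)); last by ring.
  by rewrite (le_trans (ler_normB _ _))// lerD2r (le_trans (ler_normD _ _)).
move=> /le_trans; apply; lra.
Qed.

End Vague.

(** * Regularly varying tails *)

(** Every a >= A is a point of [A, 2 A] doubled finitely often. Estimates on regularly varying
    functions then use the ratio 2 only. *)
Lemma dyadic_ind (R : realType) (Q : R -> Prop) (A : R) : 0 < A ->
  (forall a, A <= a <= 2 * A -> Q a) -> (forall a, A <= a -> Q a -> Q (2 * a)) ->
  forall a, A <= a -> Q a.
Proof.
move=> A0 base step a Aa.
have H n : forall b, A <= b <= 2 ^+ n * A -> Q b.
  elim: n => [|n ih] b /andP[Ab bA].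
    by apply: base; rewrite Ab (le_trans bA)// expr0 mul1r; lra.
  have [b2|b2] := leP b (2 * A); first by apply: base; rewrite Ab.
  have -> : b = 2 * (b / 2) by rewrite mulrC divfK ?pnatr_eq0.
  have h : A <= b / 2 by lra.
  apply: step => //; apply: ih; rewrite h/=.
  by move: bA; rewrite exprS -mulrA; lra.
have aA0 : 0 <= a / A by rewrite divr_ge0 ?ltW// (lt_le_trans A0).
apply: (H (Num.bound (a / A))); rewrite Aa/= -ler_pdivrMr//.
rewrite (le_trans (ltW (archi_boundP aA0)))// -natrX ler_nat.
by rewrite ltnW// ltn_expl.
Qed.

Section TruncSq.
Context (d : measure_display) (T : measurableType d) (R : realType).
Variable P : probability T R.
Implicit Types (Z W : T -> R) (a u : R).

(* [tv]: truncated variance; [tl]: two-sided tail. *)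
Definition tv Z a : R := Ex P (fun w => Num.min `|Z w| a ^+ 2).

Definition tl Z u : R := fine (P [set w | u < Z w]) + fine (P [set w | Z w <= - u]).

Lemma mgt Z u : measurable_fun [set: T] Z -> measurable [set w | u < Z w].
Proof. by move=> mZ; apply: mset_lt => //; exact: measurable_cst. Qed.

Lemma mle Z u : measurable_fun [set: T] Z -> measurable [set w | Z w <= u].
Proof. by move=> mZ; apply: mset_le => //; exact: measurable_cst. Qed.

Lemma mabs Z : measurable_fun [set: T] Z -> measurable_fun [set: T] (fun w => `|Z w|).
Proof. by move=> mZ; exact: measurableT_comp. Qed.

Lemma bmf_trunc Z a : measurable_fun [set: T] Z -> bmf (fun w => Num.min `|Z w| a).
Proof.
move=> mZ; split.
  by apply: measurable_minr; [exact: mabs|exact: measurable_cst].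
exists `|a| => w; have [h|h] := leP `|Z w| a; last by [].
by rewrite normr_id (le_trans h)// ler_norm.
Qed.

Lemma bmf_tv Z a : measurable_fun [set: T] Z -> bmf (fun w => Num.min `|Z w| a ^+ 2).
Proof. by move=> mZ; apply: bmfX; exact: bmf_trunc. Qed.

Lemma tv_ge0 Z a : 0 <= tv Z a.
Proof. by apply: Ex_ge0 => w; rewrite sqr_ge0. Qed.

Lemma min_sqr_le (z a b : R) : 0 <= z -> 0 <= a <= b -> Num.min z a ^+ 2 <= Num.min z b ^+ 2.
Proof.
move=> z0 /andP[a0 ab]; rewrite lerXn2r ?nnegrE ?le_min ?z0 ?a0 ?(le_trans a0)//.
by rewrite ge_min lexx/= ge_min ab orbT.
Qed.

Lemma tv_mono Z a b : measurable_fun [set: T] Z -> 0 <= a <= b -> tv Z a <= tv Z b.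
Proof.
by move=> mZ ab; apply: le_Ex; [exact: bmf_tv|exact: bmf_tv|move=> w; exact: min_sqr_le].
Qed.

Lemma tv_le_sqr Z a : measurable_fun [set: T] Z -> 0 <= a -> tv Z a <= a ^+ 2.
Proof.
move=> mZ a0; apply: Ex_le_cst; first exact: bmf_tv.
by move=> w; rewrite lerXn2r ?nnegrE ?le_min ?a0 ?normr_ge0// ge_min lexx orbT.
Qed.

(** Raising the level from a to 2 a changes the truncated square only where |Z| > a, and by at most
    (2 a)^2 - a^2 = 3 a^2. With the reverse bound [tv_double_lo] this reads the growth of [tv] along
    doublings off the tail. *)
Lemma tv_double_up Z a : measurable_fun [set: T] Z -> 0 < a ->
  tv Z (2 * a) <= tv Z a + 3 * a ^+ 2 * fine (P [set w | a < `|Z w|]).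
Proof.
move=> mZ a0; have mA := mgt a (mabs mZ).
rewrite -Ex_indic// -ExZ; last exact: bmf_indic.
rewrite -ExD; [|exact: bmf_tv|by apply: bmfZ; exact: bmf_indic].
apply: le_Ex; first exact: bmf_tv.
  by apply: bmfD; [exact: bmf_tv|apply: bmfZ; exact: bmf_indic].
move=> w; rewrite indicE; have z0 := normr_ge0 (Z w).
have [h|h] := leP `|Z w| a.
  by rewrite [Num.min _ (2 * a)]min_l; [rewrite lerDl !mulr_ge0//| ]; lra.
rewrite mem_set// mulr1; set m := Num.min _ _.
have : 0 <= m <= 2 * a by rewrite /m le_min ge_min lexx orbT z0/=; lra.
by move=> /andP[]; nra.
Qed.

Lemma tl_ge Z u : measurable_fun [set: T] Z ->
  fine (P [set w | u < `|Z w|]) <= tl Z u.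
Proof.
move=> mZ; have m1 := mgt u mZ; have m2 := mle (- u) mZ.
rewrite (le_trans _ (PrU P m1 m2))//; apply: le_Pr.
- exact/mgt/mabs.
- exact: measurableU.
move=> w /=; rewrite lter_normr => /orP[h|h]; [by left|right].
by rewrite lerNr ltW.
Qed.

Lemma tl_indic Z u : measurable_fun [set: T] Z ->
  bmf (fun w => \1_[set w | u < Z w] w + \1_[set w | Z w <= - u] w : R) /\
  Ex P (fun w => \1_[set w | u < Z w] w + \1_[set w | Z w <= - u] w) = tl Z u.
Proof.
move=> mZ; have m1 := bmf_indic R (mgt u mZ); have m2 := bmf_indic R (mle (- u) mZ).
split; first exact: bmfD.
by rewrite ExD// !Ex_indic//; [exact: mle|exact: mgt].
Qed.

Lemma tl_pt Z u w : 0 < u ->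
  \1_[set w | u < Z w] w + \1_[set w | Z w <= - u] w = 0 :> R \/
  \1_[set w | u < Z w] w + \1_[set w | Z w <= - u] w = 1 :> R /\ u <= `|Z w|.
Proof.
move=> u0; rewrite !indicE; have [h|h] := ltP u (Z w).
  rewrite mem_set// memNset/=; last by apply/negP; rewrite -ltNge; lra.
  by right; rewrite addr0; split=> //; rewrite (le_trans (ltW h))// ler_norm.
rewrite memNset/=; last by apply/negP; rewrite -leNgt.
have [h'|h'] := leP (Z w) (- u); last first.
  by left; rewrite memNset ?addr0//=; apply/negP; rewrite -ltNge.
right; rewrite mem_set// add0r; split=> //.
by rewrite -normrN (le_trans _ (ler_norm _))// lerNr.
Qed.

Lemma tv_double_lo Z a : measurable_fun [set: T] Z -> 0 < a ->
  tv Z a + 3 * a ^+ 2 * tl Z (2 * a) <= tv Z (2 * a).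
Proof.
move=> mZ a0; have [b1 <-] := tl_indic (2 * a) mZ.
rewrite -ExZ// -ExD; [|exact: bmf_tv|exact: bmfZ].
apply: le_Ex; [by apply: bmfD; [exact: bmf_tv|exact: bmfZ]|exact: bmf_tv|].
move=> w; have a20 : 0 < 2 * a by lra.
have [->|[-> h]] := tl_pt Z w a20.
  by rewrite mulr0 addr0; apply: min_sqr_le => //; lra.
by rewrite !min_r; [rewrite mulr1; nra|lra|lra].
Qed.

Lemma tv_ge_tl Z a : measurable_fun [set: T] Z -> 0 < a -> a ^+ 2 * tl Z a <= tv Z a.
Proof.
move=> mZ a0; have [b1 <-] := tl_indic a mZ; rewrite -ExZ//.
apply: le_Ex; [exact: bmfZ|exact: bmf_tv|move=> w].
have [->|[-> h]] := tl_pt Z w a0; first by rewrite mulr0 sqr_ge0.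
by rewrite min_r// mulr1.
Qed.

Lemma tail_small Z e : measurable_fun [set: T] Z -> 0 < e ->
  exists2 s, 0 < s & fine (P [set w | s < `|Z w|]) <= e.
Proof.
move=> mZ e0; pose F n := [set w | n.+1%:R < `|Z w|].
have mF n : measurable (F n) by apply/mgt/mabs.
have F0 : \bigcap_n F n = set0.
  rewrite -subset0 => w /(_ (Num.bound `|Z w|) I) /=.
  apply/negP; rewrite -leNgt (le_trans (ltW (archi_boundP (normr_ge0 _))))//.
  by rewrite ler_nat.
have := @nonincreasing_cvg_mu _ T R P F.
rewrite F0 measure0 => H.
have {}H : P (F n) @[n --> \oo] --> (0%:E : \bar R).
  apply: H => //.
  - by rewrite (le_lt_trans (probability_le1 _ _))// ltry.
  - apply/nonincreasing_seqP => n; apply/subsetPset => w /=; apply: lt_trans.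
    by rewrite ltr_nat.
have /fine_cvgP[_ /cvgn_leP/(_ _ e0)[N HN]] := H.
exists N.+1%:R => //; have := HN N (leqnn _).
by rewrite subr0 ger0_norm ?Pr_ge0.
Qed.

(** The square is at most s^2 up to a fixed level s, and at most a^2 beyond it, on an event of small
    probability. This makes n tv(a) - a^2 eventually nonpositive, which the intermediate value
    theorem needs in [exists_norming]. *)
Lemma tv_small Z e : measurable_fun [set: T] Z -> 0 < e ->
  exists2 A, 0 < A & forall a, A <= a -> tv Z a <= e * a ^+ 2.
Proof.
move=> mZ e0; have e20 : 0 < e / 2 by rewrite divr_gt0.
have [s s0 Hs] := tail_small mZ e20.
pose A := s * (1 + 2 / e).
have ie : 0 < 2 / e by rewrite divr_gt0.
exists A => [|a Aa]; first by rewrite /A mulr_gt0// addr_gt0.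
have mA := mgt s (mabs mZ).
have sa : 2 * s ^+ 2 <= e * a ^+ 2.
  have : (s * (1 + 2 / e)) ^+ 2 <= a ^+ 2.
    by rewrite lerXn2r ?nnegrE// ?(le_trans _ Aa)// /A mulr_ge0 ?addr_ge0 ?ltW.
  move=> /(ler_wpM2l (ltW e0)); apply: le_trans.
  have -> : e * (s * (1 + 2 / e)) ^+ 2 = s ^+ 2 * (e * (1 + 2 * (2 / e) + (2 / e) ^+ 2)) by ring.
  rewrite mulrC ler_wpM2l ?sqr_ge0//.
  have -> : e * (1 + 2 * (2 / e) + (2 / e) ^+ 2) = e + 4 + 4 / e by field; rewrite gt_eqF.
  have : 0 < 4 / e by rewrite divr_gt0.
  lra.
apply: (@le_trans _ _ (s ^+ 2 + a ^+ 2 * fine (P [set w | s < `|Z w|]))); last first.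
  have := ler_wpM2l (sqr_ge0 a) Hs; lra.
rewrite -Ex_indic// -ExZ; last exact: bmf_indic.
rewrite -(Ex_cst P (s ^+ 2)) -ExD; [|exact: bmf_cst|by apply: bmfZ; exact: bmf_indic].
apply: le_Ex; [exact: bmf_tv| |].
  by apply: bmfD; [exact: bmf_cst|apply: bmfZ; exact: bmf_indic].
have a0 : 0 < a by rewrite (lt_le_trans _ Aa)// mulr_gt0// addr_gt0.
move=> w; rewrite indicE; have z0 := normr_ge0 (Z w).
have m0 : 0 <= Num.min `|Z w| a by rewrite le_min z0 ltW.
have [h|h] := leP `|Z w| s.
  rewrite memNset/=; last by apply/negP; rewrite -leNgt.
  rewrite mulr0 addr0 lerXn2r ?nnegrE// ?(ltW s0)//.
  by rewrite ge_min h.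
rewrite mem_set// mulr1 (@le_trans _ _ (a ^+ 2))// ?lerDr ?sqr_ge0//.
by rewrite lerXn2r ?nnegrE ?(ltW a0)// ge_min lexx orbT.
Qed.

(** By the tail comparison, raising the level from 2 b to 4 b adds to [tv W] at most 4 C times what
    raising it from b to 2 b adds to [tv Z]. Summing over doublings compares the two moments; the
    shift by one doubling is why [H] pairs the levels 2 b and b. *)
Lemma tv_tail_comparison Z W (C u0 : R) : measurable_fun [set: T] Z ->
  measurable_fun [set: T] W -> 0 <= C -> 0 < u0 ->
  (forall u, u0 <= u -> fine (P [set w | u < `|W w|]) <= C * tl Z u) ->
  exists2 C', 0 <= C' & forall a, 0 <= a -> tv W a <= C' * (1 + tv Z a).
Proof.
move=> mZ mW C0 u00 HC; pose C1 := 4 * C + 16 * u0 ^+ 2.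
have u2 := sqr_ge0 u0.
have C10 : 0 <= C1 by rewrite /C1; lra.
exists C1 => // a a0; have t0 := tv_ge0 Z.
have [au|au] := leP a (2 * u0).
  rewrite (le_trans (tv_le_sqr mW a0))//.
  have h : a ^+ 2 <= 4 * u0 ^+ 2.
    have -> : 4 * u0 ^+ 2 = (2 * u0) ^+ 2 by ring.
    by rewrite lerXn2r ?nnegrE ?mulr_ge0 ?(ltW u00).
  have := mulr_ge0 C10 (t0 a); rewrite /C1; lra.
have H : forall b, u0 <= b -> tv W (2 * b) <= 16 * u0 ^+ 2 + 4 * C * tv Z b.
  apply: dyadic_ind => // b.
    move=> /andP[b1 b2]; have b0 : 0 <= 2 * b by lra.
    rewrite (le_trans (tv_le_sqr mW b0))//.
    have := mulr_ge0 C0 (t0 b).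
    have : (2 * b) ^+ 2 <= 16 * u0 ^+ 2.
      have -> : 16 * u0 ^+ 2 = (4 * u0) ^+ 2 by ring.
      by rewrite lerXn2r ?nnegrE//; lra.
    lra.
  move=> ub ih; have b0 : 0 < b := lt_le_trans u00 ub.
  have b20 : 0 < 2 * b by lra.
  have h1 := tv_double_up mW b20.
  have h2 := tv_double_lo mZ b0.
  have u2b : u0 <= 2 * b by lra.
  have b2 := sqr_ge0 (2 * b).
  have h3 := ler_wpM2l b2 (HC _ u2b).
  have h4 := ler_wpM2l C0 h2.
  nra.
have ha : u0 <= a / 2 by lra.
have := H _ ha; rewrite mulrC divfK ?pnatr_eq0// => /le_trans; apply.
have h : tv Z (a / 2) <= tv Z a by apply: tv_mono => //; lra.
have := ler_wpM2l C0 h; have := mulr_ge0 u2 (t0 a); rewrite /C1; lra.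
Qed.

Lemma tv_lip Z a b : measurable_fun [set: T] Z -> 0 <= a <= b ->
  tv Z b <= tv Z a + (b ^+ 2 - a ^+ 2).
Proof.
move=> mZ /andP[a0 ab]; rewrite -(Ex_cst P (b ^+ 2 - a ^+ 2)) -ExD; [|exact: bmf_tv|exact: bmf_cst].
apply: le_Ex; [exact: bmf_tv|by apply: bmfD; [exact: bmf_tv|exact: bmf_cst]|move=> w].
have z0 := normr_ge0 (Z w).
have [h|h] := leP `|Z w| a.
  rewrite min_l ?(le_trans h)// lerDl subr_ge0 lerXn2r ?nnegrE// (le_trans a0)//.
rewrite addrC subrK; have b0 := le_trans a0 ab.
by rewrite lerXn2r ?nnegrE ?le_min ?z0 ?b0// ge_min lexx orbT.
Qed.

Lemma tv_dist Z a b : measurable_fun [set: T] Z -> 0 <= a -> 0 <= b ->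
  `|tv Z a - tv Z b| <= `|a ^+ 2 - b ^+ 2|.
Proof.
move=> mZ; wlog ab : a b / a <= b.
  move=> H a0 b0; have [ab|/ltW ba] := leP a b; first exact: H.
  by rewrite distrC [leRHS]distrC H.
move=> a0 b0; have h1 : tv Z a <= tv Z b by apply: tv_mono; rewrite ?a0.
have h2 : tv Z b <= tv Z a + (b ^+ 2 - a ^+ 2) by apply: tv_lip; rewrite ?a0.
have h3 : a ^+ 2 <= b ^+ 2 by rewrite lerXn2r.
by rewrite !ler0_norm ?subr_le0//; lra.
Qed.

(** n tv(a) - a^2 is continuous by [tv_dist], nonnegative at 1 once n tv(1) >= 1, and nonpositive
    for large a; a_n is a zero beyond 1. Then a_n^2 >= n tv(1), which gives divergence. *)
Lemma exists_norming Z : measurable_fun [set: T] Z -> 0 < tv Z 1 ->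
  exists a : nat -> R, (forall n, 0 < a n) /\ a n @[n --> \oo] --> +oo /\
    exists n0, forall n, (n0 <= n)%N -> a n ^+ 2 = n%:R * tv Z (a n).
Proof.
move=> mZ D1.
have cD (n : nat) (x : R) : 1 <= x -> {for x, continuous (fun a => n%:R * tv Z a - a ^+ 2)}.
  move=> x1; have cs : y ^+ 2 @[y --> x] --> x ^+ 2 by apply: exprn_continuous.
  apply: cvgB => //; apply: cvgMl_tmp; apply/cvgrPdist_le => e e0.
  have x0 : 0 < x by lra.
  near=> y; apply: (le_trans (tv_dist mZ _ _)); first exact: ltW.
    by near: y; apply: lt_le_nbhsr.
  by near: y; move/cvgrPdist_le : cs => /(_ _ e0).
have ex (n : nat) : exists a : R, 0 < a /\ (1 <= n%:R * tv Z 1 -> a ^+ 2 = n%:R * tv Z a /\ 1 <= a).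
  (* For the finitely many n with n tv(1) < 1 the value 1 is a placeholder; the equation is claimed
     for large n only. *)
  have [h|h] := leP 1 (n%:R * tv Z 1); last by exists 1; split => // /le_lt_trans/(_ h); rewrite ltxx.
  have n0 : 0 < n%:R :> R.
    by rewrite -(pmulr_lgt0 _ D1) (lt_le_trans _ h).
  have ni : 0 < n%:R^-1 :> R by rewrite invr_gt0.
  have [A A0 HA] := tv_small mZ ni.
  pose B := Num.max 1 A; have B1 : 1 <= B by rewrite le_max lexx.
  have HB : n%:R * tv Z B - B ^+ 2 <= 0.
    rewrite subr_le0 -ler_pdivlMl//; apply: HA.
    by rewrite le_max lexx orbT.
  have H1 : 0 <= n%:R * tv Z 1 - 1 ^+ 2 by rewrite expr1n subr_ge0.
  have cw : {within `[1, B], continuous (fun a => n%:R * tv Z a - a ^+ 2)}.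
    apply: continuous_in_subspaceT => x; rewrite inE/= in_itv/= => /andP[x1 _].
    exact: cD.
  have [|c] := @IVT _ (fun a => n%:R * tv Z a - a ^+ 2) 1 B 0 B1 cw.
    by rewrite ge_min le_max HB H1 orbT.
  rewrite in_itv/= => /andP[c1 _] /eqP; rewrite subr_eq0 => /eqP E.
  by exists c; split => //; lra.
have [a Ha] := choice ex.
have [n0 Hn0] : exists n0, forall n, (n0 <= n)%N -> 1 <= n%:R * tv Z 1.
  exists (Num.bound (tv Z 1)^-1) => n h; rewrite -ler_pdivrMr// mul1r.
  have i0 : 0 <= (tv Z 1)^-1 by rewrite invr_ge0 ltW.
  by rewrite (le_trans (ltW (archi_boundP i0)))// ler_nat.
exists a; split; first by move=> n; have [] := Ha n.
split; last by exists n0 => n /Hn0 h; have [_ /(_ h)[]] := Ha n.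
apply/cvgryPge => B.
near=> n.
have [a0 /(_ (Hn0 n _))[|E a1]] := Ha n.
  by near: n; exists n0.
rewrite leNgt; apply/negP => h.
have B0 : 0 < B := lt_trans a0 h.
have : a n ^+ 2 < B ^+ 2 by rewrite !expr2 ltr_pM// ltW.
apply/negP; rewrite -leNgt E.
have h1 : tv Z 1 <= tv Z (a n) by apply: tv_mono; rewrite ?ler01.
rewrite (@le_trans _ _ (n%:R * tv Z 1))//; last by rewrite ler_wpM2l.
rewrite -ler_pdivrMr//; near: n.
exists (Num.bound (B ^+ 2 / tv Z 1)) => // n /= hn.
have i0 : 0 <= B ^+ 2 / tv Z 1 by rewrite divr_ge0 ?sqr_ge0// ltW.
by rewrite (le_trans (ltW (archi_boundP i0)))// ler_nat.
Unshelve. all: by end_near. Qed.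

End TruncSq.

Section Vague2.
Context (d : measure_display) (T : measurableType d) (R : realType).
Variable P : probability T R.
Variables (al p : R) (U : T -> R) (A : R -> set T) (K : R -> R) (C1 A0 : R).
Hypothesis al02 : 0 < al < 2.
Hypothesis p0 : 0 <= p.
Hypothesis mU : measurable_fun [set: T] U.
Hypothesis mA : forall u, measurable (A u).
Hypothesis AU : forall u w, A u w -> u <= U w.
Hypothesis UA : forall u w, u < U w -> A u w.
Hypothesis K0 : forall u, 0 < K u.
Hypothesis tA : forall s, 0 < s ->
  fine (P (A (s * a))) / K a @[a --> +oo] --> p * s `^ (- al).
Hypothesis tK : forall s, 0 < s -> K (s * a) / K a @[a --> +oo] --> s `^ (- al).
Hypothesis C10 : 0 <= C1.
Hypothesis UK : forall a, A0 <= a -> tv P U a <= C1 * a ^+ 2 * K a.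

Let al0 : 0 < al. Proof. by case/andP: al02. Qed.

Let kap : R := LI (fun y => Num.min 1 (expR y) ^+ 2 * expR (- (al * y))).

Lemma continuous_eal (be : R) : continuous (fun y : R => expR (- (be * y))).
Proof.
move=> y; apply: (@continuous_comp _ _ _ (fun y : R => - (be * y))); last exact: continuous_expR.
by apply: cvgN; apply: (@continuous_cmul _ be id) => z.
Qed.

Let min1_sqr (x : R) : 0 <= x -> Num.min 1 x ^+ 2 = Num.min 1 (x ^+ 2).
Proof.
move=> x0; have [h|h] := leP 1 x.
  by rewrite min_l ?expr1n// -(expr1n R 2) lerXn2r ?nnegrE.
by rewrite min_r// -(expr1n R 2) lerXn2r ?nnegrE// ltW.
Qed.

Lemma li_dom_min (g : R -> R) (C0 : R) : continuous g ->
  (forall x, `|g x| <= C0 * Num.min 1 (x ^+ 2)) ->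
  li (fun y => g (expR y) * expR (- (al * y))).
Proof.
move=> cg gC; have m0 : 0 < Num.min al (2 - al) by rewrite lt_min subr_gt0.
have C00 : 0 <= C0 by have := le_trans (normr_ge0 _) (gC 1); rewrite expr1n minxx mulr1.
apply: (li_dom (C := C0) m0).
  move=> y; apply: cvgM; last exact: continuous_eal.
  by apply: (@continuous_comp _ _ _ expR g); [exact: continuous_expR|exact: cg].
move=> y; rewrite normrM [X in _ * X]gtr0_norm ?expR_gt0//.
rewrite (le_trans (ler_wpM2r (expR_ge0 _) (gC _)))// -mulrA ler_wpM2l//.
exact: min1_sqr_expR.
Qed.

Let cmin (r : R) : continuous (fun x : R => Num.min `|x| r ^+ 2).
Proof.
move=> x; apply: (@continuous_comp _ _ _ (fun x : R => Num.min `|x| r) (fun z => z ^+ 2)).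
  by apply: continuous_min; [exact: norm_continuous|exact: cst_continuous].
exact: exprn_continuous.
Qed.

Let lmin (r : R) : 0 < r -> li (fun y => Num.min `|expR y| r ^+ 2 * expR (- (al * y))) /\
  LI (fun y => Num.min `|expR y| r ^+ 2 * expR (- (al * y))) = r `^ (2 - al) * kap.
Proof.
move=> r0.
have c1 (h : R -> R) : continuous h -> continuous (fun y => h (expR y) * expR (- (al * y))).
  move=> ch y; apply: cvgM; last exact: continuous_eal.
  by apply: (@continuous_comp _ _ _ expR h); [exact: continuous_expR|exact: ch].
split.
  apply: (@li_dom_min (fun x => Num.min `|x| r ^+ 2) (1 + r ^+ 2)) => // x.
  rewrite ger0_norm ?sqr_ge0//; have x0 := normr_ge0 x; have r2 := sqr_ge0 r.
  have [h|h] := leP 1 (x ^+ 2).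
    have : Num.min `|x| r ^+ 2 <= r ^+ 2.
      by rewrite lerXn2r ?nnegrE ?le_min ?x0 ?(ltW r0)// ge_min lexx orbT.
    lra.
  have : Num.min `|x| r ^+ 2 <= x ^+ 2.
    rewrite -[x ^+ 2]real_normK ?num_real// lerXn2r ?nnegrE ?le_min ?x0 ?(ltW r0)//.
    by rewrite ge_min lexx.
  have := mulr_ge0 r2 (sqr_ge0 x); lra.
have E y : Num.min `|expR y| r ^+ 2 * expR (- (al * y)) =
   r `^ (2 - al) * (Num.min 1 (expR (y - ln r)) ^+ 2 * expR (- (al * (y - ln r)))).
  have -> : r `^ (2 - al) = r ^+ 2 * expR (- (al * ln r)).
    by rewrite /powR gt_eqF// mulrBl expRD -mulNr expRM_natl lnK.
  have -> : r ^+ 2 * expR (- (al * ln r)) * (Num.min 1 (expR (y - ln r)) ^+ 2 *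
      expR (- (al * (y - ln r)))) = (r * Num.min 1 (expR (y - ln r))) ^+ 2 *
      (expR (- (al * ln r)) * expR (- (al * (y - ln r)))) by ring.
  rewrite -expRD; have -> : - (al * ln r) + - (al * (y - ln r)) = - (al * y) by ring.
  congr (_ ^+ 2 * _); rewrite ger0_norm ?expR_ge0// expRD expRN lnK ?posrE//.
  rewrite minr_pMr ?(ltW r0)// mulr1 minC; congr Num.min.
  by rewrite mulrC divfK// gt_eqF.
have lk : li (fun y => Num.min 1 (expR (y - ln r)) ^+ 2 * expR (- (al * (y - ln r)))).
  apply: (@li_le _ _ (fun y => expR (Num.min al (2 - al) * `|ln r|) *
      expR (- (Num.min al (2 - al) * `|y|)))).
  - apply: continuous_measurable_fun => y.
    apply: (@continuous_comp _ _ _ (fun y => y - ln r)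
       (fun y => Num.min 1 (expR y) ^+ 2 * expR (- (al * y)))).
      by apply: cvgB; [exact: cvg_id|exact: cvg_cst].
    rewrite (_ : (fun y => _) = (fun y => Num.min `|expR y| 1 ^+ 2 * expR (- (al * y)))).
      exact: (c1 (fun x => Num.min `|x| 1 ^+ 2)).
    by apply/funext => z; rewrite minC ger0_norm ?expR_ge0.
  - apply: liZ; apply: li_expabs; by rewrite lt_min subr_gt0.
  move=> y; rewrite min1_sqr ?expR_ge0// ger0_norm; last first.
    by rewrite mulr_ge0 ?expR_ge0// le_min ler01 sqr_ge0.
  rewrite (le_trans (min1_sqr_expR _ al02))// -expRD ler_expR.
  have m0 : 0 < Num.min al (2 - al) by rewrite lt_min subr_gt0.
  have := ler_wpM2l (ltW m0) (ler_dist_dist y (ln r)).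
  have := ler_wpM2l (ltW m0) (ler_norm (`|y| - `|ln r|)); lra.
rewrite (_ : (fun y => Num.min `|expR y| r ^+ 2 * expR (- (al * y))) = fun y =>
  r `^ (2 - al) * (Num.min 1 (expR (y - ln r)) ^+ 2 * expR (- (al * (y - ln r)))));
  last by apply/funext => y; exact: E.
rewrite (LIZ _ lk); congr (_ * _).
rewrite (@LI_shift _ (fun y => Num.min 1 (expR y) ^+ 2 * expR (- (al * y))) (- ln r))//.
  rewrite (_ : (fun y => _) = (fun y => Num.min `|expR y| 1 ^+ 2 * expR (- (al * y)))).
    exact: (c1 (fun x => Num.min `|x| 1 ^+ 2)).
  by apply/funext => z; rewrite minC ger0_norm ?expR_ge0.
Qed.

(** [g] is cut off near 0 by a ramp so that [vague_away] applies. The part removed is at most C0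
    min(|x|, r)^2: its expectation is at most C0 tv(r a) / a^2 <= C0 C1 r^2 K(r a), about r^(2 - al)
    K(a), and its integral scales like r^(2 - al). Both vanish with r because al < 2. *)
Lemma vague_sqr (g : R -> R) (C0 : R) : continuous g ->
  (forall x, `|g x| <= C0 * Num.min 1 (x ^+ 2)) -> (forall x, x <= 0 -> g x = 0) ->
  Ex P (fun w => g (U w / a)) / K a @[a --> +oo] -->
    p * al * LI (fun y => g (expR y) * expR (- (al * y))).
Proof.
move=> cg gC gn.
have C00 : 0 <= C0 by have := le_trans (normr_ge0 _) (gC 1); rewrite expr1n minxx mulr1.
have lig := li_dom_min cg gC.
have kap0 : 0 <= kap by apply: Rintegral_ge0 => y _; rewrite mulr_ge0 ?sqr_ge0 ?expR_ge0.
apply: cvgy_le => e e0.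
pose Q := C0 * C1 + p * al * C0 * kap + 1.
have Q1 : 0 <= C0 * C1 by rewrite mulr_ge0.
have Q2 : 0 <= p * al * C0 * kap by rewrite !mulr_ge0// ltW.
have Q0 : 0 < Q by rewrite /Q; lra.
(* This makes r^(2 - al) equal to e / (8 Q), where Q collects the constants of both error terms. *)
pose r := (e / (8 * Q)) `^ ((2 - al)^-1).
have eQ0 : 0 < e / (8 * Q) by rewrite divr_gt0// mulr_gt0.
have r0 : 0 < r by rewrite powR_gt0.
have al2 : 2 - al != 0 by rewrite subr_eq0 gt_eqF//; case/andP: al02.
have rE : r `^ (2 - al) = e / (8 * Q).
  by rewrite /r -powRrM mulVf// powRr1// ltW.
have QE : Q * (e / (8 * Q)) = e / 8 by field; rewrite gt_eqF.
pose s := r / 2.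
have s0 : 0 < s by rewrite divr_gt0.
have sr : s + s = r by rewrite /s; lra.
pose gs := fun x => g x * (1 - ramp s s x).
have rp x : 0 <= 1 - ramp s s x <= 1 by have /andP[h1 h2] := ramp_itv s s x; lra.
have gM x : `|g x| <= C0.
  by rewrite (le_trans (gC x))// -[leRHS]mulr1 ler_wpM2l// ge_min lexx.
have gsM x : `|gs x| <= C0.
  have /andP[h1 h2] := rp x.
  by rewrite normrM [X in _ * X]ger0_norm// (le_trans _ (gM x))// ler_piMr.
have cgs : continuous gs.
  move=> x; apply: cvgM; first exact: cg.
  by apply: cvgB; [exact: cvg_cst|exact: continuous_ramp].
have gs0 x : x <= s -> gs x = 0.
  by move=> xs; rewrite /gs ramp1// subrr mulr0.
have gd x : `|g x - gs x| <= C0 * Num.min `|x| r ^+ 2.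
  have -> : g x - gs x = g x * ramp s s x by rewrite /gs; ring.
  have /andP[h1 h2] := ramp_itv s s x.
  have [x0|x0] := leP x 0.
    by rewrite gn// mul0r normr0 mulr_ge0// sqr_ge0.
  have [xr|xr] := leP r x.
    by rewrite ramp0 ?sr// mulr0 normr0 mulr_ge0// sqr_ge0.
  rewrite normrM [X in _ * X]ger0_norm// (@le_trans _ _ `|g x|)//.
    by rewrite ler_piMr.
  rewrite (le_trans (gC x))// ler_wpM2l// [Num.min `|x| r]min_l ?gtr0_norm ?(ltW xr)//.
  by rewrite ge_min lexx orbT.
have [ligs Hgs] := vague_away al0 p0 mU mA AU UA K0 tA cgs gsM s0 gs0.
have [lm Lm] := lmin r0.
have near2 : `|p * al * LI (fun y => g (expR y) * expR (- (al * y))) -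
    p * al * LI (fun y => gs (expR y) * expR (- (al * y)))| <= e / 8.
  rewrite -mulrBr normrM [X in X * _]ger0_norm ?mulr_ge0 ?(ltW al0)//.
  have key y : `|g (expR y) * expR (- (al * y)) - gs (expR y) * expR (- (al * y))| <=
      C0 * (Num.min `|expR y| r ^+ 2 * expR (- (al * y))).
    rewrite -mulrBl normrM [X in _ * X]ger0_norm ?expR_ge0// mulrA.
    by rewrite ler_wpM2r ?expR_ge0.
  have : `|LI (fun y => g (expR y) * expR (- (al * y))) -
      LI (fun y => gs (expR y) * expR (- (al * y)))| <= C0 * (r `^ (2 - al) * kap).
    rewrite -LIB// -Lm -LIZ// ler_norml; apply/andP; split; last first.
      apply: le_LI => //; [exact: liB|exact: liZ|].
      by move=> y; rewrite (le_trans (ler_norm _)).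
    rewrite -mulN1r -LIZ//; last exact: liZ.
    apply: le_LI; [by apply: liZ; exact: liZ|exact: liB|].
    by move=> y; rewrite mulN1r lerNl (le_trans (ler_norm _))// -normrN opprK.
  have pal : 0 <= p * al by rewrite mulr_ge0// ltW.
  move=> /(ler_wpM2l pal)/le_trans; apply; rewrite rE -QE.
  have -> : p * al * (C0 * (e / (8 * Q) * kap)) = (p * al * C0 * kap) * (e / (8 * Q)) by ring.
  by rewrite ler_wpM2r ?(ltW eQ0)// /Q; lra.
have e8 : 0 < e / 8 by rewrite divr_gt0.
have [B1 H1] := cvgy_leP Hgs e8.
pose Q' := C0 * C1 * r ^+ 2 + 1.
have Q'0 : 0 < Q' by rewrite /Q' ltr_wpDl// mulr_ge0// sqr_ge0.
have eQ' : 0 < e / (8 * Q') by rewrite divr_gt0// mulr_gt0.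
have [B2 H2] := cvgy_leP (tK r0) eQ'.
exists (Num.max 0 (Num.max B1 (Num.max B2 (A0 / r)))) => a.
rewrite !gt_max => /and4P[a0 a1 a2 a3].
have {}H1 := H1 a a1; have {}H2 := H2 a a2.
have near1 : `|Ex P (fun w => g (U w / a)) / K a - Ex P (fun w => gs (U w / a)) / K a| <= e / 4.
  have bg : bmf (fun w => g (U w / a)).
    by apply: (bmf_ccomp (f := fun w => U w / a) _ cg gM); exact: measurable_funM.
  have bgs : bmf (fun w => gs (U w / a)).
    by apply: (bmf_ccomp (f := fun w => U w / a) _ cgs gsM); exact: measurable_funM.
  rewrite -mulrBl normrM [X in _ * X]gtr0_norm ?invr_gt0// ler_pdivrMr//.
  have bt := bmf_tv (r * a) mU.
  have h : Ex P (fun w => `|g (U w / a) - gs (U w / a)|) <= C0 / a ^+ 2 * tv P U (r * a).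
    rewrite -ExZ//; apply: le_Ex; [by apply: bmf_norm; exact: bmfB|exact: bmfZ|move=> w].
    rewrite (le_trans (gd _))// -mulrA ler_wpM2l// normrM [X in _ * X]gtr0_norm ?invr_gt0//.
    have -> : r = r * a / a by rewrite mulfK// gt_eqF.
    rewrite -minr_pMl ?invr_ge0 ?(ltW a0)// exprMn exprVn mulfK ?gt_eqF//.
    by rewrite mulrC.
  rewrite (le_trans (Ex_normB _ bg bgs))// (le_trans h)//.
  have ra : A0 <= r * a by rewrite mulrC -ler_pdivrMr// ltW.
  have a20 : 0 <= C0 / a ^+ 2 by rewrite divr_ge0// sqr_ge0.
  rewrite (le_trans (ler_wpM2l a20 (UK ra)))//.
  have -> : C0 / a ^+ 2 * (C1 * (r * a) ^+ 2 * K (r * a)) =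
     (C0 * C1 * r ^+ 2 * (K (r * a) / K a)) * K a.
    by field; rewrite !gt_eqF.
  rewrite ler_pM2r//.
  have h3 : K (r * a) / K a <= r `^ (- al) + e / (8 * Q') by have := ler_normlW H2; lra.
  have h4 : 0 <= C0 * C1 * r ^+ 2 by rewrite mulr_ge0// sqr_ge0.
  rewrite (le_trans (ler_wpM2l h4 h3))// mulrDr.
  have h5 : C0 * C1 * r ^+ 2 * r `^ (- al) <= e / 8.
    rewrite -mulrA -powR_mulrn ?(ltW r0)// -powRD; last first.
      by apply/implyP => _; rewrite gt_eqF.
    by rewrite rE -QE ler_wpM2r ?(ltW eQ0)// /Q; lra.
  have h6 : C0 * C1 * r ^+ 2 * (e / (8 * Q')) <= e / 8.
    have -> : e / 8 = Q' * (e / (8 * Q')) by field; rewrite gt_eqF.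
    by rewrite ler_wpM2r ?(ltW eQ')// /Q'; lra.
  lra.
set X1 := Ex P _ / K a in H1 near1 *.
set X2 := Ex P _ / K a in H1 near1 *.
set Y1 := p * al * _ in H1 near2 *.
set Y2 := p * al * _ in H1 near2 *.
move: H1 near1 near2; rewrite !ler_norml; lra.
Qed.

End Vague2.

Lemma cvgn_eq (R : realType) (u v : nat -> R) (l : R) (N : nat) :
  (forall n, (N <= n)%N -> u n = v n) ->
  u n @[n --> \oo] --> l -> v n @[n --> \oo] --> l.
Proof.
move=> uv /cvgn_leP ul; apply: cvgn_le => e /ul[M HM].
by exists (maxn N M) => n; rewrite geq_max => /andP[n1 n2]; rewrite -uv// HM.
Qed.

Lemma cvgy_eq (R : realType) (u v : R -> R) (l : R) : (forall x, u x = v x) ->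
  u x @[x --> +oo] --> l -> v x @[x --> +oo] --> l.
Proof. by move=> uv; have -> : u = v by exact/funext. Qed.

Lemma sin_subid3 (R : realType) (y : R) : `|sin y - y| <= `|y| ^+ 3.
Proof.
wlog y0 : y / 0 < y.
  move=> H; have [y0|y0|->] := ltrgtP y 0; last by rewrite sin0 subrr normr0 expr0n.
    by have := H (- y); rewrite sinN -opprD !normrN; apply; rewrite oppr_gt0.
  exact: H.
have [c /andP[c0 cy] ->] := sin_MVT y0.
have [h1 [h2 _]] := cos_sub1 c.
have -> : cos c * y - y = - ((1 - cos c) * y) by ring.
rewrite normrN normrM !ger0_norm ?(ltW y0)// exprSr ler_wpM2r ?(ltW y0)//.
by rewrite (le_trans h2)// lerXn2r ?nnegrE ?(ltW c0) ?(ltW y0) ?(ltW cy).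
Qed.

Lemma cos_sub2 (R : realType) (y : R) : `|1 - cos y - y ^+ 2 / 2| <= `|y| ^+ 3.
Proof.
have E : 1 - cos y = 2 * sin (y / 2) ^+ 2.
  have -> : cos y = cos ((y / 2) *+ 2) by rewrite -mulr_natr divfK.
  by rewrite cos_mulr2n sin2cos2 -mulr_natl; ring.
have -> : 1 - cos y - y ^+ 2 / 2 = 2 * ((sin (y / 2) - y / 2) * (sin (y / 2) + y / 2)).
  by rewrite E; field.
rewrite !normrM [`|2|]ger0_norm//.
have h1 := sin_subid (y / 2); have h2 := sin_norm_le (y / 2).
have h3 : `|sin (y / 2) + y / 2| <= `|y|.
  rewrite (le_trans (ler_normD _ _))// (le_trans (lerD h2 (lexx _)))//.
  by rewrite normrM [`|2^-1|]ger0_norm// -mulrDr; lra.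
have y0 := normr_ge0 y.
have h4 : `|sin (y / 2) - y / 2| <= `|y| ^+ 2 / 4.
  by rewrite (le_trans h1)// real_normK ?num_real//; lra.
have := ler_pM (normr_ge0 _) (normr_ge0 _) h4 h3.
have := exprn_ge0 3 y0; rewrite exprSr; lra.
Qed.

Section RegVar.
Context (d : measure_display) (T : measurableType d) (R : realType).
Variable P : probability T R.
Variables (al pp pm : R) (Z : T -> R).
Hypothesis al02 : 0 < al <= 2.
Hypothesis pp0 : 0 <= pp.
Hypothesis pm0 : 0 <= pm.
Hypothesis ppm : pp + pm = 1.
Hypothesis mZ : measurable_fun [set: T] Z.
Notation K := (tl P Z).
Hypothesis K0 : forall u, 0 < K u.
Hypothesis tZp : forall s, 0 < s ->
  fine (P [set w | s * a < Z w]) / K a @[a --> +oo] --> pp * s `^ (- al).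
Hypothesis tZm : forall s, 0 < s ->
  fine (P [set w | Z w <= - (s * a)]) / K a @[a --> +oo] --> pm * s `^ (- al).
Hypothesis K2 : al = 2 -> forall B, exists2 u, 0 < u & B <= u ^+ 2 * K u.

Let al0 : 0 < al. Proof. by case/andP: al02. Qed.

Lemma tl_ratio s : 0 < s -> K (s * a) / K a @[a --> +oo] --> s `^ (- al).
Proof.
move=> s0; rewrite -[s `^ (- al)]mul1r -ppm mulrDl.
rewrite (_ : (fun a => _) = fun a => fine (P [set w | s * a < Z w]) / K a +
  fine (P [set w | Z w <= - (s * a)]) / K a).
  by apply: cvgD; [exact: tZp|exact: tZm].
by apply/funext => a; rewrite {1}/tl mulrDl.
Qed.

Let K_mono a b : a <= b -> K b <= K a.
Proof.
move=> ab; apply: lerD; apply: le_Pr; try exact: mgt; try exact: mle.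
  by move=> w /=; exact: le_lt_trans.
by move=> w /= /le_trans; apply; rewrite lerN2.
Qed.

(** A Karamata estimate by doubling. Since 2^(-al) > 1/4, eventually K(2 a) >= q K(a) with q > 1/4,
    so a^2 K(a) grows at least by the factor 4 q > 1 at each doubling and absorbs the increments of
    [tv], at most 3 a^2 K(a). *)
Lemma tv_regvar_bound : al < 2 -> exists C1, 0 <= C1 /\ exists2 A, 0 < A &
  forall a, A <= a -> tv P Z a <= C1 * a ^+ 2 * K a.
Proof.
move=> al2; pose q := (4^-1 + 2 `^ (- al)) / 2 : R.
have h4 : 4^-1 < 2 `^ (- al) :> R.
  have -> : 4^-1 = 2 `^ (- 2) :> R by rewrite powRN powR_mulrn// -exprVn; field.
  rewrite /powR (_ : (2 : R) == 0 = false) ?pnatr_eq0// ltr_expR.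
  by rewrite ltr_pM2r ?ln_gt0 ?ltr1n// ltrN2.
have q4 : 4^-1 < q by rewrite /q; lra.
have qe : q < 2 `^ (- al) by rewrite /q; lra.
have e0 : 0 < 2 `^ (- al) - q by lra.
have [B HB] := cvgy_leP (tl_ratio (ltr0Sn R 1)) e0.
pose A := Num.max 1 (B + 1).
have A1 : 1 <= A by rewrite le_max lexx.
have A0 : 0 < A by lra.
have HK a : A <= a -> q * K a <= K (2 * a).
  move=> Aa; have : B < a by rewrite (lt_le_trans _ Aa)// lt_max ltrDl ltr01 orbT.
  move=> /HB h; have : q <= K (2 * a) / K a by move: h; rewrite ler_norml; lra.
  by rewrite ler_pdivlMr.
(* The first entry ensures C1 + 3 <= 4 q C1, the induction step; the second covers the initial
   interval [A, 2 A]. *)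
pose C1 := Num.max (3 / (4 * q - 1)) (tv P Z (2 * A) / (A ^+ 2 * K (2 * A))).
have C10 : 0 <= C1.
  by rewrite le_max divr_ge0//; lra.
exists C1; split=> //; exists A => //; apply: dyadic_ind => // a.
  move=> /andP[Aa aA]; have aa0 : 0 < a by lra.
  have h1 : tv P Z a <= tv P Z (2 * A) by apply: tv_mono => //; rewrite (ltW aa0).
  have h2 : tv P Z (2 * A) <= C1 * (A ^+ 2 * K (2 * A)).
    by rewrite -ler_pdivrMr ?mulr_gt0 ?exprn_gt0// le_max lexx orbT.
  rewrite (le_trans h1)// (le_trans h2)// -mulrA ler_wpM2l// ler_pM ?sqr_ge0 ?(ltW (K0 _))//.
    by rewrite lerXn2r ?nnegrE ?(ltW A0) ?(ltW aa0).
  exact: K_mono.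
move=> Aa ih; have a0 : 0 < a by lra.
have h1 := tv_double_up P mZ a0; have h2 := tl_ge P a mZ; have h3 := HK a Aa.
have a2 : 0 < a ^+ 2 by rewrite exprn_gt0.
have h5 : tv P Z (2 * a) <= (C1 + 3) * a ^+ 2 * K a.
  have := ler_wpM2l (ltW a2) h2; lra.
have h6 : C1 + 3 <= 4 * C1 * q.
  have : 3 / (4 * q - 1) <= C1 by rewrite le_max lexx.
  rewrite ler_pdivrMr; lra.
have k0 : 0 <= a ^+ 2 * K a by rewrite mulr_ge0 ?ltW.
have c4 : 0 <= 4 * C1 * a ^+ 2 by rewrite !mulr_ge0// ltW.
have h7 := ler_wpM2r k0 h6; have h8 := ler_wpM2l c4 h3.
have -> : C1 * (2 * a) ^+ 2 * K (2 * a) = 4 * C1 * a ^+ 2 * K (2 * a) by ring.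
lra.
Qed.

Lemma tv1_gt0 : 0 < tv P Z 1.
Proof.
have := tv_ge_tl P mZ ltr01; rewrite expr1n mul1r; exact: lt_le_trans.
Qed.

(** For al < 2, [tv_regvar_bound] bounds a^2 K(a) below by a multiple of tv(a), hence of D = tv(A),
    so every doubling adds at least e = 3 D / (4 C1). For al = 2 divergence comes from the assumed
    unboundedness of u^2 K(u). *)
Lemma tv_unbounded B : exists2 A, 0 < A & forall a, A <= a -> B <= tv P Z a.
Proof.
suff [A A0 HA] : exists2 A, 0 < A & B <= tv P Z A.
  by exists A => // a Aa; rewrite (le_trans HA)// tv_mono// (ltW A0).
have [al2|al2|al2] := ltrgtP al 2; last 2 first.
- by case/andP: al02 => _; rewrite leNgt al2.
- have [u u0 hu] := K2 al2 B; exists u => //.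
  by rewrite (le_trans hu)// tv_ge_tl.
have [C1 [C10 [A A0 HA]]] := tv_regvar_bound al2.
pose D := tv P Z A; have D0 : 0 < D.
  by rewrite /D (lt_le_trans _ (tv_ge_tl P mZ A0))// mulr_gt0// exprn_gt0.
have C1p : 0 < C1 * A ^+ 2 * K A by exact: lt_le_trans D0 (HA A (lexx _)).
have {}C10 : 0 < C1.
  by rewrite lt0r C10 andbT; apply: contraTneq C1p => ->; rewrite !mul0r ltxx.
pose e := 3 / (4 * C1) * D.
have e0 : 0 < e by rewrite mulr_gt0// divr_gt0// mulr_gt0.
have step n : n%:R * e <= tv P Z (2 ^+ n * A) /\ A <= 2 ^+ n * A.
  elim: n => [|n [ih1 ih2]]; first by rewrite mul0r expr0 mul1r lexx tv_ge0.
  have b0 : 0 < 2 ^+ n * A by lra.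
  have h1 := tv_double_lo P mZ b0.
  have hA : A <= 2 * (2 ^+ n * A) by lra.
  have h2 := HA _ hA.
  rewrite exprS -mulrA; split=> //.
  have h3 : D <= tv P Z (2 * (2 ^+ n * A)) by apply: tv_mono => //; rewrite ltW.
  have h4 : e <= 3 * (2 ^+ n * A) ^+ 2 * K (2 * (2 ^+ n * A)).
    rewrite /e mulrAC ler_pdivrMr ?mulr_gt0//.
    have : D <= C1 * (2 * (2 ^+ n * A)) ^+ 2 * K (2 * (2 ^+ n * A)) by lra.
    rewrite exprMn; lra.
  rewrite -natr1 mulrDl mul1r; lra.
have Be : 0 <= `|B| / e by rewrite divr_ge0// ltW.
exists (2 ^+ (Num.bound (`|B| / e)) * A); first by rewrite mulr_gt0// exprn_gt0.
have [h _] := step (Num.bound (`|B| / e)).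
rewrite (le_trans _ h)// (le_trans (ler_norm _))// -ler_pdivrMr//.
exact: ltW (archi_boundP Be).
Qed.

(** Induction on k: suppose tv(a) >= (k / 2) a^2 K(a). As K(a) is nearly 4 K(2 a), doubling yields
    about (2 k + 3) a^2 K(2 a), while k + 1 requires (2 k + 2) a^2 K(2 a). The surplus pays for the
    tolerance 1 / (16 (k + 1)) on the ratio of tails. *)
Lemma tv_dominates (M : R) : al = 2 -> exists2 A, 0 < A &
  forall a, A <= a -> M * (a ^+ 2 * K a) <= tv P Z a.
Proof.
move=> al2.
suff H (k : nat) : exists2 A, 0 < A &
    forall a, A <= a -> k%:R / 2 * (a ^+ 2 * K a) <= tv P Z a.
  have [A A0 HA] := H (Num.bound (`|2 * M|)); exists A => // a Aa.
  have k0 : 0 <= a ^+ 2 * K a by rewrite mulr_ge0 ?sqr_ge0 ?(ltW (K0 _)).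
  rewrite (le_trans _ (HA a Aa))// ler_wpM2r//.
  have := archi_boundP (normr_ge0 (2 * M)); have := ler_norm (2 * M); lra.
elim: k => [|k [A A0 HA]].
  by exists 1 => // a _; rewrite !mul0r tv_ge0.
have e0 : 0 < (16 * (k%:R + 1))^-1 :> R by rewrite invr_gt0 mulr_gt0// ltr_wpDl.
have [B HB] := cvgy_leP (tl_ratio (ltr0Sn R 1)) e0.
pose A' := Num.max A (B + 1).
have AA' : A <= A' by rewrite le_max lexx.
have BA' : B < A' by rewrite lt_max ltrDl ltr01 orbT.
exists (2 * A'); first by lra.
move=> b Ab; have -> : b = 2 * (b / 2) by rewrite mulrC divfK.
set a := b / 2; have Aa : A' <= a by rewrite /a; lra.
have a0 : 0 < a by lra.
have h1 := tv_double_lo P mZ a0.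
have h2 : k%:R / 2 * (a ^+ 2 * K a) <= tv P Z a by apply: HA; lra.
have Ba : B < a by lra.
have := HB a Ba; rewrite al2 powRN powR_mulrn//; rewrite ler_norml => /andP[h3' h3].
have k1 : 0 < k%:R + 1 :> R by rewrite ltr_wpDl.
have i16 : (16 * (k%:R + 1))^-1 <= 16^-1 :> R.
  by rewrite lef_pV2 ?posrE ?mulr_gt0// ler_peMr// lerDr.
have h4 : K (2 * a) <= (4^-1 + (16 * (k%:R + 1))^-1) * K a.
  by rewrite -ler_pdivrMr//; lra.
have h4' : 8^-1 * K a <= K (2 * a).
  by rewrite -ler_pdivlMr//; lra.
have a2 : 0 < a ^+ 2 by rewrite exprn_gt0.
have h5 : 4 * k%:R * K (2 * a) <= k%:R * K a + 2 * K (2 * a).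
  have := ler_wpM2l (ler0n R k) h4.
  have h : k%:R * (16 * (k%:R + 1))^-1 <= 16^-1 :> R.
    rewrite invfM mulrCA ler_piMr ?invr_ge0// ler_pdivrMr// mul1r lerDl //.
  have := ler_wpM2r (ltW (K0 a)) h; lra.
rewrite exprMn -natr1.
have := ler_wpM2l (ltW a2) h5; lra.
Qed.

(** [vague_sqr] handles each tail, for Z and for - Z. As g vanishes at 0 it is the sum of its
    restrictions to the two half-lines, written with [Num.max] so as to stay continuous. *)
Lemma Ex_vague (g : R -> R) (C0 : R) : al < 2 -> continuous g ->
  (forall x, `|g x| <= C0 * Num.min 1 (x ^+ 2)) ->
  Ex P (fun w => g (Z w / a)) / K a @[a --> +oo] -->
    al * (pp * LI (fun y => g (expR y) * expR (- (al * y))) +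
          pm * LI (fun y => g (- expR y) * expR (- (al * y)))).
Proof.
move=> al2 cg gC; have al02' : 0 < al < 2 by rewrite al0.
have [C1 [C10 [A A0 HA]]] := tv_regvar_bound al2.
have g00 : g 0 = 0.
  by apply/eqP; rewrite -normr_le0 (le_trans (gC 0))// expr0n/= min_r ?mulr0.
have C00 : 0 <= C0 by have := le_trans (normr_ge0 _) (gC 1); rewrite expr1n minxx mulr1.
have cmax : continuous (fun x : R => Num.max x 0).
  by move=> x; apply: continuous_max; [exact: cvg_id|exact: cvg_cst].
have maxC (x : R) : Num.min 1 (Num.max x 0 ^+ 2) <= Num.min 1 (x ^+ 2).
  have [h|h] := leP x 0; last by [].
  by rewrite expr0n/= min_r ?ler01// le_min ler01 sqr_ge0.
have H1 := @vague_sqr _ _ _ P al pp Z (fun u => [set w | u < Z w]) K C1 A al02' pp0 mZ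
  (fun u => mgt u mZ) (fun u w => @ltW _ _ _ _) (fun u w h => h) K0 tZp tl_ratio C10 HA
  (fun x => g (Num.max x 0)) C0.
have mN : measurable_fun [set: T] (fun w => - Z w) by exact: measurableT_comp.
have HA' a : A <= a -> tv P (fun w => - Z w) a <= C1 * a ^+ 2 * K a.
  by move=> /HA; congr (_ <= _); congr Ex; apply/funext => w; rewrite normrN.
have AU' u w : [set w | Z w <= - u] w -> u <= - Z w by rewrite /= lerNr.
have UA' u w : u < - Z w -> [set w | Z w <= - u] w by rewrite /= ltrNr => /ltW.
have H2 := @vague_sqr _ _ _ P al pm (fun w => - Z w) (fun u => [set w | Z w <= - u]) K C1 A
  al02' pm0 mN (fun u => mle (- u) mZ) AU' UA' K0 tZm tl_ratio C10 HA'
  (fun x => g (- Num.max x 0)) C0.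
have E1 : (fun y => g (Num.max (expR y) 0) * expR (- (al * y))) =
    (fun y => g (expR y) * expR (- (al * y))).
  by apply/funext => y; rewrite max_l ?expR_ge0.
have E2 : (fun y => g (- Num.max (expR y) 0) * expR (- (al * y))) =
    (fun y => g (- expR y) * expR (- (al * y))).
  by apply/funext => y; rewrite max_l ?expR_ge0.
rewrite E1 in H1; rewrite E2 in H2.
have c1 : continuous (fun x : R => g (Num.max x 0)).
  by move=> x; apply: (@continuous_comp _ _ _ (fun x : R => Num.max x 0) g); [exact: cmax|exact: cg].
have c2 : continuous (fun x : R => g (- Num.max x 0)).
  move=> x; apply: (@continuous_comp _ _ _ (fun x : R => - Num.max x 0) g); last exact: cg.
  by apply: cvgN; exact: cmax.
have {}H1 := H1 c1 (fun x => le_trans (gC _) (ler_wpM2l C00 (maxC x))).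
have {}H2 : Ex P (fun w => g (- Num.max (- Z w / a) 0)) / K a @[a --> +oo] -->
    pm * al * LI (fun y => g (- expR y) * expR (- (al * y))).
  apply: H2 => // x; last by move=> x0; rewrite max_r// oppr0.
  by rewrite (le_trans (gC _))// sqrrN ler_wpM2l.
have {}H1 : Ex P (fun w => g (Num.max (Z w / a) 0)) / K a @[a --> +oo] -->
    pp * al * LI (fun y => g (expR y) * expR (- (al * y))).
  by apply: H1 => x x0; rewrite max_r.
have gM x : `|g x| <= C0.
  by rewrite (le_trans (gC x))// -[leRHS]mulr1 ler_wpM2l// ge_min lexx.
rewrite mulrDr ![al * (_ * _)]mulrA [al * pp]mulrC [al * pm]mulrC.
have H := cvgD H1 H2.
refine (cvgy_eq _ (H _)) => a /=.
rewrite -mulrDl -ExD.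
- congr (_ / _); congr Ex; apply/funext => w; rewrite mulNr.
  have [h|h] := leP (Z w / a) 0.
    by rewrite g00 add0r max_l ?oppr_ge0// opprK.
  by rewrite max_r ?oppr_le0 ?(ltW h)// oppr0 g00 addr0.
- apply: (bmf_ccomp (f := fun w => Z w / a) _ c1) => //; exact: measurable_funM.
- apply: (bmf_ccomp (f := fun w => - Z w / a) _ c2) => //; exact: measurable_funM.
Qed.

(** tv(a) / a^2 is the expectation of min(1, (Z / a)^2). At a_n it equals 1 / n, and for al < 2 it
    is equivalent to l K(a) by [Ex_vague], so n K(a_n) tends to 1 / l. For al = 2 [tv_dominates]
    forces the limit 0. *)
Lemma regvar_norming : exists (a : nat -> R) (k0 : R),
  [/\ forall n, 0 < a n, a n @[n --> \oo] --> +oo,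
      exists n0, forall n, (n0 <= n)%N -> a n ^+ 2 = n%:R * tv P Z (a n),
      n%:R * K (a n) @[n --> \oo] --> k0 &
      if al == 2 then k0 = 0 else
        k0 * (al * LI (fun y => Num.min 1 (expR y ^+ 2) * expR (- (al * y)))) = 1].
Proof.
have [a [apos [ainf [n0 Hn0]]]] := exists_norming mZ tv1_gt0.
have near_a B : exists N, forall n, (N <= n)%N -> B < a n.
  move/cvgryPgt : ainf => /(_ B) [N _ HN]; by exists N => n Nn; apply: HN.
have [al2|al2] := eqVneq al 2.
  exists a, 0; split => //; first by exists n0.
  apply: cvgn_le => e e0.
  have [A A0 HA] := tv_dominates e^-1 al2.
  have [N HN] := near_a A.
  exists (maxn 1 (maxn n0 N)) => n; rewrite !geq_max => /and3P[n1 n2 n3].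
  have h := HA _ (ltW (HN n n3)); have E := Hn0 n n2; have an := apos n.
  have nn : 0 < n%:R :> R by rewrite ltr0n.
  rewrite subr0 ger0_norm ?mulr_ge0 ?(ltW (K0 _))//.
  have a2 : 0 < a n ^+ 2 by rewrite exprn_gt0.
  rewrite -(ler_pM2l a2).
  move: h; rewrite ler_pdivrMl// => /(ler_wpM2l (ltW nn)).
  rewrite [n%:R * (e * _)]mulrCA -E; lra.
have al2' : al < 2 by rewrite lt_neqAle al2; case/andP: al02.
have al02' : 0 < al < 2 by rewrite al0.
pose g (x : R) := Num.min 1 (x ^+ 2).
have cg : continuous g.
  move=> x; apply: (@continuous_min _ _ (fun=> 1) (fun z : R => z ^+ 2)); first exact: cvg_cst.
  exact: exprn_continuous.
have gC x : `|g x| <= 1 * Num.min 1 (x ^+ 2).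
  by rewrite mul1r ger0_norm// le_min ler01 sqr_ge0.
have := Ex_vague al2' cg gC.
have -> : (fun y => g (- expR y) * expR (- (al * y))) = (fun y => g (expR y) * expR (- (al * y))).
  by apply/funext => y; rewrite /g sqrrN.
rewrite -mulrDl ppm mul1r; set l := al * _ => H.
have Q n : (maxn 1 n0 <= n)%N -> Ex P (fun w => g (Z w / a n)) = n%:R^-1.
  rewrite geq_max => /andP[n1 n2]; have E := Hn0 n n2; have an := apos n.
  have nn : 0 < n%:R :> R by rewrite ltr0n.
  have -> : (fun w => g (Z w / a n)) = (fun w => (a n ^+ 2)^-1 * Num.min `|Z w| (a n) ^+ 2).
    apply/funext => w; rewrite -exprVn -exprMn minr_pMr ?invr_ge0 ?(ltW an)//.
    rewrite mulVf ?gt_eqF// /g -[(Z w / a n) ^+ 2]real_normK ?num_real//.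
    rewrite normrM [`|(a n)^-1|]gtr0_norm ?invr_gt0// [(a n)^-1 * _]mulrC.
    set u := `|Z w| / a n; have u0 : 0 <= u by rewrite divr_ge0// ltW.
    have [h|h] := leP u 1.
      by rewrite min_r// -(expr1n R 2) lerXn2r ?nnegrE.
    by rewrite expr1n min_l// -(expr1n R 2) lerXn2r ?nnegrE// ltW.
  rewrite ExZ; last exact: bmf_tv.
  rewrite -/(tv P Z (a n)) E; have tp : 0 < tv P Z (a n).
    by rewrite -(pmulr_rgt0 _ nn) -E exprn_gt0.
  by rewrite invfM mulfVK// gt_eqF.
(* The inequality 1 - cos x <= 2 min(1, x^2) bounds l below through the positive constant of
   [stable_integrals]. *)
have l0 : 0 < l.
  have [Ic Ic0 /(_ 1)[HI _]] := stable_integrals al02'.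
  rewrite mulr_gt0// (lt_le_trans (y := Ic / 2))// ?divr_gt0// ler_pdivrMr//.
  move: HI; rewrite normr1 powR1 mul1r => <-.
  rewrite -[leRHS]mulrC -LIZ; last exact: (li_dom_min al02' cg gC).
  have cc : continuous (fun x : R => 1 - cos (1 * x)).
    by move=> x; apply: cvgB; [exact: cvg_cst|exact: continuous_cosM].
  have ccC (x : R) : `|1 - cos (1 * x)| <= 2 * Num.min 1 (x ^+ 2).
    rewrite mul1r; have [h1 [h2 _]] := cos_sub1 x; rewrite ger0_norm//.
    have := cos_geN1 x; case: (leP 1 (x ^+ 2)) => _; lra.
  apply: le_LI.
  - exact: (li_dom_min al02' cc ccC).
  - by apply: liZ; exact: (li_dom_min al02' cg gC).
  move=> y; rewrite mulrA ler_wpM2r ?expR_ge0//.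
  by rewrite (le_trans (ler_norm _))// ccC.
exists a, l^-1; split => //; first by exists n0.
  have H' : Ex P (fun w => g (Z w / a n)) / K (a n) @[n --> \oo] --> l.
    exact: (cvg_comp _ _ ainf H).
  have H2 := cvgV (lt0r_neq0 l0) H'.
  refine (cvgn_eq (N := maxn 1 n0) _ (H2 _)) => n hn /=; rewrite Q//.
  by rewrite invfM !invrK mulrC.
by rewrite mulVf// gt_eqF.
Qed.

Let bmfdiv (h : R -> R) (M a : R) : continuous h -> (forall x, `|h x| <= M) ->
  bmf (fun w => h (Z w / a)).
Proof.
move=> ch hM; apply: (bmf_ccomp (f := fun w => Z w / a) _ ch hM).
exact: measurable_funM.
Qed.

(** The norming gives n E min(1, (Z / a_n)^2) = 1, so a function at most e x^2 near 0 contributes at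
    most e there; away from 0 the contribution is at most C0 n K(r a_n), which vanishes. For al = 2
    this discards everything but the quadratic term. *)
Lemma small_square (a : nat -> R) (h : R -> R) (C0 : R) : (forall n, 0 < a n) ->
  a n @[n --> \oo] --> +oo ->
  (exists n0, forall n, (n0 <= n)%N -> a n ^+ 2 = n%:R * tv P Z (a n)) ->
  n%:R * K (a n) @[n --> \oo] --> (0 : R) -> continuous h ->
  (forall x, `|h x| <= C0) ->
  (forall e, 0 < e -> exists2 r, 0 < r <= 1 & forall x, `|x| <= r -> `|h x| <= e * x ^+ 2) ->
  n%:R * Ex P (fun w => h (Z w / a n)) @[n --> \oo] --> (0 : R).
Proof.
move=> apos ainf [n0 Hn0] HK ch hC hs; apply: cvgn_le => e e0.
have C00 : 0 <= C0 := le_trans (normr_ge0 _) (hC 0).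
have e20 : 0 < e / 2 by rewrite divr_gt0.
have [r /andP[r0 r1] Hr] := hs _ e20.
have HKr : n%:R * K (r * a n) @[n --> \oo] --> (0 : R).
  have h1 : K (r * a n) / K (a n) @[n --> \oo] --> r `^ (- al).
    exact: (cvg_comp _ _ ainf (tl_ratio r0)).
  rewrite -(mul0r (r `^ (- al))).
  have H := cvgM HK h1; refine (cvgn_eq (N := 0) _ (H _)) => n _ /=.
  by rewrite mulrA [_ * K (r * _)]mulrC; field; rewrite gt_eqF.
have e3 : 0 < e / (2 * (C0 + 1)) by rewrite divr_gt0// mulr_gt0// ltr_wpDl.
have [N HN] := cvgn_leP HKr e3.
exists (maxn 1 (maxn n0 N)) => n; rewrite !geq_max => /and3P[n1 n2 n3]; rewrite subr0.
have E := Hn0 n n2; have an := apos n; have nn : 0 < n%:R :> R by rewrite ltr0n.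
have {HN} := HN n n3; rewrite subr0 ger0_norm ?mulr_ge0 ?(ltW (K0 _))// => HN.
have bh := bmfdiv (a n) ch hC.
have mA : measurable [set w | r * a n < `|Z w|] by apply/mgt/mabs.
have key : `|Ex P (fun w => h (Z w / a n))| <=
    e / 2 / a n ^+ 2 * tv P Z (a n) + C0 * fine (P [set w | r * a n < `|Z w|]).
  rewrite (le_trans (Ex_norm _ bh))// -Ex_indic// /tv.
  rewrite -(ExZ P _ (bmf_tv (a n) mZ)) -(ExZ P _ (bmf_indic R mA)).
  rewrite -ExD; [|by apply: bmfZ; exact: bmf_tv|by apply: bmfZ; exact: bmf_indic].
  apply: le_Ex; [exact: bmf_norm| |move=> w].
    by apply: bmfD; [apply: bmfZ; exact: bmf_tv|apply: bmfZ; exact: bmf_indic].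
  rewrite indicE; have [hw|hw] := leP `|Z w| (r * a n).
    rewrite memNset/=; last by apply/negP; rewrite -leNgt.
    rewrite mulr0 addr0 min_l; last by rewrite (le_trans hw)// ler_piMl// ltW.
    have hr : `|Z w / a n| <= r.
      by rewrite normrM [`|(a n)^-1|]gtr0_norm ?invr_gt0// ler_pdivrMr.
    rewrite (le_trans (Hr _ hr))// real_normK ?num_real//.
    have -> : e / 2 * (Z w / a n) ^+ 2 = e / 2 / a n ^+ 2 * Z w ^+ 2 by field; rewrite gt_eqF.
    by [].
  rewrite mem_set// mulr1 (le_trans (hC _))// lerDr mulr_ge0 ?sqr_ge0//.
  by rewrite divr_ge0 ?sqr_ge0 ?ltW.
rewrite normrM [`|n%:R|]gtr0_norm//.
rewrite (le_trans (ler_wpM2l (ltW nn) key))// mulrDr.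
have -> : n%:R * (e / 2 / a n ^+ 2 * tv P Z (a n)) = e / 2.
  have tp : 0 < tv P Z (a n).
    by rewrite -(pmulr_rgt0 _ nn) -E exprn_gt0.
  by rewrite E; field; rewrite !gt_eqF.
have h2 : n%:R * (C0 * fine (P [set w | r * a n < `|Z w|])) <= e / 2.
  rewrite mulrCA (@le_trans _ _ (C0 * (e / (2 * (C0 + 1)))))//.
    rewrite ler_wpM2l// (le_trans _ HN)// ler_wpM2l ?(ltW nn)//.
    exact: tl_ge.
  have -> : C0 * (e / (2 * (C0 + 1))) = (e / 2) * (C0 / (C0 + 1)).
    by field; rewrite gt_eqF// ltr_wpDl.
  by rewrite ler_piMr ?(ltW e20)// ler_pdivrMr ?ltr_wpDl// mul1r lerDl.
lra.
Qed.

Theorem regvar_limits : exists (a : nat -> R) (c be ga : R),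
  [/\ forall n, 0 < a n, a n @[n --> \oo] --> +oo,
      exists n0, forall n, (n0 <= n)%N -> a n ^+ 2 = n%:R * tv P Z (a n),
      0 < c /\ -1 <= be <= 1 &
   [/\ forall t, n%:R * Ex P (fun w => 1 - cos (t * (Z w / a n))) @[n --> \oo] -->
        c * `|t| `^ al,
      forall t, n%:R * Ex P (fun w => sin (t * (Z w / a n)) - t * sin (Z w / a n))
        @[n --> \oo] --> stable_phase al c be ga t &
      forall e, 0 < e -> exists2 M, 1 <= M & exists N, forall n, (N <= n)%N ->
        n%:R * fine (P [set w | M * a n < `|Z w|]) <= e]].
Proof.
have [a [k0 [apos ainf [n0 Hn0] HK Hk0]]] := regvar_norming.
have tailM e : 0 < e -> exists2 M, 1 <= M & exists N, forall n, (N <= n)%N ->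
    n%:R * fine (P [set w | M * a n < `|Z w|]) <= e.
  (* n K(M a_n) tends to k0 M^(-al), and M makes this limit at most e / 2. *)
  move=> e0; pose M := (2 * `|k0| / e + 1) `^ (al^-1).
  have b1 : 1 <= 2 * `|k0| / e + 1 by rewrite lerDr divr_ge0 ?mulr_ge0 ?(ltW e0).
  have powR1' (r : R) : 1 `^ r = 1 by rewrite powR1.
  have M1 : 1 <= M.
    by rewrite -[leLHS](powR1' al^-1) ge0_ler_powR ?nnegrE ?invr_ge0 ?(ltW al0)// (le_trans _ b1).
  have M0 : 0 < M by lra.
  have HMe : k0 * M `^ (- al) <= e / 2.
    rewrite powRN /M -powRrM mulVf ?gt_eqF// powRr1 ?(le_trans _ b1)//.
    rewrite ler_pdivrMr ?(lt_le_trans _ b1)// (le_trans (ler_norm _))//.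
    have -> : e / 2 * (2 * `|k0| / e + 1) = `|k0| + e / 2 by field; rewrite gt_eqF.
    by rewrite lerDl divr_ge0// ltW.
  have h1 : K (M * a n) / K (a n) @[n --> \oo] --> M `^ (- al).
    exact: (cvg_comp _ _ ainf (tl_ratio M0)).
  have e2 : 0 < e / 2 by rewrite divr_gt0.
  have [N HN] := cvgn_leP (cvgM HK h1) e2.
  exists M => //; exists N => n nN; have := HN n nN => /=.
  rewrite (_ : n%:R * K (a n) * (K (M * a n) / K (a n)) = n%:R * K (M * a n)); last first.
    by field; rewrite gt_eqF.
  have := ler_wpM2l (ler0n R n) (tl_ge P (M * a n) mZ).
  rewrite ler_norml; lra.
have ccos t : continuous (fun x : R => 1 - cos (t * x)).
  by move=> x; apply: cvgB; [exact: cvg_cst|exact: continuous_cosM].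
have csin t : continuous (fun x : R => sin (t * x) - t * sin x).
  move=> x; apply: cvgB; first exact: continuous_sinM.
  by apply: continuous_cmul; exact: continuous_sin.
have bcos (t x : R) : `|1 - cos (t * x)| <= 2 :> R.
  have := cos_geN1 (t * x); have := cos_le1 (t * x); rewrite ler_norml; lra.
have bsin (t x : R) : `|sin (t * x) - t * sin x| <= 1 + `|t|.
  rewrite (le_trans (ler_normB _ _))// lerD//.
    by rewrite ler_norml sin_geN1 sin_le1.
  by rewrite normrM ler_piMr// ler_norml sin_geN1 sin_le1.
have [al2|al2] := eqVneq al 2.
  rewrite al2 eqxx in Hk0; rewrite {}Hk0 in HK.
  (* The norming fixes the truncated variance at 1, hence the Gaussian exponent t^2 / 2; the
     compensated sine is O(|x|^3) and leaves no phase. *)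
  exists a, (2^-1), 0, 0; split => //; first by exists n0.
    by split; lra.
  split => // t; last first.
    rewrite (_ : stable_phase _ _ _ _ _ = 0); last first.
      by rewrite /stable_phase al2; case: ifP => _; rewrite !(mulr0, mul0r) ?subrr ?addr0.
    apply: (@small_square a (fun x => sin (t * x) - t * sin x) (1 + `|t|)) => //; first by exists n0.
    move=> e e0; pose b := `|t| ^+ 3 + `|t|.
    have b0 : 0 <= b by rewrite addr_ge0 ?exprn_ge0.
    have q0 : 0 < e / (b + 1) by rewrite divr_gt0// ltr_wpDl.
    exists (Num.min 1 (e / (b + 1))); first by rewrite lt_min ltr01 q0 ge_min lexx.
    move=> x; rewrite le_min => /andP[x1 xe].
    have -> : sin (t * x) - t * sin x = (sin (t * x) - t * x) - t * (sin x - x) by ring.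
    have h1 := sin_subid3 (t * x); have h2 := sin_subid3 x.
    have h3 : `|sin (t * x) - t * x - t * (sin x - x)| <= b * `|x| ^+ 3.
      rewrite (le_trans (ler_normB _ _))// mulrDl lerD//.
        by rewrite (le_trans h1)// normrM exprMn.
      by rewrite normrM ler_wpM2l.
    rewrite (le_trans h3)// exprS mulrA real_normK ?num_real// ler_wpM2r ?sqr_ge0//.
    rewrite (le_trans (ler_wpM2l b0 xe))// mulrCA ler_piMr ?(ltW e0)//.
    by rewrite ler_pdivrMr ?ltr_wpDl// mul1r lerDl.
  pose h (x : R) := 1 - cos (t * x) - t ^+ 2 / 2 * Num.min `|x| 1 ^+ 2.
  have cm : continuous (fun x : R => Num.min `|x| 1 ^+ 2).
    move=> x; apply: (@continuous_comp _ _ _ (fun x : R => Num.min `|x| 1) (fun z => z ^+ 2)).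
      by apply: continuous_min; [exact: norm_continuous|exact: cst_continuous].
    exact: exprn_continuous.
  have t2 : 0 <= t ^+ 2 / 2 by rewrite divr_ge0 ?sqr_ge0.
  have H : n%:R * Ex P (fun w => h (Z w / a n)) @[n --> \oo] --> (0 : R).
    apply: (@small_square a h (2 + t ^+ 2 / 2)) => //; first by exists n0.
    - by move=> x; apply: cvgB; [exact: ccos|apply: (@continuous_cmul _ (t ^+ 2 / 2) (fun x : R => Num.min `|x| 1 ^+ 2)); exact: cm].
    - move=> x; rewrite (le_trans (ler_normB _ _))// lerD//.
      have m1 : 0 <= Num.min `|x| 1 <= 1 by rewrite le_min normr_ge0 ge_min lexx orbT ler01.
      rewrite normrM ger0_norm// ler_piMr// ger0_norm ?sqr_ge0// expr_le1//; by case/andP: m1.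
    move=> e e0; pose b := `|t| ^+ 3.
    have b0 : 0 <= b by rewrite exprn_ge0.
    have q0 : 0 < e / (b + 1) by rewrite divr_gt0// ltr_wpDl.
    exists (Num.min 1 (e / (b + 1))); first by rewrite lt_min ltr01 q0 ge_min lexx.
    move=> x; rewrite le_min => /andP[x1 xe].
    rewrite /h min_l// real_normK ?num_real//.
    have -> : 1 - cos (t * x) - t ^+ 2 / 2 * x ^+ 2 = 1 - cos (t * x) - (t * x) ^+ 2 / 2 by ring.
    rewrite (le_trans (cos_sub2 _))// normrM exprMn -/b.
    rewrite exprS mulrA real_normK ?num_real// ler_wpM2r ?sqr_ge0//.
    rewrite (le_trans (ler_wpM2l b0 xe))// mulrCA ler_piMr ?(ltW e0)//.
    by rewrite ler_pdivrMr ?ltr_wpDl// mul1r lerDl.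
  have -> : 2^-1 * `|t| `^ al = 0 + t ^+ 2 / 2.
    by rewrite al2 powR_mulrn// real_normK ?num_real// add0r mulrC.
  have H2 := cvgD H (@cvg_cst _ (t ^+ 2 / 2 : R) _ \oo _).
  refine (cvgn_eq (N := maxn 1 n0) _ (H2 _ _)) => n; rewrite geq_max => /andP[n1 n2] /=.
  have E := Hn0 n n2; have an := apos n; have nn : 0 < n%:R :> R by rewrite ltr0n.
  have b1 := bmfdiv (a n) (ccos t) (bcos t).
  have b2 : bmf (fun w => (a n ^+ 2)^-1 * Num.min `|Z w| (a n) ^+ 2).
    by apply: bmfZ; exact: bmf_tv.
  have -> : (fun w => h (Z w / a n)) = (fun w => (1 - cos (t * (Z w / a n))) -
      t ^+ 2 / 2 * ((a n ^+ 2)^-1 * Num.min `|Z w| (a n) ^+ 2)).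
    apply/funext => w; rewrite /h; congr (_ - _ * _).
    rewrite -exprVn -exprMn minr_pMr ?invr_ge0 ?(ltW an)// mulVf ?gt_eqF//.
    by rewrite normrM [`|(a n)^-1|]gtr0_norm ?invr_gt0// [(a n)^-1 * _]mulrC.
  rewrite ExB//; last exact: bmfZ.
  rewrite ExZ// ExZ; last exact: bmf_tv.
  have tp : 0 < tv P Z (a n) by rewrite -(pmulr_rgt0 _ nn) -E exprn_gt0.
  rewrite -/(tv P Z (a n)) E; set X := Ex P _; field; rewrite !gt_eqF//.
have al2' : al < 2 by rewrite lt_neqAle al2; case/andP: al02.
have al02' : 0 < al < 2 by rewrite al0.
rewrite (negPf al2) in Hk0.
have [Ic Ic0 HIc] := stable_integrals al02'.
have k00 : 0 < k0.
  rewrite lt0r; apply/andP; split.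
    by apply: contra_eq_neq Hk0 => ->; rewrite mul0r eq_sym oner_neq0.
  apply: (@le_cvgn _ (fun=> 0) _ _ _ (@cvg_cst _ (0 : R) _ \oo _) HK).
  by exists 0%N => n _; rewrite mulr_ge0 ?(ltW (K0 _)).
pose be : R := pp - pm.
have be1 : -1 <= be <= 1.
  by move: pp0 pm0 ppm; rewrite /be => h1 h2 h3; apply/andP; split; lra.
pose c := k0 * al * Ic.
(* For al <> 1 the compensator t sin x leaves a term linear in t in [stable_integrals]; the location
   parameter records it. *)
exists a, c, be, (if al == 1 then 0 else - (c * be * tan (pi * al / 2))).
have cmp (h : R -> R) l : Ex P (fun w => h (Z w / a)) / K a @[a --> +oo] --> l ->
    n%:R * Ex P (fun w => h (Z w / a n)) @[n --> \oo] --> k0 * l.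
  move=> H; have H' : Ex P (fun w => h (Z w / a n)) / K (a n) @[n --> \oo] --> l.
    exact: (cvg_comp _ _ ainf H).
  have H2 := cvgM HK H'; refine (cvgn_eq (N := 0) _ (H2 _)) => n _ /=.
  by field; rewrite gt_eqF.
split => //; first by exists n0.
  split; first by rewrite /c !mulr_gt0.
  exact: be1.
have mn (C A B : R) x : 0 <= A -> 0 <= B -> `|C| <= A -> `|C| <= B * x ^+ 2 ->
    `|C| <= (A + B) * Num.min 1 (x ^+ 2).
  move=> A0 B0 CA CB; have x2 := sqr_ge0 x; case: (leP 1 (x ^+ 2)) => h; first lra.
  have := mulr_ge0 A0 x2; lra.
have bs2 (t x : R) : `|sin (t * x) - t * sin x| <= ((1 + `|t|) + (t ^+ 2 + `|t|)) * Num.min 1 (x ^+ 2).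
  have A0 : 0 <= 1 + `|t| by rewrite addr_ge0.
  have B0 : 0 <= t ^+ 2 + `|t| by rewrite addr_ge0 ?sqr_ge0.
  apply: (mn _ _ _ _ A0 B0 (bsin t x)).
  have -> : sin (t * x) - t * sin x = (sin (t * x) - t * x) - t * (sin x - x) by ring.
  have h1 := sin_subid (t * x); have h2 := sin_subid x.
  rewrite (le_trans (ler_normB _ _))// mulrDl lerD//.
    by rewrite (le_trans h1)// exprMn.
  by rewrite normrM ler_wpM2l.
split => // t.
  have := @Ex_vague (fun x => 1 - cos (t * x)) (2 + t ^+ 2) al2' (ccos t).
  have -> : (fun y => (1 - cos (t * - expR y)) * expR (- (al * y))) =
      (fun y => (1 - cos (t * expR y)) * expR (- (al * y))).
    by apply/funext => y; rewrite mulrN cosN.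
  have [-> _] := HIc t; rewrite -mulrDl ppm mul1r => H.
  rewrite (_ : c * _ = k0 * (al * (`|t| `^ al * Ic))); last by rewrite /c; ring.
  apply: (cmp (fun x => 1 - cos (t * x))); apply: H => x.
  apply: (mn _ _ _ _ (ler0n R 2) (sqr_ge0 t) (bcos t x)).
  have [h1 [h2 _]] := cos_sub1 (t * x).
  by rewrite ger0_norm// -exprMn.
have := @Ex_vague (fun x => sin (t * x) - t * sin x) ((1 + `|t|) + (t ^+ 2 + `|t|)) al2' (csin t).
have [_ Es] := HIc t.
have lS : li (fun y => (sin (t * expR y) - t * sin (expR y)) * expR (- (al * y))).
  apply: (@li_dom_min _ _ al02' (fun x => sin (t * x) - t * sin x) ((1 + `|t|) + (t ^+ 2 + `|t|))).
    exact: csin.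
  exact: bs2.
have -> : (fun y => (sin (t * - expR y) - t * sin (- expR y)) * expR (- (al * y))) =
    (fun y => -1 * ((sin (t * expR y) - t * sin (expR y)) * expR (- (al * y)))).
  by apply/funext => y; rewrite mulrN !sinN; ring.
rewrite LIZ// Es => H.
rewrite (_ : stable_phase _ _ _ _ _ = k0 * (al * (pp * (if al == 1 then - (2 / pi) * Ic * t * ln `|t|
  else Ic * tan (pi * al / 2) * (Num.sg t * `|t| `^ al - t)) +
  pm * (-1 * (if al == 1 then - (2 / pi) * Ic * t * ln `|t|
  else Ic * tan (pi * al / 2) * (Num.sg t * `|t| `^ al - t)))))); last first.
  by rewrite /stable_phase /c /be; case: (al == 1); ring.
apply: (cmp (fun x => sin (t * x) - t * sin x)); apply: H => x.
exact: bs2.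
Qed.

End RegVar.

(** * The stable limit theorem for i.i.d. sums *)

Section ComplexPower.
Variable R : realType.
Implicit Types (w v : R[i]) (x y A B : R).

Definition cis (x : R) : R[i] := (cos x +i* sin x)%C.

Let normc_ReIm w : Normc.normc w <= `|complex.Re w| + `|complex.Im w|.
Proof.
case: w => a b /=; rewrite -[leRHS]ger0_norm ?addr_ge0// -sqrtr_sqr ler_wsqrtr//.
rewrite sqrrD !real_normK ?num_real// -addrA lerD2l lerDr.
by rewrite mulrn_wge0// mulr_ge0.
Qed.

Let Re_normc w : `|complex.Re w| <= Normc.normc w /\ `|complex.Im w| <= Normc.normc w.
Proof.
by case: w => a b /=; split; rewrite -sqrtr_sqr ler_wsqrtr// ?lerDl ?lerDr sqr_ge0.
Qed.

Let ReB w v : complex.Re (w - v) = complex.Re w - complex.Re v.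
Proof. by case: w v => a b [a' b']. Qed.

Let ImB w v : complex.Im (w - v) = complex.Im w - complex.Im v.
Proof. by case: w v => a b [a' b']. Qed.

Lemma normc_pow_sub w v n : Normc.normc w <= 1 -> Normc.normc v <= 1 ->
  Normc.normc (w ^+ n) <= 1 /\
  Normc.normc (w ^+ n - v ^+ n) <= n%:R * Normc.normc (w - v).
Proof.
move=> w1 v1; have n0 (z : R[i]) : 0 <= Normc.normc z by case: z => a b; exact: sqrtr_ge0.
have v1n m : Normc.normc (v ^+ m) <= 1.
  elim: m => [|m ih]; first by rewrite expr0 Normc.normc1.
  by rewrite exprS Normc.normcM mulr_ile1.
elim: n => [|n [ih1 ih2]].
  by rewrite !expr0 Normc.normc1 subrr Normc.normc0 mul0r.
split; first by rewrite exprS Normc.normcM mulr_ile1.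
have -> : w ^+ n.+1 - v ^+ n.+1 = w * (w ^+ n - v ^+ n) + (w - v) * v ^+ n.
  by rewrite !exprS; ring.
rewrite (le_trans (complex.le_normcD _ _))// !Normc.normcM -natr1 mulrDl mul1r lerD//.
  by rewrite (le_trans _ ih2)// ler_piMl.
by rewrite ler_piMr.
Qed.

Lemma cisX x n : cis x ^+ n = cis (n%:R * x).
Proof.
elim: n => [|n ih]; first by rewrite expr0 /cis mul0r cos0 sin0.
rewrite exprS ih -natr1 mulrDl mul1r addrC /cis cosD sinD.
by apply/eqP; rewrite eq_complex /=; apply/andP; split; apply/eqP; ring.
Qed.

(** [w n] is compared with v n = exp(- A / n) cis (B / n), whose n-th power is exactly the limit.
    Both have modulus at most 1, so their n-th powers differ by at most n |w n - v n|. This replaces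
    a complex logarithm. *)
Lemma cvg_complex_pow (w : nat -> R[i]) A B : 0 <= A ->
  (forall n, Normc.normc (w n) <= 1) ->
  n%:R * (1 - complex.Re (w n)) @[n --> \oo] --> A ->
  n%:R * complex.Im (w n) @[n --> \oo] --> B ->
  complex.Re (w n ^+ n) @[n --> \oo] --> expR (- A) * cos B /\
  complex.Im (w n ^+ n) @[n --> \oo] --> expR (- A) * sin B.
Proof.
move=> A0 w1 HA HB.
pose v n : R[i] := ((expR (- (A / n%:R)))%:C * cis (B / n%:R))%C.
have eA n : 0 <= expR (- (A / n%:R)) <= 1.
  rewrite expR_ge0 -expR0 ler_expR oppr_le0 divr_ge0//.
have v1 n : Normc.normc (v n) <= 1.
  rewrite /v Normc.normcM /Normc.normc /= cos2Dsin2 sqrtr1 mulr1 expr0n/= addr0.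
  by rewrite sqrtr_sqr ger0_norm; case/andP: (eA n).
have vn n : (0 < n)%N -> v n ^+ n = ((expR (- A) * cos B) +i* (expR (- A) * sin B))%C.
  move=> n0; have nn : n%:R != 0 :> R by rewrite pnatr_eq0 -lt0n.
  rewrite /v exprMn cisX -rmorphXn/= -expRM_natl [n%:R * - _]mulrN ![n%:R * (_ / _)]mulrC !divfK//.
  by apply/eqP; rewrite eq_complex /=; apply/andP; split; apply/eqP; ring.
have key e : 0 < e -> exists N, forall n, (N <= n)%N ->
    Normc.normc (w n ^+ n - v n ^+ n) <= e.
  move=> e0; have e3 : 0 < e / 3 by rewrite divr_gt0.
  have [N1 H1] := cvgn_leP HA e3; have [N2 H2] := cvgn_leP HB e3.
  (* Q / n is n times the bound on the second-order remainders of [v n]. *)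
  pose Q := A ^+ 2 + B ^+ 2 + A * `|B| + B ^+ 2.
  have Q0 : 0 <= Q by rewrite !addr_ge0 ?sqr_ge0 ?mulr_ge0.
  have Qe : 0 <= Q / (e / 3) by rewrite divr_ge0// ltW.
  exists (maxn 1 (maxn (Num.bound (Q / (e / 3))) (maxn N1 N2))) => n.
  rewrite !geq_max => /and4P[n0 nQ n1 n2].
  have [_ h] := normc_pow_sub n (w1 n) (v1 n); rewrite (le_trans h)//.
  have nn : 0 < n%:R :> R by rewrite ltr0n.
  have {H1} := H1 n n1; have {H2} := H2 n n2 => h2 h1.
  rewrite (le_trans (ler_wpM2l (ltW nn) (normc_ReIm _)))//.
  set x := A / n%:R; set y := B / n%:R.
  have xn : n%:R * x = A by rewrite /x mulrC divfK// gt_eqF.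
  have yn : n%:R * y = B by rewrite /y mulrC divfK// gt_eqF.
  have x0 : 0 <= x by rewrite divr_ge0.
  have [ex0 ex1 ex2 ex3] := expRN_bounds x0.
  have Rv : complex.Re (v n) = expR (- x) * cos y by rewrite /v /=; ring.
  have Iv : complex.Im (v n) = expR (- x) * sin y by rewrite /v /=; ring.
  have b1 : `|expR (- x) * cos y - 1 + x| <= x ^+ 2 + y ^+ 2.
    have [c1 [c2 _]] := cos_sub1 y.
    have -> : expR (- x) * cos y - 1 + x = (expR (- x) - 1 + x) - expR (- x) * (1 - cos y) by ring.
    rewrite (le_trans (ler_normB _ _))// lerD//.
      by rewrite ger0_norm; lra.
    rewrite ger0_norm ?mulr_ge0 ?(ltW ex0)// (le_trans _ c2)// ler_piMl//.
  have b2 : `|expR (- x) * sin y - y| <= x * `|y| + y ^+ 2.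
    have -> : expR (- x) * sin y - y = (expR (- x) - 1) * sin y + (sin y - y) by ring.
    rewrite (le_trans (ler_normD _ _))// lerD//; last exact: sin_subid.
    rewrite normrM ler_pM//; last exact: sin_norm_le.
    by rewrite ler0_norm; lra.
  have Re_sub : `|complex.Re (w n - v n)| <= `|1 - complex.Re (w n) - x| + (x ^+ 2 + y ^+ 2).
    rewrite ReB Rv.
    have -> : complex.Re (w n) - expR (- x) * cos y = - (1 - complex.Re (w n) - x) -
      (expR (- x) * cos y - 1 + x) by ring.
    by rewrite (le_trans (ler_normB _ _))// normrN lerD2l.
  have Im_sub : `|complex.Im (w n - v n)| <= `|complex.Im (w n) - y| + (x * `|y| + y ^+ 2).
    rewrite ImB Iv.
    have -> : complex.Im (w n) - expR (- x) * sin y = (complex.Im (w n) - y) -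
      (expR (- x) * sin y - y) by ring.
    by rewrite (le_trans (ler_normB _ _))// lerD2l.
  have g1 : n%:R * `|1 - complex.Re (w n) - x| <= e / 3.
    by rewrite -[X in X * _](gtr0_norm nn) -normrM mulrBr xn.
  have g2 : n%:R * `|complex.Im (w n) - y| <= e / 3.
    by rewrite -[X in X * _](gtr0_norm nn) -normrM mulrBr yn.
  have g3 : n%:R * (x ^+ 2 + y ^+ 2 + x * `|y| + y ^+ 2) <= e / 3.
    have -> : n%:R * (x ^+ 2 + y ^+ 2 + x * `|y| + y ^+ 2) = Q / n%:R.
      rewrite /Q /x /y normrM [`|n%:R^-1|]gtr0_norm ?invr_gt0//; field; by rewrite gt_eqF.
    rewrite ler_pdivrMr// mulrC -ler_pdivrMr//.
    by rewrite (le_trans (ltW (archi_boundP Qe)))// ler_nat.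
  have := ler_wpM2l (ltW nn) Re_sub; have := ler_wpM2l (ltW nn) Im_sub; lra.
split; apply: cvgn_le => e /key[N HN]; exists (maxn 1 N) => n; rewrite geq_max => /andP[n0 nN];
  have := HN n nN; apply: le_trans; have [h1 h2] := Re_normc (w n ^+ n - v n ^+ n).
  by rewrite (le_trans _ h1)// ReB vn.
by rewrite (le_trans _ h2)// ImB vn.
Qed.

End ComplexPower.

Lemma Ex_sum_sqr (d : measure_display) (T : measurableType d) (R : realType)
  (P : probability T R) (F : nat -> T -> R) n : (forall k, bmf (F k)) ->
  (forall j k, j != k -> Ex P (fun w => F j w * F k w) = 0) ->
  Ex P (fun w => (\sum_(k < n) F k w) ^+ 2) = \sum_(k < n) Ex P (fun w => F k w ^+ 2).
Proof.
move=> bF F0; elim: n => [|n ih].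
  rewrite big_ord0 -[RHS](Ex_cst P); congr Ex; apply/funext => w.
  by rewrite big_ord0 expr0n.
have bS : bmf (fun w => \sum_(k < n) F k w) by apply: bmf_sum => k _.
rewrite big_ord_recr/= -ih.
rewrite (_ : (fun w => _) = (fun w => (\sum_(k < n) F k w) ^+ 2 +
    2 * (\sum_(k < n) F k w * F n w) + F n w ^+ 2)); last first.
  by apply/funext => w; rewrite big_ord_recr/= -mulr_suml; ring.
have bSF : bmf (fun w => \sum_(k < n) F k w * F n w).
  by apply: bmf_sum => k _; exact: bmfM.
rewrite ExD; [|by apply: bmfD; [exact: bmfX|exact: bmfZ]|exact: bmfX].
rewrite ExD; [|exact: bmfX|exact: bmfZ].
rewrite ExZ// Ex_sum; last by move=> k _; exact: bmfM.
by rewrite big1 ?mulr0 ?addr0// => k _; rewrite F0// ltn_eqF.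
Qed.

Section IidSum.
Context (d : measure_display) (T : measurableType d) (R : realType).
Variable P : probability T R.
Variables (Zs : nat -> T -> R).
Hypothesis mZ : forall k, measurable_fun [set: T] (Zs k.+1).
Hypothesis Hid : forall k (g : R -> R), measurable_fun [set: R] g ->
  (exists M, forall x, `|g x| <= M) ->
  Ex P (fun w => g (Zs k.+1 w)) = Ex P (fun w => g (Zs 1%N w)).
Hypothesis Hprod : forall n (f g : R -> R), continuous f -> continuous g ->
  (exists M, forall x, `|f x| <= M) -> (exists M, forall x, `|g x| <= M) ->
  Ex P (fun w => f (\sum_(k < n) Zs k.+1 w) * g (Zs n.+1 w)) =
  Ex P (fun w => f (\sum_(k < n) Zs k.+1 w)) * Ex P (fun w => g (Zs n.+1 w)).
Hypothesis Hpair : forall j k (f g : R -> R), j != k -> continuous f -> continuous g ->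
  (exists M, forall x, `|f x| <= M) -> (exists M, forall x, `|g x| <= M) ->
  Ex P (fun w => f (Zs j.+1 w) * g (Zs k.+1 w)) =
  Ex P (fun w => f (Zs j.+1 w)) * Ex P (fun w => g (Zs k.+1 w)).

Let Z := Zs 1%N.
Let m (a : R) := Ex P (fun w => sin (Z w / a)).

Lemma measurable_sumZ n : measurable_fun [set: T] (fun w => \sum_(k < n) Zs k.+1 w).
Proof.
by apply: measurable_sum => k; exact: mZ.
Qed.

Let ccos (p q : R) : continuous (fun x : R => cos (p * x + q)).
Proof.
move=> x; apply: (@continuous_comp _ _ _ (fun x : R => p * x + q)); last exact: continuous_cos.
by apply: cvgD; [apply: (@continuous_cmul _ p id) => z|exact: cvg_cst].
Qed.

Let csin (p q : R) : continuous (fun x : R => sin (p * x + q)).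
Proof.
move=> x; apply: (@continuous_comp _ _ _ (fun x : R => p * x + q)); last exact: continuous_sin.
by apply: cvgD; [apply: (@continuous_cmul _ p id) => z|exact: cvg_cst].
Qed.

Let bcos (p q x : R) : `|cos (p * x + q)| <= 1.
Proof. by rewrite ler_norml cos_geN1 cos_le1. Qed.

Let bsin (p q x : R) : `|sin (p * x + q)| <= 1.
Proof. by rewrite ler_norml sin_geN1 sin_le1. Qed.

(** Characteristic function of one centred term: [p] will be the frequency t / a_n and [q] the phase
    - t m(a_n). *)
Definition cf1 (p q : R) : R[i] :=
  (Ex P (fun w => cos (p * Z w + q)) +i* Ex P (fun w => sin (p * Z w + q)))%C.

Lemma cf_sum (p q : R) n :
  ((Ex P (fun w => cos (p * (\sum_(k < n) Zs k.+1 w) + n%:R * q))) +i*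
   (Ex P (fun w => sin (p * (\sum_(k < n) Zs k.+1 w) + n%:R * q))))%C = cf1 p q ^+ n.
Proof.
elim: n => [|n ih].
  rewrite expr0; apply/eqP; rewrite eq_complex/=; apply/andP; split; apply/eqP.
    rewrite -[RHS](Ex_cst P); congr Ex; apply/funext => w.
    by rewrite big_ord0 mulr0 mul0r addr0 cos0.
  rewrite -[RHS](Ex_cst P); congr Ex; apply/funext => w.
  by rewrite big_ord0 mulr0 mul0r addr0 sin0.
rewrite exprSr -{}ih /cf1.
have e1 (x : T -> R) : (fun w => p * (\sum_(k < n.+1) Zs k.+1 w) + n.+1%:R * q) =
    (fun w => (p * (\sum_(k < n) Zs k.+1 w) + n%:R * q) + (p * Zs n.+1 w + q)).
  by apply/funext => w; rewrite big_ord_recr/= -natr1; ring.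
have I (f : R -> R) : (forall x, `|f x| <= 1) -> exists M, forall x, `|f x| <= M by move=> h; exists 1.
have bm (f : R -> R) : continuous f -> (forall x, `|f x| <= 1) ->
    bmf (fun w => f (\sum_(k < n) Zs k.+1 w)).
  by move=> cf f1; apply: (bmf_ccomp (f := fun w => _) _ cf f1); exact: measurable_sumZ.
have bm1 (f : R -> R) : continuous f -> (forall x, `|f x| <= 1) ->
    bmf (fun w => f (Zs n.+1 w)).
  by move=> cf f1; apply: (bmf_ccomp (f := fun w => _) _ cf f1).
have HI (f g : R -> R) : continuous f -> continuous g -> (forall x, `|f x| <= 1) ->
   (forall x, `|g x| <= 1) ->
   Ex P (fun w => f (\sum_(k < n) Zs k.+1 w) * g (Zs n.+1 w)) =
  Ex P (fun w => f (\sum_(k < n) Zs k.+1 w)) * Ex P (fun w => g (Z w)).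
  move=> cf cg f1 g1; rewrite Hprod//; [|exact: I|exact: I].
  by rewrite (@Hid n g)//; [exact: continuous_measurable_fun|exact: I].
have c1 := @ccos p (n%:R * q); have c2 := @csin p (n%:R * q).
have c3 := @ccos p q; have c4 := @csin p q.
have b1 := @bcos p (n%:R * q); have b2 := @bsin p (n%:R * q).
have b3 := @bcos p q; have b4 := @bsin p q.
apply/eqP; rewrite eq_complex/=; apply/andP; split; apply/eqP.
  rewrite -(HI _ _ c1 c3 b1 b3) -(HI _ _ c2 c4 b2 b4) -ExB.
  - congr Ex; apply/funext => w; rewrite -cosD; congr cos.
    by rewrite big_ord_recr/= -natr1; ring.
  - exact: (bmfM (bm _ c1 b1) (bm1 _ c3 b3)).
  - exact: (bmfM (bm _ c2 b2) (bm1 _ c4 b4)).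
rewrite -(HI _ _ c1 c4 b1 b4) -(HI _ _ c2 c3 b2 b3) -ExD.
- congr Ex; apply/funext => w; rewrite [RHS]addrC -sinD; congr sin.
  by rewrite big_ord_recr/= -natr1; ring.
- exact: (bmfM (bm _ c1 b1) (bm1 _ c4 b4)).
- exact: (bmfM (bm _ c2 b2) (bm1 _ c3 b3)).
Qed.

Let bZ (f : R -> R) : continuous f -> (exists M, forall x, `|f x| <= M) ->
  bmf (fun w => f (Z w)).
Proof. by move=> cf [M fM]; apply: (bmf_ccomp (f := fun w => _) _ cf fM); exact: mZ. Qed.

Lemma cf1_le1 p q : Normc.normc (cf1 p q) <= 1.
Proof.
rewrite /cf1 /= -(sqrtr1 R) ler_wsqrtr//.
have b1 := bZ (@ccos p q) (ex_intro _ 1 (@bcos p q)).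
have b2 := bZ (@csin p q) (ex_intro _ 1 (@bsin p q)).
rewrite (le_trans (lerD (Ex_sqr P b1) (Ex_sqr P b2)))// -ExD; [|exact: bmfX|exact: bmfX].
rewrite (_ : (fun x => _) = fun=> 1) ?Ex_cst//.
by apply/funext => w; rewrite cos2Dsin2.
Qed.

Variables (al c be ga : R) (a : nat -> R).
Hypothesis al0 : 0 < al.
Hypothesis c0 : 0 < c.
Hypothesis be1 : -1 <= be <= 1.
Hypothesis apos : forall n, 0 < a n.
Hypothesis ainf : a n @[n --> \oo] --> +oo.
Hypothesis aeq : exists n0, forall n, (n0 <= n)%N -> a n ^+ 2 = n%:R * tv P Z (a n).
Hypothesis tvinf : forall B, exists2 A, 0 < A & forall x, A <= x -> B <= tv P Z x.
Hypothesis Hcos : forall t, n%:R * Ex P (fun w => 1 - cos (t * (Z w / a n))) @[n --> \oo] -->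
  c * `|t| `^ al.
Hypothesis Hsin : forall t, n%:R * Ex P (fun w => sin (t * (Z w / a n)) - t * sin (Z w / a n))
  @[n --> \oo] --> stable_phase al c be ga t.
Hypothesis Htail : forall e, 0 < e -> exists2 M, 1 <= M & exists N, forall n, (N <= n)%N ->
  n%:R * fine (P [set w | M * a n < `|Z w|]) <= e.

Lemma norming_square : forall e, 0 < e -> exists N, forall n, (N <= n)%N ->
  n%:R <= e * a n ^+ 2.
Proof.
move=> e e0; have [n0 Hn0] := aeq; have [A A0 HA] := tvinf e^-1.
move/cvgryPge : (ainf) => /(_ A) [N _ HN].
exists (maxn n0 N) => n; rewrite geq_max => /andP[n1 n2].
have /HA h := HN n n2; rewrite Hn0// mulrCA ler_peMr//.
by rewrite -ler_pdivrMl// mulr1.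
Qed.

(** Split at a fixed level s. Where |Z| <= s the sine is at most s / a_n, and n / a_n^2 tends to 0
    by [norming_square]. Elsewhere Cauchy-Schwarz pairs n E min(|Z| / a_n, 1)^2 = 1 with the small
    probability of |Z| > s. *)
Lemma centering_small : n%:R * m (a n) ^+ 2 @[n --> \oo] --> (0 : R).
Proof.
apply: cvgn_le => e e0; have e4 : 0 < e / 4 by rewrite divr_gt0.
have [s s0 Hs] := tail_small P (mZ 0) e4.
have s2 : 0 < e / (4 * s ^+ 2) by rewrite divr_gt0// mulr_gt0// exprn_gt0.
have [N1 H1] := norming_square s2; have [n0 Hn0] := aeq.
exists (maxn 1 (maxn N1 n0)) => n; rewrite !geq_max => /and3P[n1 n2 n3].
have an := apos n; have nn : 0 < n%:R :> R by rewrite ltr0n.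
have h0 : 0 <= n%:R * m (a n) ^+ 2 by rewrite mulr_ge0// sqr_ge0.
rewrite subr0 (ger0_norm h0).
have mA := mgt s (mabs (mZ 0)).
pose f := fun w => (a n)^-1 * Num.min `|Z w| (a n).
have bf : bmf f by apply: bmfZ; apply: bmf_trunc; exact: mZ.
pose B : T -> R := \1_[set w | s < `|Z w|].
have bB : bmf B by exact: bmf_indic.
have fE w : f w = Num.min (`|Z w| / a n) 1.
  by rewrite /f minr_pMr ?invr_ge0 ?(ltW an)// mulVf ?gt_eqF// mulrC.
have sinm w : `|sin (Z w / a n)| <= f w.
  rewrite fE le_min; apply/andP; split.
    by rewrite (le_trans (sin_norm_le _))// normrM [`|(a n)^-1|]gtr0_norm ?invr_gt0.
  by rewrite ler_norml sin_geN1 sin_le1.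
have bs : bmf (fun w => sin (Z w / a n)).
  have mZa : measurable_fun [set: T] (fun w => Z w / a n).
    by apply: measurable_funM => //; exact: mZ.
  apply: (bmf_ccomp (M := 1) mZa (@continuous_sin R)) => x.
  by rewrite ler_norml sin_geN1 sin_le1.
have mle : `|m (a n)| <= s / a n + Ex P (fun w => f w * B w).
  rewrite (le_trans (Ex_norm P bs))// -(Ex_cst P (s / a n)) -ExD; [|exact: bmf_cst|exact: bmfM].
  apply: le_Ex; [exact: bmf_norm|by apply: bmfD; [exact: bmf_cst|exact: bmfM]|move=> w].
  rewrite (le_trans (sinm w))// /B indicE.
  have [h|h] := leP `|Z w| s; last by rewrite mem_set// mulr1 lerDr divr_ge0// ltW.
  rewrite memNset/=; last by apply/negP; rewrite -leNgt.
  by rewrite mulr0 addr0 fE ge_min ler_wpM2r ?invr_ge0 ?(ltW an).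
have CS := Ex_CS P bf bB.
have Ef2 : n%:R * Ex P (fun w => f w ^+ 2) = 1.
  rewrite (_ : (fun w => _) = fun w => (a n ^+ 2)^-1 * Num.min `|Z w| (a n) ^+ 2); last first.
    by apply/funext => w; rewrite exprMn exprVn.
  rewrite ExZ; last exact/bmf_tv/mZ.
  rewrite -/(tv P Z (a n)) mulrCA -Hn0// mulVf// gt_eqF// exprn_gt0//.
have EB : Ex P (fun w => B w ^+ 2) <= e / 4.
  rewrite (_ : (fun w => _) = B) ?Ex_indic//.
  by apply/funext => w; rewrite /B indicE; case: (_ \in _); rewrite ?expr1n ?expr0n.
set X := Ex P (fun w => f w * B w) in mle CS.
have h1 : m (a n) ^+ 2 <= 2 * (s / a n) ^+ 2 + 2 * X ^+ 2.
  have : m (a n) ^+ 2 <= (s / a n + X) ^+ 2.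
    rewrite -[leLHS]real_normK ?num_real// lerXn2r ?nnegrE//.
    exact: le_trans mle.
  have := sqr_ge0 (s / a n - X); lra.
have h2 : n%:R * (s / a n) ^+ 2 <= e / 4.
  have := H1 n n2; have -> : n%:R * (s / a n) ^+ 2 = n%:R * s ^+ 2 / a n ^+ 2.
    by field; rewrite gt_eqF.
  rewrite [n%:R * s ^+ 2 / _ <= _]ler_pdivrMr ?exprn_gt0//.
  have -> : e / (4 * s ^+ 2) * a n ^+ 2 = (e / 4 * a n ^+ 2) / s ^+ 2 by field; rewrite gt_eqF.
  by rewrite ler_pdivlMr ?exprn_gt0.
have h3 : n%:R * X ^+ 2 <= e / 4.
  by rewrite (le_trans (ler_wpM2l (ltW nn) CS))// mulrA Ef2 mul1r.
have := ler_wpM2l (ltW nn) h1; lra.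
Qed.

Let Y n w := \sum_(k < n) (Zs k.+1 w / a n - m (a n)).

Let YE n w : Y n w = (a n)^-1 * \sum_(k < n) Zs k.+1 w + n%:R * - m (a n).
Proof.
rewrite /Y sumrB sumr_const card_ord -[in LHS]mulr_natl mulrN; congr (_ - _).
by rewrite mulr_sumr; apply: eq_bigr => k _; rewrite mulrC.
Qed.

Let mY n : measurable_fun [set: T] (Y n).
Proof.
rewrite (_ : Y n = fun w => (a n)^-1 * \sum_(k < n) Zs k.+1 w + n%:R * - m (a n)).
  apply: measurable_funD => //; apply: measurable_funM => //; exact: measurable_sumZ.
by apply/funext => w; rewrite YE.
Qed.

Let mZa n : measurable_fun [set: T] (fun w => Z w / a n).
Proof. by apply: measurable_funM => //; exact: mZ. Qed.

Let b_sin t n : bmf (fun w => sin (t * (Z w / a n))).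
Proof.
apply: (bmf_ccomp (M := 1) (mZa n) (@continuous_sinM R t)) => x.
by rewrite ler_norml sin_geN1 sin_le1.
Qed.

Let b_cos t n : bmf (fun w => cos (t * (Z w / a n))).
Proof.
apply: (bmf_ccomp (M := 1) (mZa n) (@continuous_cosM R t)) => x.
by rewrite ler_norml cos_geN1 cos_le1.
Qed.

Lemma cvg_m : m (a n) @[n --> \oo] --> (0 : R).
Proof.
apply: cvgn_le => e e0; have e2 : 0 < e ^+ 2 by rewrite exprn_gt0.
have [N HN] := cvgn_leP centering_small e2.
exists (maxn 1 N) => n; rewrite geq_max => /andP[n1 n2].
have h0 : 0 <= n%:R * m (a n) ^+ 2 by rewrite mulr_ge0// sqr_ge0.
have := HN n n2; rewrite !subr0 (ger0_norm h0) => h.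
have : m (a n) ^+ 2 <= e ^+ 2.
  by rewrite (le_trans _ h)// ler_peMl ?sqr_ge0// ler1n.
rewrite -[m (a n) ^+ 2]real_normK ?num_real// => h2.
by rewrite -(@ler_pXn2r _ 2) ?nnegrE// ltW.
Qed.

Let w_ t n := cf1 (t / a n) (- (t * m (a n))).

(** Centering multiplies the characteristic function by exp(- i t m). Apart from the expected
    limits, what remains are products of t m with itself or with quantities of order 1 / n; after
    multiplication by n they are controlled by n m^2 and by |m|, which vanish. *)
Lemma cvg_w t : n%:R * (1 - complex.Re (w_ t n)) @[n --> \oo] --> c * `|t| `^ al /\
  n%:R * complex.Im (w_ t n) @[n --> \oo] --> stable_phase al c be ga t.
Proof.
pose p n := 1 - Ex P (fun w => cos (t * (Z w / a n))).
pose q n := Ex P (fun w => sin (t * (Z w / a n))).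
have Hp : n%:R * p n @[n --> \oo] --> c * `|t| `^ al.
  have H := @Hcos t; refine (cvgn_eq (N := 0) _ H) => n _.
  by rewrite ExB ?Ex_cst//; exact: bmf_cst.
have Hq : n%:R * (q n - t * m (a n)) @[n --> \oo] --> stable_phase al c be ga t.
  have H := @Hsin t; refine (cvgn_eq (N := 0) _ H) => n _.
  have bs1 : bmf (fun w => sin (Z w / a n)).
    have := b_sin 1 n; congr bmf; apply/funext => w; by rewrite mul1r.
  by rewrite ExB ?ExZ//; exact: bmfZ.
have p1 n : `|1 - p n| <= 1.
  rewrite /p opprB addrC subrK (le_trans (Ex_norm P (b_cos t n)))//.
  apply: Ex_le_cst; first exact: bmf_norm.
  by move=> w; rewrite ler_norml cos_geN1 cos_le1.
have p0 n : 0 <= p n.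
  by rewrite /p subr_ge0; apply: Ex_le_cst => // w; exact: cos_le1.
have q1 n : `|q n| <= 1.
  rewrite (le_trans (Ex_norm P (b_sin t n)))//.
  apply: Ex_le_cst; first exact: bmf_norm.
  by move=> w; rewrite ler_norml sin_geN1 sin_le1.
have E n : complex.Re (w_ t n) = (1 - p n) * cos (t * m (a n)) + q n * sin (t * m (a n)) /\
    complex.Im (w_ t n) = q n * cos (t * m (a n)) - (1 - p n) * sin (t * m (a n)).
  have e0 (w : T) : t / a n * Z w = t * (Z w / a n) by ring.
  have -> : 1 - p n = Ex P (fun w => cos (t * (Z w / a n))) by rewrite /p; ring.
  rewrite /w_ /cf1 /= /q; split.
    rewrite (_ : (fun w => _) = (fun w => cos (t * m (a n)) * cos (t * (Z w / a n)) +
      sin (t * m (a n)) * sin (t * (Z w / a n)))).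
      by rewrite ExD ?ExZ//; [ring|exact: bmfZ|exact: bmfZ].
    by apply/funext => w; rewrite e0 cosD cosN sinN; ring.
  rewrite (_ : (fun w => _) = (fun w => cos (t * m (a n)) * sin (t * (Z w / a n)) -
    sin (t * m (a n)) * cos (t * (Z w / a n)))).
    by rewrite ExB ?ExZ//; [ring|exact: bmfZ|exact: bmfZ].
  by apply/funext => w; rewrite e0 sinD cosN sinN; ring.
have am : `|t| * `|m (a n)| @[n --> \oo] --> (0 : R).
  rewrite -(mulr0 `|t|); apply: cvgMl_tmp.
  by have h := cvg_norm cvg_m; rewrite normr0 in h; exact: h.
have mm : 2 * t ^+ 2 * (n%:R * m (a n) ^+ 2) @[n --> \oo] --> (0 : R).
  by rewrite -(mulr0 (2 * t ^+ 2)); apply: cvgMl_tmp; exact: centering_small.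
have squeeze (u v b : nat -> R) (l : R) : u n @[n --> \oo] --> l ->
    b n @[n --> \oo] --> (0 : R) -> (forall n, `|v n - u n| <= b n) -> v n @[n --> \oo] --> l.
  move=> Hu Hb uv; apply: cvgn_le => e e0; have e2 : 0 < e / 2 by rewrite divr_gt0.
  have [N1 H1] := cvgn_leP Hu e2; have [N2 H2] := cvgn_leP Hb e2.
  exists (maxn N1 N2) => n; rewrite geq_max => /andP[/H1 h1 /H2].
  rewrite subr0 => h2; have h3 := uv n; have h4 := ler_norm (b n).
  have := ler_normD (v n - u n) (u n - l); rewrite addrA subrK; lra.
split.
  apply: (squeeze _ _ (fun n => 2 * t ^+ 2 * (n%:R * m (a n) ^+ 2) +
      `|n%:R * (q n - t * m (a n))| * (`|t| * `|m (a n)|)) _ Hp).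
    rewrite -(addr0 0) -[X in _ --> _ + X](mulr0 `|stable_phase al c be ga t|).
    by apply: cvgD => //; apply: cvgM => //; apply: cvg_norm.
  move=> n; have [-> _] := E n.
  set s := t * m (a n); have nn := ler0n R n.
  have [h1 [h2 _]] := cos_sub1 s; have h3 := sin_norm_le s.
  have -> : n%:R * (1 - ((1 - p n) * cos s + q n * sin s)) - n%:R * p n =
    n%:R * ((1 - p n) * (1 - cos s) - (q n - s) * sin s - s * sin s) by ring.
  rewrite normrM (ger0_norm nn).
  have -> : 2 * t ^+ 2 * (n%:R * m (a n) ^+ 2) + `|n%:R * (q n - s)| * (`|t| * `|m (a n)|) =
    n%:R * (s ^+ 2 + `|q n - s| * `|s| + s ^+ 2).
    by rewrite normrM (ger0_norm nn) /s normrM; ring.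
  rewrite ler_wpM2l// (le_trans (ler_normB _ _))// lerD//; last first.
    by rewrite normrM -[leRHS]real_normK ?num_real// expr2 ler_wpM2l.
  rewrite (le_trans (ler_normB _ _))// lerD//; last by rewrite normrM ler_wpM2l.
  by rewrite normrM (le_trans _ h2)// (ger0_norm h1) ler_piMl.
apply: (squeeze _ _ (fun n => 2 * t ^+ 2 * (n%:R * m (a n) ^+ 2) +
    (n%:R * p n) * (`|t| * `|m (a n)|)) _ Hq).
  rewrite -(addr0 0) -[X in _ --> _ + X](mulr0 (c * `|t| `^ al)).
  by apply: cvgD => //; exact: cvgM.
move=> n; have [_ ->] := E n.
set s := t * m (a n); have nn := ler0n R n.
have [h1 [h2 _]] := cos_sub1 s; have h3 := sin_subid s.
have -> : n%:R * (q n * cos s - (1 - p n) * sin s) - n%:R * (q n - s) =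
  n%:R * (- (q n * (1 - cos s)) - (1 - p n) * (sin s - s) + p n * s) by ring.
rewrite normrM (ger0_norm nn).
have -> : 2 * t ^+ 2 * (n%:R * m (a n) ^+ 2) + n%:R * p n * (`|t| * `|m (a n)|) =
  n%:R * (s ^+ 2 + s ^+ 2 + p n * `|s|).
  by rewrite /s normrM; ring.
rewrite ler_wpM2l// (le_trans (ler_normD _ _))// lerD//; last first.
  by rewrite normrM (ger0_norm (p0 n)).
rewrite (le_trans (ler_normB _ _))// lerD//.
  by rewrite normrN normrM (le_trans _ h2)// (ger0_norm h1) ler_piMl.
by rewrite normrM (le_trans _ h3)// ler_piMl.
Qed.

Let YwE t n w : t * Y n w = t / a n * (\sum_(k < n) Zs k.+1 w) + n%:R * - (t * m (a n)).
Proof. by rewrite YE; ring. Qed.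

Lemma cvg_cosY t : Ex P (fun w => cos (t * Y n w)) @[n --> \oo] -->
    expR (- (c * `|t| `^ al)) * cos (stable_phase al c be ga t) /\
  Ex P (fun w => sin (t * Y n w)) @[n --> \oo] -->
    expR (- (c * `|t| `^ al)) * sin (stable_phase al c be ga t).
Proof.
have A0 : 0 <= c * `|t| `^ al by rewrite mulr_ge0 ?(ltW c0) ?powR_ge0.
have [H1 H2] := cvg_w t.
have [H3 H4] := cvg_complex_pow A0 (fun n => cf1_le1 _ _) H1 H2.
have e n : (w_ t n) ^+ n = (Ex P (fun w => cos (t * Y n w)) +i* Ex P (fun w => sin (t * Y n w)))%C.
  rewrite /w_ -cf_sum; apply/eqP; rewrite eq_complex/=; apply/andP; split; apply/eqP;
    by congr Ex; apply/funext => w; rewrite YwE.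
split; [refine (cvgn_eq (N := 0) _ H3) => n _|refine (cvgn_eq (N := 0) _ H4) => n _];
  by rewrite /= e.
Qed.

Let Pid k u : fine (P [set w | u < `|Zs k.+1 w|]) = fine (P [set w | u < `|Z w|]).
Proof.
have mB : measurable [set x : R | u < `|x|].
  by apply: mset_lt; [exact: measurable_cst|apply: mabs; exact: measurable_id].
have := @Hid k (\1_[set x : R | u < `|x|]).
have mk j : measurable [set w | u < `|Zs j.+1 w|] by apply: mgt; exact: mabs.
have e j : (fun w => \1_[set x : R | u < `|x|] (Zs j.+1 w) : R) =
    \1_[set w | u < `|Zs j.+1 w|].
  by apply/funext => w; rewrite !indicE.
rewrite !e !Ex_indic//; apply.
  exact: measurable_indic.
by exists 1 => x; rewrite indicE ger0_norm ?lern1 ?leq_b1.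
Qed.

(** Y n splits into centred sines, pairwise uncorrelated with total variance at most 1, and
    remainders x - sin x, which for |x| <= M are at most (M + 2) min(|x|, 1)^2, with total mean M +
    2. The event that some |Z_k| exceeds M a_n is discarded. *)
Lemma tightY e : 0 < e -> exists K : R, exists N, forall n,
  (N <= n)%N -> fine (P [set w | K < `|Y n w|]) <= e.
Proof.
move=> e0; have e3 : 0 < e / 3 by rewrite divr_gt0.
have [M M1 [N1 HM]] := Htail e3; have [n0 Hn0] := aeq.
have M20 : 0 < M + 2 by lra.
(* The term 12 / e, with K >= 1, serves Chebyshev's bound for the sines, and 6 (M + 2) / e Markov's
   bound for the remainders; each leaves e / 3. *)
pose K := 1 + 6 * (M + 2) / e + 12 / e.
have ie : 0 < 12 / e by rewrite divr_gt0.
have iM : 0 < 6 * (M + 2) / e by rewrite divr_gt0// mulr_gt0.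
have K1 : 1 <= K by rewrite /K; lra.
have K0 : 0 < K by lra.
exists K, (maxn 1 (maxn N1 n0)) => n; rewrite !geq_max => /and3P[n1 n2 n3].
have an := apos n; have nn : 0 < n%:R :> R by rewrite ltr0n.
have tva : n%:R * ((a n ^+ 2)^-1 * tv P Z (a n)) = 1.
  by rewrite mulrCA -Hn0// mulVf// gt_eqF// exprn_gt0.
pose sk k w := sin (Zs k.+1 w / a n).
pose rho (x : R) := (M + 2) * Num.min `|x| 1 ^+ 2.
have crho : continuous rho.
  apply: continuous_cmul => x.
  apply: (@continuous_comp _ _ _ (fun x : R => Num.min `|x| 1) (fun z => z ^+ 2)).
    by apply: continuous_min; [exact: norm_continuous|exact: cst_continuous].
  exact: exprn_continuous.
have m1 (x : R) : 0 <= Num.min `|x| 1 <= 1 by rewrite le_min normr_ge0 ge_min lexx orbT ler01.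
have m2 (x : R) : 0 <= Num.min `|x| 1 ^+ 2 <= 1.
  by have /andP[h1 h2] := m1 x; rewrite sqr_ge0 expr_le1.
have brho x : `|rho x| <= M + 2.
  have /andP[h1 h2] := m2 x; rewrite /rho ger0_norm ?mulr_ge0 ?(ltW M20)//.
  by rewrite ler_piMr// ltW.
have cdiv (f : R -> R) : continuous f -> continuous (fun x : R => f (x / a n)).
  move=> cf x; apply: (@continuous_comp _ _ _ (fun x : R => x / a n) f); last exact: cf.
  by apply: cvgMr_tmp; exact: cvg_id.
have mZk k : measurable_fun [set: T] (fun w => Zs k.+1 w / a n).
  by apply: measurable_funM => //; exact: mZ.
have bs k : bmf (sk k).
  apply: (bmf_ccomp (M := 1) (mZk k) (@continuous_sin R)) => x.
  by rewrite ler_norml sin_geN1 sin_le1.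
have br k : bmf (fun w => rho (Zs k.+1 w / a n)) := bmf_ccomp (mZk k) crho brho.
have rhoE : (fun w => rho (Z w / a n)) = (fun w => (M + 2) * ((a n ^+ 2)^-1 * Num.min `|Z w| (a n) ^+ 2)).
  apply/funext => w; rewrite /rho; congr (_ * _).
  rewrite -exprVn -exprMn minr_pMr ?invr_ge0 ?(ltW an)// mulVf ?gt_eqF//.
  by rewrite normrM [`|(a n)^-1|]gtr0_norm ?invr_gt0// [(a n)^-1 * _]mulrC.
have bt := bmf_tv (a n) (mZ 0).
have Erho k : Ex P (fun w => rho (Zs k.+1 w / a n)) = (M + 2) * ((a n ^+ 2)^-1 * tv P Z (a n)).
  rewrite (@Hid k (fun x => rho (x / a n))).
  - by rewrite rhoE ExZ ?ExZ//; exact: bmfZ.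
  - by apply: continuous_measurable_fun; exact: cdiv.
  - by exists (M + 2) => x; exact: brho.
pose A1 := \big[setU/set0]_(k < n) [set w | M * a n < `|Zs k.+1 w|].
pose S1 w := \sum_(k < n) (sk k w - m (a n)).
pose S2 w := \sum_(k < n) rho (Zs k.+1 w / a n).
have bS1 : bmf S1 by apply: bmf_sum => k _; apply: bmfB => //; exact: bmf_cst.
have bS2 : bmf S2 by apply: bmf_sum => k _.
have mS2 : measurable [set w | K / 2 < S2 w] by apply: mgt; case: bS2.
have mS1 : measurable [set w | K / 2 < `|S1 w|] by apply/mgt/mabs; case: bS1.
have mAk k : measurable [set w | M * a n < `|Zs k.+1 w|] by apply: mgt; exact: mabs.
have mA1 : measurable A1 by apply: bigsetU_measurable.
have sub : [set w | K < `|Y n w|] `<=` A1 `|` ([set w | K / 2 < `|S1 w|] `|` [set w | K / 2 < S2 w]).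
  move=> w /= hY; have [hA|hA] := pselect (A1 w); [by left|right].
  have hk (k : 'I_n) : `|Zs k.+1 w / a n| <= M.
    rewrite normrM [`|(a n)^-1|]gtr0_norm ?invr_gt0// ler_pdivrMr// leNgt.
    apply/negP => h; apply: hA; rewrite /A1 -(bigcup_mkord n (fun k => [set w | M * a n < `|Zs k.+1 w|])); exists k => //=.
  have hr (k : 'I_n) : `|Zs k.+1 w / a n - sk k w| <= rho (Zs k.+1 w / a n).
    rewrite /sk /rho; set x := Zs k.+1 w / a n; have := hk k; rewrite -/x => xM.
    have [h|h] := leP `|x| 1.
      rewrite distrC (le_trans (sin_subid x))// real_normK ?num_real// ler_peMl ?sqr_ge0//.
      by lra.
    rewrite expr1n mulr1 (le_trans (ler_normB _ _))//.
    have : `|sin x| <= 1 by rewrite ler_norml sin_geN1 sin_le1.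
    lra.
  have hYS : `|Y n w| <= `|S1 w| + S2 w.
    have -> : Y n w = S1 w + \sum_(k < n) (Zs k.+1 w / a n - sk k w).
      by rewrite /S1 /Y -big_split/=; apply: eq_bigr => k _; ring.
    rewrite (le_trans (ler_normD _ _))// lerD2l (le_trans (ler_norm_sum _ _ _))//.
    exact: ler_sum.
  have [h|h] := ltP (K / 2) `|S1 w|; [by left|right => /=].
  lra.
rewrite (le_trans (le_Pr P _ _ sub))//.
- by apply/mgt/mabs; exact: mY.
- by apply: measurableU => //; exact: measurableU.
rewrite (le_trans (PrU _ _ _))//; first exact: measurableU.
have PA : fine (P A1) <= e / 3.
  rewrite (le_trans (Pr_bigU P n (fun k => mAk k)))//.
  under eq_bigr do rewrite Pid.
  by rewrite sumr_const card_ord; have := HM n n2; rewrite mulr_natl.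
have ES1 : Ex P (fun w => S1 w ^+ 2) <= 1.
  rewrite (@Ex_sum_sqr _ _ _ P (fun k w => sk k w - m (a n))).
  - rewrite -tva mulr_natl -[X in _ *+ X]card_ord -sumr_const; apply: ler_sum => k _.
    have bk := bs k.
    have Ek : Ex P (sk k) = m (a n).
      rewrite /sk (@Hid k (fun x => sin (x / a n)))//.
        by apply: continuous_measurable_fun; apply: (cdiv sin); exact: continuous_sin.
      by exists 1 => x; rewrite ler_norml sin_geN1 sin_le1.
    rewrite (_ : (fun w => _) = (fun w => sk k w ^+ 2 - (2 * m (a n)) * sk k w + m (a n) ^+ 2)); last first.
      by apply/funext => w; ring.
    rewrite ExD; [|by apply: bmfB; [exact: bmfX|exact: bmfZ]|exact: bmf_cst].
    rewrite ExB; [|exact: bmfX|exact: bmfZ].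
    rewrite ExZ// Ek Ex_cst.
    have h1 : Ex P (fun w => sk k w ^+ 2) <= (a n ^+ 2)^-1 * tv P Z (a n).
      rewrite -ExZ// /sk (@Hid k (fun x => sin (x / a n) ^+ 2))//.
      - apply: le_Ex; [exact: (bmfX 2 (bs 0))|exact: bmfZ|move=> w].
        rewrite -exprVn -exprMn -[leLHS]real_normK ?num_real// lerXn2r ?nnegrE//.
          by rewrite mulr_ge0 ?invr_ge0 ?(ltW an)// le_min normr_ge0 (ltW an).
        rewrite minr_pMr ?invr_ge0 ?(ltW an)// mulVf ?gt_eqF// le_min.
        rewrite (ler_norml _ 1) sin_geN1 sin_le1 andbT (le_trans (sin_norm_le _))//.
        by rewrite normrM [`|(a n)^-1|]gtr0_norm ?invr_gt0// [(a n)^-1 * _]mulrC.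
      - apply: continuous_measurable_fun; apply: (cdiv (fun x => sin x ^+ 2)) => x.
        apply: (@continuous_comp _ _ _ sin (fun z : R => z ^+ 2)); first exact: continuous_sin.
        exact: exprn_continuous.
      - exists (1 : R); move=> y; have h1 := sin_geN1 y; have h2 := sin_le1 y.
        by rewrite ger0_norm ?sqr_ge0//; nra.
    have := sqr_ge0 (m (a n)); rewrite expr2; lra.
  - by move=> k; apply: bmfB => //; exact: bmf_cst.
  move=> j k jk.
  have cs : continuous (fun x : R => sin (x / a n) - m (a n)).
    move=> x; apply: cvgB; last exact: cvg_cst.
    by apply: (cdiv sin); exact: continuous_sin.
  have bds : exists B, forall x : R, `|sin (x / a n) - m (a n)| <= B.
    exists (1 + `|m (a n)|) => x; rewrite (le_trans (ler_normB _ _))// lerD2r.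
    by rewrite ler_norml sin_geN1 sin_le1.
  rewrite (Hpair jk cs cs bds bds).
  have -> : Ex P (fun w => sin (Zs j.+1 w / a n) - m (a n)) = 0.
    rewrite (@Hid j (fun x => sin (x / a n) - m (a n)))//; last exact: continuous_measurable_fun.
    rewrite ExB ?Ex_cst ?subrr//; [exact: (bs 0)|exact: bmf_cst].
  by rewrite mul0r.
have K20 : 0 < K / 2 by rewrite divr_gt0.
have PS1 : fine (P [set w | K / 2 < `|S1 w|]) <= e / 3.
  have := Ex_markov P (c := (K / 2) ^+ 2) (bmfX 2 bS1) (fun w => sqr_ge0 (S1 w)) mS1.
  move=> /(_ _)/le_trans; have hm w : [set w | K / 2 < `|S1 w|] w -> (K / 2) ^+ 2 <= S1 w ^+ 2.
    by move=> /= h; rewrite -[leRHS]real_normK ?num_real// lerXn2r ?nnegrE ?(ltW K20) ?(ltW h).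
  move=> /(_ _ hm ES1); rewrite -ler_pdivlMl ?exprn_gt0// mulr1 => /le_trans; apply.
  rewrite -[leRHS]invrK lef_pV2 ?posrE ?exprn_gt0 ?invr_gt0// invf_div.
  have : 12 / e <= K by rewrite /K; lra.
  have -> : 12 / e = 4 * (3 / e) by ring.
  have := ler_wpM2l (ltW K0) K1; rewrite expr_div_n mulr1 -expr2; lra.
have PS2 : fine (P [set w | K / 2 < S2 w]) <= e / 3.
  have S20 w : 0 <= S2 w.
    apply: sumr_ge0 => k _; rewrite /rho; apply: mulr_ge0; first exact: ltW.
    exact: sqr_ge0.
  have := Ex_markov P (c := K / 2) bS2 S20 mS2 (fun w h => ltW h).
  have -> : Ex P S2 = M + 2.
    rewrite Ex_sum//; under eq_bigr do rewrite Erho.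
    rewrite sumr_const card_ord -mulrnAr.
    by move: tva; rewrite mulr_natl => ->; rewrite mulr1.
  rewrite -ler_pdivlMl// => /le_trans; apply; rewrite mulrC ler_pdivrMr//.
  have : e / 3 * (6 * (M + 2) / e / 2) <= e / 3 * (K / 2).
    rewrite ler_wpM2l ?(ltW e3)// ler_pM2r//; rewrite /K; lra.
  have -> : e / 3 * (6 * (M + 2) / e / 2) = M + 2 by field; rewrite gt_eqF.
  by [].
have := PrU P mS1 mS2; lra.
Qed.

Theorem iid_stable_limit : exists2 mu : probability R R, stable_law al mu &
  forall f : R -> R, continuous f -> (exists M, forall x, `|f x| <= M) ->
  Ex P (fun w => f (Y n w)) @[n --> \oo] --> Ex mu f.
Proof.
have HY f : continuous f -> (exists M, forall x, `|f x| <= M) ->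
    cvg (Ex P (fun w => f (Y n w)) @[n --> \oo]).
  apply: cvg_Ex_of_cf => //; last exact: tightY.
    move=> t; apply/cvg_ex; exists (expR (- (c * `|t| `^ al)) * cos (stable_phase al c be ga t)).
    by have [] := cvg_cosY t.
  move=> t; apply/cvg_ex; exists (expR (- (c * `|t| `^ al)) * sin (stable_phase al c be ga t)).
  by have [] := cvg_cosY t.
have [mu Hmu] := weak_limit mY HY tightY.
exists mu => //; exists c, be, ga; split=> //; split=> // t.
have bc : exists M, forall x : R, `|cos (t * x)| <= M.
  by exists 1 => x; rewrite ler_norml cos_geN1 cos_le1.
have bs : exists M, forall x : R, `|sin (t * x)| <= M.
  by exists 1 => x; rewrite ler_norml sin_geN1 sin_le1.
have [h1 h2] := cvg_cosY t.
have bmc : bmf (fun x : R => cos (t * x)).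
  by split => //; apply: continuous_measurable_fun; exact: continuous_cosM.
have bms : bmf (fun x : R => sin (t * x)).
  by split => //; apply: continuous_measurable_fun; exact: continuous_sinM.
rewrite !ExE//; split; congr EFin.
  exact: (cvg_unique _ (Hmu _ (@continuous_cosM R t) bc) h1).
exact: (cvg_unique _ (Hmu _ (@continuous_sinM R t) bs) h2).
Qed.

End IidSum.

(** * Functions of disjoint sets of factors *)

Section Cylinders.
Context (d : measure_display) (T : measurableType d) (R : realType).
Variable P : probability T R.
Variables (q : nat) (X : nat -> T -> 'M[R]_q).
Hypothesis hiid : iid_mx P X.
Implicit Types (I J : set nat) (B : nat -> set 'M[R]_q).

Lemma mx_measurableT : mx_measurable [set: 'M[R]_q].
Proof. exact: (@measurableT _ (g_sigma_algebraType _)). Qed.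

Lemma mx_measurableI (A B : set 'M[R]_q) : mx_measurable A -> mx_measurable B ->
  mx_measurable (A `&` B).
Proof. exact: (@measurableI _ (g_sigma_algebraType _)). Qed.

(** Events fixed by finitely many factors with indices in [I], written with trivial conditions
    outside [I] and beyond some N: intersections then combine index by index, and independence
    becomes the product formula of [iid_mx]. *)
Definition cyl I : set (set T) := [set A | exists B : nat -> set 'M[R]_q,
  (forall n, mx_measurable (B n)) /\ (exists N, forall n, (N < n)%N -> B n = setT) /\
  (forall n, ~ I n -> B n = setT) /\
  A = \bigcap_(n in [set n | (1 <= n)%N]) (X n @^-1` B n)].

Let Xm n (B : set 'M[R]_q) : (1 <= n)%N -> mx_measurable B -> measurable (X n @^-1` B).
Proof. by case: hiid => + _; exact. Qed.

Let capE B N : (forall n, (N < n)%N -> B n = setT) ->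
  \bigcap_(n in [set n | (1 <= n)%N]) (X n @^-1` B n) =
  \big[setI/setT]_(n <- iota 1 N) (X n @^-1` B n).
Proof.
move=> BN; rewrite -bigcap_seq; apply/seteqP; split => w H n /=.
  by rewrite mem_iota => /andP[n1 _]; exact: H.
move=> n1; have [nN|Nn] := leqP n N; last by rewrite BN.
by apply: H => /=; rewrite mem_iota n1 add1n ltnS.
Qed.

Lemma cyl_measurable I : cyl I `<=` measurable.
Proof.
move=> A [B [mB [[N BN] [_ ->]]]]; apply: bigcap_measurable; first by exists 1%N.
by move=> n n1; exact: Xm.
Qed.

Lemma cylT I : cyl I setT.
Proof.
exists (fun=> setT); split; first by move=> _; exact: mx_measurableT.
split; first by exists 0%N.
by split=> //; apply/seteqP; split.
Qed.

Lemma cylI I : setI_closed (cyl I).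
Proof.
move=> A A' [B [mB [[N BN] [BI ->]]]] [B' [mB' [[N' BN'] [BI' ->]]]].
exists (fun n => B n `&` B' n); split; first by move=> n; exact: mx_measurableI.
split; first by exists (maxn N N') => n; rewrite gtn_max => /andP[h1 h2]; rewrite BN// BN'// setIT.
split; first by move=> n nI; rewrite BI// BI'// setIT.
by rewrite -bigcapI.
Qed.

Lemma cylS I J : I `<=` J -> cyl I `<=` cyl J.
Proof.
move=> IJ A [B [mB [BN [BI ->]]]]; exists B; do !split => //.
by move=> n nJ; apply: BI => /IJ.
Qed.

Let Pcyl B N : (forall n, mx_measurable (B n)) -> (forall n, (N < n)%N -> B n = setT) ->
  fine (P (\bigcap_(n in [set n | (1 <= n)%N]) (X n @^-1` B n))) =
  \prod_(n <- iota 1 N) fine (P (X n @^-1` B n)).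
Proof.
move=> mB BN; rewrite (capE BN); have [_ [H _]] := hiid; apply: H => //.
  exact: iota_uniq.
by apply/allP => n; rewrite mem_iota => /andP[].
Qed.

Lemma cyl_indep I J : (forall n, I n -> J n -> False) -> indep P (cyl I) (cyl J).
Proof.
move=> IJ; apply: indep_pi; try exact: cyl_measurable; try exact: cylI; try exact: cylT.
move=> A A' cA cA'.
have mA := cyl_measurable cA; have mA' := cyl_measurable cA'.
have mAA' := measurableI _ _ mA mA'.
rewrite (Pr_fine P mA) (Pr_fine P mA') (Pr_fine P mAA') -EFinM; congr EFin.
case: cA => [B [mB [[N BN] [BI ->]]]]; case: cA' => [B' [mB' [[N' BN'] [BI' ->]]]].
have h1 n : (maxn N N' < n)%N -> B n = setT by rewrite gtn_max => /andP[+ _]; exact: BN.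
have h2 n : (maxn N N' < n)%N -> B' n = setT by rewrite gtn_max => /andP[_]; exact: BN'.
rewrite -bigcapI (@Pcyl (fun n => B n `&` B' n) (maxn N N')); last 2 first.
- by move=> n; exact: mx_measurableI.
- by move=> n nN; rewrite h1// h2// setIT.
rewrite (Pcyl mB h1) (Pcyl mB' h2) -big_split/=; apply: eq_big_seq => n.
rewrite mem_iota => /andP[n1 _].
have [nI|nI] := pselect (I n).
  have -> : B' n = setT by apply: BI' => /(IJ _ nI).
  by rewrite setIT preimage_setT probability_setT mulr1.
by rewrite BI// setTI preimage_setT probability_setT mul1r.
Qed.

Lemma mx_entry (i j : 'I_q) (B : set R) : measurable B ->
  mx_measurable [set M : 'M[R]_q | B (M i j)].
Proof. by move=> mB; apply: sub_sigma_algebra; exists i, j, B. Qed.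

Lemma cyl_preimage I n (B : set 'M[R]_q) : (1 <= n)%N -> I n -> mx_measurable B ->
  cyl I (X n @^-1` B).
Proof.
move=> n1 nI mB; exists (fun m => if m == n then B else setT); split.
  by move=> m; case: eqP => // _; exact: mx_measurableT.
split; first by exists n => m nm; rewrite gtn_eqF.
split; first by move=> m; case: eqP => // ->.
apply/seteqP; split => w /=; last by move=> /(_ n n1); rewrite eqxx.
by move=> h m _ /=; case: eqP => // ->.
Qed.

Lemma entry_wrt I n i j : (1 <= n)%N -> I n -> meas_wrt (cyl I) (fun w => X n w i j).
Proof.
move=> n1 nI _ B mB; rewrite setTI; apply: sub_sigma_algebra.
exact: (cyl_preimage n1 nI (mx_entry i j mB)).
Qed.

Lemma meas_wrtS I J (f : T -> R) : I `<=` J -> meas_wrt (cyl I) f -> meas_wrt (cyl J) f.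
Proof.
move=> IJ mf _ B mB; have := mf measurableT B mB; rewrite !setTI.
by apply: sub_smallest2r; [exact: smallest_sigma_algebra|move=> A /(cylS IJ)].
Qed.

Lemma wrt_measurable I (f : T -> R) : meas_wrt (cyl I) f -> measurable_fun [set: T] f.
Proof. by apply: meas_wrtW; exact: cyl_measurable. Qed.

Lemma wrt_prod I J (f g : T -> R) : (forall n, I n -> J n -> False) ->
  meas_wrt (cyl I) f -> meas_wrt (cyl J) g ->
  (exists M, forall x, `|f x| <= M) -> (exists M, forall x, `|g x| <= M) ->
  Ex P (fun x => f x * g x) = Ex P f * Ex P g.
Proof.
by move=> /cyl_indep IJ mf mg bf bg; apply: (indep_Ex _ _ IJ) => //; exact: cyl_measurable.
Qed.

Definition mxfun (G : 'M[R]_q -> R) :=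
  measurable_fun [set: g_sigma_algebraType [set A : set 'M[R]_q |
    exists (i j : 'I_q) (B : set R), measurable B /\ A = [set M : 'M[R]_q | B (M i j)]]] G.

Lemma mxfun_entry i j : mxfun (fun M => M i j).
Proof. by move=> _ B mB; rewrite setTI; exact: mx_entry. Qed.

Lemma mxfun_wrt I n (G : 'M[R]_q -> R) : (1 <= n)%N -> I n -> mxfun G ->
  meas_wrt (cyl I) (fun w => G (X n w)).
Proof.
move=> n1 nI mG _ B mB; rewrite setTI; apply: sub_sigma_algebra.
apply: (@cyl_preimage I n (G @^-1` B)) => //.
by have := mG measurableT B mB; rewrite setTI.
Qed.

Lemma mxfun_law n (G : 'M[R]_q -> R) (B : set R) : (1 <= n)%N -> mxfun G -> measurable B ->
  P ((fun w => G (X n w)) @^-1` B) = P ((fun w => G (X 1%N w)) @^-1` B).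
Proof.
move=> n1 mG mB; case: hiid => _ [_ H]; apply: (H n (G @^-1` B)) => //.
by have := mG measurableT B mB; rewrite setTI.
Qed.

End Cylinders.

Lemma Ex_eq_law (d : measure_display) (T : measurableType d) (R : realType)
  (P : probability T R) (Y Y' : T -> R) (g : R -> R) :
  measurable_fun [set: T] Y -> measurable_fun [set: T] Y' ->
  (forall B, measurable B -> P (Y @^-1` B) = P (Y' @^-1` B)) ->
  measurable_fun [set: R] g -> (exists M, forall x, `|g x| <= M) ->
  Ex P (fun w => g (Y w)) = Ex P (fun w => g (Y' w)).
Proof.
move=> mY mY' YY' mg [M gM].
have bg (Z : T -> R) : measurable_fun [set: T] Z -> bmf (fun w => g (Z w)).
  by move=> mZ; apply: (bmf_comp (f := Z) mZ mg gM).
have ig (Z : T -> R) : measurable_fun [set: T] Z ->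
    P.-integrable (Z @^-1` setT) ((EFin \o g) \o Z).
  move=> mZ; rewrite preimage_setT.
  by have := bmf_integrable P (bg Z mZ).
have mEg : measurable_fun [set: R] (EFin \o g) by exact/measurable_EFinP.
apply: EFin_inj; rewrite -!ExE; [|exact: bg|exact: bg].
have h1 := integral_pushforward mY mEg (ig Y mY) measurableT.
have h2 := integral_pushforward mY' mEg (ig Y' mY') measurableT.
rewrite !preimage_setT in h1 h2.
transitivity (\int[pushforward P Y]_y (EFin \o g) y)%E; first by rewrite h1.
rewrite (eq_measure_integral (pushforward P Y')); first by rewrite h2.
by move=> A mA _; exact: YY'.
Qed.

(** * Nonnegative matrices *)

Section NonnegMatrices.
Variables (R : realType) (q : nat).
Hypothesis q0 : (0 < q)%N.
Implicit Types (A B M : 'M[R]_q) (u v r : 'I_q -> R) (h : R).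

Definition csum M (j : 'I_q) : R := \sum_i M i j.
Definition rsum M (i : 'I_q) : R := \sum_j M i j.

Lemma csum_gt0 M j : in_S M -> 0 < csum M j.
Proof.
move=> [M0 [_ Mc]]; have [i Mij] := Mc j.
by rewrite /csum (bigD1 i)//= ltr_pwDl// sumr_ge0.
Qed.

Lemma rsum_gt0 M i : in_S M -> 0 < rsum M i.
Proof.
move=> [M0 [Mr _]]; have [j Mij] := Mr i.
by rewrite /rsum (bigD1 j)//= ltr_pwDl// sumr_ge0.
Qed.

Lemma Nsum_csum M : Nsum M = \sum_j csum M j.
Proof. by rewrite /Nsum exchange_big. Qed.

Lemma Nsum_gt0 M : in_S M -> 0 < Nsum M.
Proof.
move=> SM; pose i0 : 'I_q := Ordinal q0.
rewrite /Nsum (bigD1 i0)//= ltr_pwDl ?rsum_gt0//.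
by apply: sumr_ge0 => i _; apply: ltW; exact: rsum_gt0.
Qed.

Lemma in_S1 : in_S (1%:M : 'M[R]_q).
Proof.
split; first by move=> i j; rewrite mxE ler0n.
by split => i; exists i; rewrite mxE eqxx.
Qed.

Lemma in_S_mul A B : in_S A -> in_S B -> in_S (A *m B).
Proof.
move=> [A0 [Ar Ac]] [B0 [Br Bc]]; split.
  by move=> i j; rewrite mxE sumr_ge0// => k _; rewrite mulr_ge0.
split.
  move=> i; have [k Aik] := Ar i; have [j Bkj] := Br k; exists j.
  rewrite mxE (bigD1 k)//= ltr_pwDl ?mulr_gt0// sumr_ge0// => l _.
  by rewrite mulr_ge0.
move=> j; have [k Bkj] := Bc j; have [i Aik] := Ac k; exists i.
rewrite mxE (bigD1 k)//= ltr_pwDl ?mulr_gt0// sumr_ge0// => l _.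
by rewrite mulr_ge0.
Qed.

Lemma csum_mul A B j : csum (A *m B) j = \sum_i csum A i * B i j.
Proof.
rewrite /csum; under eq_bigr do rewrite mxE.
by rewrite exchange_big; apply: eq_bigr => k _; rewrite mulr_suml.
Qed.

Lemma rsum_mul A B i : rsum (A *m B) i = \sum_j A i j * rsum B j.
Proof.
rewrite /rsum; under eq_bigr do rewrite mxE.
by rewrite exchange_big; apply: eq_bigr => k _; rewrite mulr_sumr.
Qed.

Lemma Nsum_mul A B : Nsum (A *m B) = \sum_j csum A j * rsum B j.
Proof.
rewrite Nsum_csum; under eq_bigr do rewrite csum_mul.
by rewrite exchange_big; apply: eq_bigr => k _; rewrite mulr_sumr.
Qed.

Lemma csum_le_Nsum A j : in_S A -> csum A j <= Nsum A.
Proof.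
move=> SA; rewrite Nsum_csum (bigD1 j)//= lerDl sumr_ge0// => i _.
exact/ltW/csum_gt0.
Qed.

Lemma rsum_le_Nsum A i : in_S A -> rsum A i <= Nsum A.
Proof.
move=> SA; rewrite /Nsum (bigD1 i)//= lerDl sumr_ge0// => k _.
by apply: ltW; exact: rsum_gt0.
Qed.

Lemma entry_le_Nsum A i j : in_S A -> A i j <= Nsum A.
Proof.
move=> SA; rewrite (le_trans _ (rsum_le_Nsum i SA))// /rsum (bigD1 j)//= lerDl.
by rewrite sumr_ge0// => k _; case: SA.
Qed.

Lemma Nsum_mul_le A B : in_S A -> in_S B -> Nsum (A *m B) <= Nsum A * Nsum B.
Proof.
move=> SA SB; rewrite Nsum_mul (Nsum_csum A) mulr_suml; apply: ler_sum => j _.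
by rewrite ler_wpM2l ?rsum_le_Nsum// ltW// csum_gt0.
Qed.

Lemma VminE M : exists2 i, Vmin M = rsum M i & forall k, Vmin M <= rsum M k.
Proof.
pose i0 : 'I_q := Ordinal q0.
case: (@arg_minP _ _ _ i0 xpredT (rsum M) isT) => i _ Hi.
have lb : lbound [set rsum M k | k in [set: 'I_q]] (rsum M i).
  by move=> _ [k _ <-]; exact: Hi.
have E : Vmin M = rsum M i.
  apply/eqP; rewrite eq_le; apply/andP; split.
    by apply: ge_inf; [exists (rsum M i)|exists i].
  by apply: lb_le_inf => //; exists (rsum M i), i.
by exists i => // k; rewrite E; exact: Hi.
Qed.

Lemma Vmin_gt0 M : in_S M -> 0 < Vmin M.
Proof. by move=> SM; have [i -> _] := VminE M; exact: rsum_gt0. Qed.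

Lemma Vmin_le_Nsum M : in_S M -> Vmin M <= Nsum M.
Proof. by move=> SM; have [i -> _] := VminE M; exact: rsum_le_Nsum. Qed.

Lemma Vmin_mul_le A M : in_S A -> in_S M -> Vmin M * Nsum A <= Nsum (A *m M).
Proof.
move=> SA SM; rewrite Nsum_mul (Nsum_csum A) mulr_sumr; apply: ler_sum => j _.
have [_ _ h] := VminE M.
by rewrite mulrC ler_wpM2l// ltW// csum_gt0.
Qed.

(* Defect of additivity of [ln (Nsum _)] when [A] multiplies [M] on the left. *)
Definition eta A M : R := ln (Nsum M) + ln (Nsum A) - ln (Nsum (A *m M)).

Definition Wrange M : R := ln (Nsum M) - ln (Vmin M).

(** Nsum of the product is the sum over j of csum A j times rsum M j, and each row sum of M lies
    between Vmin M and Nsum M. *)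
Lemma eta_itv A M : in_S A -> in_S M -> 0 <= eta A M <= Wrange M.
Proof.
move=> SA SM; have NA := Nsum_gt0 SA; have NM := Nsum_gt0 SM.
have NAM := Nsum_gt0 (in_S_mul SA SM); have V0 := Vmin_gt0 SM.
rewrite /eta /Wrange; apply/andP; split.
  by rewrite subr_ge0 -lnM ?posrE// ler_ln ?posrE ?mulr_gt0// mulrC Nsum_mul_le.
have : ln (Vmin M) + ln (Nsum A) <= ln (Nsum (A *m M)).
  by rewrite -lnM ?posrE// ler_ln ?posrE ?mulr_gt0// Vmin_mul_le.
lra.
Qed.

Lemma eta1 M : eta 1%:M M = ln q%:R.
Proof.
rewrite /eta mul1mx [ln (Nsum M) + _]addrC addrK; congr ln; rewrite /Nsum.
under eq_bigr => i _.
  rewrite (bigD1 i)//= mxE eqxx big1 ?addr0; last by move=> j /negPf; rewrite mxE eq_sym => ->.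
  over.
by rewrite sumr_const card_ord.
Qed.

(* Closeness in the projective metric: [u] and [v] are proportional up to a factor
   ranging over an interval of ratio [1 + h]. *)
Definition close h u v := exists2 m, 0 < m & forall i, m * v i <= u i <= m * (1 + h) * v i.

Definition vmul u B (j : 'I_q) : R := \sum_i u i * B i j.

Lemma close_mul h u v B : (forall i j, 0 <= B i j) -> close h u v ->
  close h (vmul u B) (vmul v B).
Proof.
move=> B0 [m m0 H]; exists m => // j; rewrite /vmul !mulr_sumr; apply/andP; split;
  apply: ler_sum => i _; have /andP[h1 h2] := H i; rewrite mulrA ler_wpM2r//.
Qed.

Section GoodBlock.
Variables (c1 c2 : R) (B : 'M[R]_q).
Hypothesis c10 : 0 < c1.
Hypothesis cB : forall i j, c1 <= B i j <= c2.

Let c20 : 0 < c2.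
Proof.
by have /andP[h1 h2] := cB (Ordinal q0) (Ordinal q0); rewrite (lt_le_trans c10)// (le_trans h1).
Qed.

Lemma vmul_good u j : (forall i, 0 <= u i) ->
  c1 * \sum_i u i <= vmul u B j <= c2 * \sum_i u i.
Proof.
move=> u0; rewrite /vmul !mulr_sumr; apply/andP; split; apply: ler_sum => i _;
  by have /andP[h1 h2] := cB i j; rewrite [_ * u i]mulrC ler_wpM2l.
Qed.

(** Each image entry lies between c1 and c2 times the sum of the vector, so any two images are
    close, whatever the nonzero nonnegative vectors were. *)
Lemma close_good u v : (forall i, 0 <= u i) -> (forall i, 0 <= v i) ->
  0 < \sum_i u i -> 0 < \sum_i v i ->
  close ((c2 / c1) ^+ 2 - 1) (vmul u B) (vmul v B).
Proof.
move=> u0 v0; set su := \sum_i u i; set sv := \sum_i v i => pu pv.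
exists (c1 * su / (c2 * sv)); first by rewrite divr_gt0// mulr_gt0.
move=> j; have /andP[u1 u2] := vmul_good j u0; have /andP[v1 v2] := vmul_good j v0.
rewrite -/su -/sv in u1 u2 v1 v2; apply/andP; split.
  rewrite (le_trans _ u1)// mulrAC ler_pdivrMr ?mulr_gt0// ler_pM2l ?mulr_gt0//.
rewrite (le_trans u2)//.
have -> : 1 + ((c2 / c1) ^+ 2 - 1) = (c2 / c1) ^+ 2 by ring.
have -> : c1 * su / (c2 * sv) * (c2 / c1) ^+ 2 = (c2 * su) / (c1 * sv).
  by field; rewrite !gt_eqF.
by rewrite mulrAC ler_pdivlMr ?mulr_gt0// ler_pM2l ?mulr_gt0.
Qed.

(** Birkhoff's contraction. The gaps u1 = u - m v and u2 = m (1 + h) v - u are nonnegative, and the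
    block sends them above s1 and s2 times the image of v, with s1 + s2 = (c1 / c2) m h. Both ends
    of the interval of ratios move inwards, by the fraction c1 / c2 of its length in total. *)
Lemma close_contract h u v : 0 <= h -> (forall i, 0 <= v i) -> 0 < \sum_i v i ->
  close h u v -> close (h * (1 - c1 / c2)) (vmul u B) (vmul v B).
Proof.
move=> h0 v0 pv [m m0 H]; set sv := \sum_i v i in pv.
pose u1 i := u i - m * v i; pose u2 i := m * (1 + h) * v i - u i.
have u10 i : 0 <= u1 i by rewrite subr_ge0; case/andP: (H i).
have u20 i : 0 <= u2 i by rewrite subr_ge0; case/andP: (H i).
pose s1 := c1 / c2 * (\sum_i u1 i / sv); pose s2 := c1 / c2 * (\sum_i u2 i / sv).
have s10 : 0 <= s1.
  by rewrite mulr_ge0 ?divr_ge0 ?(ltW c10) ?(ltW c20)// sumr_ge0// => i _; rewrite divr_ge0// ltW.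
have s20 : 0 <= s2.
  by rewrite mulr_ge0 ?divr_ge0 ?(ltW c10) ?(ltW c20)// sumr_ge0// => i _; rewrite divr_ge0// ltW.
have lo (w : 'I_q -> R) j : (forall i, 0 <= w i) ->
    c1 / c2 * (\sum_i w i / sv) * vmul v B j <= vmul w B j.
  move=> w0; have /andP[w1 _] := vmul_good j w0; have /andP[_ v2] := vmul_good j v0.
  rewrite (le_trans _ w1)// -mulr_suml.
  have W0 : 0 <= \sum_i w i by rewrite sumr_ge0.
  have : c1 / c2 * ((\sum_i w i) / sv) * vmul v B j <=
      c1 / c2 * ((\sum_i w i) / sv) * (c2 * sv).
    by rewrite ler_wpM2l// !mulr_ge0 ?invr_ge0 ?(ltW c10) ?(ltW c20) ?(ltW pv).
  move=> /le_trans; apply; rewrite le_eqVlt; apply/orP; left; apply/eqP.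
  by field; rewrite !gt_eqF.
have s12 : s1 + s2 = c1 / c2 * (m * h).
  rewrite /s1 /s2 -mulrDr -big_split/=; congr (_ * _).
  rewrite (eq_bigr (fun i => m * h / sv * v i)); last by move=> i _; rewrite /u1 /u2; field; rewrite gt_eqF.
  by rewrite -mulr_sumr -/sv divfK// gt_eqF.
exists (m + s1); first by rewrite ltr_pwDl.
move=> j; have L1 := lo u1 j u10; have L2 := lo u2 j u20.
have E1 : vmul u1 B j = vmul u B j - m * vmul v B j.
  by rewrite /vmul mulr_sumr -sumrB; apply: eq_bigr => i _; rewrite /u1; ring.
have E2 : vmul u2 B j = m * (1 + h) * vmul v B j - vmul u B j.
  by rewrite /vmul mulr_sumr -sumrB; apply: eq_bigr => i _; rewrite /u2; ring.
rewrite E1 -/s1 in L1; rewrite E2 -/s2 in L2.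
have vB0 : 0 <= vmul v B j.
  have /andP[h1 _] := vmul_good j v0; rewrite (le_trans _ h1)// mulr_ge0 ?(ltW c10)//.
  exact: ltW.
apply/andP; split; first lra.
have h3 : vmul u B j <= (m + m * h - s2) * vmul v B j by lra.
rewrite (le_trans h3)// ler_wpM2r//.
have c12 : c1 / c2 <= 1.
  rewrite ler_pdivrMr// mul1r.
  by have /andP[x1 x2] := cB (Ordinal q0) (Ordinal q0); rewrite (le_trans x1).
have : 0 <= s1 * (h * (1 - c1 / c2)) by apply: (mulr_ge0 s10 (mulr_ge0 h0 _)); rewrite subr_ge0.
have -> : (m + s1) * (1 + h * (1 - c1 / c2)) = m + s1 + m * h - c1 / c2 * (m * h) +
  s1 * (h * (1 - c1 / c2)) by ring.
rewrite -s12; lra.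
Qed.

End GoodBlock.

(** eta depends on A only through its column sums, and the common factor m cancels between ln (Nsum
    A) and ln (Nsum (A *m M)); the factor 1 + h is what remains. *)
Lemma close_eta h A A' M : in_S A -> in_S A' -> in_S M -> 0 <= h ->
  close h (csum A) (csum A') -> `|eta A M - eta A' M| <= ln (1 + h).
Proof.
move=> SA SA' SM h0 [m m0 H].
have NA := Nsum_gt0 SA; have NA' := Nsum_gt0 SA'; have NM := Nsum_gt0 SM.
have NAM := Nsum_gt0 (in_S_mul SA SM); have NAM' := Nsum_gt0 (in_S_mul SA' SM).
have h1 : 0 < 1 + h by rewrite ltr_pwDl.
have key (x x' : R) : 0 < x -> 0 < x' -> m * x' <= x <= m * (1 + h) * x' ->
    ln m + ln x' <= ln x <= ln m + ln (1 + h) + ln x'.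
  move=> x0 x0' /andP[a b]; rewrite -!lnM ?posrE ?mulr_gt0//.
  by rewrite !ler_ln ?posrE ?mulr_gt0// a b.
have /andP[a1 a2] : m * Nsum A' <= Nsum A <= m * (1 + h) * Nsum A'.
  rewrite !Nsum_csum !mulr_sumr; apply/andP; split; apply: ler_sum => i _;
    by case/andP: (H i).
have /andP[b1 b2] : m * Nsum (A' *m M) <= Nsum (A *m M) <= m * (1 + h) * Nsum (A' *m M).
  rewrite !Nsum_mul !mulr_sumr; apply/andP; split; apply: ler_sum => i _;
    rewrite mulrA ler_wpM2r ?(ltW (rsum_gt0 _ SM))//; by case/andP: (H i).
have /andP[p1 p2] := key _ _ NA NA' (introT andP (conj a1 a2)).
have /andP[p3 p4] := key _ _ NAM NAM' (introT andP (conj b1 b2)).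
rewrite /eta ler_norml; lra.
Qed.

(* Bounds the loss of comparability between the entries of a product caused by one factor. *)
Definition Kcond M : R := Nsum M * (\sum_j (csum M j)^-1 + \sum_i (rsum M i)^-1).

Lemma Kcond_csum M j : in_S M -> Nsum M <= Kcond M * csum M j.
Proof.
move=> SM; have N0 := Nsum_gt0 SM; have C0 := csum_gt0 j SM.
rewrite /Kcond -mulrA ler_peMr ?(ltW N0)// -ler_pdivrMr// mul1r (bigD1 j)//= -addrA lerDl.
apply: addr_ge0; last by apply: sumr_ge0 => i _; rewrite invr_ge0 ltW// rsum_gt0.
by apply: sumr_ge0 => i _; rewrite invr_ge0 ltW// csum_gt0.
Qed.

Lemma Kcond_rsum M i : in_S M -> Nsum M <= Kcond M * rsum M i.
Proof.
move=> SM; have N0 := Nsum_gt0 SM; have C0 := rsum_gt0 i SM.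
rewrite /Kcond -mulrA ler_peMr ?(ltW N0)// -ler_pdivrMr// mul1r addrC (bigD1 i)//= -addrA lerDl.
apply: addr_ge0; last by apply: sumr_ge0 => k _; rewrite invr_ge0 ltW// csum_gt0.
by apply: sumr_ge0 => k _; rewrite invr_ge0 ltW// rsum_gt0.
Qed.

Lemma Kcond_ge1 M : in_S M -> 1 <= Kcond M.
Proof.
move=> SM; pose i0 : 'I_q := Ordinal q0; have N0 := Nsum_gt0 SM.
have K0 : 0 <= Kcond M.
  rewrite mulr_ge0 ?(ltW N0)// addr_ge0// sumr_ge0// => i _; rewrite invr_ge0 ltW//.
    exact: csum_gt0.
  exact: rsum_gt0.
rewrite -(ler_pM2r N0) mul1r (le_trans (Kcond_csum i0 SM))// ler_wpM2l//.
exact: csum_le_Nsum.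
Qed.

(** All column sums of the identity are 1, so this measures how unequal those of M are: the initial
    distance when one more factor M is compared with none. *)
Lemma close_init M : in_S M -> close (Kcond M - 1) (csum M) (csum 1%:M).
Proof.
move=> SM; have N0 := Nsum_gt0 SM; have K1 := Kcond_ge1 SM.
have c1 i : csum 1%:M i = 1.
  by rewrite /csum (bigD1 i)//= mxE eqxx big1 ?addr0// => j /negPf; rewrite mxE => ->.
have K0 : 0 < Kcond M by lra.
exists (Nsum M / Kcond M); first by rewrite divr_gt0.
move=> i; rewrite c1 !mulr1 addrC subrK divfK ?gt_eqF// csum_le_Nsum// andbT.
by rewrite ler_pdivrMr// mulrC Kcond_csum.
Qed.

Lemma csum_vmul A B : csum (A *m B) = vmul (csum A) B.
Proof. by apply/funext => j; rewrite csum_mul. Qed.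

End NonnegMatrices.

(** * Spectral radius of a nonnegative matrix *)

Section SpectralRadius.
Variables (R : realType) (q : nat).
Hypothesis q0 : (0 < q)%N.
Implicit Types (M : 'M[R]_q).
Local Notation C := R[i].
Let cmx M : 'M[C]_q := map_mx (fun r : R => (r%:C)%C) M.
Let spec M := [set Normc.normc z | z in [set z : C | eigenvalue (cmx M) z]].

Let mpow (K : pzRingType) (A : 'M[K]_q) k : 'M[K]_q := iter k (mulmx A) 1%:M.

Let mpowS (K : pzRingType) (A : 'M[K]_q) k : mpow A k.+1 = A *m mpow A k.
Proof. by []. Qed.

Let normc_ge0 (z : C) : 0 <= Normc.normc z.
Proof. by case: z => a b; exact: sqrtr_ge0. Qed.

Let normc_sum (F : 'I_q -> C) : Normc.normc (\sum_i F i) <= \sum_i Normc.normc (F i).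
Proof.
elim/big_ind2 : _ => [|x x' y y' h1 h2|//]; first by rewrite Normc.normc0.
by rewrite (le_trans (complex.le_normcD _ _))// lerD.
Qed.

Let normc_real (r : R) : Normc.normc (r%:C)%C = `|r|.
Proof. by rewrite /Normc.normc /= expr0n/= addr0 sqrtr_sqr. Qed.

Let normcX (z : C) k : Normc.normc (z ^+ k) = Normc.normc z ^+ k.
Proof. by elim: k => [|k ih]; rewrite ?expr0 ?Normc.normc1// !exprS Normc.normcM ih. Qed.

(** Taking moduli in the equation of a left eigenvector and summing over the columns leaves row sums
    of M, each at most Nsum M. *)
Lemma spec_le_Nsum M : in_S M -> ubound (spec M) (Nsum M).
Proof.
move=> SM _ [z /eigenvalueP[v vz v0] <-].
have H j : Normc.normc z * Normc.normc (v 0 j) <= \sum_i Normc.normc (v 0 i) * M i j.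
  rewrite -Normc.normcM; have := congr1 (fun u : 'rV[C]_q => u 0 j) vz.
  rewrite !mxE => <-; rewrite (le_trans (normc_sum _))// ler_sum// => i _.
  rewrite Normc.normcM mxE normc_real ger0_norm//; by case: SM.
have [j vj] : exists j, v 0 j != 0.
  apply/existsP; apply: contraNT v0; rewrite negb_exists => /forallP h.
  by apply/eqP/rowP => j; rewrite mxE; apply/eqP; have := h j; rewrite negbK.
have s0 : 0 < \sum_i Normc.normc (v 0 i).
  rewrite (bigD1 j)//= ltr_pwDl// ?sumr_ge0// lt_neqAle normc_ge0 andbT eq_sym.
  by apply: contra vj => /eqP/Normc.eq0_normc/eqP.
rewrite -(ler_pM2r s0) mulr_sumr (le_trans (ler_sum _ (fun j _ => H j)))//.
rewrite exchange_big/= mulr_sumr; apply: ler_sum => i _.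
by rewrite -mulr_sumr mulrC ler_wpM2r//; exact: rsum_le_Nsum.
Qed.

Let trig_pow (U : 'M[C]_q) k : is_trig_mx U ->
  is_trig_mx (mpow U k) /\ forall i, mpow U k i i = U i i ^+ k.
Proof.
move=> /is_trig_mxP tU; elim: k => [|k [/is_trig_mxP ih1 ih2]].
  split; last by move=> i; rewrite mxE eqxx.
  by apply/is_trig_mxP => i j ij; rewrite mxE -val_eqE/= ltn_eqF.
split.
  apply/is_trig_mxP => i j ij; rewrite /mpow iterS mxE big1// => l _.
  have [il|li] := ltnP i l; first by rewrite tU// mul0r.
  by rewrite ih1 ?mulr0// (leq_ltn_trans li).
move=> i; rewrite /mpow iterS mxE (bigD1 i)//= -/(mpow U k) ih2 big1 ?addr0 ?exprS// => l li.
have [il|] := ltnP i l; first by rewrite tU// mul0r.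
by rewrite leq_eqVlt val_eqE (negPf li)/= => h; rewrite ih1 ?mulr0.
Qed.

(** Schur's unitary triangularisation: the diagonal consists of eigenvalues, and its powers give the
    traces of the powers of M. *)
Let eig_diag M : exists lam : 'I_q -> C, (forall i, spec M (Normc.normc (lam i))) /\
  forall k, \tr (mpow (cmx M) k) = \sum_i lam i ^+ k.
Proof.
have [Q Qu tQ] := Schur (cmx M) q0.
have Qi : Q \in unitmx by exact: unitarymx_unit.
pose U := Q *m cmx M *m invmx Q.
have tU : is_trig_mx U by move: tQ; rewrite /similar_to conjumx.
exists (fun i => U i i); split.
  move=> i; exists (U i i) => //=.
  have : eigenvalue U (U i i).
    rewrite eigenvalue_root_char char_poly_trig// /root.
    by rewrite horner_prod (bigD1 i)//= hornerXsubC subrr mul0r.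
  move=> /eigenvalueP[v vU v0]; apply/eigenvalueP; exists (v *m Q).
    by rewrite scalemxAl -vU /U !mulmxA mulmxKV.
  by apply: contra v0 => /eqP h; rewrite -(mulmxK Qi v) h mul0mx.
move=> k; have [_ h] := trig_pow k tU.
transitivity (\tr (mpow U k)); last by apply: eq_bigr => i _; rewrite h.
have -> : mpow U k = Q *m mpow (cmx M) k *m invmx Q.
  elim: k {h} => [|k ih]; first by rewrite /= mulmx1 mulmxV.
  by rewrite !mpowS ih /U !mulmxA mulmxKV.
by rewrite -mulmxA mxtrace_mulC mulmxKV.
Qed.

Let spec_sup M : in_S M -> has_sup (spec M).
Proof.
move=> SM; split; last by exists (Nsum M); exact: spec_le_Nsum.
have [lam [h _]] := eig_diag M; exists (Normc.normc (lam (Ordinal q0))); exact: h.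
Qed.

Lemma spectral_radius_le_Nsum M : in_S M -> spectral_radius M <= Nsum M.
Proof.
move=> SM; have [ne _] := spec_sup SM; apply: ge_sup => //; exact: spec_le_Nsum.
Qed.

Let pow_nonneg M k i : in_S M -> (forall j l, 0 <= mpow M k j l) /\ M i i ^+ k <= mpow M k i i.
Proof.
move=> [M0 _]; elim: k => [|k [ih1 ih2]].
  by split; [move=> j l; rewrite mxE ler0n|rewrite mxE eqxx].
rewrite /mpow iterS -/(mpow M k); split.
  by move=> j l; rewrite mxE sumr_ge0// => r _; rewrite mulr_ge0.
rewrite mxE (bigD1 i)//= exprS (le_trans (ler_wpM2l (M0 i i) ih2))// lerDl.
by rewrite sumr_ge0// => r _; rewrite mulr_ge0.
Qed.

(** The k-th power of M i i is at most the trace of the k-th power of M, a sum of k-th powers of q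
    eigenvalues, hence at most q L^k. Letting k grow, Bernoulli's inequality excludes M i i > L.
    This stands in for Perron-Frobenius theory. *)
Lemma diag_le_spectral_radius M i : in_S M -> M i i <= spectral_radius M.
Proof.
move=> SM; set L := spectral_radius M; have M0 : 0 <= M i i by case: SM.
have [lam [Hl Ht]] := eig_diag M.
have lamL j : Normc.normc (lam j) <= L.
  by apply: ub_le_sup; [case: (spec_sup SM)|exact: Hl].
have L0 : 0 <= L := le_trans (normc_ge0 _) (lamL (Ordinal q0)).
have H k : M i i ^+ k <= q%:R * L ^+ k.
  have [h1 h2] := pow_nonneg k i SM.
  rewrite (le_trans h2)//.
  have h3 : mpow M k i i <= \tr (mpow M k).
    by rewrite /mxtrace (bigD1 i)//= lerDl sumr_ge0.
  have e : ((\tr (mpow M k))%:C)%C = \tr (mpow (cmx M) k).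
    rewrite /mxtrace rmorph_sum/=; apply: eq_bigr => j _.
    have -> : mpow (cmx M) k = map_mx (fun r : R => (r%:C)%C) (mpow M k).
      elim: k {h1 h2 h3} => [|k ih]; first by rewrite /= map_mx1.
      by rewrite !mpowS ih map_mxM.
    by rewrite mxE.
  rewrite (le_trans h3)// (le_trans (ler_norm _))// -normc_real e Ht.
  rewrite (le_trans (normc_sum _))//.
  have -> : q%:R * L ^+ k = \sum_(j < q) L ^+ k by rewrite sumr_const card_ord mulr_natl.
  apply: ler_sum => j _; rewrite normcX lerXn2r ?nnegrE//.
rewrite leNgt; apply/negP => LM.
have Mp : 0 < M i i := le_lt_trans L0 LM.
have [L00|Lp] := eqVneq L 0.
  by have := H 1%N; rewrite !expr1 L00 mulr0 leNgt Mp.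
have {}Lp : 0 < L by rewrite lt_neqAle eq_sym Lp.
pose x := M i i / L - 1.
have x0 : 0 < x by rewrite subr_gt0 ltr_pdivlMr// mul1r.
have B k : 1 + k%:R * x <= (M i i / L) ^+ k.
  have -> : M i i / L = 1 + x by rewrite /x addrC subrK.
  elim: k => [|k ih]; first by rewrite mul0r addr0 expr0.
  rewrite exprS -natr1.
  have := ler_wpM2l (ltW (ltr_pwDl ltr01 (ltW x0))) ih.
  have : 0 <= k%:R * x * x by rewrite !mulr_ge0 ?(ltW x0).
  lra.
have qx : 0 <= q%:R / x by rewrite divr_ge0 ?ler0n ?(ltW x0).
have [k hk] : exists k : nat, q%:R < k%:R * x.
  by exists (Num.bound (q%:R / x)); rewrite -ltr_pdivrMr//; exact: archi_boundP.
have := B k; have := H k; rewrite expr_div_n.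
rewrite -ler_pdivrMr ?exprn_gt0//.
lra.
Qed.

End SpectralRadius.

(** * Products over windows and the effect of one more factor *)

Section Products.
Variables (R : realType) (q : nat) (T : Type).
Hypothesis q0 : (0 < q)%N.
Variable X : nat -> T -> 'M[R]_q.
Hypothesis hS : forall n w, (1 <= n)%N -> in_S (X n w).

Fixpoint Qp (k m : nat) (w : T) : 'M[R]_q :=
  if m is m'.+1 then X (k + m').+1 w *m Qp k m' w else 1%:M.

Lemma Qp_in_S k m w : in_S (Qp k m w).
Proof. by elim: m => [|m ih]; [exact: in_S1|apply: in_S_mul => //; exact: hS]. Qed.

Lemma Qp_cat k m m' w : Qp k (m + m') w = Qp (k + m) m' w *m Qp k m w.
Proof.
elim: m' => [|m' ih]; first by rewrite addn0 mul1mx.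
by rewrite addnS /= ih mulmxA addnA.
Qed.

Lemma Xprod_Qp n w : Xprod X n w = Qp 0 n w.
Proof. by elim: n => //= n ->. Qed.

Lemma Qp_front k m w : Qp k m.+1 w = Qp k.+1 m w *m X k.+1 w.
Proof.
by rewrite -add1n Qp_cat /= addn0 mulmx1 addn1.
Qed.

(* [et k m] is the defect of [X k] against the [m] factors that follow it, [te] its
   truncation at [a], and [dl] the effect on [te] of one more factor. *)
Definition et k m w := eta (Qp k m w) (X k w).

Lemma ln_Nsum_telescope n w : ln (Nsum (Xprod X n w)) =
  ln q%:R + \sum_(k < n) ln (Nsum (X k.+1 w)) - \sum_(k < n) et k.+1 (n - k.+1) w.
Proof.
(* The starting point k is quantified because peeling off the rightmost factor shifts the window. *)
have H m : forall k, ln (Nsum (Qp k m w)) = ln q%:R +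
    \sum_(i < m) (ln (Nsum (X (k + i).+1 w)) - et (k + i).+1 (m - i.+1) w).
  elim: m => [|m ih] k.
    rewrite big_ord0 addr0 /=; congr ln.
    rewrite /Nsum; under eq_bigr => i _.
      rewrite (bigD1 i)//= mxE eqxx big1 ?addr0; last by move=> l /negPf; rewrite mxE eq_sym => ->.
      over.
    by rewrite sumr_const card_ord.
  rewrite Qp_front big_ord_recl addn0 subn1 /=.
  have -> : \sum_(i < m) (ln (Nsum (X (k + bump 0 i).+1 w)) -
      et (k + bump 0 i).+1 (m.+1 - (bump 0 i).+1) w) =
      ln (Nsum (Qp k.+1 m w)) - ln q%:R.
    rewrite ih addrC addKr; apply: eq_bigr => i _.
    by rewrite /bump/= add1n addSnnS subSS.
  rewrite /et /eta; lra.
by rewrite Xprod_Qp H -addrA -sumrB.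
Qed.

Definition te (a : R) k m w := Num.min (et k m w) a.
Definition dl (a : R) k m w := te a k m.+1 w - te a k m w.

Lemma et_itv k m w : (1 <= k)%N -> 0 <= et k m w <= Wrange (X k w).
Proof. by move=> k1; apply: eta_itv => //; [exact: Qp_in_S|exact: hS]. Qed.

Lemma Wrange_ge0 k w : (1 <= k)%N -> 0 <= Wrange (X k w).
Proof. by move=> k1; have /andP[h1 h2] := et_itv 0 w k1; rewrite (le_trans h1). Qed.

Lemma te_itv a k m w : 0 < a -> (1 <= k)%N ->
  0 <= te a k m w <= Num.min (Wrange (X k w)) a.
Proof.
move=> a0 k1; have /andP[h1 h2] := et_itv m w k1; rewrite /te !le_min h1 (ltW a0)/=.
by rewrite !ge_min h2 lexx orbT.
Qed.

Lemma te0 a k w : te a k 0 w = Num.min (ln q%:R) a.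
Proof. by rewrite /te /et eta1. Qed.

Lemma te_sum a k m w : te a k m w = Num.min (ln q%:R) a + \sum_(j < m) dl a k j w.
Proof.
elim: m => [|m ih]; first by rewrite te0 big_ord0 addr0.
by rewrite big_ord_recr/= addrA -ih /dl addrC subrK.
Qed.

Lemma dl_W a k m w : 0 < a -> (1 <= k)%N -> `|dl a k m w| <= Num.min (Wrange (X k w)) a.
Proof.
move=> a0 k1; have /andP[h1 h2] := te_itv m w a0 k1; have /andP[h3 h4] := te_itv m.+1 w a0 k1.
by rewrite /dl ler_norml; lra.
Qed.

Lemma min_lip (x y a : R) : `|Num.min x a - Num.min y a| <= `|x - y|.
Proof.
case: (leP x a) => h1; case: (leP y a) => h2 //.
- by rewrite !ler0_norm; lra.
- by rewrite !ger0_norm; lra.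
- by rewrite subrr normr0.
Qed.

Let dl_close a k m w h : (1 <= k)%N -> 0 <= h ->
  close h (csum (Qp k m.+1 w)) (csum (Qp k m w)) -> `|dl a k m w| <= ln (1 + h).
Proof.
move=> k1 h0 hc; rewrite (le_trans (min_lip _ _ _))//.
by apply: close_eta => //; try exact: Qp_in_S; exact: hS.
Qed.

Let csumQ k m w : csum (Qp k m.+1 w) = vmul (csum (X (k + m).+1 w)) (Qp k m w).
Proof. by rewrite /= csum_vmul. Qed.

Let csumQ1 k m w : csum (Qp k m w) = vmul (csum 1%:M) (Qp k m w).
Proof. by rewrite -csum_vmul mul1mx. Qed.

(** The extra factor replaces the column sums of the identity by its own before the same
    multiplication by [Qp k m], which cannot increase the distance. *)
Lemma dl_Kcond a k m w : (1 <= k)%N -> `|dl a k m w| <= ln (Kcond (X (k + m).+1 w)).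
Proof.
move=> k1; have SX : in_S (X (k + m).+1 w) by exact: hS.
have K1 := Kcond_ge1 q0 SX.
rewrite (_ : Kcond _ = 1 + (Kcond (X (k + m).+1 w) - 1)); last by rewrite addrC subrK.
apply: dl_close => //; first by rewrite subr_ge0.
rewrite csumQ csumQ1; apply: close_mul; last exact: close_init.
by case: (Qp_in_S k m w).
Qed.

Section Good.
Variables (c1 c2 : R) (n0 : nat) (gd : nat -> T -> bool).
Hypothesis c10 : 0 < c1.
Hypothesis c12 : c1 < c2.
Hypothesis hgd : forall k w, gd k w -> forall i j, c1 <= Qp k n0 w i j <= c2.

Let th : R := 1 - c1 / c2.
Let H0 : R := (c2 / c1) ^+ 2 - 1.
Let c20 : 0 < c2. Proof. exact: lt_trans c12. Qed.

Let th01 : 0 < th < 1.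
Proof.
by rewrite /th subr_gt0 ltr_pdivrMr// mul1r c12/= gtrBl divr_gt0.
Qed.

Let H00 : 0 <= H0.
Proof.
rewrite /H0 subr_ge0 -(expr1n R 2) lerXn2r ?nnegrE ?divr_ge0 ?(ltW c10) ?(ltW c20)//.
by rewrite ler_pdivlMr// mul1r ltW.
Qed.

(* Number of good windows among the [B] consecutive windows of length [n0] after time [k]. *)
Fixpoint nb (B k : nat) (w : T) : nat :=
  if B is B'.+1 then (nb B' (k + n0) w + gd k w)%N else 0%N.

Let pos_vmul (u : 'I_q -> R) k m w : (forall i, 0 <= u i) -> 0 < \sum_i u i ->
  (forall i, 0 <= vmul u (Qp k m w) i) /\ 0 < \sum_i vmul u (Qp k m w) i.
Proof.
move=> u0 us; have SQ := Qp_in_S k m w; have Q0 : forall i j, 0 <= Qp k m w i j by case: SQ.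
split; first by move=> i; apply: sumr_ge0 => j _; rewrite mulr_ge0.
rewrite exchange_big/= (eq_bigr (fun i => u i * rsum (Qp k m w) i)); last first.
  by move=> i _; rewrite mulr_sumr.
have h0 i : 0 <= u i * rsum (Qp k m w) i by rewrite mulr_ge0// ltW// rsum_gt0.
rewrite lt_neqAle sumr_ge0// andbT eq_sym; apply: contraTneq us => /eqP.
rewrite psumr_eq0// => /allP h; rewrite big1 ?ltxx// => i _.
have := h i (mem_index_enum _); rewrite mulf_eq0 (gt_eqF (rsum_gt0 i SQ)) orbF.
by move/eqP.
Qed.

Let vmul_cat (u : 'I_q -> R) k m m' w :
  vmul u (Qp k (m + m') w) = vmul (vmul u (Qp (k + m) m' w)) (Qp k m w).
Proof.
rewrite Qp_cat; apply/funext => j; rewrite /vmul.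
under eq_bigr do rewrite mxE mulr_sumr.
by rewrite exchange_big; apply: eq_bigr => i _; rewrite mulr_suml; apply: eq_bigr => l _; rewrite mulrA.
Qed.

(** The vectors meet the latest window first and the window at k last. The first good window met
    makes them close with constant H0, and each further one contracts by th: hence the predecessor
    in the exponent. *)
Lemma close_blocks B : forall k w (u v : 'I_q -> R), (forall i, 0 <= u i) -> 0 < \sum_i u i ->
  (forall i, 0 <= v i) -> 0 < \sum_i v i -> (0 < nb B k w)%N ->
  close (H0 * th ^+ (nb B k w).-1) (vmul u (Qp k (B * n0) w)) (vmul v (Qp k (B * n0) w)).
Proof.
elim: B => [//|B ih] k w u v u0 us v0 vs /=.
rewrite mulSn !vmul_cat.
have [u0' us'] := pos_vmul (k + n0) (B * n0) w u0 us.
have [v0' vs'] := pos_vmul (k + n0) (B * n0) w v0 vs.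
have Q0 : forall i j, 0 <= Qp k n0 w i j by case: (Qp_in_S k n0 w).
case g : (gd k w); last first.
  rewrite addn0 => nb0; apply: close_mul => //; exact: ih.
rewrite addn1 => _ /=.
have [nb0|nb0] := posnP (nb B (k + n0) w).
  rewrite nb0 expr0 mulr1; apply: (@close_good _ _ q0 c1 c2) => //.
  exact: hgd.
rewrite -(prednK nb0) exprSr mulrA.
apply: (@close_contract _ _ q0 c1 c2) => //.
- exact: hgd.
- by rewrite mulr_ge0// exprn_ge0// ltW//; case/andP: th01.
- exact: ih.
Qed.

Lemma dl_blocks a k m w B : (1 <= k)%N -> (B * n0 <= m)%N -> (0 < nb B k w)%N ->
  `|dl a k m w| <= H0 * th ^+ (nb B k w).-1.
Proof.
move=> k1 Bm nb0; have h0 : 0 <= H0 * th ^+ (nb B k w).-1.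
  by rewrite mulr_ge0// exprn_ge0// ltW//; case/andP: th01.
apply: (le_trans (@dl_close a k m w _ k1 h0 _)); last first.
  have h1 : 0 < 1 + H0 * th ^+ (nb B k w).-1 by rewrite ltr_pwDl.
  by have := @le_ln1Dx R (H0 * th ^+ (nb B k w).-1); apply; rewrite (lt_le_trans _ h0)// ltrN10.
rewrite csumQ csumQ1 -(subnKC Bm) !vmul_cat.
have SX : in_S (X (k + (B * n0 + (m - B * n0))).+1 w) by exact: hS.
have u0 i : 0 <= csum (X (k + (B * n0 + (m - B * n0))).+1 w) i by apply/ltW/csum_gt0.
have us : 0 < \sum_i csum (X (k + (B * n0 + (m - B * n0))).+1 w) i.
  by rewrite -Nsum_csum; exact: Nsum_gt0.
have v0 i : 0 <= csum (1%:M : 'M[R]_q) i by apply/ltW/csum_gt0/in_S1.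
have vs : 0 < \sum_i csum (1%:M : 'M[R]_q) i.
  by rewrite -Nsum_csum; apply: Nsum_gt0 => //; exact: in_S1.
have [u0' us'] := pos_vmul (k + B * n0) (m - B * n0) w u0 us.
have [v0' vs'] := pos_vmul (k + B * n0) (m - B * n0) w v0 vs.
exact: close_blocks.
Qed.

(** Two bounds in one product: without a good window the range of X_k is all there is; otherwise the
    geometric bound holds, th^(-2) making up for the predecessor in the exponent. The product form
    separates X_k from the factors after it, which are independent of it. *)
Lemma dl_sqr_blocks a k m w B : 0 < a -> (1 <= k)%N -> (B * n0 <= m)%N ->
  dl a k m w ^+ 2 <= (H0 ^+ 2 / th ^+ 2 + Num.min (Wrange (X k w)) a ^+ 2) *
    (th ^+ 2) ^+ nb B k w.
Proof.
move=> a0 k1 Bm; have /andP[t0 t1] := th01.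
rewrite -[leLHS]real_normK ?num_real//.
have m0 : 0 <= Num.min (Wrange (X k w)) a by rewrite le_min Wrange_ge0// ltW.
have t2 : 0 < th ^+ 2 by rewrite exprn_gt0.
have D0 : 0 <= H0 ^+ 2 / th ^+ 2 by rewrite divr_ge0 ?sqr_ge0.
have [nb0|nb0] := posnP (nb B k w).
  rewrite nb0 expr0 mulr1 (le_trans (y := Num.min (Wrange (X k w)) a ^+ 2)) ?lerDr//.
  by rewrite lerXn2r ?nnegrE// dl_W.
have h := dl_blocks a k1 Bm nb0.
have e : (H0 * th ^+ (nb B k w).-1) ^+ 2 = H0 ^+ 2 / th ^+ 2 * (th ^+ 2) ^+ nb B k w.
  have e2 j : (th ^+ j) ^+ 2 = (th ^+ 2) ^+ j by rewrite -!exprM mulnC.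
  have e3 (Y : R) : H0 ^+ 2 * Y = H0 ^+ 2 / th ^+ 2 * (th ^+ 2 * Y).
    by rewrite mulrA divfK// gt_eqF.
  by rewrite exprMn e2 -[in RHS](prednK nb0) (exprS (th ^+ 2)); exact: e3.
rewrite (le_trans (y := (H0 * th ^+ (nb B k w).-1) ^+ 2))//.
  rewrite lerXn2r ?nnegrE// mulr_ge0// exprn_ge0// ltW//.
have t20 : 0 <= (th ^+ 2) ^+ nb B k w by rewrite exprn_ge0// ltW.
rewrite e; apply: ler_wpM2r => //; rewrite lerDl; exact: sqr_ge0.
Qed.

End Good.

(** Meant for a fixed distance: dl is at most K0 unless the new factor is badly conditioned, an
    event independent of X_k. Its mean square is then K0^2 plus a small fraction of the truncated
    moment of the range. *)
Lemma dl_sqr_small a k m w (K0 : R) : 0 < a -> (1 <= k)%N -> 0 <= K0 ->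
  dl a k m w ^+ 2 <= K0 ^+ 2 +
    (K0 < ln (Kcond (X (k + m).+1 w)))%R%:R * Num.min (Wrange (X k w)) a ^+ 2.
Proof.
move=> a0 k1 K00; rewrite -[leLHS]real_normK ?num_real//.
have h1 := dl_Kcond a m w k1; have h2 := dl_W m w a0 k1.
have m0 : 0 <= Num.min (Wrange (X k w)) a by rewrite le_min Wrange_ge0// ltW.
have [h|h] := ltP; last first.
  by rewrite mul0r addr0 lerXn2r ?nnegrE// (le_trans h1).
by rewrite mul1r (le_trans (y := Num.min (Wrange (X k w)) a ^+ 2)) ?lerXn2r ?nnegrE// lerDr sqr_ge0.
Qed.

End Products.

(** * Geometrically weighted sums *)

Section Geometric.
Variable R : realType.

Lemma bernoulli (x : R) n : 0 <= x <= 1 -> 1 - n%:R * x <= (1 - x) ^+ n.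
Proof.
move=> /andP[x0 x1]; elim: n => [|n ih]; first by rewrite mul0r subr0 expr0.
have h : 0 <= 1 - x by lra.
rewrite exprS -natr1; have := ler_wpM2l h ih.
have : 0 <= n%:R * x * x by rewrite !mulr_ge0.
lra.
Qed.

Lemma geo_root (la : R) n : 0 <= la < 1 -> (0 < n)%N ->
  exists2 r, 0 < r < 1 & la <= r ^+ n.
Proof.
move=> /andP[l0 l1] n0; pose x := (1 - la) / n.+1%:R.
have n1 : 0 < n.+1%:R :> R by rewrite ltr0n.
have x0 : 0 < x by rewrite divr_gt0// subr_gt0.
have x1 : x < 1.
  rewrite ltr_pdivrMr// mul1r (@lt_le_trans _ _ 2)//; first by lra.
  by rewrite ler_nat.
exists (1 - x); first by lra.
have x01 : 0 <= x <= 1 by rewrite (ltW x0) (ltW x1).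
have := bernoulli n x01.
have : n.+1%:R * x = 1 - la by rewrite /x mulrC divfK// gt_eqF.
rewrite -natr1; lra.
Qed.

Lemma geo_sum (r : R) n : 0 < r < 1 -> \sum_(j < n) r ^+ j <= (1 - r)^-1.
Proof.
move=> /andP[r0 r1]; have h : 0 < 1 - r by lra.
rewrite -[leRHS]div1r ler_pdivlMr//.
suff -> : (\sum_(j < n) r ^+ j) * (1 - r) = 1 - r ^+ n by rewrite gerBl exprn_ge0// ltW.
elim: n => [|n ih]; first by rewrite big_ord0 mul0r expr0 subrr.
by rewrite big_ord_recr/= mulrDl ih exprSr; ring.
Qed.

Lemma geo_small (r e : R) : 0 < r < 1 -> 0 < e -> exists n, forall m, (n <= m)%N -> r ^+ m <= e.
Proof.
move=> /andP[r0 r1] e0; have h : `|r| < 1 by rewrite gtr0_norm.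
have [N HN] := cvgn_leP (cvg_expr h) e0; exists N => m Nm; have := HN m Nm.
by rewrite subr0 ger0_norm// exprn_ge0// ltW.
Qed.

Lemma linear_geo (r : R) : 0 < r < 1 ->
  exists2 C, 0 <= C & forall j, (2 * j + 3)%:R * r ^+ j <= C.
Proof.
move=> r01; have /andP[r0 r1] := r01; pose y := r^-1 - 1.
have y0 : 0 < y by rewrite subr_gt0 invf_gt1.
exists (3 + 2 / y) => [|j]; first by rewrite addr_ge0// divr_ge0// ltW.
have B : 1 + j%:R * y <= (r^-1) ^+ j.
  elim: j => [|j ih]; first by rewrite mul0r addr0 expr0.
  have ri : 0 <= r^-1 by rewrite invr_ge0 ltW.
  rewrite exprS -natr1; have := ler_wpM2l ri ih.
  have -> : r^-1 = 1 + y by rewrite /y addrC subrK.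
  have : 0 <= j%:R * y * y by rewrite !mulr_ge0 ?(ltW y0).
  lra.
have rj : 0 < r ^+ j by rewrite exprn_gt0.
have rj1 : r ^+ j <= 1 by rewrite exprn_ile1 ?(ltW r0) ?(ltW r1).
have B2 : r ^+ j * (j%:R * y) <= 1.
  have := ler_wpM2l (ltW rj) B; rewrite exprVn mulfV ?gt_eqF// => h; lra.
have B3 : r ^+ j * j%:R <= y^-1 by rewrite -[leRHS]div1r ler_pdivlMr// -mulrA.
rewrite natrD natrM; lra.
Qed.

Lemma split_sum (F : nat -> R) M n : (M <= n)%N ->
  \sum_(j < n) F j = \sum_(j < M) F j + \sum_(j < n - M) F (M + j)%N.
Proof.
move=> Mn; have [k ->] : exists k, n = (M + k)%N by exists (n - M)%N; rewrite subnKC.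
by rewrite addKn big_split_ord/=.
Qed.

(** Dominated convergence for series. The condition la <= r^3 provides three factors r^j: one pays
    for the weight, one for 2 j + 3, and one is left to sum the tail. *)
Lemma weighted_sum_small (f : nat -> nat -> R) (C la r : R) N0 : 0 <= la -> 0 < r < 1 ->
  la <= r ^+ 3 -> 0 <= C -> (forall n j, 0 <= f n j) ->
  (forall n j, (N0 <= n)%N -> f n j <= C * la ^+ j) ->
  (forall j, f n j @[n --> \oo] --> (0 : R)) ->
  forall e, 0 < e -> exists N, forall n, (N <= n)%N ->
    \sum_(j < n) (r ^+ j)^-1 * ((2 * j + 3)%:R * f n j) <= e.
Proof.
move=> la0 r01 lar C0 f0 fC fcv e e0; have /andP[r0 r1] := r01.
have [C' C'0 HC'] := linear_geo r01.
have e2 : 0 < e / 2 by rewrite divr_gt0.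
pose D := C * C' / (1 - r) + 1.
have r1' : 0 < 1 - r by lra.
have D0 : 0 < D by rewrite ltr_wpDl// divr_ge0 ?mulr_ge0// ltW.
have eD : 0 < e / (2 * D) by rewrite divr_gt0// mulr_gt0.
have [M HM] := geo_small r01 eD.
have head : (\sum_(j < M) (r ^+ j)^-1 * ((2 * j + 3)%:R * f n j)) @[n --> \oo] --> (0 : R).
  have H j : (j < M)%N -> ((r ^+ j)^-1 * ((2 * j + 3)%:R * f n j)) @[n --> \oo] --> (0 : R).
    move=> _; rewrite -[X in _ --> X](mulr0 (r ^+ j)^-1); apply: cvgMl_tmp.
    by rewrite -[X in _ --> X](mulr0 (2 * j + 3)%:R); apply: cvgMl_tmp; exact: fcv.
  have h := @cvg_sum_ord R nat \oo M (fun j n => (r ^+ j)^-1 * ((2 * j + 3)%:R * f n j))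
    (fun=> 0) _ H.
  have h2 : \sum_(j < M) (0 : R) = 0 by rewrite big1.
  by rewrite h2 in h; exact: h.
have [N1 HN1] := cvgn_leP head e2.
exists (maxn M (maxn N0 N1)) => n; rewrite !geq_max => /and3P[nM n0 n1].
have h1 : \sum_(j < M) (r ^+ j)^-1 * ((2 * j + 3)%:R * f n j) <= e / 2.
  by have := HN1 n n1; rewrite subr0; apply: le_trans; exact: ler_norm.
have rj j : 0 < r ^+ j by rewrite exprn_gt0.
have term j : (r ^+ j)^-1 * ((2 * j + 3)%:R * f n j) <= C * C' * r ^+ j.
  rewrite ler_pdivrMl//.
  have h : f n j <= C * (r ^+ 3) ^+ j.
    rewrite (le_trans (fC n j n0))// ler_wpM2l// lerXn2r ?nnegrE// exprn_ge0// ltW//.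
  rewrite (le_trans (ler_wpM2l (ler0n _ _) h))//.
  have -> : (r ^+ 3) ^+ j = r ^+ j * r ^+ j * r ^+ j by rewrite -!exprMn -expr2 -exprSr.
  have := ler_wpM2l (mulr_ge0 C0 (mulr_ge0 (ltW (rj j)) (ltW (rj j)))) (HC' j); lra.
have -> : \sum_(j < n) (r ^+ j)^-1 * ((2 * j + 3)%:R * f n j) =
    \sum_(j < M) (r ^+ j)^-1 * ((2 * j + 3)%:R * f n j) +
    \sum_(j < n - M) (r ^+ (M + j))^-1 * ((2 * (M + j) + 3)%:R * f n (M + j)%N).
  exact: (@split_sum (fun j => (r ^+ j)^-1 * ((2 * j + 3)%:R * f n j)) M n nM).
have h2 : \sum_(j < n - M) (r ^+ (M + j))^-1 * ((2 * (M + j) + 3)%:R * f n (M + j)%N) <=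
    C * C' * r ^+ M * (1 - r)^-1.
  rewrite (le_trans (ler_sum _ (fun (j : 'I_(n - M)) _ => term (M + j)%N)))//.
  have -> : \sum_(i < n - M) C * C' * r ^+ (M + i) = C * C' * r ^+ M * \sum_(i < n - M) r ^+ i.
    by rewrite mulr_sumr; apply: eq_bigr => i _; rewrite exprD; ring.
  by rewrite ler_wpM2l ?geo_sum// mulr_ge0 ?mulr_ge0 ?(ltW (rj M)).
have h3 : C * C' * r ^+ M * (1 - r)^-1 <= e / 2.
  have h4 := HM M (leqnn M).
  have CC : 0 <= C * C' / (1 - r) by rewrite divr_ge0 ?mulr_ge0 ?(ltW r1').
  have := ler_wpM2l CC h4.
  have -> : C * C' / (1 - r) * r ^+ M = C * C' * r ^+ M * (1 - r)^-1 by ring.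
  move=> /le_trans; apply.
  have -> : e / 2 = D * (e / (2 * D)) by field; rewrite gt_eqF.
  by rewrite ler_wpM2r ?(ltW eD)// /D lerDl.
lra.
Qed.

(** Cauchy-Schwarz with weights r^j. It bounds the mean square of a sum over distances by the mean
    squares at single distances, without estimating correlations between distances. *)
Lemma weighted_CS (r : R) (U : nat -> R) n : 0 < r < 1 ->
  (\sum_(j < n) U j) ^+ 2 <= (1 - r)^-1 * \sum_(j < n) (r ^+ j)^-1 * U j ^+ 2.
Proof.
move=> r01; have /andP[r0 r1] := r01; have r1' : 0 < 1 - r by lra.
have rj j : 0 < r ^+ j by rewrite exprn_gt0.
have H : (\sum_(j < n) U j) ^+ 2 <=
    (\sum_(j < n) r ^+ j) * \sum_(j < n) (r ^+ j)^-1 * U j ^+ 2.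
  elim: n => [|n ih]; first by rewrite !big_ord0 expr0n mulr0.
  rewrite !big_ord_recr/=.
  set S := \sum_(i < n) U i in ih *; set A := \sum_(i < n) r ^+ i in ih *.
  set B := \sum_(i < n) _ in ih *; set u := U n.
  have A0 : 0 <= A by apply: sumr_ge0 => i _; exact: ltW.
  have B0 : 0 <= B by apply: sumr_ge0 => i _; rewrite mulr_ge0 ?invr_ge0 ?(ltW (rj i)) ?sqr_ge0.
  have rn := rj n; set x := r ^+ n in rn *.
  have -> : (A + x) * (B + x^-1 * u ^+ 2) = A * B + A * x^-1 * u ^+ 2 + x * B + u ^+ 2.
    by field; rewrite gt_eqF.
  have key : 2 * S * u <= A * x^-1 * u ^+ 2 + x * B.
    have [->|Sn] := eqVneq S 0.
      rewrite mulr0 mul0r; apply: addr_ge0; last exact: (mulr_ge0 (ltW rn) B0).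
      by apply: mulr_ge0; [apply: (mulr_ge0 A0); rewrite invr_ge0 ltW|exact: sqr_ge0].
    have Ap : 0 < A.
      rewrite lt_neqAle A0 andbT eq_sym; apply: contraTneq ih => ->.
      by rewrite mul0r -ltNge exprn_even_gt0.
    have h : S ^+ 2 * (x / A) <= x * B.
      have : S ^+ 2 * (x / A) <= A * B * (x / A) by rewrite ler_wpM2r// divr_ge0 ?ltW.
      by have -> : A * B * (x / A) = x * B by field; rewrite gt_eqF.
    rewrite (le_trans _ (lerD (lexx _) h))//.
    have : 0 <= (A / x) * (u - S * (x / A)) ^+ 2 by rewrite mulr_ge0 ?divr_ge0 ?sqr_ge0 ?ltW.
    have -> : (A / x) * (u - S * (x / A)) ^+ 2 = A * x^-1 * u ^+ 2 + S ^+ 2 * (x / A) - 2 * S * u.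
      by field; rewrite !gt_eqF.
    lra.
  lra.
rewrite (le_trans H)// ler_wpM2r ?geo_sum// sumr_ge0// => j _.
by rewrite mulr_ge0 ?invr_ge0 ?(ltW (rj j)) ?sqr_ge0.
Qed.

End Geometric.

(** Each term has a nonzero mean product with at most L earlier ones, and each such product has mean
    at most s by 2 x y <= x^2 + y^2. *)
Lemma Ex_sum_mdep (d : measure_display) (T : measurableType d) (R : realType)
  (P : probability T R) (F : nat -> T -> R) (s : R) (L n : nat) : (forall k, bmf (F k)) ->
  (forall j k, (j + L < k)%N -> Ex P (fun w => F j w * F k w) = 0) ->
  (forall k, (k < n)%N -> Ex P (fun w => F k w ^+ 2) <= s) ->
  Ex P (fun w => (\sum_(k < n) F k w) ^+ 2) <= n%:R * ((2 * L + 1)%:R * s).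
Proof.
move=> bF F0 Fs; elim: n Fs => [|n ih] Fs.
  rewrite mul0r (_ : (fun w => _) = fun=> 0) ?Ex_cst//.
  by apply/funext => w; rewrite big_ord0 expr0n.
have s0 : 0 <= s by rewrite (le_trans _ (Fs n (ltnSn n)))// Ex_ge0// => w; exact: sqr_ge0.
have bS : bmf (fun w => \sum_(k < n) F k w) by apply: bmf_sum => k _.
rewrite (_ : (fun w => _) = (fun w => (\sum_(k < n) F k w) ^+ 2 +
    2 * (\sum_(k < n) F k w * F n w) + F n w ^+ 2)); last first.
  by apply/funext => w; rewrite big_ord_recr/= -mulr_suml; ring.
have bSF : bmf (fun w => \sum_(k < n) F k w * F n w).
  by apply: bmf_sum => k _; exact: bmfM.
rewrite ExD; [|by apply: bmfD; [exact: bmfX|exact: bmfZ]|exact: bmfX].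
rewrite ExD; [|exact: bmfX|exact: bmfZ].
rewrite ExZ// Ex_sum; last by move=> k _; exact: bmfM.
have h1 : \sum_(i < n) Ex P (fun x => F i x * F n x) <= L%:R * s.
  have h2 (i : 'I_n) : Ex P (fun x => F i x * F n x) <= (n <= i + L)%N%:R * s.
    have [h|h] := leqP n (i + L); last by rewrite F0// mul0r.
    rewrite mul1r.
    have h3 : Ex P (fun x => F i x * F n x) <= (Ex P (fun x => F i x ^+ 2) + Ex P (fun x => F n x ^+ 2)) / 2.
      rewrite -ExD; [|exact: bmfX|exact: bmfX]; rewrite mulrC -ExZ; last by apply: bmfD; exact: bmfX.
      apply: le_Ex; [exact: bmfM|by apply: bmfZ; apply: bmfD; exact: bmfX|move=> x].
      have := sqr_ge0 (F i x - F n x); lra.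
    have := Fs i (ltnW (ltn_ord i)); have := Fs n (ltnSn n); lra.
  rewrite (le_trans (ler_sum _ (fun i _ => h2 i)))// -mulr_suml ler_wpM2r//.
  rewrite -natr_sum ler_nat -(big_mkord xpredT (fun i => nat_of_bool (n <= i + L)%N)).
  have [nL|Ln] := leqP n L.
    rewrite (leq_trans _ nL)// -[leqRHS]subn0 -[leqRHS]muln1 -sum_nat_const_nat.
    by apply: leq_sum => i _; exact: leq_b1.
  rewrite (@big_cat_nat _ _ _ (n - L))//= ?leq_subr// big_nat_cond big1 ?add0n; last first.
    move=> i /andP[/andP[_ hi] _]; rewrite leqNgt.
    by have -> : (i + L < n)%N by rewrite addnC -ltn_subRL.
  rewrite (leq_trans (n := \sum_(n - L <= i < n) 1))//.
    by apply: leq_sum => i _; exact: leq_b1.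
  by rewrite sum_nat_const_nat muln1 subKn// ltnW.
have h2 := ih (fun k kn => Fs k (ltnW kn)).
have h3 := Fs n (ltnSn n).
have -> : n.+1%:R * ((2 * L + 1)%:R * s) = n%:R * ((2 * L + 1)%:R * s) + 2 * (L%:R * s) + s.
  by rewrite -natr1 natrD natrM; ring.
lra.
Qed.

(** * Contracting blocks and decorrelation *)

Section RandomProducts.
Context (d : measure_display) (T : measurableType d) (R : realType).
Variable P : probability T R.
Variables (q : nat) (X : nat -> T -> 'M[R]_q).
Hypothesis q0 : (0 < q)%N.
Hypothesis hiid : iid_mx P X.
Hypothesis hS : forall n w, (1 <= n)%N -> in_S (X n w).

Definition win (a b : nat) : set nat := [set n | (a < n <= b)%N].

Lemma Qp_entry_wrt k m i j : meas_wrt (cyl X (win k (k + m))) (fun w => Qp X k m w i j).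
Proof.
elim: m i j => [|m ih] i j; first exact: measurable_cst.
rewrite /= (_ : (fun w => _) = fun w => \sum_l X (k + m).+1 w i l * Qp X k m w l j); last first.
  by apply/funext => w; rewrite mxE.
apply: measurable_sum => l; apply: measurable_funM.
  by apply: entry_wrt => //; rewrite /win /= addnS ltnS leq_addr leqnn.
apply: meas_wrtS (ih l j) => n /=; rewrite /win /= addnS => /andP[-> h]/=.
exact: leqW.
Qed.

Lemma mxfun_Nsum : mxfun (@Nsum R q).
Proof. by apply: measurable_sum => i; apply: measurable_sum => j; exact: mxfun_entry. Qed.

Lemma mxfun_csum j : mxfun (fun M : 'M[R]_q => csum M j).
Proof. by apply: measurable_sum => i; exact: mxfun_entry. Qed.

Lemma mxfun_rsum i : mxfun (fun M : 'M[R]_q => rsum M i).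
Proof. by apply: measurable_sum => j; exact: mxfun_entry. Qed.

Lemma mxfun_Vmin : mxfun (@Vmin R q).
Proof.
pose i0 : 'I_q := Ordinal q0.
rewrite (_ : @Vmin R q = fun M => \big[Num.min/rsum M i0]_(i <- index_enum 'I_q) rsum M i).
  elim: (index_enum _) => [|i s ih].
    rewrite (_ : (fun M => _) = fun M => rsum M i0); first exact: mxfun_rsum.
    by apply/funext => M; rewrite big_nil.
  rewrite (_ : (fun M => _) = fun M => Num.min (rsum M i) (\big[Num.min/rsum M i0]_(i <- s) rsum M i)).
    by apply: measurable_minr => //; exact: mxfun_rsum.
  by apply/funext => M; rewrite big_cons.
apply/funext => M; have [i E H] := VminE q0 M.
apply/eqP; rewrite eq_le; apply/andP; split.
  by apply/bigmin_geP; split=> // k _; exact: H.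
by rewrite E; apply: bigmin_le_cond.
Qed.

Lemma mxfun_ln G : mxfun G -> mxfun (fun M : 'M[R]_q => ln (G M)).
Proof. by move=> mG; apply: (measurableT_comp (@measurable_ln R) mG). Qed.

Lemma mxfun_Wrange : mxfun (@Wrange R q).
Proof.
by apply: measurable_funB; apply: mxfun_ln; [exact: mxfun_Nsum|exact: mxfun_Vmin].
Qed.

Lemma measurable_inv : measurable_fun [set: R] (@GRing.inv R).
Proof.
rewrite (_ : @GRing.inv R = fun x => if 0 < x then expR (- ln x) else
   if x < 0 then - expR (- ln (- x)) else 0).
  apply: measurable_fun_ifT.
  - by apply: measurable_fun_ltr; [exact: measurable_cst|exact: measurable_id].
  - apply: (measurableT_comp (@measurable_expR R)).
    by apply: measurableT_comp => //; exact: measurable_ln.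
  apply: measurable_fun_ifT => //.
    by apply: measurable_fun_ltr; [exact: measurable_id|exact: measurable_cst].
  apply: measurableT_comp => //; apply: (measurableT_comp (@measurable_expR R)).
  apply: measurableT_comp => //; apply: (measurableT_comp (@measurable_ln R)).
  by apply: continuous_measurable_fun => y; apply: cvgN; exact: cvg_id.
apply/funext => x; case: (ltrgtP 0 x) => [x0|x0|<-]; last by rewrite invr0.
  by rewrite expRN lnK.
by rewrite expRN lnK ?posrE ?oppr_gt0// invrN opprK.
Qed.

Lemma mxfun_Kcond : mxfun (@Kcond R q).
Proof.
apply: measurable_funM; first exact: mxfun_Nsum.
apply: measurable_funD; apply: measurable_sum => i;
  apply: (measurableT_comp measurable_inv); [exact: mxfun_csum|exact: mxfun_rsum].
Qed.

Lemma law_measurable n G : (1 <= n)%N -> mxfun G -> measurable_fun [set: T] (fun w => G (X n w)).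
Proof.
move=> n1 mG; apply: (wrt_measurable hiid (I := setT)); exact: (mxfun_wrt n1 _ mG).
Qed.

Lemma Ex_law n G (g : R -> R) : (1 <= n)%N -> mxfun G -> measurable_fun [set: R] g ->
  (exists M, forall x, `|g x| <= M) ->
  Ex P (fun w => g (G (X n w))) = Ex P (fun w => g (G (X 1%N w))).
Proof.
move=> n1 mG mg bg; apply: (Ex_eq_law (Y := fun w => G (X n w))) => //.
- exact: law_measurable.
- exact: law_measurable.
- by move=> B mB; apply: (mxfun_law hiid n1 mG mB).
Qed.

Definition pm (F : nat -> 'M[R]_q) (m : nat) : 'M[R]_q := iteri m (fun i A => F i *m A) 1%:M.

Lemma Qp_pm k m w : Qp X k m w = pm (fun i => X (k + i).+1 w) m.
Proof. by elim: m => //= m ->. Qed.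

Lemma pm_mono (c : R) (F G : nat -> 'M[R]_q) m : 0 <= c ->
  (forall r i j, (r < m)%N -> 0 <= F r i j /\ F r i j <= c * G r i j) ->
  forall i j, 0 <= pm F m i j /\ pm F m i j <= c ^+ m * pm G m i j.
Proof.
move=> c0; elim: m => [|m ih] H i j.
  by rewrite expr0 mul1r; split => //; rewrite mxE ler0n.
have {}ih := ih (fun r i j rm => H r i j (ltnW rm)).
have Hm i j := H m i j (ltnSn m).
rewrite /pm /= -!/(pm _ m) !mxE; split.
  by apply: sumr_ge0 => l _; rewrite mulr_ge0//; [case: (Hm i l)|case: (ih l j)].
rewrite mulr_sumr; apply: ler_sum => l _.
have [h1 h2] := Hm i l; have [h3 h4] := ih l j.
rewrite (le_trans (ler_pM h1 h3 h2 h4))// exprS; lra.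
Qed.

(* A positive product of [n] factors is detected by 0/1 patterns bounding its factors
   from below; there are countably many patterns, so some pattern whose product is
   positive occurs with positive probability. *)
Definition patt (s : seq 'M[bool]_q) (r : nat) : 'M[R]_q :=
  \matrix_(i, j) (nth (const_mx false) s r i j)%:R.

Definition valid s := forall i j, 0 < pm (patt s) (size s) i j.

Definition bpat (s : seq 'M[bool]_q) (N : nat) (r : nat) : set 'M[R]_q :=
  [set M : 'M[R]_q | (forall i j, N.+1%:R^-1 * patt s r i j <= M i j) /\ Nsum M <= N.+1%:R].

Lemma bpat_measurable s N r : mx_measurable (bpat s N r).
Proof.
have -> : bpat s N r = \bigcap_(i in [set: 'I_q]) \bigcap_(j in [set: 'I_q])
   ([set M : 'M[R]_q | N.+1%:R^-1 * patt s r i j <= M i j] `&` [set M | Nsum M <= N.+1%:R]).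
  apply/seteqP; split => M /=.
    by move=> [h1 h2] i _ j _; split; [exact: h1|].
  move=> h; split; first by move=> i j; have [] := h i I j I.
  by have [] := h (Ordinal q0) I (Ordinal q0) I.
apply: (@fin_bigcap_measurable _ (g_sigma_algebraType _)) => // i _.
apply: (@fin_bigcap_measurable _ (g_sigma_algebraType _)) => // j _.
apply: (@measurableI _ (g_sigma_algebraType _)).
  by apply: mset_le; [exact: measurable_cst|exact: mxfun_entry].
by apply: mset_le; [exact: mxfun_Nsum|exact: measurable_cst].
Qed.

Definition gev s N k : set T :=
  \big[setI/setT]_(n <- iota k.+1 (size s)) (X n @^-1` bpat s N (n - k.+1)).

Lemma gevP s N k w : gev s N k w <->
  forall r, (r < size s)%N -> bpat s N r (X (k + r).+1 w).
Proof.
rewrite /gev -bigcap_seq; split => [H r rs|H n /=].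
  have := H (k + r).+1; rewrite /= mem_iota ltnS leq_addr addSn ltnS ltn_add2l rs => /(_ isT).
  by rewrite subSS addKn.
rewrite mem_iota => /andP[kn nk]; have := H (n - k.+1)%N.
rewrite ltn_subLR// nk => /(_ isT).
by rewrite -addSn subnKC.
Qed.

Lemma gev_prob s N k : fine (P (gev s N k)) = fine (P (gev s N 0)).
Proof.
have [_ [H1 H2]] := hiid.
have E j : fine (P (gev s N j)) = \prod_(r <- iota 0 (size s)) fine (P (X 1%N @^-1` bpat s N r)).
  rewrite /gev (H1 _ (fun n => bpat s N (n - j.+1))) ?iota_uniq//.
  - rewrite -[X in iota X](addn0) iotaDl big_map; apply: eq_big_seq => r _.
    by rewrite addKn H2// ?addSn//; exact: bpat_measurable.
  - by apply/allP => n; rewrite mem_iota => /andP[h _]; rewrite (leq_trans _ h).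
  - by move=> n; exact: bpat_measurable.
by rewrite !E.
Qed.

Lemma gev_wrt s N k : <<s cyl X (win k (k + size s)) >> (gev s N k).
Proof.
have H n : (k < n <= k + size s)%N -> <<s cyl X (win k (k + size s)) >> (X n @^-1` bpat s N (n - k.+1)).
  move=> kn; apply: sub_sigma_algebra; apply: cyl_preimage => //.
    by case/andP: kn => h _; exact: leq_trans h.
  exact: bpat_measurable.
rewrite /gev; have : all (fun n => k < n <= k + size s)%N (iota k.+1 (size s)).
  by apply/allP => n; rewrite mem_iota addSn ltnS.
elim: (iota _ _) => [_|n l ih]; first by rewrite big_nil; exact: (@measurableT _ (g_sigma_algebraType (cyl X (win k (k + size s))))).
rewrite big_cons /= => /andP[h1 h2].
by apply: (@measurableI _ (g_sigma_algebraType (cyl X (win k (k + size s))))); [exact: H|exact: ih].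
Qed.

(** On the event each factor lies entrywise between (N + 1)^-1 times its pattern and N + 1 times the
    all-ones matrix, and products of nonnegative matrices are monotone. *)
Lemma gev_entries s N : valid s -> exists c1 c2 : R, 0 < c1 < c2 /\
  forall k w, gev s N k w -> forall i j, c1 <= Qp X k (size s) w i j <= c2.
Proof.
move=> vs; have N0 : 0 < N.+1%:R :> R by rewrite ltr0n.
pose one : 'M[R]_q := const_mx 1.
pose n0 := size s.
have [c c0 Hc] : exists2 c : R, 0 < c & forall i j, c <= pm (patt s) n0 i j.
  pose i0 : 'I_q := Ordinal q0.
  case: (@arg_minP _ _ _ (i0, i0) xpredT (fun x => pm (patt s) n0 x.1 x.2) isT) => -[i j] _ H.
  by exists (pm (patt s) n0 i j) => [|k l]; [exact: vs|exact: (H (k, l))].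
pose c1 := N.+1%:R^-1 ^+ n0 * c.
have c10 : 0 < c1 by rewrite mulr_gt0// exprn_gt0// invr_gt0.
have [C HC] : exists C : R, forall i j, N.+1%:R ^+ n0 * pm (fun=> one) n0 i j <= C.
  exists (\sum_i \sum_j `|N.+1%:R ^+ n0 * pm (fun=> one) n0 i j|) => i j.
  rewrite (le_trans (ler_norm _))// (bigD1 i)//= (bigD1 j)//= -addrA lerDl addr_ge0//.
    by apply: sumr_ge0.
  by apply: sumr_ge0 => k _; apply: sumr_ge0.
(* The upper bound C is enlarged so as to be strictly above c1. *)
exists c1, (C + c1 + 1 + `|C|); split.
  by rewrite c10/=; have := ler_norm (- C); rewrite normrN; lra.
move=> k w /gevP G i j; rewrite Qp_pm; apply/andP; split.
  have H r a b : (r < n0)%N -> 0 <= patt s r a b /\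
      patt s r a b <= N.+1%:R * X (k + r).+1 w a b.
    move=> rs; split; first by rewrite mxE ler0n.
    by have [/(_ a b) + _] := G r rs; rewrite ler_pdivrMl.
  have [_ h] := pm_mono (ltW N0) H i j.
  by rewrite /c1 exprVn ler_pdivrMl ?exprn_gt0//; apply: (le_trans (Hc i j)).
have H r a b : (r < n0)%N -> 0 <= X (k + r).+1 w a b /\
    X (k + r).+1 w a b <= N.+1%:R * one a b.
  move=> rs; have SX := hS w (ltn0Sn (k + r)); split; first by case: SX.
  rewrite mxE mulr1; have [_] := G r rs; apply: le_trans; exact: entry_le_Nsum.
have [_ h] := pm_mono (F := fun r => X (k + r).+1 w) (G := fun=> one) (ltW N0) H i j.
apply: (@le_trans _ _ C); last by have := normr_ge0 C; lra.
exact: le_trans (HC i j).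
Qed.

Lemma Spos_gev n w : (1 <= n)%N -> in_Spos (Xprod X n w) ->
  exists s N, size s = n /\ valid s /\ gev s N 0 w.
Proof.
move=> n1 pos.
pose s : seq 'M[bool]_q := [seq (\matrix_(i, j) (0 < X r.+1 w i j)) | r <- iota 0 n].
have ss : size s = n by rewrite size_map size_iota.
have sn r : (r < n)%N -> nth (const_mx false) s r = \matrix_(i, j) (0 < X r.+1 w i j).
  by move=> rn; rewrite (nth_map 0%N) ?size_iota// nth_iota.
(* [m] dominates every Nsum and every inverse of a positive entry; a zero entry contributes 0, its
   formal inverse being 0. *)
pose m := \sum_(r < n) (Nsum (X r.+1 w) + \sum_i \sum_j `|(X r.+1 w i j)^-1|).
have m0 (r : 'I_n) : 0 <= Nsum (X r.+1 w) + \sum_i \sum_j `|(X r.+1 w i j)^-1|.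
  rewrite addr_ge0//; first by apply/ltW/Nsum_gt0 => //; exact: hS.
  by apply: sumr_ge0 => i _; apply: sumr_ge0.
pose N := Num.bound m.
have mN : m <= N.+1%:R.
  have mm : 0 <= m by apply: sumr_ge0.
  by rewrite (le_trans (ltW (archi_boundP mm)))// ler_nat.
have N0 : 0 < N.+1%:R :> R by rewrite ltr0n.
have HN (r : 'I_n) : Nsum (X r.+1 w) <= N.+1%:R /\
    forall i j, `|(X r.+1 w i j)^-1| <= N.+1%:R.
  have h : Nsum (X r.+1 w) + \sum_i \sum_j `|(X r.+1 w i j)^-1| <= N.+1%:R.
    rewrite (le_trans _ mN)// /m (bigD1 r)//= lerDl sumr_ge0//.
  have p1 : 0 < Nsum (X r.+1 w) by apply: Nsum_gt0 => //; exact: hS.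
  have p2 : 0 <= \sum_i \sum_j `|(X r.+1 w i j)^-1|.
    by apply: sumr_ge0 => i _; apply: sumr_ge0.
  split; first lra.
  move=> i j; apply: (@le_trans _ _ (\sum_i \sum_j `|(X r.+1 w i j)^-1|)); last lra.
  rewrite (bigD1 i)//= (bigD1 j)//= -addrA lerDl addr_ge0//; first by apply: sumr_ge0.
  by apply: sumr_ge0 => k _; apply: sumr_ge0.
have S0 r : (r < n)%N -> in_S (X r.+1 w) by move=> _; exact: hS.
exists s, N; split=> //; split.
  move=> i j; rewrite ss.
  have H r a b : (r < n)%N -> 0 <= X (0 + r).+1 w a b /\
      X (0 + r).+1 w a b <= N.+1%:R * patt s r a b.
    move=> rn; have [X0 _] := S0 r rn; split=> //.
    rewrite mxE sn// mxE; have [x0|x0] := ltP 0 (X (0 + r).+1 w a b); last by rewrite mulr0.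
    rewrite mulr1 (le_trans (entry_le_Nsum a b (S0 r rn)))//.
    by have [] := HN (Ordinal rn).
  have [_ h] := pm_mono (F := fun r => X (0 + r).+1 w) (G := patt s) (ltW N0) H i j.
  have : 0 < N.+1%:R ^+ n * pm (patt s) n i j.
    by rewrite (lt_le_trans _ h)// -Qp_pm -Xprod_Qp.
  by rewrite pmulr_rgt0// exprn_gt0.
apply/gevP => r; rewrite ss => rn; split; last by have [] := HN (Ordinal rn).
move=> a b; rewrite mxE sn// mxE; have [x0|x0] := ltP 0 (X r.+1 w a b); last first.
  by rewrite mulr0; case: (S0 r rn).
have [_ /(_ a b)] := HN (Ordinal rn); rewrite /= mulr1 gtr0_norm ?invr_gt0// => h.
by rewrite -[leRHS]invrK lef_pV2 ?posrE ?invr_gt0.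
Qed.

Hypothesis hcontr : (0 < P (\bigcup_(n in [set n | (1 <= n)%N])
                      [set w | in_Spos (Xprod X n w)]))%E.

Lemma good_block_exists : exists s N, (0 < size s)%N /\ valid s /\ 0 < fine (P (gev s N 0)).
Proof.
apply: contrapT => H.
pose F (k : nat) : set T := if unpickle k is Some (s, N) then
  (if `[< (0 < size s)%N /\ valid s >] then gev s N 0 else set0) else set0.
have mgev s N : measurable (gev s N 0).
  apply: (gsigma_measurable (C := cyl X (win 0 (0 + size s)))); last exact: gev_wrt.
  exact: (cyl_measurable hiid).
have nF k : P.-negligible (F k).
  rewrite /F; case: (unpickle k) => [[s N]|]; last exact: negligible_set0.
  case: asboolP => [[s0 vs]|_]; last exact: negligible_set0.
  have [_ h0] := negligibleP P (mgev s N); apply: h0.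
  have E := Pr_fine P (mgev s N); apply: (etrans E); congr EFin; apply/eqP; rewrite eq_le Pr_ge0 andbT leNgt; apply/negP => h.
  by apply: H; exists s, N.
have mS n : measurable [set w | in_Spos (Xprod X n w)].
  rewrite (_ : mkset _ = \bigcap_(i in [set: 'I_q]) \bigcap_(j in [set: 'I_q])
     [set w | 0 < Qp X 0 n w i j]); last first.
    apply/seteqP; split => w /=; first by move=> h i _ j _; rewrite /= -Xprod_Qp.
    by move=> h i j; have := h i I j I; rewrite /= -Xprod_Qp.
  apply: fin_bigcap_measurable => // i _; apply: fin_bigcap_measurable => // j _.
  apply: mset_lt; first exact: measurable_cst.
  exact: (wrt_measurable hiid (@Qp_entry_wrt 0 n i j)).
have := negligible_bigcup nF; rewrite negligibleP.
  move=> h; move: hcontr; rewrite (_ : P _ = 0%E) ?ltxx//.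
  apply/negligibleP; first exact: bigcup_measurable.
  apply: (negligibleS _ (negligible_bigcup nF)) => w [n n1 /(Spos_gev n1)[s [N [ss [vs g]]]]].
  exists (pickle (s, N)) => //; rewrite /F pickleK.
  by case: asboolP => // h'; exfalso; apply: h'; rewrite ss.
apply: bigcupT_measurable => k; rewrite /F; case: (unpickle k) => [[s N]|] //.
by case: asboolP.
Qed.

End RandomProducts.

Section Decorrelation.
Context (d : measure_display) (T : measurableType d) (R : realType).
Variable P : probability T R.
Variables (q : nat) (X : nat -> T -> 'M[R]_q).
Hypothesis q0 : (0 < q)%N.
Hypothesis hiid : iid_mx P X.
Hypothesis hS : forall n w, (1 <= n)%N -> in_S (X n w).
Variables (c1 c2 p : R) (n0 : nat) (G : nat -> set T).
Hypothesis c10 : 0 < c1.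
Hypothesis c12 : c1 < c2.
Hypothesis n00 : (0 < n0)%N.
Hypothesis hG : forall k w, G k w -> forall i j, c1 <= Qp X k n0 w i j <= c2.
Hypothesis mG : forall k, <<s cyl X (win k (k + n0)) >> (G k).
Hypothesis pG : forall k, fine (P (G k)) = p.
Hypothesis p0 : 0 < p.

Definition gd k w : bool := `[< G k w >].
Let hgd k w : gd k w -> forall i j, c1 <= Qp X k n0 w i j <= c2.
Proof. by move=> /asboolP; exact: hG. Qed.

Let th : R := 1 - c1 / c2.
Let H0 : R := (c2 / c1) ^+ 2 - 1.
Let t : R := th ^+ 2.
Let C0 : R := H0 ^+ 2 / th ^+ 2.
Let nb := nb n0 gd.
Let rho : R := 1 - p + p * t.

Let c20 : 0 < c2. Proof. exact: lt_trans c12. Qed.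

Let th01 : 0 < th < 1.
Proof. by rewrite /th subr_gt0 ltr_pdivrMr// mul1r c12/= gtrBl divr_gt0. Qed.

Let t01 : 0 < t < 1.
Proof.
have /andP[h1 h2] := th01; rewrite /t exprn_gt0//= expr_lt1//; exact: ltW.
Qed.

Let GT k : measurable (G k).
Proof.
apply: (gsigma_measurable (C := cyl X (win k (k + n0)))); last exact: mG.
exact: (cyl_measurable hiid).
Qed.

Let p1 : p <= 1. Proof. by rewrite -(pG 0); exact: (Pr_le1 P (GT 0)). Qed.

Let rho01 : 0 <= rho < 1.
Proof.
have /andP[h1 h2] := t01; rewrite /rho; apply/andP; split.
  by have := p1; have := mulr_ge0 (ltW p0) (ltW h1); lra.
have : p * t < p * 1 by rewrite ltr_pM2l.
lra.
Qed.

Let indG k w : \1_(G k) w = (gd k w)%:R :> R.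
Proof.
rewrite indicE /gd; case: asboolP => h; first by rewrite mem_set.
by rewrite memNset.
Qed.

Let tg_wrt k : meas_wrt (cyl X (win k (k + n0))) (fun w => t ^+ gd k w).
Proof.
rewrite /meas_wrt (_ : (fun w => _) = fun w => 1 - (1 - t) * \1_(G k) w); last first.
  apply/funext => w; rewrite indG.
  by case: (gd k w); rewrite ?expr1 ?expr0 ?mulr1 ?mulr0; ring.
apply: measurable_funB; first exact: measurable_cst.
apply: measurable_funM; first exact: measurable_cst.
apply: (@measurable_indic _ (g_sigma_algebraType (cyl X (win k (k + n0))))); exact: mG.
Qed.

Let tnb_le B k w : `|t ^+ nb B k w| <= 1.
Proof.
have /andP[h1 h2] := t01; have h3 : 0 <= t ^+ nb B k w by apply: exprn_ge0; exact: ltW.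
by rewrite (ger0_norm h3); apply: exprn_ile1; exact: ltW.
Qed.

Let nb_wrt B : forall k, meas_wrt (cyl X [set n | (k < n)%N]) (fun w => t ^+ nb B k w).
Proof.
elim: B => [|B ih] k; first exact: measurable_cst.
rewrite /meas_wrt (_ : (fun w => _) = fun w => t ^+ nb B (k + n0) w * t ^+ gd k w); last first.
  by apply/funext => w; rewrite -exprD.
apply: measurable_funM.
  apply: meas_wrtS (ih (k + n0)%N) => n /=; exact: leq_ltn_trans (leq_addr _ _).
by refine (meas_wrtS _ (@tg_wrt k)) => n /= /andP[].
Qed.

(** The windows are disjoint, so the number of good ones is binomial and rho = 1 - p + p t is the
    generating function of a single window. *)
Let E_nb B : forall k, Ex P (fun w => t ^+ nb B k w) = rho ^+ B.
Proof.
have /andP[t0 t1] := t01.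
elim: B => [|B ih] k.
  by rewrite expr0 -[RHS](Ex_cst P); congr Ex.
rewrite (_ : (fun w => _) = fun w => t ^+ nb B (k + n0) w * t ^+ gd k w); last first.
  by apply/funext => w; rewrite -exprD.
rewrite (wrt_prod hiid (I := [set n | (k + n0 < n)%N]) (J := win k (k + n0))).
- rewrite ih exprSr; congr (_ * _).
  rewrite (_ : (fun w => _) = fun w => 1 - (1 - t) * \1_(G k) w); last first.
    apply/funext => w; rewrite indG.
    by case: (gd k w); rewrite ?expr1 ?expr0 ?mulr1 ?mulr0; ring.
  rewrite ExB ?ExZ ?Ex_cst ?Ex_indic ?pG//; try exact: bmf_cst; try exact: bmf_indic.
    by rewrite /rho; ring.
  by apply: bmfZ; exact: bmf_indic.
- by move=> n /= h1 /andP[_ h2]; rewrite ltnNge h2 in h1.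
- exact: nb_wrt.
- exact: tg_wrt.
- by exists 1 => w; exact: tnb_le.
- exists 1 => w; case: (gd k w); rewrite ?expr1 ?expr0 ?normr1//.
  by rewrite gtr0_norm// ltW.
Qed.

(** As t < 1, the event nb = 0 is t^nb >= 1, and Markov's inequality applies. *)
Lemma no_good_block_prob : exists2 r : R, 0 <= r < 1 & forall B k,
  measurable [set w | nb B k w = 0%N] /\ fine (P [set w | nb B k w = 0%N]) <= r ^+ B.
Proof.
exists rho => // B k; have /andP[t0 t1] := t01.
have mt := wrt_measurable hiid (@nb_wrt B k).
have e : [set w | nb B k w = 0%N] = [set w | 1 <= t ^+ nb B k w].
  apply/seteqP; split => w /=; first by move=> ->; rewrite expr0.
  case: (nb B k w) => // m; rewrite leNgt => /negP h; exfalso; apply: h.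
  by rewrite exprn_ilt1// ltW.
have mE : measurable [set w | 1 <= t ^+ nb B k w].
  by apply: mset_le => //; exact: measurable_cst.
have bt : bmf (fun w => t ^+ nb B k w) by split => //; exists 1 => w; exact: tnb_le.
rewrite e; split=> //; rewrite -(E_nb B k) -[leLHS]mul1r; apply: Ex_markov => // w.
by apply: exprn_ge0; exact: ltW.
Qed.

Let W1 w := Wrange (X 1%N w).
Let tvW a := tv P W1 a.

Lemma et_wrt k m : (1 <= k)%N -> meas_wrt (cyl X (win k.-1 (k + m))) (et X k m).
Proof.
move=> k1.
have hX : meas_wrt (cyl X (win k.-1 (k + m))) (fun w => ln (Nsum (X k w))).
  apply: (mxfun_wrt k1 _ (mxfun_ln (@mxfun_Nsum R q))).
  by rewrite /win /= leq_addr andbT; case: k k1.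
have hQ : meas_wrt (cyl X (win k.-1 (k + m))) (fun w => ln (Nsum (Qp X k m w))).
  apply: (measurableT_comp (@measurable_ln R)); apply: measurable_sum => i; apply: measurable_sum => j.
  refine (meas_wrtS _ (@Qp_entry_wrt _ _ _ _ X k m i j)) => n /= /andP[h1 h2].
  by rewrite /win /= h2 andbT (leq_ltn_trans (leq_pred k)).
have hQX : meas_wrt (cyl X (win k.-1 (k + m))) (fun w => ln (Nsum (Qp X k m w *m X k w))).
  have e w : Qp X k m w *m X k w = Qp X k.-1 m.+1 w by rewrite Qp_front prednK.
  rewrite /meas_wrt (_ : (fun w => _) = fun w => ln (Nsum (Qp X k.-1 m.+1 w))); last first.
    by apply/funext => w; rewrite e.
  apply: (measurableT_comp (@measurable_ln R)); apply: measurable_sum => i; apply: measurable_sum => j.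
  refine (meas_wrtS _ (@Qp_entry_wrt _ _ _ _ X k.-1 m.+1 i j)) => n /=.
  by rewrite /win /= addnS -addSn prednK.
by apply: measurable_funB => //; exact: measurable_funD.
Qed.

Lemma te_wrt a k m : (1 <= k)%N -> meas_wrt (cyl X (win k.-1 (k + m))) (te X a k m).
Proof.
by move=> k1; apply: measurable_minr; [exact: et_wrt|exact: measurable_cst].
Qed.

Lemma dl_wrt a k m : (1 <= k)%N -> meas_wrt (cyl X (win k.-1 (k + m).+1)) (dl X a k m).
Proof.
move=> k1; apply: measurable_funB.
  by have := @te_wrt a k m.+1 k1; rewrite addnS.
refine (meas_wrtS _ (@te_wrt a k m k1)) => n /= /andP[h1 h2].
by rewrite /win /= h1 leqW.
Qed.

Lemma bmf_te a k m : 0 < a -> (1 <= k)%N -> bmf (te X a k m).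
Proof.
move=> a0 k1; split; first exact: (wrt_measurable hiid (@te_wrt a k m k1)).
exists a => w; have /andP[h1 h2] := te_itv q0 hS m w a0 k1.
by rewrite ger0_norm// (le_trans h2)// ge_min lexx orbT.
Qed.

Lemma bmf_dl a k m : 0 < a -> (1 <= k)%N -> bmf (dl X a k m).
Proof. by move=> a0 k1; apply: bmfB; exact: bmf_te. Qed.

Let W_min a k w : (1 <= k)%N -> Num.min `|Wrange (X k w)| a = Num.min (Wrange (X k w)) a.
Proof. by move=> k1; rewrite ger0_norm// (Wrange_ge0 q0 hS). Qed.

Let cminsq a : measurable_fun [set: R] (fun x : R => Num.min `|x| a ^+ 2).
Proof.
apply: measurable_funX; apply: measurable_minr; last exact: measurable_cst.
by apply: mabs; exact: measurable_id.
Qed.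

Let bminsq a : 0 < a -> forall x : R, `|Num.min `|x| a ^+ 2| <= a ^+ 2.
Proof.
move=> a0 x; rewrite ger0_norm ?sqr_ge0// lerXn2r ?nnegrE ?le_min ?normr_ge0 ?(ltW a0)//.
by rewrite ge_min lexx orbT.
Qed.

Let E_Wk a k : 0 < a -> (1 <= k)%N ->
  Ex P (fun w => Num.min `|Wrange (X k w)| a ^+ 2) = tvW a.
Proof.
move=> a0 k1; rewrite (Ex_law hiid k1 (@mxfun_Wrange R q q0) (cminsq a))//.
by exists (a ^+ 2); exact: bminsq.
Qed.

Let Wk_wrt a k : (1 <= k)%N ->
  meas_wrt (cyl X [set k]) (fun w => Num.min `|Wrange (X k w)| a ^+ 2).
Proof.
move=> k1; apply: (measurableT_comp (cminsq a)).
exact: (mxfun_wrt k1 _ (@mxfun_Wrange R q q0)).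
Qed.

Lemma E_dl_blocks a k m : 0 < a -> (1 <= k)%N ->
  Ex P (fun w => dl X a k m w ^+ 2) <= (C0 + tvW a) * rho ^+ (m %/ n0).
Proof.
move=> a0 k1; set B := (m %/ n0)%N.
have bW : bmf (fun w => Num.min `|Wrange (X k w)| a ^+ 2).
  split; first exact: (wrt_measurable hiid (@Wk_wrt a k k1)).
  by exists (a ^+ 2) => w; exact: bminsq.
have bn : bmf (fun w => t ^+ nb B k w).
  split; first exact: (wrt_measurable hiid (@nb_wrt B k)).
  by exists 1 => w; exact: tnb_le.
have bC : bmf (fun w => C0 + Num.min `|Wrange (X k w)| a ^+ 2).
  by apply: bmfD => //; exact: bmf_cst.
apply: (@le_trans _ _ (Ex P (fun w => (C0 + Num.min `|Wrange (X k w)| a ^+ 2) * t ^+ nb B k w))).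
  apply: le_Ex; [by apply: bmfX; exact: bmf_dl|exact: bmfM|move=> w].
  rewrite W_min//; apply: (dl_sqr_blocks q0 hS c10 c12 hgd) => //.
  by rewrite /B leq_trunc_div.
rewrite (wrt_prod hiid (I := [set k]) (J := [set n | (k < n)%N])).
- by rewrite E_nb ExD ?Ex_cst ?E_Wk//; exact: bmf_cst.
- by move=> n /= ->; rewrite ltnn.
- by apply: measurable_funD; [exact: measurable_cst|exact: Wk_wrt].
- exact: nb_wrt.
- by case: bC.
- by case: bn.
Qed.

Let kc w := ln (Kcond (X 1%N w)).

Lemma E_dl_small a k m K0 : 0 < a -> (1 <= k)%N -> 0 <= K0 ->
  Ex P (fun w => dl X a k m w ^+ 2) <= K0 ^+ 2 + fine (P [set w | K0 < `|kc w|]) * tvW a.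
Proof.
move=> a0 k1 K00; pose l := (k + m).+1.
have bW : bmf (fun w => Num.min `|Wrange (X k w)| a ^+ 2).
  split; first exact: (wrt_measurable hiid (@Wk_wrt a k k1)).
  by exists (a ^+ 2) => w; exact: bminsq.
pose I1 (x : R) : R := \1_[set x : R | K0 < `|x|] x.
have mI1 : measurable_fun [set: R] I1.
  apply: measurable_indic; apply: mset_lt; first exact: measurable_cst.
  by apply: mabs; exact: measurable_id.
have bI1 x : `|I1 x| <= 1 by rewrite /I1 indicE ger0_norm ?lern1 ?leq_b1.
have mk := mxfun_ln (@mxfun_Kcond R q).
have kw : meas_wrt (cyl X [set l]) (fun w => I1 (ln (Kcond (X l w)))).
  by apply: (measurableT_comp mI1); exact: (mxfun_wrt (ltn0Sn _) _ mk).
have bI : bmf (fun w => I1 (ln (Kcond (X l w)))).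
  by split; [exact: (wrt_measurable hiid kw)|exists 1].
apply: (@le_trans _ _ (Ex P (fun w => K0 ^+ 2 + I1 (ln (Kcond (X l w))) *
    Num.min `|Wrange (X k w)| a ^+ 2))).
  apply: le_Ex; [by apply: bmfX; exact: bmf_dl| |move=> w].
    by apply: bmfD; [exact: bmf_cst|exact: bmfM].
  rewrite W_min// (le_trans (dl_sqr_small q0 hS m w a0 k1 K00))// lerD2l ler_wpM2r ?sqr_ge0//.
  rewrite /I1 indicE; case: ltP => h; last by rewrite ler0n.
  by rewrite mem_set//= (lt_le_trans h)// ler_norm.
rewrite ExD; [|exact: bmf_cst|exact: bmfM].
rewrite Ex_cst lerD2l (wrt_prod hiid (I := [set l]) (J := [set k])).
- rewrite E_Wk//; apply: ler_wpM2r; first exact: tv_ge0.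
  rewrite (Ex_law hiid (ltn0Sn _) mk mI1); last by exists 1.
  rewrite -Ex_indic; last first.
    by apply: mgt; apply: mabs; exact: (law_measurable hiid (leqnn 1) mk).
  by rewrite le_eqVlt; apply/orP; left; apply/eqP; congr Ex; apply/funext => w; rewrite /I1 !indicE.
- by move=> n /= -> h; move: (ltnn k); rewrite -{2}h /l ltnS leq_addr.
- exact: kw.
- exact: Wk_wrt.
- by case: bI.
- by case: bW.
Qed.

Let tvW_ge0 a : 0 <= tvW a. Proof. exact: tv_ge0. Qed.

Lemma exchange_triangle (F : nat -> nat -> R) n :
  \sum_(k < n) \sum_(j < n - k.+1) F j k = \sum_(j < n) \sum_(k < n - j.+1) F j k.
Proof.
have W (H : nat -> nat -> R) k : \sum_(j < n - k.+1) H j k =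
    \sum_(j < n | (j < n - k.+1)%N) H j k.
  by rewrite (big_ord_widen n (fun j => H j k))// leq_subr.
under eq_bigr do rewrite (W F).
under [RHS]eq_bigr do rewrite (W (fun k j => F j k)).
rewrite (exchange_big_dep xpredT)//=; apply: eq_bigr => j _; apply: eq_bigl => k.
by rewrite !ltn_subRL !addSn addnC.
Qed.

Variables (D a : nat -> R) (C' : R).
Hypothesis apos : forall n, 0 < a n.
Hypothesis Dpos : forall n, 0 < D n.
Hypothesis aeq : exists N, forall n, (N <= n)%N -> a n ^+ 2 = n%:R * D n.
Hypothesis Dinf : forall B, exists N, forall n, (N <= n)%N -> B <= D n.
Hypothesis C'0 : 0 <= C'.
Hypothesis hW : forall n, tvW (a n) <= C' * (1 + D n).

(** Largest mean square, over the positions k, of the effect of distance j, relative to D n. It is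
    at most C la^j for all large n ([f_geo]) and tends to 0 for each j ([f_cvg]): the two conditions
    of [weighted_sum_small]. *)
Let f n j : R := (\big[Num.max/0]_(k < n) Ex P (fun w => dl X (a n) k.+1 j w ^+ 2)) / D n.

Let f_ge0 n j : 0 <= f n j.
Proof. by rewrite /f divr_ge0 ?(ltW (Dpos n))// bigmax_ge_id. Qed.

Let dl_le_f n j k : (k < n)%N -> Ex P (fun w => dl X (a n) k.+1 j w ^+ 2) <= D n * f n j.
Proof.
move=> kn; rewrite /f mulrC divfK ?gt_eqF//.
exact: (le_bigmax_cond 0 (j := Ordinal kn) (fun i : 'I_n => Ex P (fun w => dl X (a n) i.+1 j w ^+ 2))).
Qed.

Let f_le n j B : 0 <= B -> (forall k, (k < n)%N -> Ex P (fun w => dl X (a n) k.+1 j w ^+ 2) <= B * D n) ->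
  f n j <= B.
Proof.
move=> B0 H; rewrite /f ler_pdivrMr//; apply/bigmax_leP; split.
  by rewrite mulr_ge0// ltW.
by move=> k _; exact: H.
Qed.

Let f_geo : exists C la, [/\ 0 <= C, 0 <= la < 1 & exists N, forall n j, (N <= n)%N -> f n j <= C * la ^+ j].
Proof.
have /andP[r0 r1] := rho01.
have C00 : 0 <= C0 by rewrite divr_ge0 ?sqr_ge0.
(* [la] is at least the n0-th root of rho and turns decay per window into decay per factor; dividing
   by la^n0 pays for the incomplete window. *)
have [la /andP[l0 l1] Hla] := geo_root rho01 n00.
have ln0 : 0 < la ^+ n0 by rewrite exprn_gt0.
exists ((C0 + 2 * C') / la ^+ n0), la; split.
- by rewrite divr_ge0 ?(ltW ln0)// addr_ge0// mulr_ge0.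
- by rewrite (ltW l0).
have [N HN] := Dinf 1; exists N => n j /HN D1.
apply: f_le => [|k kn].
  by rewrite mulr_ge0 ?exprn_ge0 ?(ltW l0)// divr_ge0 ?(ltW ln0)// addr_ge0// mulr_ge0.
have a0 := apos n.
rewrite (le_trans (E_dl_blocks j a0 (ltn0Sn k)))//.
have h1 : C0 + tvW (a n) <= (C0 + 2 * C') * D n.
  have := hW n; have := ler_wpM2l C00 D1; have := ler_wpM2l C'0 D1; lra.
have h2 : rho ^+ (j %/ n0) <= la ^+ j / la ^+ n0.
  rewrite ler_pdivlMr//.
  have h3 : rho ^+ (j %/ n0) <= (la ^+ n0) ^+ (j %/ n0) by rewrite lerXn2r ?nnegrE ?(ltW ln0).
  rewrite (le_trans (ler_wpM2r (ltW ln0) h3))// -exprM -exprD.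
  rewrite ler_wiXn2l ?(ltW l0) ?(ltW l1)//.
  rewrite {1}(divn_eq j n0) mulnC leq_add2l ltnW// ltn_mod//.
have b1 : 0 <= C0 + tvW (a n) by rewrite addr_ge0.
have b2 : 0 <= rho ^+ (j %/ n0) by rewrite exprn_ge0.
rewrite (le_trans (ler_pM b1 b2 h1 h2))// le_eqVlt; apply/orP; left; apply/eqP.
by field; rewrite gt_eqF.
Qed.

Let f_cvg j : f n j @[n --> \oo] --> (0 : R).
Proof.
apply: cvgn_le => e e0; pose e' := e / (2 * (2 * C' + 1)).
have e'0 : 0 < e' by rewrite divr_gt0// mulr_gt0// ltr_wpDl// mulr_ge0.
have mk := law_measurable hiid (leqnn 1) (mxfun_ln (@mxfun_Kcond R q)).
have [K0 K00 HK] := tail_small P mk e'0.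
have [N HN] := Dinf (Num.max 1 (2 * K0 ^+ 2 / e)).
exists N => n /HN; rewrite ge_max => /andP[D1 D2].
rewrite subr0 ger0_norm//; apply: f_le => [|k kn]; first exact: ltW.
rewrite (le_trans (E_dl_small j (apos n) (ltn0Sn k) (ltW K00)))//.
have h1 : K0 ^+ 2 <= e / 2 * D n.
  by move: D2; rewrite ler_pdivrMr//; lra.
have h2 : tvW (a n) <= 2 * C' * D n.
  have := hW n; have := ler_wpM2l C'0 D1; lra.
have h3 : fine (P [set w | K0 < `|kc w|]) * tvW (a n) <= e' * (2 * C' * D n).
  by apply: ler_pM => //; exact: Pr_ge0.
have h4 : e' * (2 * C' * D n) <= e / 2 * D n.
  rewrite mulrA ler_wpM2r ?(ltW (Dpos n))//.
  have -> : e / 2 = e' * (2 * C' + 1).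
    by rewrite /e'; field; rewrite gt_eqF// ltr_wpDl// mulr_ge0.
  by rewrite ler_wpM2l ?(ltW e'0)// lerDl.
lra.
Qed.

(** The truncation is removed by a union bound: the mean square of each truncated defect is o(D n),
    so the probability that some defect exceeds a_n is n o(D n) / a_n^2, small by the norming. The
    variance of the truncated sum is then estimated distance by distance. *)
Theorem eta_sum_concentration e : 0 < e -> exists N, forall n, (N <= n)%N ->
  fine (P [set w | e * a n < `|\sum_(k < n) et X k.+1 (n - k.+1) w -
    \sum_(k < n) Ex P (te X (a n) k.+1 (n - k.+1))|]) <= e.
Proof.
move=> e0.
have [C [la [C00 la01 [N0 HN0]]]] := f_geo; have /andP[la0 la1] := la01.
have [r r01 Hr] := geo_root la01 (isT : (0 < 3)%N); have /andP[r0 r1] := r01.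
have ir : 0 < (1 - r)^-1 by rewrite invr_gt0 subr_gt0.
pose S n := \sum_(j < n) (r ^+ j)^-1 * ((2 * j + 3)%:R * f n j).
pose lq : R := ln q%:R.
(* The factor min(e^2, 1) lets one e' serve both the union bound, of order S, and Chebyshev's bound,
   of order S / e^2. *)
pose e' := Num.min (e ^+ 2) 1 * e / (8 * (1 - r)^-1).
have e'0 : 0 < e' by rewrite divr_gt0 ?mulr_gt0// lt_min exprn_gt0// ltr01.
have [N1 H1] := weighted_sum_small la0 r01 Hr C00 f_ge0 HN0 f_cvg e'0.
have [N2 H2] := Dinf (8 * lq ^+ 2 / e); have [N3 H3] := aeq.
exists (maxn 1 (maxn N1 (maxn N2 N3))) => n; rewrite !geq_max => /and4P[n1 /H1 HS /H2 HD /H3 an].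
have a0 := apos n; have D0 := Dpos n; have nn : 0 < n%:R :> R by rewrite ltr0n.
rewrite -/(S n) in HS.
have rj j : 0 < r ^+ j by rewrite exprn_gt0.
have bd j k := bmf_dl j a0 (ltn0Sn k).
have bt j k := bmf_te j a0 (ltn0Sn k).
pose te' k := te X (a n) k.+1 (n - k.+1).
pose A1 := \big[setU/set0]_(k < n) [set w | a n < et X k.+1 (n - k.+1) w].
have met k : measurable_fun [set: T] (et X k.+1 (n - k.+1)).
  exact: (wrt_measurable hiid (@et_wrt k.+1 (n - k.+1) (ltn0Sn k))).
have mA k : measurable [set w | a n < et X k.+1 (n - k.+1) w] by exact: mgt.
have mA1 : measurable A1 by apply: bigsetU_measurable.
pose V w := \sum_(k < n) (te' k w - Ex P (te' k)).
have bV : bmf V by apply: bmf_sum => k _; apply: bmfB; [exact: bt|exact: bmf_cst].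
have mV : measurable [set w | e * a n < `|V w|] by apply: mgt; apply: mabs; case: bV.
have PA : fine (P A1) <= e / 2.
  rewrite (le_trans (Pr_bigU P n mA))//.
  have te2 (k : 'I_n) : Ex P (fun w => te' k w ^+ 2) <= 2 * lq ^+ 2 + 2 * ((1 - r)^-1 * (D n * S n)).
    have bS : bmf (fun w => \sum_(j < n - k.+1) (r ^+ j)^-1 * dl X (a n) k.+1 j w ^+ 2).
      by apply: bmf_sum => j _; apply: bmfZ; apply: bmfX; exact: bd.
    apply: (@le_trans _ _ (Ex P (fun w => 2 * lq ^+ 2 + 2 * ((1 - r)^-1 *
        \sum_(j < n - k.+1) (r ^+ j)^-1 * dl X (a n) k.+1 j w ^+ 2)))).
      apply: le_Ex; [by apply: bmfX; exact: bt|by apply: bmfD; [exact: bmf_cst|apply: bmfZ; exact: bmfZ]|move=> w].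
      rewrite /te' te_sum//.
      have lq0 : 0 <= lq by rewrite ln_ge0// ler1n.
      have m1 : 0 <= Num.min lq (a n) <= lq by rewrite le_min lq0 (ltW a0) ge_min lexx.
      set x := Num.min _ _ in m1 *.
      have CS := weighted_CS (fun j => dl X (a n) k.+1 j w) (n - k.+1) r01.
      set Y := \sum_(j < _) dl _ _ _ _ _ in CS *.
      have : (x + Y) ^+ 2 <= 2 * x ^+ 2 + 2 * Y ^+ 2 by have := sqr_ge0 (x - Y); lra.
      have : x ^+ 2 <= lq ^+ 2 by case/andP: m1 => h1 h2; rewrite lerXn2r ?nnegrE.
      lra.
    rewrite ExD; [|exact: bmf_cst|by apply: bmfZ; exact: bmfZ].
    rewrite Ex_cst lerD2l ExZ; last exact: bmfZ.
    rewrite ler_pM2l// ExZ// ler_pM2l//.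
    rewrite Ex_sum; last by move=> j _; apply: bmfZ; apply: bmfX; exact: bd.
    rewrite /S mulr_sumr.
    have h j : 0 <= D n * ((r ^+ j)^-1 * ((2 * j + 3)%:R * f n j)).
      apply: (mulr_ge0 (ltW D0)); apply: mulr_ge0; first by rewrite invr_ge0 ltW.
      by apply: mulr_ge0.
    rewrite (@split_sum _ (fun j => D n * ((r ^+ j)^-1 * ((2 * j + 3)%:R * f n j))) (n - k.+1) n) ?leq_subr//.
    rewrite -[leLHS]addr0 lerD//; last first.
      by apply: sumr_ge0 => j _; exact: h.
    apply: ler_sum => j _; rewrite ExZ; last by apply: bmfX; exact: bd.
    rewrite mulrCA ler_wpM2l ?invr_ge0 ?(ltW (rj j))// (le_trans (dl_le_f j (ltn_ord k)))//.
    rewrite ler_wpM2l ?(ltW D0)// ler_peMl// ler1n addnC//.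
  have Pk (k : 'I_n) : fine (P [set w | a n < et X k.+1 (n - k.+1) w]) <=
      (2 * lq ^+ 2 + 2 * ((1 - r)^-1 * (D n * S n))) / a n ^+ 2.
    rewrite ler_pdivlMr ?exprn_gt0// mulrC.
    apply: le_trans (te2 k); apply: Ex_markov => //.
    - by apply: bmfX; exact: bt.
    - by move=> w; exact: sqr_ge0.
    - by move=> w /= h; rewrite /te' /te min_r ?(ltW h).
  rewrite (le_trans (ler_sum _ (fun k _ => Pk k)))// sumr_const card_ord -[_ *+ n]mulr_natl.
  rewrite an.
  have -> : n%:R * ((2 * lq ^+ 2 + 2 * ((1 - r)^-1 * (D n * S n))) / (n%:R * D n)) =
     2 * lq ^+ 2 / D n + 2 * ((1 - r)^-1 * S n).
    by field; rewrite !gt_eqF// subr_gt0.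
  have g1 : 2 * lq ^+ 2 / D n <= e / 4.
    rewrite ler_pdivrMr//; move: HD; rewrite ler_pdivrMr//; lra.
  have g2 : (1 - r)^-1 * S n <= e / 8.
    rewrite (le_trans (ler_wpM2l (ltW ir) HS))//.
    have -> : (1 - r)^-1 * e' = Num.min (e ^+ 2) 1 * (e / 8).
      by rewrite /e'; field; rewrite gt_eqF// subr_gt0.
    by rewrite ler_piMl ?divr_ge0 ?(ltW e0)// ge_min lexx orbT.
  lra.
pose Fj j k w := dl X (a n) k.+1 j w - Ex P (dl X (a n) k.+1 j).
have bF j k : bmf (Fj j k) by apply: bmfB; [exact: bd|exact: bmf_cst].
(* Exchanging the sums groups the effects by distance j; those at k and k' then involve disjoint
   sets of factors as soon as k' > k + j + 1. *)
have VE w : V w = \sum_(j < n) \sum_(k < n - j.+1) Fj j k w.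
  rewrite /V -(exchange_triangle (fun j k => Fj j k w)); apply: eq_bigr => k _.
  have Ek : Ex P (te' k) = Num.min lq (a n) + \sum_(j < n - k.+1) Ex P (dl X (a n) k.+1 j).
    rewrite -Ex_sum; last by move=> j _; exact: bd.
    rewrite -[Num.min lq (a n)](Ex_cst P) -ExD; last 2 first.
    - exact: bmf_cst.
    - by apply: bmf_sum => j _; exact: bd.
    by congr Ex; apply/funext => w'; rewrite /te' te_sum.
  have tk : te' k w = Num.min lq (a n) + \sum_(j < n - k.+1) dl X (a n) k.+1 j w.
    by rewrite /te' te_sum.
  have fE : \sum_(j < n - k.+1) Fj j k w = \sum_(j < n - k.+1) dl X (a n) k.+1 j w -
      \sum_(j < n - k.+1) Ex P (dl X (a n) k.+1 j) by rewrite -sumrB.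
  by rewrite Ek tk fE opprD addrACA subrr add0r.
have F0 j k k' : (k + j.+1 < k')%N -> Ex P (fun w => Fj j k w * Fj j k' w) = 0.
  move=> kk; have E0 : Ex P (Fj j k) = 0.
    by rewrite /Fj (ExB P (bd j k) (bmf_cst _ _)) Ex_cst subrr.
  rewrite (wrt_prod hiid (I := win k (k.+1 + j).+1) (J := win k' (k'.+1 + j).+1)).
  - by apply/eqP; rewrite mulf_eq0; apply/orP; left; apply/eqP; exact: E0.
  - move=> m /andP[_ h1] /andP[h2 _]; rewrite addSnnS in h1.
    by have := leq_ltn_trans (leq_trans h1 kk) h2; rewrite ltnn.
  - by apply: measurable_funB; [exact: (@dl_wrt _ k.+1 j (ltn0Sn k))|exact: measurable_cst].
  - by apply: measurable_funB; [exact: (@dl_wrt _ k'.+1 j (ltn0Sn k'))|exact: measurable_cst].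
  - by case: (bF j k).
  - by case: (bF j k').
have EF j k : (k < n)%N -> Ex P (fun w => Fj j k w ^+ 2) <= D n * f n j.
  move=> kn; apply: le_trans (dl_le_f j kn).
  set m := Ex P (dl X (a n) k.+1 j).
  rewrite (_ : (fun w => Fj j k w ^+ 2) = fun w => dl X (a n) k.+1 j w ^+ 2 -
      2 * m * dl X (a n) k.+1 j w + m ^+ 2); last by apply/funext => w; rewrite /Fj -/m; ring.
  rewrite ExD; [|by apply: bmfB; [apply: bmfX; exact: bd|apply: bmfZ; exact: bd]|exact: bmf_cst].
  rewrite ExB; [|by apply: bmfX; exact: bd|by apply: bmfZ; exact: bd].
  rewrite ExZ; last exact: bd.
  rewrite Ex_cst -/m; have := sqr_ge0 m; rewrite expr2; lra.
have EV : Ex P (fun w => V w ^+ 2) <= (1 - r)^-1 * (n%:R * D n * S n).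
  pose Uj j w := \sum_(k < n - j.+1) Fj j k w.
  have bU j : bmf (Uj j) by apply: bmf_sum => k _; exact: bF.
  have bUS : bmf (fun w => \sum_(j < n) (r ^+ j)^-1 * Uj j w ^+ 2).
    by apply: bmf_sum => j _; apply: bmfZ; exact: bmfX.
  apply: (@le_trans _ _ (Ex P (fun w => (1 - r)^-1 * \sum_(j < n) (r ^+ j)^-1 * Uj j w ^+ 2))).
    apply: le_Ex; [exact: bmfX|exact: bmfZ|move=> w].
    by rewrite VE; exact: (weighted_CS (fun j => Uj j w) n r01).
  rewrite ExZ// ler_pM2l// Ex_sum; last by move=> j _; apply: bmfZ; exact: bmfX.
  rewrite /S mulr_sumr; apply: ler_sum => j _; rewrite ExZ; last exact: bmfX.
  rewrite mulrCA ler_wpM2l ?invr_ge0 ?(ltW (rj j))//.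
  have Fs k : (k < n - j.+1)%N -> Ex P (fun w => Fj j k w ^+ 2) <= D n * f n j.
    by move=> kn; apply: EF; rewrite (leq_trans kn)// leq_subr.
  rewrite (le_trans (Ex_sum_mdep (bF j) (F0 j) Fs))//.
  have -> : (2 * j.+1 + 1 = 2 * j + 3)%N by rewrite mulnS addnAC addnC.
  have -> : n%:R * D n * ((2 * j + 3)%:R * f n j) = n%:R * ((2 * j + 3)%:R * (D n * f n j)) by ring.
  apply: ler_wpM2r; first exact: (mulr_ge0 (ler0n _ _) (mulr_ge0 (ltW D0) (f_ge0 n j))).
  by rewrite ler_nat leq_subr.
have PV : fine (P [set w | e * a n < `|V w|]) <= e / 2.
  have ea : 0 < e * a n by rewrite mulr_gt0.
  have hm w : [set w | e * a n < `|V w|] w -> (e * a n) ^+ 2 <= V w ^+ 2.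
    by move=> /= h; rewrite -[leRHS]real_normK ?num_real// lerXn2r ?nnegrE ?(ltW ea) ?(ltW h).
  have := Ex_markov P (c := (e * a n) ^+ 2) (bmfX 2 bV) (fun w => sqr_ge0 (V w)) mV hm.
  move=> /le_trans/(_ EV); rewrite -ler_pdivlMl ?exprn_gt0// => /le_trans; apply.
  rewrite exprMn an.
  have -> : (e ^+ 2 * (n%:R * D n))^-1 * ((1 - r)^-1 * (n%:R * D n * S n)) = (1 - r)^-1 * S n / e ^+ 2.
    by field; rewrite !gt_eqF// subr_gt0.
  rewrite ler_pdivrMr ?exprn_gt0// (le_trans (ler_wpM2l (ltW ir) HS))//.
  have -> : (1 - r)^-1 * e' = Num.min (e ^+ 2) 1 * (e / 8).
    by rewrite /e'; field; rewrite gt_eqF// subr_gt0.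
  have h : Num.min (e ^+ 2) 1 <= e ^+ 2 by rewrite ge_min lexx.
  have e80 : 0 <= e / 8 by rewrite divr_ge0// ltW.
  have := ler_wpM2r e80 h; have := mulr_ge0 (ltW e0) (sqr_ge0 e); lra.
have sub : [set w | e * a n < `|\sum_(k < n) et X k.+1 (n - k.+1) w -
    \sum_(k < n) Ex P (te X (a n) k.+1 (n - k.+1))|] `<=` A1 `|` [set w | e * a n < `|V w|].
  move=> w /= h; have [hA|hA] := pselect (A1 w); [by left|right => /=].
  rewrite (_ : V w = \sum_(k < n) et X k.+1 (n - k.+1) w -
    \sum_(k < n) Ex P (te X (a n) k.+1 (n - k.+1)))// /V sumrB; congr (_ - _).
  apply: eq_bigr => k _; rewrite /te' /te min_l// leNgt; apply/negP => hk; apply: hA.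
  by rewrite /A1 -(bigcup_mkord n (fun k => [set w | a n < et X k.+1 (n - k.+1) w])); exists k => //=.
have mL : measurable [set w | e * a n < `|\sum_(k < n) et X k.+1 (n - k.+1) w -
    \sum_(k < n) Ex P (te X (a n) k.+1 (n - k.+1))|].
  apply: mgt; apply: mabs; apply: measurable_funB; last exact: measurable_cst.
  by apply: measurable_sum => k; exact: met.
rewrite (le_trans (le_Pr P mL _ sub))//; first exact: measurableU.
by rewrite (le_trans (PrU P mA1 mV))//; lra.
Qed.

End Decorrelation.

(** * Comparability of the entries of the product *)

Section Remainder.
Context (d : measure_display) (T : measurableType d) (R : realType).
Variable P : probability T R.
Variables (q : nat) (X : nat -> T -> 'M[R]_q).
Hypothesis q0 : (0 < q)%N.
Hypothesis hiid : iid_mx P X.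
Hypothesis hS : forall n w, (1 <= n)%N -> in_S (X n w).
Variables (c1 c2 p : R) (n0 : nat) (G : nat -> set T).
Hypothesis c10 : 0 < c1.
Hypothesis c12 : c1 < c2.
Hypothesis n00 : (0 < n0)%N.
Hypothesis hG : forall k w, G k w -> forall i j, c1 <= Qp X k n0 w i j <= c2.
Hypothesis mG : forall k, <<s cyl X (win k (k + n0)) >> (G k).
Hypothesis pG : forall k, fine (P (G k)) = p.
Hypothesis p0 : 0 < p.

Let c20 : 0 < c2. Proof. exact: lt_trans c12. Qed.

Lemma nb_gt0 B : forall k w, (0 < nb n0 (gd G) B k w)%N -> exists2 i, (i < B)%N & G (k + i * n0) w.
Proof.
elim: B => [//|B ih] k w /=; rewrite addn_gt0 => /orP[/ih[i iB Gi]|].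
  by exists i.+1 => //; rewrite mulSn addnA.
by rewrite lt0b => /asboolP h; exists 0%N => //; rewrite mul0n addn0.
Qed.

Let QS k m w : in_S (Qp X k m w). Proof. exact: Qp_in_S. Qed.

(** Each factor costs at most its [Kcond]. The loss is exponential in m, which is harmless for the
    end pieces, whose length stays bounded. *)
Lemma csum_Qp_lower (eK : R) k m w j : 1 <= eK ->
  (forall l, (k < l <= k + m)%N -> Kcond (X l w) <= eK) ->
  Nsum (Qp X k m w) <= Nsum (1%:M : 'M[R]_q) * eK ^+ m * csum (Qp X k m w) j.
Proof.
move=> e1; have e0 : 0 < eK by lra.
elim: m => [|m ih] H.
  rewrite /= expr0 mulr1 (_ : csum 1%:M j = 1) ?mulr1//.
  by rewrite /csum (bigD1 j)//= mxE eqxx big1 ?addr0// => i /negPf; rewrite mxE => ->.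
have {}ih := ih (fun l hl => H l (let: conj a b := andP hl in introT andP (conj a (leq_trans b (leq_add (leqnn k) (leqnSn m)))))).
set Q := Qp X k m w in ih *; set Y := X (k + m).+1 w.
have SY : in_S Y by exact: hS.
have KY : Kcond Y <= eK by apply: H; rewrite ltnS leq_addr addnS leqnn.
have NY := Nsum_gt0 q0 SY.
have h1 : Nsum Y * csum Q j <= eK * csum (Y *m Q) j.
  rewrite csum_mul mulr_sumr /csum mulr_sumr; apply: ler_sum => i _.
  have Q0 : 0 <= Q i j by case: (QS k m w).
  rewrite mulrA ler_wpM2r// (le_trans (Kcond_csum q0 i SY))// ler_wpM2r//.
  exact/ltW/csum_gt0.
rewrite /= -/Q -/Y (le_trans (Nsum_mul_le SY (QS k m w)))//.
have := ler_wpM2l (ltW NY) ih.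
have N1 : 0 <= Nsum (1%:M : 'M[R]_q) * eK ^+ m.
  by rewrite mulr_ge0 ?exprn_ge0 ?(ltW e0)// ltW//; apply: Nsum_gt0 => //; exact: in_S1.
have := ler_wpM2l N1 h1; rewrite exprS; lra.
Qed.

Lemma rsum_Qp_lower (eK : R) k m w i : 1 <= eK ->
  (forall l, (k < l <= k + m)%N -> Kcond (X l w) <= eK) ->
  Nsum (Qp X k m w) <= Nsum (1%:M : 'M[R]_q) * eK ^+ m * rsum (Qp X k m w) i.
Proof.
move=> e1; have e0 : 0 < eK by lra.
elim: m i => [|m ih] i H.
  rewrite /= expr0 mulr1 (_ : rsum 1%:M i = 1) ?mulr1//.
  by rewrite /rsum (bigD1 i)//= mxE eqxx big1 ?addr0// => j /negPf; rewrite mxE eq_sym => ->.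
have {}ih i' := ih i' (fun l hl => H l (let: conj a b := andP hl in introT andP (conj a (leq_trans b (leq_add (leqnn k) (leqnSn m)))))).
set Q := Qp X k m w in ih *; set Y := X (k + m).+1 w.
have SY : in_S Y by exact: hS.
have KY : Kcond Y <= eK by apply: H; rewrite ltnS leq_addr addnS leqnn.
have NQ := Nsum_gt0 q0 (QS k m w); rewrite -/Q in NQ.
have N1 : 0 <= Nsum (1%:M : 'M[R]_q) * eK ^+ m.
  by rewrite mulr_ge0 ?exprn_ge0 ?(ltW e0)// ltW//; apply: Nsum_gt0 => //; exact: in_S1.
have h1 : rsum Y i * Nsum Q <= Nsum (1%:M : 'M[R]_q) * eK ^+ m * rsum (Y *m Q) i.
  rewrite rsum_mul mulr_sumr /rsum mulr_suml; apply: ler_sum => l _.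
  have Y0 : 0 <= Y i l by case: SY.
  rewrite [leRHS]mulrCA; apply: ler_wpM2l => //; exact: ih.
rewrite /= -/Q -/Y (le_trans (Nsum_mul_le SY (QS k m w)))//.
have h2 : Nsum Y <= eK * rsum Y i.
  rewrite (le_trans (Kcond_rsum q0 i SY))// ler_wpM2r//; exact/ltW/rsum_gt0.
have := ler_wpM2r (ltW NQ) h2; have := ler_wpM2l (ltW e0) h1; rewrite exprS; lra.
Qed.

(** The product is written A1 Gb A2 Ga B1 with good blocks Ga and Gb. Up to the bounds c1 and c2 a
    good block acts as a matrix of rank one, so the entry at (k, l) is comparable to rsum A1 k times
    Nsum A2 times csum B1 l. Only the ends A1 and B1, of at most L n0 factors, are then controlled
    factor by factor. *)
Lemma entries_lower (eK : R) (L n : nat) w : 1 <= eK -> (2 * (L * n0) <= n)%N ->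
  (0 < nb n0 (gd G) L 0 w)%N -> (0 < nb n0 (gd G) L (n - L * n0) w)%N ->
  (forall l, (0 < l <= L * n0)%N -> Kcond (X l w) <= eK) ->
  (forall l, (n - L * n0 < l <= n)%N -> Kcond (X l w) <= eK) ->
  forall i j, Nsum (Xprod X n w) <=
    (c2 / c1 * (Nsum (1%:M : 'M[R]_q) * eK ^+ (L * n0))) ^+ 2 * Xprod X n w i j.
Proof.
move=> e1 nL /nb_gt0[i1 i1L G1] /nb_gt0[i2 i2L G2] K1 K2 i j.
have e0 : 0 < eK by lra.
rewrite add0n in G1; set a := (i1 * n0)%N in G1; set b := (n - L * n0 + i2 * n0)%N in G2.
have aL : (a + n0 <= L * n0)%N by rewrite /a addnC -mulSn leq_mul2r i1L orbT.
have nLL : (L * n0 <= n)%N by rewrite (leq_trans _ nL)// leq_pmull.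
have LnL : (L * n0 <= n - L * n0)%N by rewrite leq_subRL// addnn -mul2n.
have ab : (a + n0 <= b)%N by rewrite (leq_trans aL)// (leq_trans LnL)// leq_addr.
have bn : (b + n0 <= n)%N.
  rewrite /b -addnA -[leqRHS](subnK nLL) leq_add2l addnC -mulSn leq_mul2r i2L orbT//.
pose A1 := Qp X (b + n0) (n - (b + n0)) w; pose A2 := Qp X (a + n0) (b - (a + n0)) w.
pose B1 := Qp X 0 a w; pose Ga := Qp X a n0 w; pose Gb := Qp X b n0 w.
have E : Xprod X n w = A1 *m (Gb *m (A2 *m (Ga *m B1))).
  rewrite Xprod_Qp -{1}(subnKC bn) Qp_cat add0n -/A1; congr (_ *m _).
  rewrite Qp_cat add0n -/Gb; congr (_ *m _).
  rewrite -{1}(subnKC ab) Qp_cat add0n -/A2; congr (_ *m _).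
  by rewrite Qp_cat add0n.
have SA1 : in_S A1 by exact: QS.
have SA2 : in_S A2 by exact: QS.
have SB1 : in_S B1 by exact: QS.
have N2 := Nsum_gt0 q0 SA2.
have Eij k l : Xprod X n w k l = \sum_r \sum_s \sum_u \sum_v
    A1 k r * Gb r s * A2 s u * Ga u v * B1 v l.
  rewrite E mxE; apply: eq_bigr => r _; rewrite mxE mulr_sumr; apply: eq_bigr => s _.
  rewrite mxE !mulr_sumr; apply: eq_bigr => u _; rewrite mxE !mulr_sumr.
  by apply: eq_bigr => v _; rewrite !mulrA.
have prodE (c : R) k l : c ^+ 2 * (rsum A1 k * Nsum A2 * csum B1 l) =
    \sum_r \sum_s \sum_u \sum_v A1 k r * c * A2 s u * c * B1 v l.
  transitivity (\sum_r A1 k r * (c ^+ 2 * (Nsum A2 * csum B1 l))).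
    by rewrite -mulr_suml -/(rsum A1 k); ring.
  apply: eq_bigr => r _; transitivity (\sum_s rsum A2 s * (A1 k r * c ^+ 2 * csum B1 l)).
    by rewrite -mulr_suml -/(Nsum A2) /Nsum; ring.
  apply: eq_bigr => s _; rewrite /rsum mulr_suml; apply: eq_bigr => u _.
  transitivity (\sum_v B1 v l * (A1 k r * c ^+ 2 * A2 s u)); last by apply: eq_bigr => v _; ring.
  by rewrite -mulr_suml -/(csum B1 l); ring.
have A10 : forall k l, 0 <= A1 k l by case: SA1.
have A20 : forall k l, 0 <= A2 k l by case: SA2.
have B10 : forall k l, 0 <= B1 k l by case: SB1.
have lo k l : c1 ^+ 2 * (rsum A1 k * Nsum A2 * csum B1 l) <= Xprod X n w k l.
  rewrite prodE Eij; apply: ler_sum => r _; apply: ler_sum => s _.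
  apply: ler_sum => u _; apply: ler_sum => v _.
  have /andP[g1 _] := hG G1 u v; have /andP[g2 _] := hG G2 r s.
  have c1p := ltW c10.
  rewrite ler_wpM2r// ler_pM ?mulr_ge0// ler_wpM2r// ler_wpM2l//.
have up k l : Xprod X n w k l <= c2 ^+ 2 * (rsum A1 k * Nsum A2 * csum B1 l).
  rewrite prodE Eij; apply: ler_sum => r _; apply: ler_sum => s _.
  apply: ler_sum => u _; apply: ler_sum => v _.
  have /andP[g1 g1'] := hG G1 u v; have /andP[g2 g2'] := hG G2 r s.
  have c1p := ltW c10; have gp1 := le_trans c1p g1; have gp2 := le_trans c1p g2.
  rewrite ler_wpM2r// ler_pM ?mulr_ge0// ler_wpM2r// ler_wpM2l//.
have NX : Nsum (Xprod X n w) <= c2 ^+ 2 * (Nsum A1 * Nsum A2 * Nsum B1).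
  apply: (@le_trans _ _ (\sum_k \sum_l c2 ^+ 2 * (rsum A1 k * Nsum A2 * csum B1 l))).
    by apply: ler_sum => k _; apply: ler_sum => l _; exact: up.
  rewrite le_eqVlt; apply/orP; left; apply/eqP.
  rewrite (Nsum_csum B1).
  transitivity (\sum_k rsum A1 k * (c2 ^+ 2 * (Nsum A2 * \sum_l csum B1 l))).
    apply: eq_bigr => k _.
    transitivity (\sum_l (c2 ^+ 2 * (rsum A1 k * Nsum A2)) * csum B1 l).
      by apply: eq_bigr => l _; rewrite -!mulrA.
    rewrite -mulr_sumr; move: (\sum_l _) (rsum A1 k) (Nsum A2) => u v z; ring.
  by rewrite -mulr_suml -/(Nsum A1) /Nsum; ring.
set M1 := Nsum (1%:M : 'M[R]_q).
have M1p : 0 < M1 by apply: Nsum_gt0 => //; exact: in_S1.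
set eL := eK ^+ (L * n0).
have eX m : (m <= L * n0)%N -> eK ^+ m <= eL by move=> h; exact: ler_weXn2l.
have hA1 : Nsum A1 <= M1 * eL * rsum A1 i.
  have := @rsum_Qp_lower eK (b + n0) (n - (b + n0)) w i e1.
  move=> /(_ _)/le_trans; apply.
    move=> l; rewrite subnKC// => /andP[l1 l2]; apply: K2; rewrite l2 andbT.
    by rewrite (leq_ltn_trans _ l1)// /b -addnA leq_addr.
  rewrite ler_wpM2r ?(ltW (rsum_gt0 _ SA1))// ler_wpM2l ?(ltW M1p)// eX//.
  by rewrite leq_subLR -{1}(subnK nLL) leq_add2r /b -addnA leq_addr.
have hB1 : Nsum B1 <= M1 * eL * csum B1 j.
  have := @csum_Qp_lower eK 0 a w j e1.
  move=> /(_ _)/le_trans; apply.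
    move=> l; rewrite add0n => /andP[l1 l2]; apply: K1; rewrite l1 (leq_trans l2)//.
    by rewrite (leq_trans _ aL)// leq_addr.
  rewrite ler_wpM2r ?(ltW (csum_gt0 _ SB1))// ler_wpM2l ?(ltW M1p)// eX//.
  by rewrite (leq_trans _ aL)// leq_addr.
rewrite (le_trans NX)//.
have rA := rsum_gt0 i SA1; have cB := csum_gt0 j SB1.
have eL0 : 0 < eL by rewrite exprn_gt0.
have NA1 := Nsum_gt0 q0 SA1; have NB1 := Nsum_gt0 q0 SB1.
have h1 : Nsum A1 * Nsum B1 <= (M1 * eL * rsum A1 i) * (M1 * eL * csum B1 j).
  by apply: ler_pM => //; exact: ltW.
have h2 := lo i j.
have h3 : c2 ^+ 2 * (Nsum A1 * Nsum A2 * Nsum B1) <=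
   (c2 / c1 * (M1 * eL)) ^+ 2 * (c1 ^+ 2 * (rsum A1 i * Nsum A2 * csum B1 j)).
  have -> : (c2 / c1 * (M1 * eL)) ^+ 2 * (c1 ^+ 2 * (rsum A1 i * Nsum A2 * csum B1 j)) =
    c2 ^+ 2 * Nsum A2 * ((M1 * eL * rsum A1 i) * (M1 * eL * csum B1 j)).
    by field; rewrite gt_eqF.
  have -> : c2 ^+ 2 * (Nsum A1 * Nsum A2 * Nsum B1) = c2 ^+ 2 * Nsum A2 * (Nsum A1 * Nsum B1) by ring.
  by rewrite ler_wpM2l// mulr_ge0 ?sqr_ge0 ?(ltW N2).
by rewrite (le_trans h3)// ler_wpM2l// sqr_ge0.
Qed.

(** Four exceptional events of probability at most e / 4 are excluded: no good window among the
    first L, none among the last L, and a badly conditioned factor at either end. *)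
Lemma entries_comparable e : 0 < e -> exists2 C : R, 1 <= C & exists N, forall n, (N <= n)%N ->
  exists2 E, measurable E & 1 - e <= fine (P E) /\
    forall w, E w -> forall i j, Nsum (Xprod X n w) <= C * Xprod X n w i j.
Proof.
move=> e0; have [r /andP[r0 r1] Hr] := no_good_block_prob hiid c10 c12 mG pG p0.
(* r may be 0, whereas [geo_small] asks for a positive ratio. *)
pose r' : R := (r + 1) / 2.
have r'01 : 0 < r' < 1 by rewrite /r'; apply/andP; split; lra.
have e4 : 0 < e / 4 by lra.
have [L HL] := geo_small r'01 e4.
have rL : r ^+ L <= e / 4.
  rewrite (le_trans _ (HL _ (leqnn L)))// lerXn2r ?nnegrE//; first by case/andP: r'01 => /ltW.
  by rewrite /r'; lra.
pose m := (L * n0)%N; pose kc l w := ln (Kcond (X l w)).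
have m0 : 0 < m.+1%:R :> R by rewrite ltr0n.
have em : 0 < e / (4 * m.+1%:R) by rewrite divr_gt0// mulr_gt0.
have mK := mxfun_ln (@mxfun_Kcond R q).
have mkc l : measurable_fun [set: T] (kc l.+1) by exact: (law_measurable hiid _ mK).
have [K K0 HK] := tail_small P (mkc 0%N) em.
pose KC l := [set w | K < `|kc l.+1 w|].
have mKC l : measurable (KC l).
  by apply: mset_lt; [exact: measurable_cst|exact: measurableT_comp].
have mB : measurable [set x : R | K < `|x|].
  by apply: mset_lt; [exact: measurable_cst|apply: mabs; exact: measurable_id].
have PKC l : fine (P (KC l)) <= e / (4 * m.+1%:R).
  by have := mxfun_law hiid (n := l.+1) isT mK mB; rewrite /KC => E; rewrite [P _]E.
have Pm (F : nat -> nat) : fine (P (\big[setU/set0]_(i < m) KC (F i))) <= e / 4.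
  rewrite (le_trans (Pr_bigU P m (fun i => mKC (F i))))//.
  apply: (@le_trans _ _ (\sum_(i < m) e / (4 * m.+1%:R))).
    by apply: ler_sum => i _; exact: PKC.
  rewrite sumr_const card_ord -[leLHS]mulr_natr.
  rewrite [leLHS](_ : _ = e / 4 * (m%:R / m.+1%:R)); last by field; rewrite gt_eqF.
  by rewrite ler_piMr ?(ltW e4)// ler_pdivrMr// mul1r ler_nat.
pose eK := expR K; have eK1 : 1 <= eK by rewrite /eK -expR0 ler_expR ltW.
pose M1 := Nsum (1%:M : 'M[R]_q) * eK ^+ m.
exists (1 + (c2 / c1 * M1) ^+ 2); first by rewrite lerDl sqr_ge0.
exists (2 * m)%N => n mn.
have [mA1 A1le] := Hr L 0%N; have [mA2 A2le] := Hr L (n - m)%N.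
set A1 := [set w | _] in mA1 A1le; set A2 := [set w | _] in mA2 A2le.
pose A3 := \big[setU/set0]_(i < m) KC i.
pose A4 := \big[setU/set0]_(i < m) KC (n - m + i)%N.
have mA3 : measurable A3 by exact: bigsetU_measurable.
have mA4 : measurable A4 by exact: bigsetU_measurable.
have mA34 := measurableU _ _ mA3 mA4; have mA12 := measurableU _ _ mA1 mA2.
have mA := measurableU _ _ mA12 mA34.
exists (~` ((A1 `|` A2) `|` (A3 `|` A4))); first exact: measurableC.
split.
  rewrite Pr_setC//; have := PrU P mA12 mA34; have := PrU P mA1 mA2; have := PrU P mA3 mA4.
  by have := Pm id; have := Pm (fun i => n - m + i)%N; rewrite -/A3 -/A4; lra.
move=> w Ew i j.
have n1 : ~ A1 w by move=> h; apply: Ew; left; left.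
have n2 : ~ A2 w by move=> h; apply: Ew; left; right.
have n3 : ~ A3 w by move=> h; apply: Ew; right; left.
have n4 : ~ A4 w by move=> h; apply: Ew; right; right.
have KE l : ~ KC l w -> Kcond (X l.+1 w) <= eK.
  move=> /negP; rewrite -leNgt /kc => h.
  have K1 := Kcond_ge1 q0 (hS w (n := l.+1) isT).
  have Kp : 0 < Kcond (X l.+1 w) by lra.
  rewrite -[leLHS](lnK Kp) ler_expR (le_trans (ler_norm _))//.
have := @entries_lower eK L n w eK1 mn.
rewrite !lt0n => /(_ (introN eqP n1) (introN eqP n2)) H.
have {}H := H _ _ i j.
have Xij : 0 <= Xprod X n w i j by rewrite Xprod_Qp; case: (QS 0 n w).
rewrite mulrDl mul1r; apply: (le_trans (H _ _)); last by rewrite lerDr.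
  move=> [//|l] /andP[_ lm]; apply: KE => h; apply: n3; rewrite /A3.
  by rewrite -(bigcup_mkord m KC); exists l.
move=> [//|l] /andP[l1 l2]; apply: KE => h; apply: n4; rewrite /A4.
rewrite -(bigcup_mkord m (fun i => KC (n - m + i)%N)); rewrite ltnS in l1.
exists (l - (n - m))%N; last by rewrite subnKC.
by rewrite /= ltn_subLR// subnK// (leq_trans _ mn)// leq_pmull.
Qed.

Lemma bilinear_range (M : 'M[R]_q) (x y : 'cV[R]_q) (C : R) : 0 < C -> (forall i j, 0 <= M i j) ->
  (forall i j, Nsum M <= C * M i j) -> in_Bbar x -> in_Bbar y ->
  Nsum M / C <= dotv y (M *m x) <= Nsum M.
Proof.
move=> C0 M0 HM [x0 x1] [y0 y1].
have sx : \sum_i x i 0 = 1 by rewrite -[RHS]x1; apply: eq_bigr => i _; rewrite ger0_norm.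
have sy : \sum_i y i 0 = 1 by rewrite -[RHS]y1; apply: eq_bigr => i _; rewrite ger0_norm.
have E : dotv y (M *m x) = \sum_i \sum_j y i 0 * (M i j * x j 0).
  by apply: eq_bigr => i _; rewrite mxE mulr_sumr.
have le1 (z : 'cV[R]_q) i : (forall k, 0 <= z k 0) -> \sum_k z k 0 = 1 -> z i 0 <= 1.
  by move=> z0 <-; rewrite (bigD1 i)//= lerDl sumr_ge0.
apply/andP; split; last first.
  rewrite E; apply: ler_sum => i _; apply: ler_sum => j _.
  have xj := le1 x j x0 sx; have yi := le1 y i y0 sy.
  rewrite (le_trans (ler_piMl _ yi))// ?mulr_ge0// ler_piMr//.
have -> : Nsum M / C = \sum_i \sum_j y i 0 * (Nsum M / C * x j 0).
  under eq_bigr => i _ do rewrite -mulr_sumr -mulr_sumr sx mulr1.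
  by rewrite -mulr_suml sy mul1r.
rewrite E; apply: ler_sum => i _; apply: ler_sum => j _.
by rewrite ler_wpM2l// ler_wpM2r// ler_pdivrMr// mulrC.
Qed.

Lemma ln_range (N v C : R) : 1 <= C -> 0 < N -> N / C <= v <= N -> `|ln v - ln N| <= ln C.
Proof.
move=> C1 N0 /andP[v1 v2]; have C0 : 0 < C by lra.
have v0 : 0 < v by rewrite (lt_le_trans _ v1)// divr_gt0.
have h1 : ln v <= ln N by rewrite ler_ln// posrE.
have h2 : ln (N / C) <= ln v by rewrite ler_ln// posrE// divr_gt0.
rewrite ln_div ?posrE// in h2.
by rewrite ler0_norm; lra.
Qed.

Theorem coef_radius_close e : 0 < e -> exists2 c : R, 0 <= c & exists N, forall n, (N <= n)%N ->
  exists2 E, measurable E & 1 - e <= fine (P E) /\ forall w, E w ->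
    `|ln (spectral_radius (Xprod X n w)) - ln (Nsum (Xprod X n w))| <= c /\
    forall x y, in_Bbar x -> in_Bbar y ->
      `|logcoef X x y n w - ln (Nsum (Xprod X n w))| <= c.
Proof.
move=> e0; have [C C1 [N HN]] := entries_comparable e0.
have C0 : 0 < C by lra.
exists (ln C); first exact: ln_ge0.
(* [T_le] asks for an index at least 1. On the event all entries of X^(n) are positive, so the
   default value 0 of [logcoef] does not occur. *)
exists N.+1 => n Nn; have [E mE [PE HE]] := HN n (ltnW Nn).
exists E => //; split=> // w Ew; have {}HE := HE w Ew.
have SX : in_S (Xprod X n w) by rewrite Xprod_Qp; exact: QS.
set M := Xprod X n w in HE SX *.
have NM := Nsum_gt0 q0 SX.
split.
  pose i0 : 'I_q := Ordinal q0.
  apply: ln_range => //; apply/andP; split; last exact: spectral_radius_le_Nsum.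
  rewrite (le_trans _ (diag_le_spectral_radius q0 i0 SX))// ler_pdivrMr// mulrC; exact: HE.
move=> x y Bx By.
have hT : T_le X n w.
  exists n; split; first by rewrite leqnn andbT (leq_trans _ Nn).
  by move=> i j; have := lt_le_trans NM (HE i j); rewrite pmulr_rgt0.
rewrite /logcoef; case: asboolP => // _.
by apply: ln_range => //; apply: bilinear_range => //; case: SX.
Qed.

End Remainder.

(** * Consequences of the tail hypotheses *)

Lemma near_pinfty_bound (R : realType) (Q : R -> Prop) : (\forall u \near +oo, Q u) ->
  exists2 A : R, 0 < A & forall u, A <= u -> Q u.
Proof.
move=> [A [_ H]]; exists (`|A| + 1) => [|u Au]; first by rewrite ltr_wpDl.
by apply: H; have := ler_norm A; lra.
Qed.

Lemma scale_pinfty (R : realType) (s : R) : 0 < s -> s * u @[u --> +oo] --> +oo.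
Proof.
move=> s0; apply/cvgryPge => A; exists (`|A| / s); split; first exact: num_real.
move=> u; rewrite ltr_pdivrMr// mulrC => h; have := ler_norm A; lra.
Qed.

(** F(s u) / K(u) is eventually the product of the normalised F at s u, the ratio L(s u) / L(u), the
    inverse of the normalised K at u, and s^(-al); each factor has a limit. *)
Lemma slow_ratio (R : realType) (al : R) (L F K : R -> R) (f c : R) : slowly_varying L -> 0 < c ->
  u `^ al / L u * F u @[u --> +oo] --> f -> u `^ al / L u * K u @[u --> +oo] --> c ->
  forall s, 0 < s -> F (s * u) / K u @[u --> +oo] --> f / c * s `^ (- al).
Proof.
move=> [_ [[x0 L0] Ls]] c0 hF hK s s0.
have h1 : (s * u) `^ al / L (s * u) * F (s * u) @[u --> +oo] --> f.
  exact: (cvg_comp _ _ (scale_pinfty s0) hF).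
have h2 := cvgM h1 (Ls s s0).
have h3 := cvgM (h2 _) (cvgV (lt0r_neq0 c0) hK).
have hc : (fun _ : R => s `^ (- al)) u @[u --> +oo] --> s `^ (- al) by exact: cvg_cst.
have h4 := cvgM (h3 _ _ _) hc.
rewrite mulr1 in h4; apply: cvg_trans; last exact: h4.
apply: near_eq_cvg.
near=> u => /=.
have u0 : 0 < u by near: u; apply: nbhs_pinfty_gt; exact: num_real.
have Lu : 0 < L u by apply: L0; near: u; apply: nbhs_pinfty_gt; exact: num_real.
have Lsu : 0 < L (s * u).
  by apply: L0; rewrite -ltr_pdivrMl//; near: u; apply: nbhs_pinfty_gt; exact: num_real.
rewrite powRM ?ltW// powRN !invfM !invrK.
have us : 0 < u `^ al by exact: powR_gt0.
have ss : 0 < s `^ al by exact: powR_gt0.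
by move: (K u)^-1 => k; field; rewrite !gt_eqF.
Unshelve. all: by end_near. Qed.

Section TailConditions.
Context (d : measure_display) (T : measurableType d) (R : realType).
Variable P : probability T R.
Variables (al cp cm : R) (L : R -> R) (Z : T -> R).
Hypothesis hL : slowly_varying L.
Hypothesis hL2 : al = 2 -> unbounded_fun L.
Hypothesis cpm : 0 < cp + cm.
Hypothesis mZ : measurable_fun [set: T] Z.
Hypothesis hp : u `^ al / L u * fine (P [set w | u < Z w]) @[u --> +oo] --> cp.
Hypothesis hm : u `^ al / L u * fine (P [set w | Z w <= - u]) @[u --> +oo] --> cm.
Notation K := (tl P Z).
Let c : R := cp + cm.
Let c0 : 0 < c. Proof. exact: cpm. Qed.
Let c2 : 0 < c / 2. Proof. exact: divr_gt0. Qed.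

Lemma cvg_tl : u `^ al / L u * K u @[u --> +oo] --> cp + cm.
Proof. by apply: cvgy_eq (cvgD hp hm) => u; rewrite /tl mulrDr. Qed.

Lemma tl_lower : exists2 A, 0 < A & forall u, A <= u ->
  0 < L u /\ c / 2 * L u <= u `^ al * K u.
Proof.
have [_ [[x0 L0] _]] := hL.
have c2c : c / 2 < c by have := c0; lra.
have [A A0 HA] := near_pinfty_bound (cvgr_gt _ cvg_tl _ c2c).
exists (A + `|x0| + 1) => [|u Au]; first by have := normr_ge0 x0; lra.
have Lu : 0 < L u by apply: L0; have := ler_norm x0; lra.
have := HA u; rewrite -ler_pdivlMr// => H; split=> //; apply: ltW.
have := H _; rewrite mulrAC; apply; have := normr_ge0 x0; lra.
Qed.

Lemma tl_mono a b : a <= b -> K b <= K a.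
Proof.
move=> ab; apply: lerD; apply: le_Pr; do ?[exact: mgt|exact: mle].
  by move=> w /=; exact: le_lt_trans.
by move=> w /= h; rewrite (le_trans h)// lerN2.
Qed.

Lemma tl_gt0 u : 0 < K u.
Proof.
have [A A0 HA] := tl_lower; pose v := Num.max A u.
have Av : A <= v by rewrite le_max lexx.
have [Lv H] := HA v Av.
have v0 : 0 < v `^ al by apply: powR_gt0; lra.
apply: (@lt_le_trans _ _ (K v)); last by apply: tl_mono; rewrite le_max lexx orbT.
by have := lt_le_trans (mulr_gt0 c2 Lv) H; rewrite pmulr_rgt0.
Qed.

Lemma right_tail_ratio s : 0 < s ->
  fine (P [set w | s * a < Z w]) / K a @[a --> +oo] --> cp / c * s `^ (- al).
Proof. exact: (slow_ratio hL cpm hp cvg_tl). Qed.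

Lemma left_tail_ratio s : 0 < s ->
  fine (P [set w | Z w <= - (s * a)]) / K a @[a --> +oo] --> cm / c * s `^ (- al).
Proof. exact: (slow_ratio hL cpm hm cvg_tl). Qed.

(** u^2 K(u) is eventually at least a positive multiple of L(u): the unboundedness of L is what
    makes the truncated second moment diverge when al = 2. *)
Lemma tl_square_unbounded : al = 2 -> forall B, exists2 u, 0 < u & B <= u ^+ 2 * K u.
Proof.
move=> al2 B; have [A A0 HA] := tl_lower.
have [u [Au Lu]] := hL2 al2 ((c / 2)^-1 * B) A.
have u0 : 0 < u by lra.
exists u => //; have [_] := HA u (ltW Au); rewrite al2 (powR_mulrn 2 (ltW u0)) => H.
by apply: le_trans H; rewrite -ler_pdivrMl// ltW.
Qed.

Variables (N V : T -> R).
Hypothesis ZE : forall w, Z w = ln (N w).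
Hypothesis NV : forall w, 0 < V w <= N w.
Hypothesis mV : measurable_fun [set: T] V.
Hypothesis hV : exists M : R, \forall u \near +oo,
  u `^ al / L u * fine (P [set w | V w <= expR (- u)]) <= M.

(** ln N - ln V > u forces ln N > u / 2 or ln V <= - u / 2. The first event has probability at most
    K(u / 2); the assumption on V and [tl_lower] bound the second by a multiple of K(u / 2). Finally
    K(u / 2) <= (B + 1) K(u), where B = 2^al is the limit of the ratio. *)
Lemma range_tail : exists C u0 : R, [/\ 0 <= C, 0 < u0 & forall u, u0 <= u ->
  fine (P [set w | u < `|ln (N w) - ln (V w)|]) <= C * K u].
Proof.
have [M /near_pinfty_bound[A1 A10 HM]] := hV.
have [A A0 HA] := tl_lower.
have s2 : 0 < 2^-1 :> R by lra.
have ppm : cp / c + cm / c = 1 by rewrite -mulrDl mulfV// gt_eqF.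
have hr := tl_ratio ppm right_tail_ratio left_tail_ratio s2.
set B := _ `^ _ in hr; have B1 : B < B + 1 by rewrite ltrDl.
have [A2 A20 HK] := near_pinfty_bound (cvgr_lt _ hr _ B1).
have B0 : 0 <= B by exact: powR_ge0.
pose M' := `|M| / (c / 2).
have M'0 : 0 <= M' by rewrite divr_ge0// ltW.
exists ((1 + M') * (B + 1)), (2 * (A + A1 + A2)); split.
- by rewrite mulr_ge0; lra.
- lra.
move=> u hu; have uA : A <= 2^-1 * u by lra.
have uA1 : A1 <= 2^-1 * u by lra.
have uA2 : A2 <= u by lra.
have Ku := HK u uA2; rewrite ltr_pdivrMr ?tl_gt0// in Ku.
set v := 2^-1 * u in uA uA1 Ku.
have [Lv H1] := HA v uA; have H2 := HM v uA1.
have v0 : 0 < v by lra.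
have pv : 0 < v `^ al by exact: powR_gt0.
have H3 : fine (P [set w | V w <= expR (- v)]) <= M' * K v.
  set F := fine _ in H2 *; have F0 : 0 <= F by exact: Pr_ge0.
  have H4 : v `^ al * F <= `|M| * L v.
    by rewrite -ler_pdivrMr// mulrAC (le_trans H2)// ler_norm.
  have H5 : `|M| * (c / 2 * L v) <= `|M| * (v `^ al * K v) by rewrite ler_wpM2l.
  have q : v `^ al * (c / 2) * F <= v `^ al * (c / 2) * (M' * K v).
    have -> : v `^ al * (c / 2) * (M' * K v) = `|M| * (v `^ al * K v).
      by rewrite /M'; field; rewrite gt_eqF// gt_eqF.
    have H6 := ler_wpM2r (ltW c2) H4.
    have E5 : `|M| * (c / 2 * L v) = `|M| * L v * (c / 2) by ring.
    by rewrite E5 in H5; rewrite [leLHS]mulrAC; exact: le_trans H6 H5.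
  by move: q; rewrite ler_pM2l// mulr_gt0.
have mN' : measurable [set w | v < Z w] by exact: mgt.
have mV' : measurable [set w | V w <= expR (- v)] by exact: mle.
have N0 w : 0 < N w by have /andP[h1 h2] := NV w; exact: lt_le_trans h2.
apply: (@le_trans _ _ (fine (P ([set w | v < Z w] `|` [set w | V w <= expR (- v)])))).
  apply: le_Pr; [|exact: measurableU|].
    apply: mset_lt; [exact: measurable_cst|apply: mabs; apply: measurable_funB].
      by rewrite (_ : (fun w => _) = Z)//; apply/funext => w; rewrite ZE.
    exact: measurableT_comp.
  move=> w /=; have /andP[V0 VN] := NV w.
  have lV : ln (V w) <= ln (N w) by rewrite ler_ln// posrE.
  rewrite ger0_norm ?subr_ge0// => h.
  have [h1|h1] := ltP v (Z w); [by left|right].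
  rewrite -(lnK V0) ler_expR; rewrite ZE in h1; rewrite /v in h1 *; lra.
rewrite (le_trans (PrU _ _ _))//.
have h1 : fine (P [set w | v < Z w]) <= K v by rewrite /tl lerDl Pr_ge0.
apply: (@le_trans _ _ ((1 + M') * K v)); first by rewrite mulrDl mul1r lerD.
rewrite -mulrA ler_wpM2l//; lra.
Qed.

End TailConditions.

(** * Transfer of the limit law from the sum of the logarithms *)

Section Assembly.
Context (d : measure_display) (T : measurableType d) (R : realType).
Variable P : probability T R.
Variables (S B : nat -> T -> R) (beta a m : nat -> R) (c0 : R) (mu : probability R R).
Hypothesis apos : forall n, 0 < a n.
Hypothesis ainf : a n @[n --> \oo] --> +oo.
Hypothesis mS : forall n, measurable_fun [set: T] (S n).
Hypothesis mB : forall n, measurable_fun [set: T] (B n).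
Hypothesis B_small : forall e, 0 < e -> exists N, forall n, (N <= n)%N ->
  fine (P [set w | e * a n < `|B n w - beta n|]) <= e.
Hypothesis S_limit : forall f : R -> R, continuous f -> (exists M, forall x, `|f x| <= M) ->
  Ex P (fun w => f (S n w / a n - m n)) @[n --> \oo] --> Ex mu f.

(** At scale a_n three differences disappear: the bounded error c outside a small event, the
    constant c0, and the fluctuation of B around the deterministic beta. [V] is compared directly
    with the measurable centred sum, so [slutsky] applies to it as it is. *)
Lemma stable_limit_transfer (V : nat -> T -> R) :
  (forall e, 0 < e -> exists2 c : R, 0 <= c & exists N, forall n, (N <= n)%N ->
    exists2 E, measurable E & 1 - e <= fine (P E) /\ forall w, E w ->
      `|V n w - (c0 + S n w - B n w)| <= c) ->
  cvg_in_distribution P (fun n w => (V n w - (a n * m n - beta n)) / a n) mu.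
Proof.
move=> HV; apply: (@slutsky _ _ _ P _ (fun n w => S n w / a n - m n)) => //.
  by move=> n; apply: measurable_funB => //; apply: measurable_funM.
move=> e e0; have e2 : 0 < e / 2 by lra.
have [c cp [N1 H1]] := HV _ e2; have [N2 H2] := B_small e2.
have [N3 _ H3] := cvgry_ge ainf ((c + `|c0|) / (e / 2)).
exists (maxn N1 (maxn N2 N3)) => n; rewrite !geq_max => /and3P[n1 n2 n3].
have [E mE [PE HE]] := H1 n n1; have PB := H2 n n2; have an := H3 n n3; have a0 := apos n.
set A := [set w | _] in PB.
have mA : measurable A.
  apply: mset_lt; [exact: measurable_cst|apply: mabs; exact: measurable_funB].
have mEA : measurable (E `&` ~` A) by apply: measurableI => //; exact: measurableC.
exists (E `&` ~` A) => //; split.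
  have h := PrU P mE mA; rewrite -[E `&` ~` A]setCK Pr_setC; last exact: measurableC.
  rewrite setCI setCK; have := PrU P (measurableC mE) mA; rewrite (Pr_setC P mE); lra.
move=> w [/HE h1 /negP]; rewrite -leNgt => h2.
have -> : (V n w - (a n * m n - beta n)) / a n - (S n w / a n - m n) =
   ((V n w - (c0 + S n w - B n w)) + c0 - (B n w - beta n)) / a n.
  by field; rewrite gt_eqF.
rewrite normrM (gtr0_norm (x := (a n)^-1)) ?invr_gt0// ler_pdivrMr//.
rewrite (le_trans (ler_normB _ _))//.
have h3 := ler_normD (V n w - (c0 + S n w - B n w)) c0.
by move: an; rewrite ler_pdivrMr// => an; lra.
Qed.

End Assembly.

Theorem theoremI (R : realType) (q : nat) (hq : (1 <= q)%N)
  (d : measure_display) (Omega : measurableType d) (P : probability Omega R)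
  (X : nat -> Omega -> 'M[R]_q)
  (hiid : iid_mx P X)
  (hS : forall n w, (1 <= n)%N -> in_S (X n w))
  (hcontr : (0 < P (\bigcup_(n in [set n | (1 <= n)%N])
                      [set w | in_Spos (Xprod X n w)]))%E)
  (alpha : R) (halpha : 0 < alpha <= 2)
  (L : R -> R) (hL : slowly_varying L) (hL2 : alpha = 2 -> unbounded_fun L)
  (cp cm : R) (hcp : 0 <= cp) (hcm : 0 <= cm) (hc : 0 < cp + cm)
  (hi1 : (u `^ alpha / L u * fine (P [set w | expR u < Nsum (X 1%N w)]))
           @[u --> +oo] --> cp)
  (hi2 : (u `^ alpha / L u * fine (P [set w | Nsum (X 1%N w) <= expR (- u)]))
           @[u --> +oo] --> cm)
  (hii : exists M : R, \forall u \near +oo,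
           u `^ alpha / L u * fine (P [set w | Vmin (X 1%N w) <= expR (- u)]) <= M) :
  exists (a : nat -> R) (b : nat -> R),
    (forall n, (1 <= n)%N -> 0 < a n) /\ a n @[n --> \oo] --> +oo /\
    exists mu : probability R R, stable_law alpha mu /\
      (forall x y : nat -> 'cV[R]_q,
         (forall n, (1 <= n)%N -> in_Bbar (x n) /\ in_Bbar (y n)) ->
         cvg_in_distribution P
           (fun n w => (logcoef X (x n) (y n) n w - b n) / a n) mu) /\
      cvg_in_distribution P
        (fun n w => (ln (spectral_radius (Xprod X n w)) - b n) / a n) mu.
Proof.
pose Zs k w := ln (Nsum (X k w)); pose Z := Zs 1%N.
have al0 : 0 < alpha by case/andP: halpha.
have mN := mxfun_ln (@mxfun_Nsum R q).
have mZs k : measurable_fun [set: Omega] (Zs k.+1) by exact: (law_measurable hiid _ mN).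
have N1 w : 0 < Nsum (X 1%N w) by apply: Nsum_gt0 => //; exact: hS.
have tp : u `^ alpha / L u * fine (P [set w | u < Z w]) @[u --> +oo] --> cp.
  apply: cvgy_eq hi1 => u; congr (_ * fine (P _)); apply/funext => w; apply/propext => /=.
  by rewrite /Z /Zs -{1}(lnK (N1 w)) ltr_expR.
have tm : u `^ alpha / L u * fine (P [set w | Z w <= - u]) @[u --> +oo] --> cm.
  apply: cvgy_eq hi2 => u; congr (_ * fine (P _)); apply/funext => w; apply/propext => /=.
  by rewrite /Z /Zs -{1}(lnK (N1 w)) ler_expR.
have mZ : measurable_fun [set: Omega] Z := mZs 0%N.
have K0 := tl_gt0 hL hc mZ tp tm.
have Kp s (s1 : 0 < s) := right_tail_ratio hL hc tp tm s1.
have Km s (s1 : 0 < s) := left_tail_ratio hL hc tp tm s1.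
have K2 := tl_square_unbounded hL hL2 hc tp tm.
have pp : 0 <= cp / (cp + cm) by rewrite divr_ge0// ltW.
have pm : 0 <= cm / (cp + cm) by rewrite divr_ge0// ltW.
have ppm : cp / (cp + cm) + cm / (cp + cm) = 1 by rewrite -mulrDl mulfV// gt_eqF.
have tvinf := tv_unbounded halpha ppm mZ K0 Kp Km K2.
have [a [c [be [ga [apos ainf aeq [c0 be1] [Hcos Hsin Htail]]]]]] :=
  regvar_limits halpha pp pm ppm mZ K0 Kp Km.
pose m n := Ex P (fun w => sin (Z w / a n)).
have [mu stmu Hmu] : exists2 mu : probability R R, stable_law alpha mu &
  forall f : R -> R, continuous f -> (exists M, forall x, `|f x| <= M) ->
  Ex P (fun w => f (\sum_(k < n) (Zs k.+1 w / a n - m n))) @[n --> \oo] --> Ex mu f.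
  apply: (@iid_stable_limit _ _ _ P Zs mZs _ _ _ alpha c be ga) => //.
  - by move=> k g mg bg; exact: (Ex_law hiid (n := k.+1) isT mN mg bg).
  - move=> n f g cf cg bf bg.
    apply: (wrt_prod hiid (I := win 0 n) (J := [set n.+1])) => //.
    + by move=> i /andP[_ h] E; rewrite E ltnn in h.
    + apply: (measurableT_comp (continuous_measurable_fun cf)).
      apply: measurable_sum => k.
      by apply: (@mxfun_wrt _ _ _ _ _ _ k.+1 _ isT _ mN); rewrite /win/= ltn_ord.
    + apply: (measurableT_comp (continuous_measurable_fun cg)).
      exact: (@mxfun_wrt _ _ _ _ _ _ n.+1 _ isT erefl mN).
    + by have [M HM] := bf; exists M => w; exact: HM.
    + by have [M HM] := bg; exists M => w; exact: HM.
  - move=> j k f g jk cf cg bf bg.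
    apply: (wrt_prod hiid (I := [set j.+1]) (J := [set k.+1])) => //.
    + by move=> i -> [] E; rewrite E eqxx in jk.
    + apply: (measurableT_comp (continuous_measurable_fun cf)).
      exact: (@mxfun_wrt _ _ _ _ _ _ j.+1 _ isT erefl mN).
    + apply: (measurableT_comp (continuous_measurable_fun cg)).
      exact: (@mxfun_wrt _ _ _ _ _ _ k.+1 _ isT erefl mN).
    + by have [M HM] := bf; exists M => w; exact: HM.
    + by have [M HM] := bg; exists M => w; exact: HM.
have [s [N [s0 [vs ps]]]] := good_block_exists hq hiid hS hcontr.
have [c1 [c2 [/andP[c10 c12] hG]]] := gev_entries hq hS N vs.
have mG k := gev_wrt hq (X := X) N (s := s) (k := k).
have pG k := gev_prob hq hiid s N k.
have mW : measurable_fun [set: Omega] (fun w => Wrange (X 1%N w)).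
  exact: (law_measurable hiid _ (mxfun_Wrange hq)).
have mV : measurable_fun [set: Omega] (fun w => Vmin (X 1%N w)).
  exact: (law_measurable hiid _ (mxfun_Vmin hq)).
have NV w : 0 < Vmin (X 1%N w) <= Nsum (X 1%N w).
  by rewrite Vmin_gt0 ?Vmin_le_Nsum//; exact: hS.
have [C [u0 [C0 u00 Wtail]]] := range_tail hL hc mZ tp tm
  (fun w => erefl) NV mV hii.
have [C' C'0 hW] := tv_tail_comparison mZ mW C0 u00 Wtail.
have Dpos n : 0 < tv P Z (a n).
  by apply: lt_le_trans (tv_ge_tl P mZ (apos n)); rewrite mulr_gt0// exprn_gt0.
have Dinf D : exists n1, forall n, (n1 <= n)%N -> D <= tv P Z (a n).
  have [A A0 HA] := tvinf D; have [n1 _ Hn] := cvgry_ge ainf A.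
  by exists n1 => n nn; apply: HA; exact: Hn.
have hWn n : tv P (fun w => Wrange (X 1%N w)) (a n) <= C' * (1 + tv P Z (a n)).
  by apply: hW; exact: ltW.
have conc := eta_sum_concentration hq hiid hS c10 c12 s0 hG mG pG ps apos Dpos aeq Dinf C'0 hWn.
have close := coef_radius_close hq hiid hS c10 c12 hG mG pG ps.
pose S n w := \sum_(k < n) Zs k.+1 w.
pose B n w := \sum_(k < n) et X k.+1 (n - k.+1) w.
pose beta n := \sum_(k < n) Ex P (te X (a n) k.+1 (n - k.+1)).
have mS n : measurable_fun [set: Omega] (S n) by apply: measurable_sum => k; exact: mZs.
have mB n : measurable_fun [set: Omega] (B n).
  apply: measurable_sum => k; apply: (wrt_measurable hiid).
  exact: (@et_wrt _ _ _ _ _ k.+1 (n - k.+1) isT).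
have lim (f : R -> R) : continuous f -> (exists M, forall x, `|f x| <= M) ->
    Ex P (fun w => f (S n w / a n - n%:R * m n)) @[n --> \oo] --> Ex mu f.
  move=> cf bf; refine (cvgn_eq (N := 0) _ (Hmu f cf bf)) => n _; congr (Ex P _).
  apply/funext => w; congr f; rewrite /S mulr_suml sumrB sumr_const card_ord.
  by rewrite mulr_natl.
have transfer := stable_limit_transfer (c0 := ln q%:R) apos ainf mS mB conc lim.
(* The first term centres the sum of the logarithms of [Nsum]; [beta n], the sum of the truncated
   means, centres the sum of the defects. The constant ln q disappears in the limit. *)
exists a, (fun n => a n * (n%:R * m n) - beta n); split=> //; split=> //.
exists mu; split=> //; split.
  move=> x y Bxy; apply: transfer => e e0; have [c' c'0 [n1 Hn]] := close e e0.
  (* The vectors are only known to lie in the simplex from n = 1 on, hence the successor. *)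
  exists c' => //; exists n1.+1 => n nn; have [E mE [PE HE]] := Hn n (ltnW nn).
  exists E => //; split=> // w /HE[_]; rewrite ln_Nsum_telescope => H.
  by have [Bx By] := Bxy n (leq_trans (ltn0Sn _) nn); exact: H.
apply: transfer => e e0; have [c' c'0 [n1 Hn]] := close e e0.
exists c' => //; exists n1 => n nn; have [E mE [PE HE]] := Hn n nn.
by exists E => //; split=> // w /HE[+ _]; rewrite ln_Nsum_telescope.
Qed.
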